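(* There exists a constant $k$ such that (generalized) Rush Hour is $\mathsf{PSPACE}$-complete when restricted to boards of size $k\times n$.
   Context: Rush Hour is played on a rectangular grid board occupied by non-overlapping cars, each a $1\times 2$ or $1\times 3$ rectangle oriented horizontally or vertically; a move slides one car along its own orientation into unoccupied cells. The decision problem: given a board with an initial placement of cars and a designated target car, is there a sequence of moves that frees the target car from the board (moves it to a designated exit position on the boundary)? *)

(* Defs.v *)
(* MathComp *)
From Stdlib Require Export Relation_Operators.
From mathcomp Require Export all_boot all_algebra.

Set Implicit Arguments.
Unset Strict Implicit.
Unset Printing Implicit Defensive.

(** * Deterministic multi-tape Turing machines *)

Definition language := seq bool -> Prop.

(* A tape cell is blank ([None]), holds an input/output bit ([Some (inl b)]),
   or holds an auxiliary symbol of the machine ([Some (inr a)]). *)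
Definition symbol (A : Type) := option (bool + A).

Inductive direction := Left | Stay | Right.

(* Two-way infinite tapes: [before] lists, nearest first, the cells to the left
   of the head, and [after] those to its right; all other cells are blank. *)
Record tape (A : Type) := Tape {
  before : seq (symbol A);
  scanned : symbol A;
  after : seq (symbol A)
}.

Definition write_move (A : Type) (t : tape A) (a : symbol A * direction) :
    tape A :=
  match a.2 with
  | Stay => Tape (before t) a.1 (after t)
  | Left => Tape (behead (before t)) (head None (before t)) (a.1 :: after t)
  | Right => Tape (a.1 :: before t) (head None (after t)) (behead (after t))
  end.

(* Cells are never dropped, so this counts the cells visited so far, together
   with the cells initially holding the input. *)
Definition tape_space (A : Type) (t : tape A) : nat :=
  (size (before t) + size (after t)).+1.

(* There are [extra_tapes.+1] tapes; the machine halts when [delta] returns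
   [None]. *)
Record machine := Machine {
  extra_tapes : nat;
  state : finType;
  aux : finType;
  start : state;
  accepting : pred state;
  delta : state -> {ffun 'I_extra_tapes.+1 -> symbol aux} ->
          option (state * ('I_extra_tapes.+1 -> symbol aux * direction))
}.

Record configuration (M : machine) := Configuration {
  control : state M;
  tapes : {ffun 'I_(extra_tapes M).+1 -> tape (aux M)}
}.

Definition input_tape (A : Type) (x : seq bool) : tape A :=
  let s := [seq Some (inl b) | b <- x] in Tape [::] (head None s) (behead s).

Definition initial (M : machine) (x : seq bool) : configuration M :=
  Configuration (start M)
    [ffun i => input_tape (aux M) (if i == ord0 then x else [::])].

Definition next (M : machine) (c : configuration M) :
    option (configuration M) :=
  if delta (control c) [ffun i => scanned (tapes c i)] is Some (q, a)
  then Some (Configuration q [ffun i => write_move (tapes c i) (a i)])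
  else None.

Definition run (M : machine) (x : seq bool) (t : nat) : configuration M :=
  iter t (fun c => odflt c (next c)) (initial M x).

Definition halted (M : machine) (c : configuration M) : Prop := next c = None.

Definition space (M : machine) (c : configuration M) : nat :=
  \sum_(i < (extra_tapes M).+1) tape_space (tapes c i).

Fixpoint leading_bits (A : Type) (s : seq (symbol A)) : seq bool :=
  if s is Some (inl b) :: s' then b :: leading_bits s' else [::].

(* The output is the maximal word of bits on the first tape that starts under
   the head. *)
Definition output (M : machine) (c : configuration M) : seq bool :=
  let t := tapes c ord0 in leading_bits (scanned t :: after t).

(** * PSPACE-completeness under polynomial-time many-one reductions *)

Definition decides (M : machine) (L : language) : Prop :=
  forall x, exists2 t, halted (run M x t) &
                       (accepting (control (run M x t)) <-> L x).

Definition PSPACE (L : language) : Prop :=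
  exists (M : machine) (p : {poly nat}),
    decides M L /\ forall x t, space (run M x t) <= p.[size x]%R.

Definition polynomial_time (f : seq bool -> seq bool) : Prop :=
  exists (M : machine) (p : {poly nat}), forall x,
    exists t, [/\ t <= p.[size x]%R, halted (run M x t) &
                  output (run M x t) = f x].

Definition reduces (L L' : language) : Prop :=
  exists2 f, polynomial_time f & forall x, L x <-> L' (f x).

Definition PSPACE_complete (L : language) : Prop :=
  PSPACE L /\ forall L', PSPACE L' -> reduces L' L.

(** * Rush Hour *)

Definition cell := (nat * nat)%type.  (* (row, column), counted from 0 *)

(* A horizontal car lies in the row [lane] and its leftmost column is [pos];
   a vertical car lies in the column [lane] and its topmost row is [pos].
   It has length 3 if [long], and length 2 otherwise. *)
Record car := Car { horizontal : bool; long : bool; lane : nat; pos : nat }.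

Definition cells (c : car) : seq cell :=
  [seq if horizontal c then (lane c, p) else (p, lane c)
     | p <- iota (pos c) (if long c then 3 else 2)].

Definition slide_to (c : car) (p : nat) : car :=
  Car (horizontal c) (long c) (lane c) p.

Record game := Game {
  rows : nat;
  cols : nat;
  exit : cell;
  target : car;
  others : seq car
}.

Definition on_board (G : game) (x : cell) : bool :=
  (x.1 < rows G) && (x.2 < cols G).

Definition placement (G : game) (s : seq car) : bool :=
  let occupied := flatten [seq cells c | c <- s] in
  all (on_board G) occupied && uniq occupied.

(* The exit is a boundary cell through which the target car, driving along its
   own orientation, can leave the board. *)
Definition exit_ok (G : game) : bool :=
  on_board G (exit G) &&
  (if horizontal (target G)
   then ((exit G).2 == 0) || ((exit G).2 == (cols G).-1)
   else ((exit G).1 == 0) || ((exit G).1 == (rows G).-1)).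

Definition valid (G : game) : bool :=
  placement G (target G :: others G) && exit_ok G.

(* One car slides from position [pos c] to position [q], and no cell that it
   sweeps on its way is off the board or occupied by another car. *)
Definition move (G : game) (s s' : seq car) : Prop :=
  exists s1 c s2 q,
    [/\ s = s1 ++ c :: s2, s' = s1 ++ slide_to c q :: s2 &
        forall p, minn (pos c) q <= p <= maxn (pos c) q ->
          placement G (s1 ++ slide_to c p :: s2)].

Definition solvable (G : game) : Prop :=
  exists t s, clos_refl_trans _ (move G) (target G :: others G) (t :: s) /\
              exit G \in cells t.

Definition encode_nat (n : nat) : seq bool := rcons (nseq n true) false.

Definition encode_car (c : car) : seq bool :=
  [:: horizontal c, long c & encode_nat (lane c) ++ encode_nat (pos c)].

(* Coordinates are in unary: the length of an encoding is polynomial in the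
   number of cells of the board. *)
Definition encode (G : game) : seq bool :=
  encode_nat (rows G) ++ encode_nat (cols G) ++
  encode_nat (exit G).1 ++ encode_nat (exit G).2 ++
  flatten [seq encode_car c | c <- target G :: others G].

(* The boards with [k] rows and any number [n] of columns. *)
Definition rush_hour (k : nat) : language := fun x =>
  exists G, [/\ x = encode G, valid G, rows G = k & solvable G].

(* Main.v *)
(** Hardness.  A board is cut into 17 x 17 tiles joined by border cars that lie in one of the two adjacent
    tiles, so that a tile imposes clauses on the borders that may be occupied from inside; blocks of 2 x 3 tiles
    give all the clauses that are needed, including the crossing of two borders.  A strip of constant height
    then carries, for each place [i] and letter [a] of a word, a wire whose value says that place [i] may hold
    [a], and the tiles forbid incompatible letters at adjacent places.  Sliding cars thus amounts to rewriting a
    word over a fixed alphabet, in both directions.  The word holds a single token that walks by a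
    deterministic rule; as acceptance is a dead end, undirected rewriting reaches it iff the computation does.
    By sweeping over the word the token simulates one step of a Turing machine per sweep, and the height of the
    strip depends on the machine only.  The board is given by arithmetic expressions with bounded sums in the
    size and the bits of the input, and all such expressions are evaluated in polynomial time.

    Membership.  By Savitch's theorem, solvability is a quantified Boolean formula whose matrix is again such an
    expression, and a machine evaluates it in polynomial space.

    Hardness yields a height that depends on the language.  To get one height [k] for all of PSPACE, take the
    one obtained from a machine that decides Rush Hour on boards of all heights, and compose the two
    reductions. *)
From HB Require Import structures.
From Stdlib Require Import FunctionalExtensionality.
Require Import Defs.
From mathcomp Require Import zify.

Set Implicit Arguments.
Unset Strict Implicit.
Unset Printing Implicit Defensive.

(** For tiles and for blocks of tiles, a state above is represented by one canonical state below,
    and every state below is projected to a state above. Paths are needed only between canonical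
    states. That nothing else can happen follows from the projection, because the forbidden sets are
    confirmed by exhaustive search below. One generic simulation serves both levels.

    A second danger is that cars of one tile stray into another. Tiles are therefore packed with
    fixed cars until every car is confined to an interval of positions; this is again a finite check
    on single tiles.

    A constraint says only that certain borders are not all occupied from inside, as in
    nondeterministic constraint logic. It is monotone: vacating a border never violates it. Hence
    paths are stored only for occupying one more border, and their reverses serve for vacating it.

    The height is constant, so there is no room to lay out time along the board: the computation
    unfolds in the moves, and the strip holds one configuration. A place is wired only to its two
    neighbours, by rows that are reused by every second place. *)

Module Tiles.

(** * Tiles and the checks on them by computation *)

Record slider := Slider { is_h : bool; is_long : bool; track : nat; lo : nat; hi : nat }.

Definition slider_code (s : slider) := (is_h s, is_long s, track s, lo s, hi s).
Definition slider_decode x := let: (h, l, t, a, b) := x in Slider h l t a b.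
Lemma slider_codeK : cancel slider_code slider_decode. Proof. by case. Qed.
HB.instance Definition _ := Equality.copy slider (can_type slider_codeK).

Definition at_pos (s : slider) (p : nat) : car := Car (is_h s) (is_long s) (track s) p.

(** The first bit is set for the top and bottom ports, whose border cars are vertical; the second
    for the right and bottom ports. A border is later named after the tile whose right or bottom
    port it is. *)
Definition port := (bool * bool)%type.
Definition pL : port := (false, false).
Definition pR : port := (false, true).
Definition pT : port := (true, false).
Definition pB : port := (true, true).
Definition all_ports : seq port := [:: pL; pR; pT; pB].

Definition ports := (bool * bool * bool * bool)%type.
Definition occ (p : ports) (e : port) : bool :=
  let: (l, r, t, b) := p in
  if e.1 then (if e.2 then b else t) else (if e.2 then r else l).
Definition ports_of (f : port -> bool) : ports := (f pL, f pR, f pT, f pB).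
Definition all_sets : seq ports :=
  [seq (x, d) | x <- [seq (x, c) | x <- [seq (x, b) | x <- [:: true; false], b <- [:: true; false]],
      c <- [:: true; false]], d <- [:: true; false]].

(* A port is occupied when the car on that border lies inside the tile.  [forbidden] lists the sets of ports
   that cannot be occupied together.  Given the occupied ports among the [relevant] ones, [canon_table] gives
   positions of the movers, and for a further port [e] [path_table] gives the movers to be shifted, one cell
   at a time, to reach the positions prescribed once [e] is occupied.  The tables were found by computer
   search. *)
Record tile := Tile {
  movers : seq slider;
  walls : seq slider;
  relevant : seq port;
  forbidden : seq (seq port);
  canon_table : seq (seq port * seq nat);
  path_table : seq (seq port * port * seq nat)
}.

Definition h2 := Slider true false.
Definition h3 := Slider true true.
Definition v2 := Slider false false.
Definition v3 := Slider false true.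

Definition baseD : tile := Tile
  [:: h2 8 11 12; v3 11 6 9; h3 11 8 9; v2 8 11 12; h2 10 9 10; h2 10 7 8; h2 10 5 6; v2 5 8 9; h2
   8 3 4; h2 8 1 2; h2 8 13 14; v2 8 13 14; v3 7 10 11]
  [:: h3 14 5 5; h3 16 5 5; h2 11 5 5; v3 6 7 7; h3 7 3 3; h3 9 7 7; v2 10 8 8; v3 10 5 5; h2 5 11
   11; v2 12 9 9; v3 12 11 11; h3 12 9 9; h3 16 2 2; h2 16 0 0; v3 16 14 14; v3 16 5 5; h2 0 6 6;
   h2 0 4 4; v3 16 9 9; v2 16 12 12; v3 16 0 0; v2 16 3 3; h2 16 9 9; v3 0 5 5; h2 7 1 1; v2 0 3
   3; h2 16 14 14; h3 16 11 11; v2 0 9 9; h2 0 0 0; h2 0 2 2; v2 0 1 1; v2 0 11 11; v2 4 9 9; h3 0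
   9 9; v3 0 13 13; h3 0 12 12; v3 15 0 0; v2 15 3 3; h3 5 13 13; v3 4 11 11; v2 4 14 14; h2 2 7
   7; h3 2 9 9; v2 10 3 3; v3 6 1 1; h3 2 12 12; v2 12 14 14; v3 6 4 4]
  [:: pL; pR; pB]
  [:: [:: pL; pR]; [:: pR; pB]]
  [:: ([:: pL; pB], [:: 12; 6; 9; 11; 10; 8; 6; 9; 4; 2; 14; 13; 11]); ([:: pL], [:: 12; 6; 9; 11;
   10; 8; 6; 9; 4; 2; 14; 13; 11]); ([:: pR], [:: 11; 9; 8; 12; 9; 7; 5; 8; 3; 1; 13; 14; 11]);
   ([:: pB], [:: 12; 6; 9; 11; 10; 8; 6; 9; 4; 2; 14; 13; 11]); ([::], [:: 12; 6; 9; 11; 10; 8; 6;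
   9; 4; 2; 14; 13; 11])]
  [:: ([:: pL], pB, [:: ]); ([:: pB], pL, [:: ]); ([::], pL, [:: ]); ([::], pR, [:: 1; 9; 11; 3;
   8; 2; 7; 6; 5; 4; 1; 1; 0; 10]); ([::], pB, [:: ])].

Definition baseY : tile := Tile
  [:: v2 1 6 7; v2 1 4 5; h2 4 1 2; h3 4 3 4; v2 6 4 5; v2 6 6 7; v3 15 8 9; h3 11 12 13; h3 11 9
   10; v3 9 8 9; h3 8 6 8; h2 1 8 9; h2 1 10 11; v3 12 1 2; v3 12 4 5; h2 7 10 11; h3 7 7 8; h3 15
   5 6; v2 5 13 14; v2 5 11 12; h2 11 5 6; v2 7 8 10; v2 7 6 8; h3 9 4 5; h3 10 4 5; h3 11 2 3]
  [:: h2 8 12 12; v2 8 9 9; h3 16 5 5; v3 11 8 8; h3 0 9 9; h3 5 7 7; v3 8 11 11; h2 12 6 6; v2 5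
   7 7; v2 5 5 5; v3 16 9 9; v3 0 5 5; v2 0 3 3; h2 0 12 12; v2 13 6 6; v3 3 8 8; h3 3 1 1; h2 5
   10 10; h3 12 9 9; h3 12 12 12; h2 12 15 15; v3 7 2 2; v2 7 0 0; h3 2 8 8; v3 11 2 2; h2 3 5 5;
   v3 4 1 1; v2 13 1 1; h2 9 1 1; v2 2 7 7; v2 2 5 5; h2 7 3 3; v3 0 9 9; v3 13 3 3; h2 0 14 14;
   v2 16 0 0; h3 16 2 2; h2 16 0 0; v3 4 13 13; h2 12 3 3; h3 12 0 0; v2 1 10 10; v2 16 15 15; v2
   16 13 13; v3 16 5 5; h2 7 14 14; v3 14 8 8; h3 16 9 9; v3 9 13 13; h3 14 6 6; v3 16 2 2; h2 0 0
   0; v2 0 1 1; v3 0 13 13; v3 6 0 0; h3 0 2 2; v3 5 0 0; h2 16 14 14; h2 16 12 12]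
  [:: pL; pT; pR; pB]
  [:: [:: pT; pB]; [:: pL; pR]; [:: pT; pR]]
  [:: ([:: pL; pT], [:: 6; 4; 2; 4; 5; 7; 8; 13; 10; 9; 8; 9; 11; 2; 5; 10; 7; 6; 14; 12; 5; 10;
   8; 4; 4; 2]); ([:: pL; pB], [:: 6; 4; 2; 4; 5; 7; 8; 13; 10; 9; 8; 8; 10; 1; 4; 11; 8; 5; 13;
   11; 6; 8; 6; 4; 4; 2]); ([:: pR; pB], [:: 7; 5; 1; 3; 4; 6; 9; 12; 9; 8; 6; 8; 10; 1; 4; 11; 8;
   5; 13; 11; 6; 9; 6; 4; 4; 2]); ([:: pL], [:: 6; 4; 2; 4; 5; 7; 8; 13; 10; 9; 8; 8; 10; 1; 4;
   11; 8; 6; 13; 11; 6; 9; 6; 4; 4; 2]); ([:: pT], [:: 6; 4; 2; 4; 5; 7; 8; 13; 10; 9; 8; 9; 11;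
   2; 5; 10; 7; 6; 14; 12; 5; 10; 8; 4; 4; 2]); ([:: pR], [:: 7; 5; 1; 3; 4; 6; 9; 12; 9; 8; 6; 8;
   10; 1; 4; 11; 8; 5; 13; 11; 6; 9; 6; 4; 4; 2]); ([:: pB], [:: 7; 5; 1; 3; 5; 7; 8; 13; 10; 9;
   8; 8; 10; 1; 4; 11; 8; 5; 13; 11; 6; 8; 6; 4; 4; 2]); ([::], [:: 6; 4; 2; 4; 5; 7; 8; 13; 10;
   9; 8; 8; 10; 1; 4; 11; 8; 5; 13; 11; 6; 9; 6; 4; 4; 2])]
  [:: ([:: pL], pT, [:: 18; 19; 20; 21; 22; 22; 16; 15; 14; 13; 12; 11]); ([:: pL], pB, [:: 17;
   21]); ([:: pT], pL, [:: ]); ([:: pR], pB, [:: ]); ([:: pB], pL, [:: 3; 2; 1; 0]); ([:: pB], pR,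
   [:: 4; 5; 21; 10; 10; 9; 8; 7; 6]); ([::], pL, [:: 17]); ([::], pT, [:: 17; 18; 19; 20; 21; 22;
   22; 16; 15; 14; 13; 12; 11]); ([::], pR, [:: 0; 1; 2; 3; 4; 5; 10; 10; 9; 8; 7; 6]); ([::], pB,
   [:: 0; 1; 2; 3; 21])].

Definition baseO : tile := Tile
  [:: v2 1 8 9; v3 1 10 11; h2 13 1 2; h2 13 3 4; v3 5 10 11; v2 5 8 9; h2 11 6 9; h2 1 8 9; h3 1
   10 11; v2 13 1 2; v2 13 3 4; h3 5 10 11; h2 5 8 9; h3 15 8 9; v2 11 13 14; v2 11 11 12; h3 11 8
   11; v3 10 8 9; h3 8 5 9; v3 8 5 9; h3 7 8 9; h2 7 6 7; v3 5 5 6]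
  [:: h3 16 9 9; h2 0 9 9; h3 0 11 11; h3 10 11 11; v3 0 9 9; v2 0 12 12; h2 12 9 9; h3 12 6 6; v3
   6 13 13; h3 14 3 3; h2 14 0 0; v2 2 14 14; v2 0 15 15; h3 16 1 1; h3 16 4 4; v2 7 15 15; v2 7
   13 13; h3 14 8 8; v3 7 4 4; h3 4 8 8; v3 11 2 2; v2 12 8 8; v2 12 6 6; h3 6 13 13; v2 14 4 4;
   v3 14 1 1; h2 0 14 14; v2 16 0 0; v3 16 2 2; v3 16 5 5; h2 16 15 15; h2 4 5 5; v3 7 0 0; h3 2 8
   8; v3 16 9 9; v3 16 12 12; h2 15 15 15; v3 0 5 5; h2 7 1 1; v2 2 8 8; v3 2 10 10; v2 0 3 3; h3
   16 12 12; v3 12 13 13; h2 12 12 12; v3 14 13 13; v2 14 11 11; v2 14 9 9; v2 14 7 7; v3 0 0 0;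
   h3 0 1 1; h3 0 4 4; h2 3 7 7; h2 3 9 9; v3 6 1 1; v3 4 6 6; v2 4 4 4; h2 9 3 3; v3 3 6 6; h3 5
   1 1; v3 4 1 1]
  [:: pL; pT; pB]
  [:: [:: pL; pT; pB]]
  [:: ([:: pL; pT], [:: 9; 11; 2; 4; 10; 8; 6; 9; 11; 2; 4; 10; 8; 8; 14; 12; 11; 9; 7; 9; 8; 6;
   5]); ([:: pL; pB], [:: 9; 11; 2; 4; 10; 8; 6; 8; 10; 1; 3; 11; 9; 9; 13; 11; 8; 8; 6; 5; 9; 6;
   5]); ([:: pT; pB], [:: 8; 10; 1; 3; 11; 9; 6; 9; 11; 2; 4; 10; 8; 9; 13; 11; 8; 8; 5; 8; 9; 6;
   5]); ([:: pL], [:: 9; 11; 2; 4; 10; 8; 6; 8; 10; 1; 3; 10; 8; 8; 14; 12; 11; 9; 9; 8; 9; 6;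
   5]); ([:: pT], [:: 8; 10; 1; 3; 11; 9; 6; 9; 11; 2; 4; 10; 8; 8; 13; 11; 8; 8; 5; 8; 8; 6; 5]);
   ([:: pB], [:: 8; 10; 1; 3; 11; 9; 6; 8; 10; 1; 4; 10; 8; 9; 13; 11; 8; 8; 5; 7; 9; 6; 5]);
   ([::], [:: 8; 10; 1; 4; 10; 8; 6; 8; 10; 1; 4; 10; 8; 8; 14; 12; 9; 8; 6; 9; 9; 6; 5])]
  [:: ([:: pL], pT, [:: 10; 19; 20; 9; 18; 18; 8; 7]); ([:: pL], pB, [:: 11; 12; 19; 19; 19; 18;
   18; 18; 17; 16; 16; 16; 15; 14; 13]); ([:: pT], pL, [:: 14; 15; 16; 16; 16; 17; 19; 18; 18; 5;
   4; 3; 2; 1; 0]); ([:: pT], pB, [:: 13; 20]); ([:: pB], pL, [:: 10; 11; 12; 19; 19; 18; 5; 4; 3;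
   2; 1; 0]); ([:: pB], pT, [:: 9; 19; 8; 7]); ([::], pL, [:: 2; 10; 16; 16; 17; 18; 18; 18; 19;
   1; 0]); ([::], pT, [:: 3; 4; 5; 9; 18; 19; 20; 8; 16; 7; 15; 14]); ([::], pB, [:: 3; 4; 5; 18;
   19; 19; 16; 15; 14; 13])].

Definition baseZ : tile := Tile
  [:: v2 8 3 4; v3 8 5 6; h2 8 3 4; h3 8 5 6; h2 8 1 2; v2 8 1 2]
  [:: h2 16 6 6; v2 16 15 15; v2 16 13 13; h2 0 6 6; h3 0 3 3; v3 16 0 0; v3 16 3 3; v2 16 6 6; v3
   16 10 10; h2 9 15 15; h3 0 0 0; v3 0 1 1; v2 0 4 4; v2 0 6 6; v3 0 14 14; h2 16 1 1; h3 16 3 3;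
   h2 16 9 9; h3 16 13 13; h2 16 11 11; v2 0 9 9; v3 0 11 11; h2 0 9 9; h3 0 13 13; h2 0 11 11; v2
   14 7 7; h3 9 12 12; h2 14 7 7; v2 9 7 7; h2 6 9 9; h3 9 6 6; h3 9 3 3; h2 9 1 1; h3 9 9 9; v3 6
   13 13; h3 6 13 13; h2 6 11 11; v3 9 13 13; v3 6 10 10; v3 9 10 10]
  [:: pL; pT]
  [:: [:: pL; pT]]
  [:: ([:: pL], [:: 3; 5; 4; 6; 2; 1]); ([:: pT], [:: 4; 6; 3; 5; 1; 2]); ([::], [:: 3; 5; 3; 5;
   1; 1])]
  [:: ([::], pL, [:: 3; 2; 4]); ([::], pT, [:: 1; 0; 5])].

Definition baseH : tile := Tile
  [:: h2 8 1 2; h2 8 3 4; h2 8 5 6; h2 8 7 8; h2 8 9 10; h2 8 11 12; h2 8 13 14]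
  [:: h2 16 6 6; v2 16 15 15; v3 16 12 12; v2 16 6 6; v2 16 4 4; v3 16 1 1; h2 0 15 15; h2 0 13
   13; h2 0 6 6; h3 0 3 3; h3 0 0 0; v2 0 1 1; v3 0 3 3; v2 0 6 6; v3 16 9 9; v2 0 15 15; h3 16 1
   1; h2 16 4 4; v3 0 12 12; v3 0 9 9; h2 16 9 9; h3 0 9 9; v3 12 0 0; h2 16 14 14; h3 16 11 11;
   h3 14 7 7; h3 14 4 4; h3 14 1 1; h3 14 10 10; h3 14 13 13; h3 2 6 6; h3 2 9 9; h3 2 3 3; h2 2 1
   1; v3 12 3 3; v2 12 6 6]
  [:: pL; pR]
  [:: [:: pL; pR]]
  [:: ([:: pL], [:: 2; 4; 6; 8; 10; 12; 14]); ([:: pR], [:: 1; 3; 5; 7; 9; 11; 13]); ([::], [:: 2;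
   4; 6; 8; 10; 12; 14])]
  [:: ([::], pL, [:: ]); ([::], pR, [:: 0; 1; 2; 3; 4; 5; 6])].

Definition baseN : tile := Tile
  [::]
  [:: h2 16 6 6; v2 16 15 15; v3 16 12 12; h2 0 6 6; h3 0 3 3; h3 0 14 14; v3 16 1 1; h2 0 1 1; v3
   0 0 0; v2 16 6 6; v2 16 4 4; v3 0 3 3; v2 0 6 6; v3 16 9 9; v2 0 15 15; h3 16 1 1; h2 16 4 4;
   v2 0 13 13; v2 0 11 11; v2 0 9 9; h3 0 11 11; h2 0 9 9; h2 16 9 9; h2 16 14 14; h3 16 11 11; v3
   2 7 7; v2 14 8 8; v3 2 4 4; h3 14 6 6; h3 2 6 6; h3 10 13 13; v3 9 1 1; v3 9 13 13; v3 2 1 1;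
   h3 2 3 3; v2 5 14 14; h3 10 1 1; v2 14 6 6; v2 14 4 4; v3 14 1 1; v3 9 4 4; h2 10 4 4; v3 9 10
   10; v3 9 7 7; v3 5 11 11; h3 10 6 6; h3 10 10 10]
  [::]
  [::]
  [:: ([::], [::])]
  [::].

Definition baseE : tile := Tile
  [:: h3 7 0 3; v3 15 5 6; h3 5 12 13; h3 5 9 10; h2 5 7 8; h2 5 5 6; h3 5 2 3; v2 2 5 6; h2 8 1
   2; h2 8 3 4]
  [:: h2 6 0 0; v3 1 3 3; v2 16 6 6; v2 16 4 4; v3 0 3 3; h3 4 13 13; h3 4 2 2; h2 4 11 11; h3 4 5
   5; h3 4 8 8; v3 16 1 1; h3 0 14 14; h3 16 5 5; h2 16 3 3; v3 16 14 14; h3 0 5 5; v3 16 9 9; v2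
   16 12 12; h3 9 13 13; v3 14 6 6; h2 0 3 3; h3 0 0 0; v2 0 1 1; v2 1 1 1; v2 0 15 15; h2 16 1 1;
   v3 0 12 12; h2 0 12 12; v3 0 9 9; h2 16 9 9; h2 0 9 9; v2 11 0 0; h3 16 13 13; h2 16 11 11; v2
   6 6 6; v3 6 8 8; h3 2 8 8; v2 11 2 2; v3 7 1 1; h2 14 8 8; h2 14 6 6; v3 10 13 13; h3 14 3 3;
   h2 14 1 1; v2 10 11 11; v3 10 8 8; v2 10 6 6; h2 9 11 11; v3 6 11 11]
  [:: pR]
  [::]
  [:: ([:: pR], [:: 3; 5; 12; 9; 7; 5; 2; 6; 2; 4]); ([::], [:: 0; 6; 13; 10; 8; 6; 3; 5; 2; 4])]
  [:: ([::], pR, [:: 0; 0; 0; 7; 6; 5; 4; 3; 2; 1])].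

(** A path lists movers without directions, as [move_to] shifts toward the goal position. So paths
    survive a symmetry unchanged, while positions depend on the slider. *)
Definition map_tile (fs : slider -> slider) (fq : slider -> nat -> nat)
    (fp : port -> port) (t : tile) : tile :=
  Tile (map fs (movers t)) (map fs (walls t)) (map fp (relevant t))
    (map (map fp) (forbidden t))
    [seq (map fp x.1, [seq fq y.1 y.2 | y <- zip (movers t) x.2]) | x <- canon_table t]
    [seq (map fp x.1.1, fp x.1.2, x.2) | x <- path_table t].

Definition len (s : slider) : nat := if is_long s then 3 else 2.
Definition reflect_slider (v : bool) (s : slider) : slider :=
  if is_h s (+) v
  then Slider (is_h s) (is_long s) (track s) (17 - len s - hi s) (17 - len s - lo s)
  else Slider (is_h s) (is_long s) (16 - track s) (lo s) (hi s).
Definition reflect_pos (v : bool) (s : slider) (p : nat) : nat :=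
  if is_h s (+) v then 17 - len s - p else p.
Definition reflect_tile (v : bool) : tile -> tile :=
  map_tile (reflect_slider v) (reflect_pos v)
    (fun e => if e.1 == v then (e.1, ~~ e.2) else e).
Definition transpose_tile : tile -> tile :=
  map_tile (fun s => Slider (~~ is_h s) (is_long s) (track s) (lo s) (hi s))
    (fun _ p => p) (fun e => (~~ e.1, e.2)).

(** The suffixes m and v stand for the left-right and the top-bottom reflection, r for a quarter
    turn; [V] is the transposed [H]. *)
Inductive kind := D | Dm | Dv | Y | Yv | O | Or | Z | Zm | Zv | H | V | N | E.
Definition tile_of (k : kind) : tile :=
  match k with
  | D => baseD
  | Dm => reflect_tile false baseD
  | Dv => reflect_tile true baseD
  | Y => baseY
  | Yv => reflect_tile true baseY
  | O => baseO
  | Or => reflect_tile true (transpose_tile baseO)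
  | Z => baseZ
  | Zm => reflect_tile false baseZ
  | Zv => reflect_tile true baseZ
  | H => baseH
  | V => transpose_tile baseH
  | N => baseN
  | E => baseE
  end.

(** A car on the border of two tiles covers the ring cells of both in either of its positions, and
    the port cell of the tile in which it lies. It never reaches an inner cell: a local car that
    always meets one of the three cells stops it. *)
Definition ring_cell (e : port) : cell :=
  let a := if e.2 then 16 else 0 in if e.1 then (a, 8) else (8, a).
Definition port_cell (e : port) : cell :=
  let a := if e.2 then 15 else 1 in if e.1 then (a, 8) else (8, a).
Definition inner_cell (e : port) : cell :=
  let a := if e.2 then 14 else 2 in if e.1 then (a, 8) else (8, a).
Definition in_tile (x : cell) : bool := (x.1 < 17) && (x.2 < 17).

Definition locals (t : tile) : seq slider := movers t ++ walls t.
Definition positions (s : slider) : seq nat := iota (lo s) (hi s - lo s).+1.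
Definition pos_cells (s : slider) (p : nat) : seq cell := cells (at_pos s p).
Definition sweep (s : slider) : seq cell := flatten [seq pos_cells s p | p <- positions s].
Definition meets (a b : seq cell) : bool := has (mem b) a.
Definition always (s : slider) (a : seq cell) : bool :=
  all (fun q => meets (pos_cells s q) a) (positions s).

(** A step is impossible if it ends on a ring cell, or if another car meets the old or the new cells
    wherever it stands: it cannot meet the old ones, so it blocks the new ones. *)
Definition stop_ok (t : tile) (k : nat) (p0 p : nat) : bool :=
  let s := nth (h2 0 0 0) (locals t) k in
  let u := pos_cells s p ++ pos_cells s p0 in
  meets (pos_cells s p) (map ring_cell all_ports) ||
  has (fun j => (j != k) && always (nth (h2 0 0 0) (locals t) j) u) (iota 0 (size (locals t))).

Definition low_ok t k := let s := nth (h2 0 0 0) (locals t) k in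
  (lo s == 0) || stop_ok t k (lo s) (lo s).-1.
Definition high_ok t k := let s := nth (h2 0 0 0) (locals t) k in
  (hi s + len s == 17) || stop_ok t k (hi s) (hi s).+1.

Definition port_ok (t : tile) (e : port) : bool :=
  has (fun s => always s [:: ring_cell e; port_cell e; inner_cell e]) (locals t).

Definition side (e : port) (i : nat) : cell :=
  let a := if e.2 then 16 else 0 in if e.1 then (a, i) else (i, a).
(** A car that left its tile would enter a side cell of the next one. These are permanently covered,
    cell 8 being the ring cell under the border car. *)
Definition side_ok (t : tile) (e : port) : bool :=
  all (fun i => (i == 8) || has (fun s => always s [:: side e i]) (locals t)) (iota 0 17).

Definition static_ok (t : tile) : bool :=
  let w := flatten [seq pos_cells s (lo s) | s <- walls t] in
  [&& all (fun s => (lo s <= hi s) && (track s < 17) && (hi s + len s <= 17)) (locals t),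
      all (fun s => lo s == hi s) (walls t),
      uniq (w ++ map ring_cell all_ports ++ map port_cell all_ports) &
      all (fun s => ~~ meets (sweep s) w) (movers t)].

Definition blocked_ok (t : tile) : bool :=
  all (fun k => low_ok t k && high_ok t k) (iota 0 (size (locals t))).

Definition port_cells (p : ports) : seq cell :=
  map ring_cell all_ports ++ map port_cell (filter (occ p) all_ports).

Definition mover_cells (t : tile) (s : seq nat) : seq cell :=
  flatten [seq pos_cells x.1 x.2 | x <- zip (movers t) s].
Definition valid_pos (t : tile) (p : ports) (s : seq nat) : bool :=
  [&& size s == size (movers t), all (fun x => lo x.1 <= x.2 <= hi x.1) (zip (movers t) s) &
      uniq (mover_cells t s ++ port_cells p)].

(* Conditionals rather than boolean connectives, which call-by-value evaluation
   would not short-circuit. *)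
Fixpoint extends (m : seq slider) (o : seq cell) : bool :=
  if m is s :: m' then
    (fix try qs := if qs is q :: qs' then
       let c := pos_cells s q in
       if meets c o then try qs' else if extends m' (c ++ o) then true else try qs'
     else false) (positions s)
  else true.

Definition only (f : seq port) : ports := ports_of (mem f).
(** By monotonicity it is enough to try each forbidden set with all other ports empty. *)
Definition sound_ok (t : tile) : bool :=
  all (fun f => ~~ extends (movers t) (port_cells (only f))) (forbidden t).
Definition exit_sound : bool :=
  if movers baseE is s :: m
  then ~~ extends m (pos_cells s 0 ++ port_cells (only [:: pR])) else false.

Definition allowed (t : tile) (p : ports) : bool := ~~ has (all (occ p)) (forbidden t).

Definition lookup (A : eqType) (B : Type) (d : B) (l : seq (A * B)) (a : A) : B :=
  head d [seq x.2 | x <- l & x.1 == a].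
Definition canon (t : tile) (p : ports) : seq nat :=
  lookup [::] (canon_table t) (filter (occ p) (relevant t)).
Definition path_of (t : tile) (p : ports) (e : port) : seq nat :=
  lookup [::] (path_table t) (filter (occ p) (relevant t), e).
Definition set_port (p : ports) (e : port) (b : bool) : ports :=
  ports_of (fun f => if f == e then b else occ p f).
Definition toward (a b : nat) : nat := if a < b then a.+1 else if b < a then a.-1 else a.
Definition move_to (g s : seq nat) (i : nat) : seq nat :=
  set_nth 0 s i (toward (nth 0 s i) (nth 0 g i)).
(** All positions on the way are validated while the port is still empty; the border car enters
    after the last step, whose positions [canon_ok] also validates with the port occupied. *)
Fixpoint follow (t : tile) (p : ports) (g s : seq nat) (l : seq nat) : bool :=
  if valid_pos t p s then
    if l is i :: l' then
      if i < size s then follow t p g (move_to g s i) l' else false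
    else s == g
  else false.

Definition canon_ok (t : tile) : bool :=
  all (fun p => allowed t p ==> valid_pos t p (canon t p) &&
    all (fun e => occ p e || ~~ allowed t (set_port p e true) ||
           follow t p (canon t (set_port p e true)) (canon t p) (path_of t p e)) all_ports)
  all_sets.
(** The first mover of [baseE] is the target. The default 1 makes a missing table entry fail. *)
Definition exit_canon : bool :=
  all (fun p => occ p pR || (head 1 (canon baseE p) == 0)) all_sets.

Lemma all_static k : static_ok (tile_of k). Proof. by case: k; vm_compute. Qed.
Lemma all_blocked k : blocked_ok (tile_of k). Proof. by case: k; vm_compute. Qed.
Lemma all_port k : all (port_ok (tile_of k)) all_ports. Proof. by case: k; vm_compute. Qed.
(** The left side of the exit tile is exempt: the target leaves there, and the tile will stand in
    column 0, where the board ends. *)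
Lemma all_sides k : all (fun e => side_ok (tile_of k) e || (e == pL) && (if k is E then true else false)) all_ports.
Proof. by case: k; vm_compute. Qed.
Lemma all_sound k : sound_ok (tile_of k). Proof. by case: k; vm_compute. Qed.
Lemma all_canon k : canon_ok (tile_of k). Proof. by case: k; vm_compute. Qed.
Lemma exit_checks : exit_sound && exit_canon. Proof. by vm_compute. Qed.

End Tiles.

(** * Cells of cars, and tiles shifted to their place on the board *)

Module Cells.
Import Tiles.

Definition upd (A : eqType) (B : Type) (f : A -> B) (a : A) (b : B) (x : A) : B :=
  if x == a then b else f x.

Lemma mem_pos_cells s p x :
  (x \in pos_cells s p) =
  if is_h s then (x.1 == track s) && (p <= x.2 < p + len s)
  else (x.2 == track s) && (p <= x.1 < p + len s).
Proof.
case: x => a b; rewrite /pos_cells /cells /len /=.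
apply/mapP/idP => [[q]|].
  rewrite mem_iota; case: (is_h s); case: (is_long s) => H [-> ->] /=; lia.
case: (is_h s) => /andP[/eqP-> H]; [exists b|exists a] => //; rewrite mem_iota;
  case: (is_long s) H => /=; lia.
Qed.

(** Row of the tile, column of the tile, number of the car in the tile. *)
Definition ident := (nat * nat * nat)%type.

Lemma split_map (A B : Type) (f : A -> B) l s1 b s2 : map f l = s1 ++ b :: s2 ->
  exists l1 a l2, [/\ l = l1 ++ a :: l2, s1 = map f l1, b = f a & s2 = map f l2].
Proof.
elim: s1 l => [|c s1 IH] [|a l] //=.
  by case=> <- <-; exists [::], a, l.
by case=> <- /IH[l1 [a' [l2 [-> -> -> ->]]]]; exists (a :: l1), a', l2.
Qed.

Lemma uniq_flatten_map (A B : eqType) (f : A -> seq B) l :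
  uniq l -> (forall a, a \in l -> uniq (f a)) ->
  (forall a b x, a \in l -> b \in l -> x \in f a -> x \in f b -> a = b) ->
  uniq (flatten (map f l)).
Proof.
elim: l => //= a l IH /andP[al ul] Hu Hd; rewrite cat_uniq Hu ?mem_head //= IH //.
- rewrite andbT; apply/hasPn => x /flatten_mapP[b bl xb]; apply/negP => xa.
  have bl' : b \in a :: l by rewrite inE bl orbT.
  by rewrite (Hd a b x (mem_head _ _) bl' xa xb) bl in al.
- by move=> b bl; apply: Hu; rewrite inE bl orbT.
- by move=> b c x bl cl; apply: Hd; rewrite inE ?bl ?cl orbT.
Qed.

Lemma uniq_flatten_mapP (A B : eqType) (f : A -> seq B) l a b x :
  uniq (flatten (map f l)) -> a \in l -> b \in l -> x \in f a -> x \in f b -> a = b.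
Proof.
elim: l => //= c l IH; rewrite cat_uniq => /and3P[_ /hasPn Hd Hu].
have Hx d : d \in l -> x \in f d -> x \in f c -> False.
  move=> dl xd xc; have := Hd x; rewrite /= xc => /(_ _)/negP; apply=> //.
  by apply/flatten_mapP; exists d.
rewrite !inE => /orP[/eqP->|al] /orP[/eqP->|bl] // xa xb.
- by case: (Hx b).
- by case: (Hx a).
- exact: IH.
Qed.

Lemma pos_cells_uniq s p : uniq (pos_cells s p).
Proof.
by rewrite map_inj_uniq ?iota_uniq // => a b; rewrite /=; case: (is_h s) => -[].
Qed.

Definition offset (r c : nat) (x : cell) : cell := (r * 17 + x.1, c * 17 + x.2).

Definition shift (r c : nat) (s : slider) : slider :=
  if is_h s then Slider true (is_long s) (r * 17 + track s) (c * 17 + lo s) (c * 17 + hi s)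
  else Slider false (is_long s) (c * 17 + track s) (r * 17 + lo s) (r * 17 + hi s).

Definition base (r c : nat) (s : slider) : nat := (if is_h s then c else r) * 17.

Lemma len_shift r c s : len (shift r c s) = len s.
Proof. by rewrite /shift; case: ifP. Qed.
Lemma lo_shift r c s : lo (shift r c s) = base r c s + lo s.
Proof. by rewrite /shift /base; case: ifP. Qed.
Lemma hi_shift r c s : hi (shift r c s) = base r c s + hi s.
Proof. by rewrite /shift /base; case: ifP. Qed.

Lemma mem_shift r c s p x :
  (offset r c x \in pos_cells (shift r c s) (base r c s + p)) = (x \in pos_cells s p).
Proof.
rewrite !mem_pos_cells len_shift /shift /base; case: x => a b /=.
by case: (is_h s) => /=; rewrite eqn_add2l leq_add2l -addnA ltn_add2l.
Qed.

Lemma mem_shift_ex r c s p x : x \in pos_cells (shift r c s) (base r c s + p) ->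
  exists2 y, x = offset r c y & y \in pos_cells s p.
Proof.
move=> Hx; have Ex : x = offset r c (x.1 - r * 17, x.2 - c * 17).
  move: Hx; rewrite mem_pos_cells len_shift /shift /base /offset; case: x => a b.
  by case: (is_h s) => /= /andP[/eqP-> H]; congr (_, _); lia.
by exists (x.1 - r * 17, x.2 - c * 17) => //; rewrite -(mem_shift r c) -Ex.
Qed.

End Cells.

(** * Orientations of borders, and a generic simulation *)

Module Orientations.
Import Tiles Cells.

Section Orientation.

Variables (nr nc : nat) (eh ev : nat -> nat -> bool).
Hypothesis eh_lt : forall r c, eh r c -> c.+1 < nc.
Hypothesis ev_lt : forall r c, ev r c -> r.+1 < nr.
Variable allow : nat -> nat -> ports -> bool.

Definition left_active r c := (0 < c) && eh r c.-1.
Definition top_active r c := (0 < r) && ev r.-1 c.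

Definition edge := (bool * nat * nat)%type.
Definition active (e : edge) : bool :=
  let: (v, r, c) := e in [&& r < nr, c < nc & if v then ev r c else eh r c].
Definition orientation := edge -> bool.
(** The value true places the border car in the right or lower tile. A border that is not active
    counts as occupied from both sides. *)
Definition occs (o : orientation) (r c : nat) : ports :=
  (~~ left_active r c || o (false, r, c.-1), ~~ eh r c || ~~ o (false, r, c),
   ~~ top_active r c || o (true, r.-1, c), ~~ ev r c || ~~ o (true, r, c)).
Definition good (o : orientation) : Prop :=
  forall r c, r < nr -> c < nc -> allow r c (occs o r c).
(** Only active edges are compared, so the result of a flip is determined up to its values
    elsewhere. *)
Definition flips (e0 : edge) (o o' : orientation) : Prop :=
  active e0 /\ forall e, active e -> o' e = (e == e0) (+) o e.
Definition ostep (o o' : orientation) : Prop := good o' /\ exists e0, flips e0 o o'.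

Lemma eh_active r c : r < nr -> eh r c -> active (false, r, c).
Proof. by move=> rl E; rewrite /active rl E andbT; apply: leq_trans (eh_lt E); rewrite ltnS. Qed.
Lemma ev_active r c : c < nc -> ev r c -> active (true, r, c).
Proof. by move=> cl E; rewrite /active cl E !andbT; apply: leq_trans (ev_lt E); rewrite ltnS. Qed.

Lemma eq_occs o o' r c : r < nr -> c < nc -> (forall e, active e -> o e = o' e) ->
  occs o r c = occs o' r c.
Proof.
move=> rl cl E; rewrite /occs /left_active /top_active; congr (_, _, _, _).
- case: (posnP c) => //= c0; case H: (eh r c.-1) => //=; exact/E/eh_active.
- by case H: (eh r c) => //=; rewrite E //; apply: eh_active.
- case: (posnP r) => //= c0; case H: (ev r.-1 c) => //=; exact/E/ev_active.
- by case H: (ev r c) => //=; rewrite E //; apply: ev_active.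
Qed.

Definition far (e : edge) : nat * nat :=
  let: (v, r, c) := e in if v then (r.+1, c) else (r, c.+1).

Definition port_edge r c (e : port) : edge :=
  if e.2 then (e.1, r, c) else if e.1 then (true, r.-1, c) else (false, r, c.-1).
Definition port_active r c (e : port) : bool :=
  if e.2 then (if e.1 then ev r c else eh r c)
  else if e.1 then top_active r c else left_active r c.

Lemma occ_occs o r c (e : port) :
  occ (occs o r c) e = ~~ port_active r c e || (e.2 (+) o (port_edge r c e)).
Proof. by case: e => [[] []]. Qed.

Lemma port_edge_active r c (e : port) : r < nr -> c < nc -> port_active r c e ->
  active (port_edge r c e).
Proof.
move=> rl cl; case: e => [[] []]; rewrite /port_active /port_edge /=.
- exact: ev_active.
- by case/andP=> _; apply: ev_active.
- exact: eh_active.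
- by case/andP=> _; apply: eh_active.
Qed.

Lemma ports_ext p q : (forall e, occ p e = occ q e) -> p = q.
Proof.
case: p q => [[[l r] t] b] [[[l' r'] t'] b'] H.
by move: (H pL) (H pR) (H pT) (H pB) => /= -> -> -> ->.
Qed.

Lemma occ_set_port p (f e : port) b : occ (set_port p f b) e = if e == f then b else occ p e.
Proof. by case: e => [[] []]. Qed.

Lemma occs_flip e0 o o' r c (e : port) : flips e0 o o' -> r < nr -> c < nc ->
  occ (occs o' r c) e = (port_active r c e && (port_edge r c e == e0)) (+) occ (occs o r c) e.
Proof.
move=> [_ E] rl cl; rewrite !occ_occs; case H: port_active => //=.
by rewrite E ?port_edge_active // addbCA.
Qed.

(** A flip is seen at exactly two ports: the left or top port of the far tile, and the right or
    bottom port of the near one. *)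
Lemma far_port e0 r c (e : port) : r < nr -> c < nc -> active e0 -> (r, c) = far e0 ->
  port_active r c e && (port_edge r c e == e0) = (e == (e0.1.1, false)).
Proof.
case: e0 => [[v r0] c0] rl cl /and3P[_ _ act] /=; case: v act => act [-> ->];
  case: e => [[] []]; rewrite /port_active /port_edge /top_active /left_active /= ?act ?xpair_eqE ?eqxx ?andbT ?andbF //=;
  by rewrite (gtn_eqF (ltnSn _)) andbF.
Qed.

Lemma near_port e0 r c (e : port) : r < nr -> c < nc -> active e0 -> (r, c) = (e0.1.2, e0.2) ->
  port_active r c e && (port_edge r c e == e0) = (e == (e0.1.1, true)).
Proof.
case: e0 => [[v r0] c0] rl cl /and3P[_ _ act] /=; case: v act => act [-> ->];
  case: e => [[] []]; rewrite /port_active /port_edge /top_active /left_active /= ?act ?xpair_eqE ?eqxx ?andbT ?andbF //=;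
  by apply/negbTE/negP => /andP[/andP[H1 _] /eqP H2]; lia.
Qed.

Lemma other_port e0 r c (e : port) : (r, c) != far e0 -> (r, c) != (e0.1.2, e0.2) ->
  port_active r c e && (port_edge r c e == e0) = false.
Proof.
case: e0 => [[v r0] c0] /=; rewrite !xpair_eqE => H1 H2; apply/negbTE/negP => /andP[] +  /eqP.
case: e => [[] []]; rewrite /port_active /port_edge /top_active /left_active /=.
- by move=> _ [_ E1 E2]; rewrite E1 E2 !eqxx in H2.
- by move=> /andP[r1 _] [E0 E1 E2]; move: H1; rewrite -E0 xpair_eqE; lia.
- by move=> _ [_ E1 E2]; rewrite E1 E2 !eqxx in H2.
- by move=> /andP[r1 _] [E0 E1 E2]; move: H1; rewrite -E0 xpair_eqE; lia.
Qed.

Lemma far_in e0 : active e0 -> (far e0).1 < nr /\ (far e0).2 < nc.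
Proof. by case: e0 => [[[] r] c] /= /and3P[rl cl H]; split => //; [apply: ev_lt H | apply: eh_lt H]. Qed.

Lemma occ_far o e0 : active e0 ->
  occ (occs o (far e0).1 (far e0).2) (e0.1.1, false) = o e0.
Proof.
move=> ae; have [rB cB] := far_in ae.
have := far_port (e0.1.1, false) rB cB ae; rewrite eqxx => /(_ _)/andP[].
  exact/esym/surjective_pairing.
by move=> H /eqP E; rewrite occ_occs H E.
Qed.

Lemma near_in e0 : active e0 -> e0.1.2 < nr /\ e0.2 < nc.
Proof. by case: e0 => [[v r] c] /and3P[]. Qed.

Lemma occ_near o e0 : active e0 -> occ (occs o e0.1.2 e0.2) (e0.1.1, true) = ~~ o e0.
Proof.
move=> ae; have [rB cB] := near_in ae.
have /andP[H /eqP E] : port_active e0.1.2 e0.2 (e0.1.1, true) &&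
    (port_edge e0.1.2 e0.2 (e0.1.1, true) == e0).
  by rewrite (near_port _ rB cB ae) // eqxx.
by rewrite occ_occs H E.
Qed.

Section Simulation.

(** [X] is the inner state of one tile, and [rel] stands for mutual reachability on the level below.
    The section is used twice: with positions of cars, and with values of the inner borders of a
    block. *)
Variable X : Type.
Definition put (g : nat -> nat -> X) r c s (r' c' : nat) : X :=
  if (r' == r) && (c' == c) then s else g r' c'.

Variable valid_at : nat -> nat -> ports -> X -> Prop.
Definition PV (o : orientation) (g : nat -> nat -> X) : Prop :=
  forall r c, r < nr -> c < nc -> valid_at r c (occs o r c) (g r c).
Definition agree (g g' : nat -> nat -> X) := forall r c, r < nr -> c < nc -> g r c = g' r c.

Lemma PV_put o g r c s : PV o g -> valid_at r c (occs o r c) s -> PV o (put g r c s).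
Proof. by move=> V Vs r' c' rl cl; rewrite /put; case: andP => [[/eqP-> /eqP->]|_] //; apply: V. Qed.

Lemma eq_PV o g g' : agree g g' -> PV o g -> PV o g'.
Proof. by move=> E V r c rl cl; rewrite -E //; apply: V. Qed.

Variable rel : orientation -> (nat -> nat -> X) -> orientation -> (nat -> nat -> X) -> Prop.
Hypothesis rel_refl : forall o g g', agree g g' -> rel o g o g'.
Hypothesis rel_sym : forall o g o' g', rel o g o' g' -> rel o' g' o g.
Hypothesis rel_trans : forall o g o' g' o'' g'',
  rel o g o' g' -> rel o' g' o'' g'' -> rel o g o'' g''.
Hypothesis rel_flip : forall o o' g e0, flips e0 o o' -> o e0 = false ->
  PV o g -> PV o' g -> rel o g o' g.
Variable canonical : nat -> nat -> ports -> X.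
Hypothesis canonical_valid : forall r c p, r < nr -> c < nc -> allow r c p ->
  valid_at r c p (canonical r c p).
Hypothesis canonical_move : forall o g r c (e : port), r < nr -> c < nc -> PV o g ->
  let p := occs o r c in let p' := set_port p e true in
  g r c = canonical r c p -> allow r c p -> occ p e = false -> allow r c p' ->
  rel o g o (put g r c (canonical r c p')) /\ valid_at r c p (canonical r c p').

Definition can o r c := canonical r c (occs o r c).

Lemma can_PV o : good o -> PV o (can o).
Proof. by move=> Go r c rl cl; apply: canonical_valid => //; apply: Go. Qed.

(** Before the flip the far tile empties its port, afterwards the near tile may settle. Both are
    instances of [canonical_move], the second one reversed, which is why only moves that occupy one
    more port are assumed. *)
Lemma flip_half o o' e0 : good o -> good o' -> flips e0 o o' -> o e0 = false ->
  rel o (can o) o' (can o').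
Proof.
move=> Go Go' Hf oe; have [ae E] := Hf.
have [rB cB] := far_in ae; have [rA cA] := near_in ae.
set B := far e0 in rB cB.
pose eB : port := (e0.1.1, false); pose eA : port := (e0.1.1, true).
have ofar : occ (occs o B.1 B.2) (e0.1.1, false) = false.
  by have := occ_far o ae; rewrite oe.
have onear : occ (occs o e0.1.2 e0.2) (e0.1.1, true) = true by rewrite occ_near // oe.
have pB : occs o' B.1 B.2 = set_port (occs o B.1 B.2) eB true.
  apply: ports_ext => e; rewrite (occs_flip _ Hf) // (far_port _ rB cB ae);
    last exact/esym/surjective_pairing.
  by rewrite occ_set_port; case: eqP => // ->; rewrite ofar.
have pA : occs o e0.1.2 e0.2 = set_port (occs o' e0.1.2 e0.2) eA true.
  apply: ports_ext => e; rewrite occ_set_port (occs_flip _ Hf) // (near_port _ rA cA ae) //.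
  by case: eqP => // ->; rewrite onear.
have pO r c : r < nr -> c < nc -> (r, c) != B -> (r, c) != (e0.1.2, e0.2) ->
    occs o' r c = occs o r c.
  by move=> rl cl n1 n2; apply: ports_ext => e; rewrite (occs_flip _ Hf) // other_port.
have o'e : o' e0 = true by rewrite E // eqxx oe.
(* The far tile takes its new positions while the border is still as in [o]. *)
have [R1 V1] : rel o (can o) o (put (can o) B.1 B.2 (can o' B.1 B.2)) /\
    valid_at B.1 B.2 (occs o B.1 B.2) (can o' B.1 B.2).
  have := @canonical_move o (can o) B.1 B.2 eB rB cB (can_PV Go) erefl (Go _ _ rB cB) ofar.
  by rewrite -pB; apply; apply: Go'.
(* For the near tile time runs backwards: as of [o'] its port is empty, and in [o] it is
   occupied. *)
have [R2 V2] : rel o' (can o') o' (put (can o') e0.1.2 e0.2 (can o e0.1.2 e0.2)) /\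
    valid_at e0.1.2 e0.2 (occs o' e0.1.2 e0.2) (can o e0.1.2 e0.2).
  have := @canonical_move o' (can o') e0.1.2 e0.2 eA rA cA (can_PV Go') erefl (Go' _ _ rA cA).
  by rewrite -pA; apply; [rewrite occ_near // o'e | apply: Go].
have AB : (e0.1.2, e0.2) <> B by rewrite /B /far; case: (e0) => [[[] r] c] /= []; lia.
have Eg r c : r < nr -> c < nc -> put (can o) B.1 B.2 (can o' B.1 B.2) r c =
    put (can o') e0.1.2 e0.2 (can o e0.1.2 e0.2) r c.
  move=> rl cl; rewrite /put; case: andP => [[/eqP Er /eqP Ec]|n1].
    case: andP => [[/eqP Er' /eqP Ec']|_]; last by rewrite Er Ec.
    by case: AB; rewrite -Er' -Ec' Er Ec; apply/esym/surjective_pairing.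
  case: andP => [[/eqP Er' /eqP Ec']|n2]; first by rewrite Er' Ec'.
  rewrite /can pO //; first by apply/eqP => E1; apply: n1; rewrite -E1 !eqxx.
  by apply/eqP => -[E1 E2]; apply: n2; rewrite E1 E2 !eqxx.
apply: rel_trans R1 _; apply: rel_trans (rel_flip Hf oe (PV_put (can_PV Go) V1) _) _.
  by apply: (eq_PV _ (PV_put (can_PV Go') V2)) => r c rl cl; rewrite Eg.
by apply: rel_trans (rel_sym R2); apply: rel_refl => r c rl cl; rewrite Eg.
Qed.

Lemma canonical_reach o o' : good o -> clos_refl_trans _ ostep o o' ->
  good o' /\ rel o (can o) o' (can o').
Proof.
move=> Go H; elim: (Operators_Properties.clos_rt_rtn1 _ _ _ _ H) => [|o1 o2 [G2 [e0 Hf]] _ [G1 R1]].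
  by split => //; apply: rel_refl.
split=> //; apply: rel_trans R1 _; case oe: (o1 e0); last exact: flip_half Hf oe.
apply: rel_sym; have [ae E] := Hf; apply: (flip_half (e0 := e0)) => //.
  by split=> // e aae; rewrite E // addbA addbb.
by rewrite E // eqxx oe.
Qed.

End Simulation.

End Orientation.

End Orientations.

(** * Boards made of tiles: confinement, soundness and completeness *)

Module Boards.
Import Tiles Cells Orientations.

Section Grid.

Variables (nr nc : nat) (kd : nat -> nat -> kind) (eh ev : nat -> nat -> bool).
Hypothesis eh_lt : forall r c, eh r c -> c.+1 < nc.
Hypothesis ev_lt : forall r c, ev r c -> r.+1 < nr.
Hypothesis exit_col : forall r c, kd r c = E -> c = 0.

Local Notation left_active := (left_active eh).
Local Notation top_active := (top_active ev).
Local Notation active := (active nr nc eh ev).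
Local Notation occs := (occs eh ev).
Local Notation flips := (flips nr nc eh ev).
Local Notation tl r c := (tile_of (kd r c)).

Lemma size_locals t : size (locals t) = size (movers t) + size (walls t).
Proof. exact: size_cat. Qed.

Definition tile_allow r c p := allowed (tl r c) p.
Local Notation good := (good nr nc eh ev tile_allow).
Local Notation ostep := (ostep nr nc eh ev tile_allow).

Definition slid (i : ident) : slider :=
  let: (r, c, k) := i in
  match k with
  | 0 => Slider true (eh r c) 8 15 (15 + eh r c)
  | 1 => Slider false (ev r c) 8 15 (15 + ev r c)
  | 2 => Slider true false 8 0 0
  | 3 => Slider false false 8 0 0
  | k'.+4 => nth (h2 0 0 0) (locals (tl r c)) k'
  end.

Definition is_ident (i : ident) : bool :=
  let: (r, c, k) := i in
  [&& r < nr, c < nc &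
      match k with
      | 0 | 1 => true
      | 2 => ~~ left_active r c
      | 3 => ~~ top_active r c
      | k'.+4 => k' < size (locals (tl r c))
      end].

Definition gs (i : ident) : slider := shift i.1.1 i.1.2 (slid i).

Variables (ids : seq ident) (tgt : ident) (ids' : seq ident).
Hypothesis ids_cons : ids = tgt :: ids'.
Hypothesis ids_uniq : uniq ids.
Hypothesis mem_ids : forall i : ident, (i \in ids) = is_ident i.

Variable ex : cell.
Definition placed (F : ident -> nat) : seq car := [seq at_pos (gs i) (F i) | i <- ids].
Definition game_of (F : ident -> nat) : game :=
  Game (nr * 17) (nc * 17) ex (at_pos (gs tgt) (F tgt)) [seq at_pos (gs i) (F i) | i <- ids'].
Definition on_grid (x : cell) := (x.1 < nr * 17) && (x.2 < nc * 17).
Definition fits (F : ident -> nat) : bool :=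
  let o := flatten [seq pos_cells (gs i) (F i) | i <- ids] in all on_grid o && uniq o.

Lemma fitsE F F' : placement (game_of F) (placed F') = fits F'.
Proof. by rewrite /placement /fits /placed -map_comp. Qed.

Lemma fits_on F (i : ident) x : fits F -> i \in ids -> x \in pos_cells (gs i) (F i) -> on_grid x.
Proof. by case/andP=> /allP H _ ii xi; apply: H; apply/flatten_mapP; exists i. Qed.

Lemma fits_inj F (i j : ident) x : fits F -> i \in ids -> j \in ids ->
  x \in pos_cells (gs i) (F i) -> x \in pos_cells (gs j) (F j) -> i = j.
Proof. by case/andP=> _; apply: uniq_flatten_mapP. Qed.

Lemma fitsI F : (forall i x, i \in ids -> x \in pos_cells (gs i) (F i) -> on_grid x) ->
  (forall i j x, i \in ids -> j \in ids ->
    x \in pos_cells (gs i) (F i) -> x \in pos_cells (gs j) (F j) -> i = j) -> fits F.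
Proof.
move=> H1 H2; apply/andP; split.
  by apply/allP => x /flatten_mapP[i ii]; apply: H1.
by apply: uniq_flatten_map => // i _; apply: pos_cells_uniq.
Qed.

Lemma eq_fits F F' : {in ids, F =1 F'} -> fits F = fits F'.
Proof.
move=> E; rewrite /fits; have -> // : [seq pos_cells (gs i) (F i) | i <- ids] =
  [seq pos_cells (gs i) (F' i) | i <- ids].
by apply/eq_in_map => i ii; rewrite E.
Qed.

Lemma eq_placed F F' : {in ids, F =1 F'} -> placed F = placed F'.
Proof. by move=> E; apply/eq_in_map => i ii; rewrite E. Qed.

Lemma placed_upd l1 i l2 F q : ids = l1 ++ i :: l2 ->
  placed (upd F i q) =
  [seq at_pos (gs j) (F j) | j <- l1] ++ at_pos (gs i) q :: [seq at_pos (gs j) (F j) | j <- l2].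
Proof.
move=> E; rewrite /placed E map_cat /= /upd eqxx.
have := ids_uniq; rewrite E cat_uniq /= negb_or => /and3P[_ /andP[n1 _] /andP[n2 _]].
congr (_ ++ _ :: _); apply/eq_in_map => j jl; case: eqP => // Ej; subst j.
  by rewrite jl in n1.
by rewrite jl in n2.
Qed.

Lemma moveP G0 F s' : move (game_of G0) (placed F) s' ->
  exists i q, [/\ i \in ids, s' = placed (upd F i q) &
    forall p, minn (F i) q <= p <= maxn (F i) q -> fits (upd F i p)].
Proof.
case=> s1 [c [s2 [q [E1 E2 H]]]]; case: (split_map E1) => l1 [i [l2 [E s1E cE s2E]]].
exists i, q; split; first by rewrite E mem_cat mem_head orbT.
  by rewrite (placed_upd _ _ E) E2 s1E cE s2E.
by move=> p Hp; rewrite -(fitsE G0) (placed_upd _ _ E); move: (H p); rewrite s1E s2E cE; apply.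
Qed.

Lemma move_placed G0 F i q : i \in ids ->
  (forall p, minn (F i) q <= p <= maxn (F i) q -> fits (upd F i p)) ->
  move (game_of G0) (placed F) (placed (upd F i q)).
Proof.
move=> ii H; case/splitPr: {2}ids / ii (erefl ids) => l1 l2 E.
exists [seq at_pos (gs j) (F j) | j <- l1], (at_pos (gs i) (F i)),
  [seq at_pos (gs j) (F j) | j <- l2], q; split.
- by rewrite /placed E map_cat.
- by rewrite (placed_upd _ _ E).
- by move=> p /H; rewrite -(fitsE G0) (placed_upd _ _ E).
Qed.

Definition in_range (F : ident -> nat) := forall i, i \in ids -> lo (gs i) <= F i <= hi (gs i).
Definition galways (i : ident) (u : seq cell) :=
  forall q, lo (gs i) <= q <= hi (gs i) -> exists2 x, x \in pos_cells (gs i) q & x \in u.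

(** Wherever [j] stands it meets [u]. It does not meet the present cells of [i], so it would meet
    the new ones. *)
Lemma stuck F (i : ident) p u : in_range F -> fits F -> i \in ids ->
  (forall x, x \in u -> x \in pos_cells (gs i) p \/ x \in pos_cells (gs i) (F i)) ->
  (exists2 j, j \in ids & j <> i /\ galways j u) -> ~ fits (upd F i p).
Proof.
move=> rF pF ii Hu [j ij [ji /(_ (F j) (rF j ij))[x xj /Hu[]]]] xi pF'.
  apply: (ji); apply: (fits_inj pF' ij ii (x := x)); last by rewrite /upd eqxx.
  by rewrite /upd; case: eqP.
by apply: ji; apply: (fits_inj pF ij ii xj).
Qed.

Lemma off_board F (i : ident) p x : i \in ids -> x \in pos_cells (gs i) p -> ~~ on_grid x ->
  ~ fits (upd F i p).
Proof. by move=> ii xi xb pF; case/negP: xb; apply: (fits_on pF ii); rewrite /upd eqxx. Qed.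

Lemma galways_sub (i : ident) u u' : {subset u <= u'} -> galways i u -> galways i u'.
Proof. by move=> s H q /H[x x1 x2]; exists x; rewrite ?s. Qed.

Lemma gs_low (i : ident) : lo (gs i) = base i.1.1 i.1.2 (slid i) + lo (slid i).
Proof. exact: lo_shift. Qed.
Lemma gs_high (i : ident) : hi (gs i) = base i.1.1 i.1.2 (slid i) + hi (slid i).
Proof. exact: hi_shift. Qed.
Definition gbase i := base i.1.1 i.1.2 (slid i).

Lemma galways_local (i : ident) a : always (slid i) a -> lo (slid i) <= hi (slid i) ->
  galways i (map (offset i.1.1 i.1.2) a).
Proof.
move=> /allP H lh q; rewrite gs_low gs_high => Hq.
have Eq : q = gbase i + (q - gbase i) by rewrite /gbase; lia.
have /H/hasP[x x1 x2] : q - gbase i \in positions (slid i).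
  by rewrite /positions mem_iota /gbase; lia.
by exists (offset i.1.1 i.1.2 x); [rewrite Eq mem_shift | apply: map_f].
Qed.

Lemma local_id r c s : r < nr -> c < nc -> s \in locals (tl r c) ->
  exists k, [/\ k < size (locals (tl r c)), (r, c, k.+4) \in ids & slid (r, c, k.+4) = s].
Proof.
move=> rl cl /(nthP (h2 0 0 0))[k kl <-]; exists k; split => //.
by rewrite mem_ids /= rl cl kl.
Qed.

Lemma local_static r c s : s \in locals (tl r c) ->
  [/\ lo s <= hi s, track s < 17 & hi s + len s <= 17].
Proof.
by have /and4P[/allP H _ _ _] := all_static (kd r c) => /H/andP[/andP[]].
Qed.

Lemma local_low r c s : s \in locals (tl r c) -> lo s <= hi s.
Proof. by case/local_static. Qed.

Lemma port_cover r c (e : port) : r < nr -> c < nc ->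
  exists2 j, j \in ids & [/\ j.1 = (r, c), 3 < j.2 &
    galways j (map (offset r c) [:: ring_cell e; port_cell e; inner_cell e])].
Proof.
move=> rl cl; have /allP/(_ e) := all_port (kd r c).
have -> : e \in all_ports by case: e => [[] []].
move=> /(_ isT)/hasP[s sl Hs]; have [k [kl ki Ek]] := local_id rl cl sl.
exists (r, c, k.+4) => //; split => //.
by apply: (@galways_local (r, c, k.+4)); rewrite Ek // (local_low sl).
Qed.

Lemma ring_cover r c (e : port) : r < nr -> c < nc ->
  exists2 j, j \in ids & [/\ j.2 < 4, (e.2 -> j.1 = (r, c)) &
    galways j [:: offset r c (ring_cell e)]].
Proof.
move=> rl cl; case: e => [[] []] /=.
- exists (r, c, 1); rewrite ?mem_ids /= ?rl ?cl //; split => // q.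
  rewrite gs_low gs_high /base /= => Hq; exists (offset r c (16, 8)); last by rewrite inE.
  by rewrite mem_pos_cells /gs /shift /offset /len /= eqxx; case: ifP Hq => /=; lia.
- case T: (top_active r c).
    have [r0 Tr] : 0 < r /\ ev r.-1 c by case/andP: T.
    exists (r.-1, c, 1); rewrite ?mem_ids /= ?cl ?andbT; try lia.
    split => // q; rewrite gs_low gs_high /base /= => Hq; exists (offset r c (0, 8)); last by rewrite inE.
    by rewrite mem_pos_cells /gs /shift /offset /len /= Tr eqxx; move: Hq; rewrite Tr; lia.
  exists (r, c, 3); rewrite ?mem_ids /= ?rl ?cl ?T //; split => // q.
  rewrite gs_low gs_high /base /= => Hq; exists (offset r c (0, 8)); last by rewrite inE.
  by rewrite mem_pos_cells /gs /shift /offset /len /= eqxx; lia.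
- exists (r, c, 0); rewrite ?mem_ids /= ?rl ?cl //; split => // q.
  rewrite gs_low gs_high /base /= => Hq; exists (offset r c (8, 16)); last by rewrite inE.
  by rewrite mem_pos_cells /gs /shift /offset /len /= eqxx; case: ifP Hq => /=; lia.
- case T: (left_active r c).
    have [c0 Tc] : 0 < c /\ eh r c.-1 by case/andP: T.
    exists (r, c.-1, 0); rewrite ?mem_ids /= ?rl ?andbT; try lia.
    split => // q; rewrite gs_low gs_high /base /= => Hq; exists (offset r c (8, 0)); last by rewrite inE.
    by rewrite mem_pos_cells /gs /shift /offset /len /= Tc eqxx; move: Hq; rewrite Tc; lia.
  exists (r, c, 2); rewrite ?mem_ids /= ?rl ?cl ?T //; split => // q.
  rewrite gs_low gs_high /base /= => Hq; exists (offset r c (8, 0)); last by rewrite inE.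
  by rewrite mem_pos_cells /gs /shift /offset /len /= eqxx; lia.
Qed.

(** The left side is excluded in column 0, where the exit tile may stand. *)
Lemma side_cover r c (e : port) i : r < nr -> c < nc -> i < 17 -> (e = pL -> 0 < c) ->
  exists2 j, j \in ids & galways j [:: offset r c (side e i)].
Proof.
move=> rl cl il He; have /allP/(_ e) := all_sides (kd r c).
have -> : e \in all_ports by case: e {He} => [[] []].
move=> /(_ isT)/orP[/allP/(_ i)|/andP[/eqP/He c0]]; last first.
  by case Ek: (kd r c) => // _; move: c0; rewrite (exit_col Ek).
rewrite mem_iota il => /(_ isT)/orP[/eqP->|/hasP[s sl Hs]].
  have [j ji [_ _ H]] := ring_cover e rl cl; by exists j.
have [k [kl ki Ek]] := local_id rl cl sl.
exists (r, c, k.+4) => //.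
by apply: (@galways_local (r, c, k.+4) [:: side e i]); rewrite Ek ?(local_low sl).
Qed.

Lemma ident_tile (i : ident) : i \in ids -> i.1.1 < nr /\ i.1.2 < nc.
Proof. by rewrite mem_ids; case: i => [[r c] k] /= /and3P[]. Qed.

Lemma stuck1 F (i : ident) p x : in_range F -> fits F -> i \in ids ->
  x \in pos_cells (gs i) p -> x \notin pos_cells (gs i) (F i) ->
  (exists2 j, j \in ids & galways j [:: x]) -> ~ fits (upd F i p).
Proof.
move=> rF pF ii xp xn [j ij Hj]; apply: (stuck rF pF ii (u := [:: x])).
  by move=> y; rewrite inE => /eqP->; left.
exists j => //; split=> // E; subst j; case/negP: xn.
by have [y y1] := Hj _ (rF i ii); rewrite inE => /eqP<-.
Qed.

Lemma low_out F (i : ident) : in_range F -> fits F -> i \in ids -> lo (slid i) = 0 ->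
  track (slid i) < 17 -> F i = lo (gs i) -> 0 < lo (gs i) -> ~ fits (upd F i (F i).-1).
Proof.
move=> rF pF ii l0 tr FE; rewrite FE gs_low l0 addn0 /base => lpos.
have [rl cl] := ident_tile ii.
case Hh: (is_h (slid i)) lpos => /= lpos.
  apply: (stuck1 rF pF ii (x := offset i.1.1 i.1.2.-1 (side pR (track (slid i))))).
  - rewrite mem_pos_cells /gs /shift Hh /offset /= eqxx /len; case: (is_long _); lia.
  - rewrite FE gs_low l0 /base Hh mem_pos_cells /gs /shift Hh /offset /=;
    apply/negP => /and3P[_ H1 H2]; lia.
  - by apply: side_cover => //; lia.
apply: (stuck1 rF pF ii (x := offset i.1.1.-1 i.1.2 (side pB (track (slid i))))).
- rewrite mem_pos_cells /gs /shift Hh /offset /= eqxx /len; case: (is_long _); lia.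
- rewrite FE gs_low l0 /base Hh mem_pos_cells /gs /shift Hh /offset /=;
    apply/negP => /and3P[_ H1 H2]; lia.
- by apply: side_cover => //; lia.
Qed.

Lemma high_out F (i : ident) : in_range F -> fits F -> i \in ids -> hi (slid i) + len (slid i) = 17 ->
  track (slid i) < 17 -> F i = hi (gs i) -> ~ fits (upd F i (F i).+1).
Proof.
move=> rF pF ii h0 tr FE.
have [rl cl] := ident_tile ii.
have l2 : 2 <= len (slid i) <= 3 by rewrite /len; case: ifP.
case Hh: (is_h (slid i)).
  have x1 : offset i.1.1 i.1.2.+1 (side pL (track (slid i))) \in pos_cells (gs i) (F i).+1.
    by rewrite FE gs_high /base Hh mem_pos_cells /gs len_shift /shift Hh /offset /= eqxx; lia.
  have [lc|] := ltnP i.1.2.+1 nc; last first.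
    by move=> g; apply: off_board ii x1 _; rewrite /on_grid /offset /=; apply/negP => /andP[H1 H2]; lia.
  apply: (stuck1 rF pF ii x1).
  - by rewrite FE gs_high /base Hh mem_pos_cells /gs len_shift /shift Hh /offset /=;
    apply/negP => /and3P[_ H1 H2]; lia.
  - exact: side_cover.
have x1 : offset i.1.1.+1 i.1.2 (side pT (track (slid i))) \in pos_cells (gs i) (F i).+1.
  by rewrite FE gs_high /base Hh mem_pos_cells /gs len_shift /shift Hh /offset /= eqxx; lia.
have [lc|] := ltnP i.1.1.+1 nr; last first.
  by move=> g; apply: off_board ii x1 _; rewrite /on_grid /offset /=; apply/negP => /andP[H1 H2]; lia.
apply: (stuck1 rF pF ii x1).
- by rewrite FE gs_high /base Hh mem_pos_cells /gs len_shift /shift Hh /offset /=;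
    apply/negP => /and3P[_ H1 H2]; lia.
- exact: side_cover.
Qed.

Lemma port_stuck F r c (e : port) (i : ident) p : in_range F -> fits F -> i \in ids -> i.2 < 4 ->
  r < nr -> c < nc ->
  {subset map (offset r c) [:: ring_cell e; port_cell e; inner_cell e] <=
     pos_cells (gs i) p ++ pos_cells (gs i) (F i)} -> ~ fits (upd F i p).
Proof.
move=> rF pF ii i4 rl cl Hs; have [j ij [_ j4 Hj]] := port_cover e rl cl.
apply: (stuck rF pF ii (u := pos_cells (gs i) p ++ pos_cells (gs i) (F i))).
  by move=> x; rewrite mem_cat => /orP.
exists j => //; split; first by move=> E; rewrite E ltnNge -ltnS i4 in j4.
exact: galways_sub Hj.
Qed.

Lemma local_stuck F r c k p : in_range F -> fits F -> (r, c, k.+4) \in ids ->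
  let i := (r, c, k.+4) in forall p0, F i = gbase i + p0 ->
  stop_ok (tl r c) k p0 p -> ~ fits (upd F i (gbase i + p)).
Proof.
move=> rF pF ii i p0 FE; have [rl cl] := ident_tile ii.
case/orP=> [/hasP[x x1 /mapP[e _ Ex]]|/hasP[j]].
  have [j ij [j4 _ Hj]] := ring_cover e rl cl.
  apply: (stuck rF pF ii (u := [:: offset r c x])).
    by move=> y; rewrite inE => /eqP->; left; rewrite mem_shift.
  by exists j => //; split; [move=> E; rewrite E in j4 | rewrite Ex].
rewrite mem_iota add0n => jl /andP[jk Hj].
apply: (stuck rF pF ii (u := map (offset r c) (pos_cells (slid i) p ++ pos_cells (slid i) p0))).
  move=> y /mapP[z]; rewrite mem_cat => /orP[] zz ->; [left|right].
    by rewrite mem_shift.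
  by rewrite FE mem_shift.
exists (r, c, j.+4); first by rewrite mem_ids /= rl cl.
split; first by case=> /eqP; rewrite (negPf jk).
apply: (@galways_local (r, c, j.+4)) => //=.
by apply: (@local_low r c); rewrite mem_nth.
Qed.

(** With [high_stop] this confines every car to its interval: border cars are stopped by the local
    cars behind the ports, local cars by [all_blocked], and cars at the edge of a tile by the side
    cells of the next tile or by the edge of the board. *)
Lemma low_stop F (i : ident) : in_range F -> fits F -> i \in ids -> F i = lo (gs i) ->
  0 < lo (gs i) -> ~ fits (upd F i (F i).-1).
Proof.
move=> rF pF ii FE lp; have [rl cl] := ident_tile ii.
case: i ii FE lp rl cl => [[r c] [|[|[|[|k]]]]] ii FE lp /= rl cl.
- apply: (port_stuck (e := pR) rF pF ii isT rl cl) => x.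
  rewrite FE gs_low mem_cat !mem_pos_cells /= !inE /gs /shift /base /offset /len /=.
  by case/or3P=> /eqP-> /=; rewrite eqxx /=; case: (eh r c); lia.
- apply: (port_stuck (e := pB) rF pF ii isT rl cl) => x.
  rewrite FE gs_low mem_cat !mem_pos_cells /= !inE /gs /shift /base /offset /len /=.
  by case/or3P=> /eqP-> /=; rewrite eqxx /=; case: (ev r c); lia.
- exact: low_out.
- exact: low_out.
have sl : slid (r, c, k.+4) \in locals (tl r c).
  by move: ii; rewrite mem_ids /= rl cl /=; apply: mem_nth.
have [_ tr _] := local_static sl.
have /allP/(_ k) := all_blocked (kd r c).
rewrite mem_iota add0n => /(_ _)/andP[]; first by move: ii; rewrite mem_ids /= rl cl.
case/orP=> [/eqP l0 _|st _]; first exact: low_out.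
have [l0|lpos] := posnP (lo (slid (r, c, k.+4))); first exact: low_out.
rewrite FE gs_low -/(gbase (r, c, k.+4)).
have -> : (gbase (r, c, k.+4) + lo (slid (r, c, k.+4))).-1 =
  gbase (r, c, k.+4) + (lo (slid (r, c, k.+4))).-1 by lia.
by apply: (local_stuck rF pF ii _ st); rewrite FE gs_low.
Qed.

Lemma high_stop F (i : ident) : in_range F -> fits F -> i \in ids -> F i = hi (gs i) ->
  ~ fits (upd F i (F i).+1).
Proof.
move=> rF pF ii FE; have [rl cl] := ident_tile ii.
case: i ii FE rl cl => [[r c] [|[|[|[|k]]]]] ii FE /= rl cl.
- case T: (eh r c); last by apply: high_out => //=; rewrite /len /= T.
  apply: (port_stuck (e := pL) (c := c.+1) rF pF ii isT rl (eh_lt T)) => x.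
  rewrite FE gs_high mem_cat !mem_pos_cells /= !inE /gs /shift /base /offset /len /= T.
  by case/or3P=> /eqP-> /=; rewrite eqxx /=; lia.
- case T: (ev r c); last by apply: high_out => //=; rewrite /len /= T.
  apply: (port_stuck (e := pT) (r := r.+1) rF pF ii isT (ev_lt T) cl) => x.
  rewrite FE gs_high mem_cat !mem_pos_cells /= !inE /gs /shift /base /offset /len /= T.
  by case/or3P=> /eqP-> /=; rewrite eqxx /=; lia.
- apply: (port_stuck (e := pL) rF pF ii isT rl cl) => x.
  rewrite FE gs_high mem_cat !mem_pos_cells /= !inE /gs /shift /base /offset /len /=.
  by case/or3P=> /eqP-> /=; rewrite eqxx /=; lia.
- apply: (port_stuck (e := pT) rF pF ii isT rl cl) => x.
  rewrite FE gs_high mem_cat !mem_pos_cells /= !inE /gs /shift /base /offset /len /=.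
  by case/or3P=> /eqP-> /=; rewrite eqxx /=; lia.
have sl : slid (r, c, k.+4) \in locals (tl r c).
  by move: ii; rewrite mem_ids /= rl cl /=; apply: mem_nth.
have [_ tr _] := local_static sl.
have /allP/(_ k) := all_blocked (kd r c).
rewrite mem_iota add0n => /(_ _)/andP[]; first by move: ii; rewrite mem_ids /= rl cl.
move=> _ /orP[/eqP l0|st]; first exact: high_out.
rewrite FE gs_high -/(gbase (r, c, k.+4)) -addnS.
by apply: (local_stuck rF pF ii _ st); rewrite FE gs_high.
Qed.

Definition edge_id (e : edge) : ident := let: (v, r, c) := e in (r, c, v : nat).
Definition o_of (F : ident -> nat) : orientation :=
  fun e => F (edge_id e) != lo (gs (edge_id e)).

Lemma edge_id_in e : active e -> edge_id e \in ids.
Proof. by case: e => [[[] r] c] /and3P[rl cl _]; rewrite mem_ids /= rl cl. Qed.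

Lemma edge_range F e : in_range F -> active e -> F (edge_id e) = lo (gs (edge_id e)) + o_of F e.
Proof.
move=> rF ae; have := rF _ (edge_id_in ae); rewrite /o_of.
case: e ae => [[v r] c] /and3P[_ _]; rewrite gs_low gs_high.
by case: v => /= ->; case: eqP => /=; lia.
Qed.

Lemma occ_cell F r c (e : port) : in_range F -> r < nr -> c < nc -> occ (occs (o_of F) r c) e ->
  exists2 j : ident, j \in ids &
    j.2 < 4 /\ offset r c (port_cell e) \in pos_cells (gs j) (F j).
Proof.
move=> rF rl cl; case: e => [[] []] /=.
- move=> H; have ii : (r, c, 1) \in ids by rewrite mem_ids /= rl cl.
  exists (r, c, 1) => //; split=> //; have := rF _ ii; rewrite gs_low gs_high.
  rewrite mem_pos_cells /gs /shift /base /offset /len /= eqxx /=.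
  case T: (ev r c) H => /= H; last by lia.
  by move: H; rewrite /o_of negbK => /eqP; rewrite gs_low /base /=; lia.
- case T: (top_active r c) => /= H; last first.
    have ii : (r, c, 3) \in ids by rewrite mem_ids /= rl cl T.
    exists (r, c, 3) => //; split=> //; have := rF _ ii; rewrite gs_low gs_high.
    by rewrite mem_pos_cells /gs /shift /base /offset /len /= eqxx /=; lia.
  have [r0 Tr] : 0 < r /\ ev r.-1 c by case/andP: T.
  have ae := ev_active eh ev_lt cl Tr; have := edge_range rF ae; rewrite H => FE.
  exists (r.-1, c, 1); first exact: edge_id_in ae.
  move: FE; rewrite gs_low mem_pos_cells /gs /shift /base /offset /len /= Tr /= => ->.
  by rewrite eqxx /=; lia.
- move=> H; have ii : (r, c, 0) \in ids by rewrite mem_ids /= rl cl.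
  exists (r, c, 0) => //; split=> //; have := rF _ ii; rewrite gs_low gs_high.
  rewrite mem_pos_cells /gs /shift /base /offset /len /= eqxx /=.
  case T: (eh r c) H => /= H; last by lia.
  by move: H; rewrite /o_of negbK => /eqP; rewrite gs_low /base /=; lia.
- case T: (left_active r c) => /= H; last first.
    have ii : (r, c, 2) \in ids by rewrite mem_ids /= rl cl T.
    exists (r, c, 2) => //; split=> //; have := rF _ ii; rewrite gs_low gs_high.
    by rewrite mem_pos_cells /gs /shift /base /offset /len /= eqxx /=; lia.
  have [r0 Tr] : 0 < c /\ eh r c.-1 by case/andP: T.
  have ae := eh_active ev eh_lt rl Tr; have := edge_range rF ae; rewrite H => FE.
  exists (r, c.-1, 0); first exact: edge_id_in ae.
  move: FE; rewrite gs_low mem_pos_cells /gs /shift /base /offset /len /= Tr /= => ->.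
  by rewrite eqxx /=; lia.
Qed.

(** Completeness of the search: it succeeds whenever some placement [g] exists. So a failed search
    proves an impossibility. *)
Lemma extendsI m g o :
  (forall k, k < size m -> g k \in positions (nth (h2 0 0 0) m k)) ->
  (forall k l x, k < size m -> l < size m -> x \in pos_cells (nth (h2 0 0 0) m k) (g k) ->
    x \in pos_cells (nth (h2 0 0 0) m l) (g l) -> k = l) ->
  (forall k x, k < size m -> x \in pos_cells (nth (h2 0 0 0) m k) (g k) -> x \notin o) ->
  extends m o.
Proof.
elim: m g o => // s m IH g o H1 H2 H3.
have dis : meets (pos_cells s (g 0)) o = false.
  by apply/negbTE/hasPn => x /(H3 0 x isT).
have rec : extends m (pos_cells s (g 0) ++ o).
  apply: (IH (fun k => g k.+1)) => [k|k l x kl ll xk xl|k x kl xk].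
  - exact: (H1 k.+1).
  - by have [] := H2 k.+1 l.+1 x kl ll xk xl.
  - rewrite mem_cat negb_or (H3 k.+1 x) // andbT; apply/negP => x0.
    by have := H2 k.+1 0 x kl isT xk x0.
have := H1 0 isT; cbn [extends nth]; elim: (positions s) => // q qs IHq.
rewrite inE => /orP[/eqP Eq|]; first by subst q; rewrite dis rec.
by move/IHq => ->; case: ifP => //; case: ifP.
Qed.

Lemma nth_locals r c k : k < size (movers (tl r c)) ->
  slid (r, c, k.+4) = nth (h2 0 0 0) (movers (tl r c)) k.
Proof. by move=> kl; rewrite /= nth_cat kl. Qed.

Lemma mover_id r c k : r < nr -> c < nc -> k < size (movers (tl r c)) -> (r, c, k.+4) \in ids.
Proof. by move=> rl cl kl; rewrite mem_ids /= rl cl size_cat ltn_addr. Qed.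

Lemma local_pos F r c k : in_range F -> (r, c, k.+4) \in ids ->
  let i := (r, c, k.+4) in F i = gbase i + (F i - gbase i) /\ F i - gbase i \in positions (slid i).
Proof.
move=> rF ii i; have := rF _ ii; rewrite gs_low gs_high -/i -/(gbase i) mem_iota; lia.
Qed.

(** The prefix [m0] is kept out of the search. It is empty for the forbidden sets and consists of
    the target for the exit. *)
Lemma mover_extends F r c m0 m (o : seq cell) : in_range F -> fits F -> r < nr -> c < nc ->
  movers (tl r c) = m0 ++ m ->
  (forall k x, k < size m -> x \in pos_cells (nth (h2 0 0 0) m k)
      (F (r, c, (size m0 + k).+4) - gbase (r, c, (size m0 + k).+4)) -> x \notin o) ->
  extends m o.
Proof.
move=> rF pF rl cl Em Ho.
have sl k : k < size m -> nth (h2 0 0 0) m k = slid (r, c, (size m0 + k).+4).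
  by move=> kl; rewrite nth_locals Em ?nth_cat ?size_cat ?ltn_add2l //= ltnNge leq_addr addKn.
have ii k : k < size m -> (r, c, (size m0 + k).+4) \in ids.
  by move=> kl; apply: mover_id; rewrite // Em size_cat ltn_add2l.
have cl' k x : k < size m -> x \in pos_cells (nth (h2 0 0 0) m k)
    (F (r, c, (size m0 + k).+4) - gbase (r, c, (size m0 + k).+4)) ->
    offset r c x \in pos_cells (gs (r, c, (size m0 + k).+4)) (F (r, c, (size m0 + k).+4)).
  by move=> kl; rewrite sl // => xk; have [-> _] := local_pos rF (ii _ kl); rewrite mem_shift.
apply: (extendsI (g := fun k => F (r, c, (size m0 + k).+4) - gbase (r, c, (size m0 + k).+4))).
- by move=> k kl; rewrite sl //; have [] := local_pos rF (ii _ kl).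
- move=> k l x kl ll /(cl' _ _ kl) xk /(cl' _ _ ll) xl.
  by have [/addnI] := fits_inj pF (ii _ kl) (ii _ ll) xk xl.
- exact: Ho.
Qed.

Lemma mover_port F r c k x p : in_range F -> fits F -> r < nr -> c < nc ->
  k < size (movers (tl r c)) ->
  x \in pos_cells (slid (r, c, k.+4)) (F (r, c, k.+4) - gbase (r, c, k.+4)) ->
  (forall e, occ p e -> occ (occs (o_of F) r c) e) -> x \notin port_cells p.
Proof.
move=> rF pF rl cl kl xk Hp; have ii := mover_id rl cl kl.
have xg : offset r c x \in pos_cells (gs (r, c, k.+4)) (F (r, c, k.+4)).
  by have [-> _] := local_pos rF ii; rewrite mem_shift.
apply/negP; rewrite mem_cat => /orP[]/mapP[e ee Ex]; subst x.
  have [j ij [j4 _ Hj]] := ring_cover e rl cl.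
  have [y y1] := Hj _ (rF j ij); rewrite inE => /eqP Ey; subst y.
  by move: j4; rewrite (fits_inj pF ij ii y1 xg).
move: ee; rewrite mem_filter => /andP[/Hp oe _].
have [j ij [j4 Hj]] := occ_cell rF rl cl oe.
by move: j4; rewrite (fits_inj pF ij ii Hj xg).
Qed.

(** A violated constraint would place the movers beside a forbidden set of occupied ports, which
    [all_sound] excludes. *)
Lemma good_of F : in_range F -> fits F -> good (o_of F).
Proof.
move=> rF pF r c rl cl; apply/negP => /hasP[f ff /allP af].
have /allP/(_ f ff)/negP := all_sound (kd r c); apply.
apply: (mover_extends (m0 := [::]) rF pF rl cl) => // k x kl; rewrite add0n => xk.
apply: (mover_port rF pF rl cl kl); rewrite ?nth_locals //.
by move=> e oe; apply: af; move: oe; rewrite /only; case: e => [[] []].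
Qed.

Definition lpos (g : nat -> nat -> seq nat) (i : ident) (o : orientation) : nat :=
  let: (r, c, k) := i in
  match k with
  | 0 => 15 + (eh r c && o (false, r, c))
  | 1 => 15 + (ev r c && o (true, r, c))
  | 2 | 3 => 0
  | k'.+4 => if k' < size (movers (tl r c)) then nth 0 (g r c) k' else lo (slid i)
  end.
Definition F_of (o : orientation) (g : nat -> nat -> seq nat) (i : ident) : nat :=
  gbase i + lpos g i o.
Definition valid_at r c p s : Prop := valid_pos (tl r c) p s.
Local Notation PV := (PV nr nc eh ev valid_at).

Lemma F_of_range o g : PV o g -> in_range (F_of o g).
Proof.
move=> V i ii; rewrite gs_low gs_high -/(gbase i) !leq_add2l.
case: i ii => [[r c] k] ii; have [/= rl cl] := ident_tile ii.
case: k ii => [|[|[|[|k]]]] ii //=.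
- by case: (eh r c) => //=; case: (o _).
- by case: (ev r c) => //=; case: (o _).
case: ifP => kl; last first.
  by rewrite leqnn /=; apply: (@local_low r c); rewrite mem_nth //; move: ii;
     rewrite mem_ids /= rl cl.
have /and3P[/eqP sz /allP H _] := V r c rl cl.
rewrite nth_cat kl; apply: (H (nth (h2 0 0 0) (movers (tl r c)) k, nth 0 (g r c) k)).
by rewrite -nth_zip ?mem_nth // size_zip sz minnn.
Qed.

Lemma o_of_F_of o g e : active e -> o_of (F_of o g) e = o e.
Proof.
by case: e => [[[] r] c] /and3P[_ _ H]; rewrite /o_of /F_of gs_low -/(gbase _) eqn_add2l /= H /=;
  case: (o _).
Qed.

Lemma zip_nth (A : Type) (f : slider -> nat -> A) m s : size s = size m ->
  [seq f x.1 x.2 | x <- zip m s] = [seq f (nth (h2 0 0 0) m k) (nth 0 s k) | k <- iota 0 (size m)].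
Proof.
elim: m s => [|a m IH] [|b s] //= [sz]; rewrite IH // -[1]addn0 iotaDl -map_comp.
by congr (_ :: _).
Qed.

Lemma movers_inj t p s k l x : valid_pos t p s -> k < size (movers t) -> l < size (movers t) ->
  x \in pos_cells (nth (h2 0 0 0) (movers t) k) (nth 0 s k) ->
  x \in pos_cells (nth (h2 0 0 0) (movers t) l) (nth 0 s l) -> k = l.
Proof.
case/and3P=> /eqP sz _; rewrite cat_uniq => /and3P[U _ _] kl ll xk xl; move: U.
rewrite /mover_cells zip_nth // => U; apply: (uniq_flatten_mapP U) xk xl; rewrite mem_iota //.
Qed.

Lemma movers_ports t p s k x : valid_pos t p s -> k < size (movers t) ->
  x \in pos_cells (nth (h2 0 0 0) (movers t) k) (nth 0 s k) -> x \notin port_cells p.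
Proof.
case/and3P=> /eqP sz _; rewrite cat_uniq => /and3P[_ /hasPn U _] kl xk.
apply/negP => /U/negP; apply; rewrite /= /mover_cells zip_nth //.
by apply/flatten_mapP; exists k => //; rewrite mem_iota.
Qed.

Lemma movers_walls (k : kind) p s m n x : let t := tile_of k in
  valid_pos t p s -> m < size (movers t) -> n < size (walls t) ->
  x \in pos_cells (nth (h2 0 0 0) (movers t) m) (nth 0 s m) ->
  x \in pos_cells (nth (h2 0 0 0) (walls t) n) (lo (nth (h2 0 0 0) (walls t) n)) -> False.
Proof.
move=> t /and3P[/eqP sz /allP R _] ml nl xm xn.
have /and4P[_ _ _ /allP H] := all_static k.
have /H/hasPn Hn := mem_nth (h2 0 0 0) ml.
have /Hn/negP : x \in sweep (nth (h2 0 0 0) (movers t) m).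
  apply/flatten_mapP; exists (nth 0 s m) => //; rewrite mem_iota.
  have := R (nth (h2 0 0 0) (movers t) m, nth 0 s m).
  rewrite -nth_zip // mem_nth ?size_zip ?sz ?minnn // => /(_ isT).
  by rewrite nth_zip //=; lia.
by apply; apply/flatten_mapP; exists (nth (h2 0 0 0) (walls t) n) => //; apply: mem_nth.
Qed.

Lemma walls_inj (k : kind) m n x : let t := tile_of k in
  m < size (walls t) -> n < size (walls t) ->
  x \in pos_cells (nth (h2 0 0 0) (walls t) m) (lo (nth (h2 0 0 0) (walls t) m)) ->
  x \in pos_cells (nth (h2 0 0 0) (walls t) n) (lo (nth (h2 0 0 0) (walls t) n)) -> m = n.
Proof.
move=> t ml nl xm xn; have /and4P[_ _ + _] := all_static k.
rewrite cat_uniq => /and3P[U _ _]; move: U.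
rewrite -[walls _](mkseq_nth (h2 0 0 0)) -map_comp => U.
by apply: (uniq_flatten_mapP U) xm xn; rewrite mem_iota.
Qed.

Lemma walls_ports (k : kind) n x p : let t := tile_of k in n < size (walls t) ->
  x \in pos_cells (nth (h2 0 0 0) (walls t) n) (lo (nth (h2 0 0 0) (walls t) n)) ->
  x \notin port_cells p.
Proof.
move=> t nl xn; have /and4P[_ _ + _] := all_static k.
rewrite cat_uniq => /and3P[_ /hasPn U _]; apply/negP => Hx.
have /U/negP : x \in map ring_cell all_ports ++ map port_cell all_ports.
  move: Hx; rewrite !mem_cat => /orP[->//|/mapP[e]]; rewrite mem_filter => /andP[_ ee] ->.
  by rewrite map_f // orbT.
by apply; apply/flatten_mapP; exists (nth (h2 0 0 0) (walls t) n) => //; apply: mem_nth.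
Qed.

(* The part of car [i] that lies in tile [(r, c)] is labelled by the car's local
   index, or by the port that it covers. *)
Definition label := (nat + port)%type.
Definition labelled (r c : nat) (l : label) : ident :=
  match l with
  | inl k => (r, c, k.+4)
  | inr (false, true) => (r, c, 0)
  | inr (true, true) => (r, c, 1)
  | inr (false, false) => if left_active r c then (r, c.-1, 0) else (r, c, 2)
  | inr (true, false) => if top_active r c then (r.-1, c, 1) else (r, c, 3)
  end.
Definition piece o g r c (l : label) (y : cell) : Prop :=
  match l with
  | inl k => k < size (locals (tl r c)) /\ y \in pos_cells (slid (r, c, k.+4)) (lpos g (r, c, k.+4) o)
  | inr e => y = ring_cell e \/ occ (occs o r c) e /\ y = port_cell e
  end.

Lemma piece_inj o g r c l l' y : PV o g -> r < nr -> c < nc ->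
  piece o g r c l y -> piece o g r c l' y -> l = l'.
Proof.
move=> V rl cl; have Vt := V r c rl cl.
have lp k e : piece o g r c (inl k) y -> piece o g r c (inr e) y -> False.
  move=> [kl yk] ye.
  have : y \in port_cells (occs o r c).
    rewrite mem_cat; case: ye => [|[oe]] ->; first by rewrite map_f //; case: (e) => [[] []].
    by rewrite orbC map_f // mem_filter oe; case: (e) => [[] []].
  apply/negP; move: yk; rewrite /= nth_cat; case: ifP => mk yk.
    exact: movers_ports Vt mk yk.
  by apply: walls_ports yk; move: kl; rewrite size_locals; lia.
case: l l' => [k|e] [k'|e']; first last.
- move=> H1 H2; congr inr; move: H1 H2.
  by case: e e' => [[] []] [[] []] /= [->|[_ ->]] [|[_]].
- by move=> H1 /lp H2; case: (H2 e).
- by move=> /lp H1 /H1.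
case=> kl yk [kl' yk']; congr inl; move: yk yk'; rewrite /= !nth_cat.
case: ifP => mk; case: ifP => mk' yk yk'.
- exact: movers_inj Vt mk mk' yk yk'.
- by exfalso; apply: (movers_walls Vt mk _ yk yk'); move: kl'; rewrite size_locals; lia.
- by exfalso; apply: (movers_walls Vt mk' _ yk' yk); move: kl; rewrite size_locals; lia.
suff : k - size (movers (tl r c)) = k' - size (movers (tl r c)) by lia.
by apply: (walls_inj _ _ yk yk'); move: kl kl'; rewrite !size_locals; lia.
Qed.

Lemma local_bound r c k p y : (r, c, k.+4) \in ids ->
  lo (slid (r, c, k.+4)) <= p <= hi (slid (r, c, k.+4)) ->
  y \in pos_cells (slid (r, c, k.+4)) p -> in_tile y.
Proof.
move=> ii; have sl : slid (r, c, k.+4) \in locals (tl r c).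
  by move: ii; rewrite mem_ids /= => /and3P[_ _]; apply: mem_nth.
have [_ t17 h17] := local_static sl; move: (slid _) t17 h17 {sl} => s t17 h17 Hp.
rewrite mem_pos_cells /in_tile; case: y => a b /=.
by case: (is_h s) => /andP[/eqP-> H]; rewrite t17 ?andbT /=; lia.
Qed.

(** A border car may straddle two tiles, so each of its cells is attributed to the tile containing
    it. Different tiles are disjoint, and inside one tile [piece_inj] applies; thus global
    disjointness becomes local. *)
Lemma piece_of o g i x : PV o g -> i \in ids -> x \in pos_cells (gs i) (F_of o g i) ->
  exists r c l y, [/\ r < nr, c < nc, i = labelled r c l, x = offset r c y &
    in_tile y /\ piece o g r c l y].
Proof.
move=> V ii; have := F_of_range V ii; rewrite gs_low gs_high -/(gbase i) !leq_add2l => Rp.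
have [rl cl] := ident_tile ii; move/mem_shift_ex => [y Ex yi]; move: ii Rp rl cl Ex yi.
case: i => [[r c] [|[|[|[|k]]]]] ii Rp /= rl cl Ex yi.
- move: yi; rewrite mem_pos_cells /=; case: y Ex => a b Ex /= /andP[/eqP Ea H]; subst a.
  have [b16|b17] := leqP b 16.
    exists r, c, (inr pR), (8, b); split => //; split; first by rewrite /in_tile /=; lia.
    move: H; rewrite /piece /ring_cell /port_cell /occ /occs /= /len /=.
    by case: (eh r c) => /=; [case: (o _)|] => /= H; (have [Eb|Eb] : b = 15 \/ b = 16 by lia); subst b; solve [by left | by right | lia].
  (* Column 17 of this tile is column 0 of its right neighbour; only a long border car, hence an
     active one, gets there. *)
  have T : eh r c by move: H; rewrite /len /=; case: (eh r c) => //=; lia.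
  exists r, c.+1, (inr pL), (8, b - 17); split; rewrite ?(eh_lt T) //.
  - by rewrite /= /left_active /= T.
  - by rewrite Ex /offset /=; congr (_, _); lia.
  split; first by move: H; rewrite /in_tile /len /= T /=; case: (o _) => /=; lia.
  move: H; rewrite /piece /ring_cell /port_cell /occ /occs /left_active /= /len /= T /=.
  by case: (o _) => /= H; (have [Eb|Eb] : b = 17 \/ b = 18 by lia); subst b; solve [by left | by right | lia].
- move: yi; rewrite mem_pos_cells /=; case: y Ex => a b Ex /= /andP[/eqP Ea H]; subst b.
  have [b16|b17] := leqP a 16.
    exists r, c, (inr pB), (a, 8); split => //; split; first by rewrite /in_tile /=; lia.
    move: H; rewrite /piece /ring_cell /port_cell /occ /occs /= /len /=.
    by case: (ev r c) => /=; [case: (o _)|] => /= H; (have [Eb|Eb] : a = 15 \/ a = 16 by lia); subst a; solve [by left | by right | lia].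
  have T : ev r c by move: H; rewrite /len /=; case: (ev r c) => //=; lia.
  exists r.+1, c, (inr pT), (a - 17, 8); split; rewrite ?(ev_lt T) //.
  - by rewrite /= /top_active /= T.
  - by rewrite Ex /offset /=; congr (_, _); lia.
  split; first by move: H; rewrite /in_tile /len /= T /=; case: (o _) => /=; lia.
  move: H; rewrite /piece /ring_cell /port_cell /occ /occs /top_active /= /len /= T /=.
  by case: (o _) => /= H; (have [Eb|Eb] : a = 17 \/ a = 18 by lia); subst a; solve [by left | by right | lia].
- have T : left_active r c = false by apply/negbTE; move: ii; rewrite mem_ids /= rl cl.
  move: yi; rewrite mem_pos_cells /=; case: y Ex => a b Ex /= /andP[/eqP Ea H]; subst a.
  exists r, c, (inr pL), (8, b); split; rewrite /= ?T //; split; first by move: H; rewrite /in_tile /len /=; lia.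
  by move: H; rewrite /len /= => H; (have [Eb|Eb] : b = 0 \/ b = 1 by lia); subst b; solve [by left | by right | lia].
- have T : top_active r c = false by apply/negbTE; move: ii; rewrite mem_ids /= rl cl.
  move: yi; rewrite mem_pos_cells /=; case: y Ex => a b Ex /= /andP[/eqP Ea H]; subst b.
  exists r, c, (inr pT), (a, 8); split; rewrite /= ?T //; split; first by move: H; rewrite /in_tile /len /=; lia.
  by move: H; rewrite /len /= => H; (have [Eb|Eb] : a = 0 \/ a = 1 by lia); subst a; solve [by left | by right | lia].
exists r, c, (inl k), y; split => //; split; first exact: local_bound Rp yi.
by split => //; move: ii; rewrite mem_ids /= => /and3P[].
Qed.

Lemma offset_tile r c r' c' y y' : in_tile y -> in_tile y' -> offset r c y = offset r' c' y' ->
  [/\ r = r', c = c' & y = y'].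
Proof.
case: y y' => [a b] [a' b'] /andP[/= ha hb] /andP[/= ha' hb'] [E1 E2].
have [E3 E4] : r = r' /\ c = c' by split; lia.
by split => //; congr (_, _); lia.
Qed.

Lemma PV_fits o g : PV o g -> fits (F_of o g).
Proof.
move=> V; apply: fitsI => [i x ii xi|i j x ii ji xi xj].
  have [r [c [l [y [rl cl _ -> [/andP[y1 y2] _]]]]]] := piece_of V ii xi.
  by rewrite /on_grid /offset /=; apply/andP; split; lia.
have [r [c [l [y [rl cl -> Ex [ty py]]]]]] := piece_of V ii xi.
have [r' [c' [l' [y' [rl' cl' -> Ex' [ty' py']]]]]] := piece_of V ji xj.
have [Er Ec Ey] := offset_tile ty ty' (etrans (esym Ex) Ex'); subst r' c' y'.
by rewrite (piece_inj V rl cl py py').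
Qed.

Variable G0 : ident -> nat.
Definition reach (F F' : ident -> nat) : Prop :=
  clos_refl_trans _ (move (game_of G0)) (placed F) (placed F') /\
  clos_refl_trans _ (move (game_of G0)) (placed F') (placed F).

Lemma reach_refl F : reach F F. Proof. by split; apply: rt_refl. Qed.
Lemma reach_sym F F' : reach F F' -> reach F' F. Proof. by case. Qed.
Lemma reach_trans F F' F'' : reach F F' -> reach F' F'' -> reach F F''.
Proof. by move=> [a b] [c d]; split; [apply: rt_trans a c | apply: rt_trans d b]. Qed.

(** For a shift by one cell only the two end positions have to be legal, and the shift can be
    undone; so [reach] may demand both directions. *)
Lemma near_move F F' (i : ident) : i \in ids -> fits F -> fits F' ->
  (forall j, j \in ids -> j <> i -> F' j = F j) -> F' i = (F i).+1 -> reach F F'.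
Proof.
move=> ii pF pF' Ej Ei.
have EF' : {in ids, F' =1 upd F i (F i).+1}.
  by move=> j ij; rewrite /upd; case: eqP => [->|/Ej->].
have EF : {in ids, F =1 upd F' i (F i)}.
  by move=> j ij; rewrite /upd; case: eqP => [->|/Ej->].
split; apply: rt_step.
  rewrite (eq_placed EF'); apply: move_placed => // p.
  rewrite (minn_idPl (leqnSn _)) (maxn_idPr (leqnSn _)) => Hp.
  have [->|->] : p = F i \/ p = (F i).+1 by lia.
    by rewrite (@eq_fits _ F) // => j _; rewrite /upd; case: eqP => // ->.
  by rewrite -(eq_fits EF').
rewrite (eq_placed EF); apply: move_placed => // p; rewrite Ei.
rewrite (minn_idPr (leqnSn _)) (maxn_idPl (leqnSn _)) => Hp.
have [->|->] : p = F i \/ p = (F i).+1 by lia.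
  by rewrite -(eq_fits EF).
by rewrite (@eq_fits _ F') // => j _; rewrite /upd; case: eqP => // ->.
Qed.

Lemma local_step o g r c s i q : r < nr -> c < nc -> PV o g -> g r c = s ->
  i < size s -> valid_pos (tl r c) (occs o r c) (set_nth 0 s i q) ->
  nth 0 s i = q.+1 \/ q = (nth 0 s i).+1 ->
  reach (F_of o g) (F_of o (put g r c (set_nth 0 s i q))).
Proof.
move=> rl cl V Es il Vq Hq; have V' := PV_put V (Vq : valid_at r c _ _).
have sz : size s = size (movers (tl r c)) by have /and3P[/eqP <- _ _] := V r c rl cl; rewrite Es.
have ii : (r, c, i.+4) \in ids by apply: mover_id; rewrite // -sz.
have Ej (j : ident) : j \in ids -> j <> (r, c, i.+4) ->
    F_of o (put g r c (set_nth 0 s i q)) j = F_of o g j.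
  case: j => [[r' c'] k] _ nj; rewrite /F_of; congr (_ + _).
  case: k nj => [|[|[|[|k]]]] //= nj; case: ifP => // kl; rewrite /put.
  case: andP => // -[/eqP Er /eqP Ec]; subst r' c'; rewrite nth_set_nth /= Es.
  by case: eqP => // Ek; case: nj; rewrite Ek.
have E1 : F_of o g (r, c, i.+4) = gbase (r, c, i.+4) + nth 0 s i.
  by rewrite /F_of /= -sz il Es.
have E2 : F_of o (put g r c (set_nth 0 s i q)) (r, c, i.+4) = gbase (r, c, i.+4) + q.
  by rewrite /F_of /= -sz il /put !eqxx /= nth_set_nth /= eqxx.
case: Hq => Hq.
  apply: reach_sym; apply: (near_move ii (PV_fits V') (PV_fits V)) => [j ij nj|].
    by rewrite Ej.
  by rewrite E1 E2 Hq addnS.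
apply: (near_move ii (PV_fits V) (PV_fits V')) => [j ij nj|]; first by rewrite Ej.
by rewrite E1 E2 Hq addnS.
Qed.

Lemma eq_reach o g g' F : (forall r c, r < nr -> c < nc -> g r c = g' r c) ->
  reach F (F_of o g) -> reach F (F_of o g').
Proof.
move=> Eg; have E : {in ids, F_of o g =1 F_of o g'}.
  move=> [[r c] k] ii; have [/= rl cl] := ident_tile ii; rewrite /F_of; congr (_ + _).
  by case: k ii => [|[|[|[|k]]]] //= _; rewrite Eg.
by rewrite /reach (eq_placed E).
Qed.

Lemma follow_reach o g r c s t l : r < nr -> c < nc -> PV o g -> g r c = s ->
  follow (tl r c) (occs o r c) t s l ->
  reach (F_of o g) (F_of o (put g r c t)) /\ valid_pos (tl r c) (occs o r c) t.
Proof.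
move=> rl cl; elim: l g s => [|i l IH] g s V Es /=; case: ifP => // Vs.
  move=> /eqP <-; split=> //; apply: eq_reach (reach_refl _) => r' c' _ _; rewrite /put.
  by case: andP => // -[/eqP-> /eqP->].
case: ifP => // il Hf.
have Vm : valid_pos (tl r c) (occs o r c) (move_to t s i).
  by case: l Hf {IH} => [|j l] /=; case: ifP.
have Ep : put g r c (move_to t s i) r c = move_to t s i by rewrite /put !eqxx.
have [H1 H2] := IH _ _ (PV_put V (Vm : valid_at r c _ _)) Ep Hf; split => //.
apply: reach_trans; last first.
  apply: (@eq_reach _ (put (put g r c (move_to t s i)) r c t)); last first.
    exact: H1.
  by move=> r' c' _ _; rewrite /put; case: (_ && _).
(* A path may name a mover that has already arrived, and then nothing moves. *)
have [E|N] := eqVneq (toward (nth 0 s i) (nth 0 t i)) (nth 0 s i).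
  apply: eq_reach (reach_refl _) => r' c' _ _; rewrite /put.
  case: andP => // -[/eqP-> /eqP->]; rewrite Es /move_to E.
  by apply: (@eq_from_nth _ 0) => [|k kl]; rewrite ?size_set_nth ?(maxn_idPr il) // nth_set_nth /=; case: eqP => // ->.
apply: local_step => //; move: N; rewrite /toward; case: ltnP => [_ _|_]; first by right.
by case: ltnP => [H _|_]; [left; lia | rewrite eqxx].
Qed.

Lemma all_setsP p : p \in all_sets.
Proof. by case: p => [[[[] []] []] []]. Qed.

Lemma canon_valid k p : allowed (tile_of k) p -> valid_pos (tile_of k) p (canon (tile_of k) p).
Proof. by have /allP/(_ p (all_setsP p)) := all_canon k => /implyP H /H/andP[]. Qed.

Lemma canon_follow k p (e : port) : allowed (tile_of k) p -> occ p e = false ->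
  allowed (tile_of k) (set_port p e true) ->
  follow (tile_of k) p (canon (tile_of k) (set_port p e true)) (canon (tile_of k) p)
    (path_of (tile_of k) p e).
Proof.
have /allP/(_ p (all_setsP p)) := all_canon k => /implyP H /H/andP[_ /allP/(_ e)].
have -> : e \in all_ports by case: (e) => [[] []].
by move=> /(_ isT) Hc oe al; move: Hc; rewrite oe al.
Qed.

Lemma F_of_flip o o' g e0 : flips e0 o o' -> o e0 = false -> PV o g -> PV o' g ->
  reach (F_of o g) (F_of o' g).
Proof.
move=> [ae E] oe V V'; have ii := edge_id_in ae.
apply: (near_move ii (PV_fits V) (PV_fits V')) => [j ij nj|].
  case: j ij nj => [[r c] k] ij nj; have [/= rl cl] := ident_tile ij; rewrite /F_of; congr (_ + _).
  case: k ij nj => [|[|[|[|k]]]] //= _ nj.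
    case T: (eh r c) => //=; rewrite E ?(eh_active ev eh_lt) //; case: eqP => // E0.
    by case: nj; rewrite -E0.
  case T: (ev r c) => //=; rewrite E ?(ev_active eh ev_lt) //; case: eqP => // E0.
  by case: nj; rewrite -E0.
have := E _ ae; rewrite eqxx oe /= /F_of => o'e.
case: e0 ae oe o'e {E ii} => [[[] r] c] /and3P[_ _ act] oe o'e.
  by rewrite /= act oe o'e addnS.
by rewrite /= act oe o'e addnS.
Qed.

Definition canonical r c p := canon (tl r c) p.
Local Notation can := (can eh ev canonical).

Lemma tile_canonical_reach o o' : good o -> clos_refl_trans _ ostep o o' ->
  good o' /\ reach (F_of o (can o)) (F_of o' (can o')).
Proof.
pose rel o1 g1 o2 g2 := reach (F_of o1 g1) (F_of o2 g2).
apply: (@canonical_reach _ _ _ _ eh_lt ev_lt tile_allow _ valid_at rel).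
- by move=> o1 g g' E; apply: eq_reach (reach_refl _).
- by move=> *; apply: reach_sym.
- by move=> o1 g1 o2 g2 o3 g3; apply: reach_trans.
- exact: F_of_flip.
- by move=> r c p _ _; apply: canon_valid.
- move=> o1 g r c e rl cl V p p' Eg Ap oe Ap'; apply: (follow_reach rl cl V Eg).
  exact: canon_follow.
Qed.

Lemma step_in_range F (i : ident) p : in_range F -> fits F -> i \in ids -> fits (upd F i p) ->
  p = (F i).+1 \/ F i = p.+1 -> in_range (upd F i p).
Proof.
move=> rF pF ii pF' Hp j ij; rewrite /upd; case: eqP => [->|_]; last exact: rF.
have := rF i ii; case: Hp => Hp Ri.
  have [H|H] := ltnP (F i) (hi (gs i)); first by rewrite Hp H andbT; lia.
  by case: (high_stop rF pF ii); rewrite -?Hp //; lia.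
have [H|H] := ltnP (lo (gs i)) (F i); first by lia.
by case: (low_stop rF pF ii); rewrite ?Hp //; lia.
Qed.

(** Soundness: the orientation read off from the cars stays reachable above, as far as active edges
    are concerned. *)
Definition inv (o0 : orientation) (F : ident -> nat) : Prop :=
  [/\ in_range F, fits F &
      exists2 o, clos_refl_trans _ ostep o0 o & forall e, active e -> o e = o_of F e].

Lemma edge_id_inj e e' : edge_id e = edge_id e' -> e = e'.
Proof. by case: e e' => [[[] r] c] [[[] r'] c'] // [-> ->]. Qed.

Lemma edge_or_not (i : ident) : i \in ids ->
  (exists2 e0, active e0 & i = edge_id e0) \/ (forall e, active e -> edge_id e <> i).
Proof.
case: i => [[r c] [|[|k]]] ii; have [/= rl cl] := ident_tile ii.
- case T: (eh r c); first by left; exists (false, r, c); rewrite //= rl cl T.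
  by right=> -[[[] r'] c'] // /and3P[_ _ T'] [Er Ec]; rewrite Er Ec T in T'.
- case T: (ev r c); first by left; exists (true, r, c); rewrite //= rl cl T.
  by right=> -[[[] r'] c'] // /and3P[_ _ T'] [Er Ec]; rewrite Er Ec T in T'.
by right=> -[[[] r'] c'].
Qed.

Lemma inv_step o0 F (i : ident) p : inv o0 F -> i \in ids -> fits (upd F i p) ->
  p = (F i).+1 \/ F i = p.+1 -> inv o0 (upd F i p).
Proof.
move=> [rF pF [o Ro Eo]] ii pF' Hp; have rF' := step_in_range rF pF ii pF' Hp.
split=> //; case: (edge_or_not ii) => [[e0 ae Ei]|Hn].
- exists (o_of (upd F i p)) => //; apply: rt_trans Ro _; apply: rt_step; split.
    exact: good_of.
  exists e0; split=> // e aae; rewrite Eo //.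
  case: (eqVneq e e0) => [->|ne] /=.
    have E1 : upd F i p (edge_id e0) = p by rewrite /upd Ei eqxx.
    have := edge_range rF' ae; have := edge_range rF ae; rewrite E1 -Ei.
    by move: Hp; case: (o_of F _); case: (o_of _ _) => //=; lia.
  rewrite /o_of /upd; case: (edge_id e =P i) => // E; case/eqP: ne; by apply: edge_id_inj; rewrite E.
exists o => // e aae; rewrite Eo // /o_of /upd; case: (edge_id e =P i) => // Ei; case: (Hn e aae Ei).
Qed.

Lemma eq_inv o0 F F' : {in ids, F =1 F'} -> inv o0 F -> inv o0 F'.
Proof.
move=> E [rF pF [o Ro Eo]]; split; first by move=> i ii; rewrite -E //; apply: rF.
  by rewrite -(eq_fits E).
exists o => // e ae; rewrite Eo // /o_of E //; exact: edge_id_in.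
Qed.

(** A long slide is cut into unit steps, each of which flips at most one border; [n] bounds the
    distance left. *)
Lemma inv_slide o0 n F (i : ident) q : F i - q + (q - F i) <= n -> inv o0 F -> i \in ids ->
  (forall p, minn (F i) q <= p <= maxn (F i) q -> fits (upd F i p)) -> inv o0 (upd F i q).
Proof.
elim: n F => [|n IH] F Hn IF ii Hp.
  have Eq : F i = q by lia.
  by apply: eq_inv IF => j ij; rewrite /upd; case: eqP => // ->.
have [Eq|Nq] := eqVneq (F i) q.
  by apply: eq_inv IF => j ij; rewrite /upd; case: eqP => // ->.
pose p := if F i < q then (F i).+1 else (F i).-1.
have Hpp : p = (F i).+1 \/ F i = p.+1 by rewrite /p; case: ifP; lia.
have Ip : inv o0 (upd F i p).
  by apply: inv_step => //; apply: Hp; rewrite /p; case: ifP; lia.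
have Eu r : {in ids, upd (upd F i p) i r =1 upd F i r}.
  by move=> j ij; rewrite /upd; case: eqP.
apply: (eq_inv (Eu q)); apply: IH => //.
  by rewrite {1 2}/upd eqxx /p; case: ifP; lia.
move=> r; rewrite {1 2}/upd eqxx => Hr; rewrite (eq_fits (Eu r)); apply: Hp.
by move: Hr; rewrite /p; case: ifP; lia.
Qed.

Lemma inv_reach o0 F s : inv o0 F ->
  clos_refl_trans _ (move (game_of G0)) (placed F) s ->
  exists2 F', s = placed F' & inv o0 F'.
Proof.
move=> IF H; elim: (Operators_Properties.clos_rt_rtn1 _ _ _ _ H) => [|s1 s2 Ms _ [F' Es IF']].
  by exists F.
rewrite Es in Ms; have [i [q [ii -> Hq]]] := moveP Ms.
by exists (upd F' i q) => //; apply: (inv_slide (leqnn _)).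
Qed.

Variable rE : nat.
Hypothesis rE_lt : rE < nr.
Hypothesis nc_gt0 : 0 < nc.
Hypothesis kd_exit : kd rE 0 = E.
Hypothesis tgtE : tgt = (rE, 0, 4).
(** Row 7 is the track of the target in [baseE]. *)
Hypothesis exE : ex = (rE * 17 + 7, 0).

Lemma tgt_in : tgt \in ids. Proof. by rewrite ids_cons mem_head. Qed.

Lemma tgt_slid : slid tgt = h3 7 0 3.
Proof. by rewrite tgtE /= kd_exit. Qed.

Lemma exit_cell F : (ex \in cells (at_pos (gs tgt) (F tgt))) = (F tgt == 0).
Proof.
rewrite -/(pos_cells _ _) mem_pos_cells exE /gs tgt_slid tgtE /= eqxx /= leqn0.
by case: eqP => //= ->.
Qed.

Lemma exit_free F : in_range F -> fits F -> F tgt = 0 -> ~~ occ (occs (o_of F) rE 0) pR.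
Proof.
move=> rF pF F0; apply/negP => oR; have [S _] := andP exit_checks; move: S.
rewrite /exit_sound; case Em: (movers baseE) => [|s m] // /negP; apply.
have Em' : movers (tl rE 0) = [:: s] ++ m by rewrite kd_exit.
apply: (mover_extends rF pF rE_lt nc_gt0 Em') => k x kl xk.
have kl' : (1 + k) < size (movers (tl rE 0)) by rewrite Em'.
rewrite mem_cat negb_or; apply/andP; split; last first.
  apply: (mover_port rF pF rE_lt nc_gt0 kl'); first by rewrite nth_locals // Em' add1n.
  by move=> e; case: e => [[] []].
apply/negP => xs.
have i1 := mover_id rE_lt nc_gt0 kl'; have i0 : (rE, 0, 4) \in ids by rewrite -tgtE tgt_in.
have x0 : offset rE 0 x \in pos_cells (gs (rE, 0, 4)) (F (rE, 0, 4)).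
  have [-> _] := local_pos rF i0; rewrite mem_shift -tgtE F0 sub0n tgt_slid.
  by case: Em xs => <-.
have x1 : offset rE 0 x \in pos_cells (gs (rE, 0, (1 + k).+4)) (F (rE, 0, (1 + k).+4)).
  by have [-> _] := local_pos rF i1; rewrite mem_shift nth_locals // Em'.
by have [] := fits_inj pF i0 i1 x0 x1.
Qed.

Lemma placed_cons F : placed F = at_pos (gs tgt) (F tgt) :: [seq at_pos (gs i) (F i) | i <- ids'].
Proof. by rewrite /placed ids_cons. Qed.

Theorem tile_game o0 : G0 = F_of o0 (can o0) -> good o0 ->
  valid (game_of G0) /\
  (solvable (game_of G0) <->
   exists2 o, clos_refl_trans _ ostep o0 o & ~~ occ (occs o rE 0) pR).
Proof.
move=> EG Go; have V0 : PV o0 (can o0).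
  by apply: can_PV Go => r c p _ _; apply: canon_valid.
have I0 : inv o0 G0.
  rewrite EG; split; [exact: F_of_range | exact: PV_fits | exists o0; first exact: rt_refl].
  by move=> e ae; rewrite o_of_F_of.
split.
  apply/andP; split.
    by rewrite -placed_cons fitsE; case: I0.
  rewrite /exit_ok /on_board /= exE /= /gs tgt_slid /=; lia.
split=> [[t [s [R xt]]]|[o Ro oR]].
  rewrite -placed_cons in R; have [F Es [rF pF [o Ro Eo]]] := inv_reach I0 R.
  move: Es; rewrite placed_cons => -[Et _]; rewrite Et exit_cell in xt.
  by exists o => //; rewrite (eq_occs eh_lt ev_lt _ _ Eo) //; apply: exit_free => //; apply/eqP.
have [Go' [R _]] := tile_canonical_reach Go Ro.
exists (at_pos (gs tgt) (F_of o (can o) tgt)), [seq at_pos (gs i) (F_of o (can o) i) | i <- ids'].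
rewrite -!placed_cons EG; split; first by rewrite -EG in R *.
rewrite exit_cell tgtE /F_of /gbase /base /= kd_exit /=.
have [_ /allP/(_ _ (all_setsP (occs o rE 0)))] := andP exit_checks.
rewrite (negPf oR) orFb /Orientations.can /canonical kd_exit => /eqP; case: (canon _ _) => //= a l ->.
by rewrite mul0n.
Qed.

End Grid.

End Boards.

(** * Blocks of 2 x 3 tiles *)

Module Macros.
Import Tiles Cells Orientations Boards.

Inductive macro := mX | mDT | mUT | mOR | mOt | mOb | mE | mN.

(** The ports of a block are the two ends of its upper row and the top and bottom of its middle
    column. A hub exposes the ports of one tile, while [H] and [V] transmit. The crossing [mX] is
    the only block with a circuit of its own. *)
Definition layout (m : macro) (a b : nat) : kind :=
  let hub k := [:: [:: H; k; H]; [:: N; V; N]] in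
  let l := match m with
    | mX => [:: [:: Dm; Y; Or]; [:: Zm; Yv; Z]]
    | mDT => hub D
    | mUT => hub Dv
    | mOR => hub O
    | mOt => hub Zv
    | mOb => hub Z
    | mE => [:: [:: E; H; H]; [:: N; N; N]]
    | mN => [::]
    end in nth N (nth [::] l a) b.

Definition macro_forbidden (m : macro) : seq (seq port) :=
  match m with
  | mX => [:: [:: pL; pR]; [:: pT; pB]]
  | mDT => [:: [:: pR; pL]; [:: pR; pB]]
  | mUT => [:: [:: pR; pL]; [:: pR; pT]]
  | mOR => [:: [:: pT; pB; pL]]
  | mOt => [:: [:: pB; pL]]
  | mOb => [:: [:: pT; pL]]
  | mE | mN => [::]
  end.

Definition macro_allowed (m : macro) (p : ports) : bool :=
  ~~ has (all (occ p)) (macro_forbidden m).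

(* The seven inner borders of a macro tile are numbered row by row, first the
   vertical ones. *)
Definition inner_ports (p : ports) (s : seq bool) (a b : nat) : ports :=
  (if b == 0 then (a != 0) || occ p pL else nth false s (2 * a + b.-1),
   if b == 2 then (a != 0) || occ p pR else ~~ nth false s (2 * a + b),
   if a == 0 then (b != 1) || occ p pT else nth false s (4 + b),
   if a == 0 then ~~ nth false s (4 + b) else (b != 1) || occ p pB).

Definition macro_cells : seq (nat * nat) :=
  [:: (0, 0); (0, 1); (0, 2); (1, 0); (1, 1); (1, 2)].
Definition macro_valid (m : macro) (p : ports) (s : seq bool) : bool :=
  (size s == 7) &&
  all (fun x => allowed (tile_of (layout m x.1 x.2)) (inner_ports p s x.1 x.2)) macro_cells.

(** An entry lists the inner borders with value true; without an entry all are false. The exit block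
    is treated in [macro_canon]. *)
Definition macro_table (m : macro) : seq (seq port * seq nat) :=
  match m with
  | mX => [:: ([:: pL; pT], [:: 0; 1; 2; 3; 4; 5]); ([:: pL; pB], [:: 0; 1; 2; 3; 4]);
              ([:: pR; pT], [:: 1; 5; 6]); ([:: pR; pB], [:: 3]); ([:: pL], [:: 0; 1; 2; 3; 4]);
              ([:: pT], [:: 1; 5]); ([:: pB], [:: 3])]
  | mDT => [:: ([:: pL; pT; pB], [:: 0; 1]); ([:: pL; pT], [:: 0; 1]); ([:: pL; pB], [:: 0; 1]);
              ([:: pR; pT], [:: 5]); ([:: pT; pB], [:: 1]); ([:: pL], [:: 0; 1]); ([:: pT], [:: 5]);
              ([:: pR], [:: 5]); ([:: pB], [:: 1]); ([:: ], [:: 5])]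
  | mUT => [:: ([:: pL; pT; pB], [:: 0; 1]); ([:: pL; pT], [:: 0; 1]); ([:: pL; pB], [:: 0; 1]);
              ([:: pT; pB], [:: 1]); ([:: pL], [:: 0; 1]); ([:: pT], [:: 1])]
  | mOR => [:: ([:: pL; pR; pT], [:: 0; 5]); ([:: pL; pR; pB], [:: 0]); ([:: pL; pT], [:: 0; 5]);
              ([:: pL; pR], [:: 0]); ([:: pL; pB], [:: 0]); ([:: pL], [:: 0])]
  | mOt => [:: ([:: pL; pR; pT], [:: 0; 5]); ([:: pL; pT], [:: 0; 5]); ([:: pL; pR], [:: 0; 5]);
              ([:: pL], [:: 0; 5])]
  | mOb => [:: ([:: pL; pR; pB], [:: 0]); ([:: pL; pR], [:: 0]); ([:: pL; pB], [:: 0]);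
              ([:: pL], [:: 0])]
  | mE | mN => [::]
  end.

Definition macro_canon (m : macro) (p : ports) : seq bool :=
  let l := if m is mE then if occ p pR then [::] else [:: 0; 1]
           else lookup [::] (macro_table m) (filter (occ p) all_ports) in
  [seq i \in l | i <- iota 0 7].

(** No paths are stored here: a border is set to its goal value whenever this is allowed. In the
    worst order a round settles a single border, hence seven rounds for seven borders; that they
    suffice is verified in [macro_canon_all]. *)
Definition try_flip (m : macro) (p : ports) (g s : seq bool) (i : nat) : seq bool :=
  let s' := set_nth false s i (nth false g i) in if macro_valid m p s' then s' else s.
Definition flip_order : seq nat := flatten (nseq 7 (iota 0 7)).
Definition macro_run (m : macro) (p : ports) (g s : seq bool) : seq bool :=
  foldl (try_flip m p g) s flip_order.

Definition all_bits (n : nat) : seq (seq bool) :=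
  iter n (fun l => [seq b :: s | b <- [:: true; false], s <- l]) [:: [::]].

Definition macro_canon_ok (m : macro) : bool :=
  all (fun p => macro_allowed m p ==> macro_valid m p (macro_canon m p) &&
    all (fun e => occ p e || ~~ macro_allowed m (set_port p e true) ||
      (let g := macro_canon m (set_port p e true) in
       macro_run m p g (macro_canon m p) == g)) all_ports) all_sets.
Definition macro_sound_ok (m : macro) : bool :=
  all (fun p => all (fun s => macro_valid m p s ==> macro_allowed m p) (all_bits 7)) all_sets.
(** Inner border 0 joins the exit tile to its right neighbour; if it is true, the port of the exit
    tile is empty. *)
Definition macro_exit_ok : bool :=
  all (fun p => all (fun s => macro_valid mE p s ==> nth false s 0 ==> ~~ occ p pR) (all_bits 7)) all_sets.

Lemma macro_canon_all m : macro_canon_ok m. Proof. by case: m; vm_compute. Qed.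
Lemma macro_sound_all m : macro_sound_ok m. Proof. by case: m; vm_compute. Qed.
Lemma macro_exit : macro_exit_ok. Proof. by vm_compute. Qed.

Lemma flip_order_lt : all (fun i => i < 7) flip_order. Proof. by []. Qed.
#[local] Opaque flip_order.

Lemma mem_all_bits n s : size s = n -> s \in all_bits n.
Proof.
elim: n s => [|n IH] [|b s] // [sz]; rewrite /all_bits iterS.
by apply: allpairs_f (IH _ sz); case: b.
Qed.

Lemma macro_valid_allowed m p s : macro_valid m p s -> macro_allowed m p.
Proof.
move=> V; have /allP/(_ p (all_setsP p))/allP/(_ s) := macro_sound_all m.
by rewrite V; apply; apply: mem_all_bits; case/andP: V => /eqP.
Qed.

Lemma divmod2 R a : a < 2 -> (R * 2 + a) %/ 2 = R /\ (R * 2 + a) %% 2 = a.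
Proof. by move=> H; rewrite divnMDl // modnMDl divn_small // modn_small // addn0. Qed.
Lemma divmod3 R a : a < 3 -> (R * 3 + a) %/ 3 = R /\ (R * 3 + a) %% 3 = a.
Proof. by move=> H; rewrite divnMDl // modnMDl divn_small // modn_small // addn0. Qed.

Section Macro.

Variables (nR nC : nat) (mk : nat -> nat -> macro).
Hypothesis exit_left : forall R C, mk R C = mE -> C = 0.

Definition EH (R C : nat) := C.+1 < nC.
Definition EV (R C : nat) := R.+1 < nR.
Definition mkd (r c : nat) : kind := layout (mk (r %/ 2) (c %/ 3)) (r %% 2) (c %% 3).
(** Between two blocks one border is active: that of the upper tile row for horizontal neighbours,
    that of the middle tile column for vertical ones. *)
Definition meh (r c : nat) : bool := (c.+1 < nC * 3) && ((c %% 3 != 2) || (r %% 2 == 0)).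
Definition mev (r c : nat) : bool := (r.+1 < nR * 2) && ((r %% 2 == 0) || (c %% 3 == 1)).

Lemma EH_lt R C : EH R C -> C.+1 < nC. Proof. by []. Qed.
Lemma EV_lt R C : EV R C -> R.+1 < nR. Proof. by []. Qed.
Lemma meh_lt r c : meh r c -> c.+1 < nC * 3. Proof. by case/andP. Qed.
Lemma mev_lt r c : mev r c -> r.+1 < nR * 2. Proof. by case/andP. Qed.

Definition macro_allow R C p := macro_allowed (mk R C) p.
Definition tile_allow' := tile_allow mkd.
Local Notation mgood := (good nR nC EH EV macro_allow).
Local Notation mstep := (ostep nR nC EH EV macro_allow).
Local Notation pgood := (good (nR * 2) (nC * 3) meh mev tile_allow').
Local Notation pstep := (ostep (nR * 2) (nC * 3) meh mev tile_allow').
Local Notation mactive := (active nR nC EH EV).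
Local Notation pactive := (active (nR * 2) (nC * 3) meh mev).

Definition P_of (o : orientation) (g : nat -> nat -> seq bool) : orientation :=
  fun e => let: (v, r, c) := e in let R := r %/ 2 in let C := c %/ 3 in
  if v then if r %% 2 == 0 then nth false (g R C) (4 + c %% 3) else o (true, R, C)
  else if c %% 3 == 2 then o (false, R, C) else nth false (g R C) (2 * (r %% 2) + c %% 3).

Lemma macro_coord r c : r < nR * 2 -> c < nC * 3 -> exists R a C b,
  [/\ r = R * 2 + a, c = C * 3 + b, a < 2, b < 3 & R < nR /\ C < nC].
Proof.
move=> rl cl; exists (r %/ 2), (r %% 2), (c %/ 3), (c %% 3).
by split; rewrite -?divn_eq ?ltn_mod ?ltn_divLR.
Qed.

Lemma occs_P o g R a C b : R < nR -> C < nC -> a < 2 -> b < 3 ->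
  occs meh mev (P_of o g) (R * 2 + a) (C * 3 + b) =
  inner_ports (occs EH EV o R C) (g R C) a b.
Proof.
move=> Rl Cl al bl; have [d2 m2] := divmod2 R al; have [d3 m3] := divmod3 C bl.
have HL : ~~ left_active meh (R * 2 + a) (C * 3 + b) || P_of o g (false, R * 2 + a, (C * 3 + b).-1) =
    if b == 0 then (a != 0) || (~~ left_active EH R C || o (false, R, C.-1))
    else nth false (g R C) (2 * a + b.-1).
  rewrite /left_active /meh /EH /P_of d2 m2; case: b bl d3 m3 => [|b] bl d3 m3 /=.
    case: (posnP C) => [->|C0]; first by rewrite mul0n orbT.
    have -> : (C * 3 + 0).-1 = C.-1 * 3 + 2 by lia.
    have [-> ->] := divmod3 C.-1 (isT : 2 < 3).
    have h0 : 0 < C * 3 + 0 by clear -C0; lia.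
    have h1 : (C.-1 * 3 + 2).+1 < nC * 3 by clear -C0 Cl; lia.
    by rewrite h0 h1 prednK // Cl eqxx /=; case: (a == 0).
  have -> : (C * 3 + b.+1).-1 = C * 3 + b by lia.
  have [-> ->] := divmod3 C (ltnW bl : b < 3).
  have h0 : 0 < C * 3 + b.+1 by clear; lia.
  have h1 : (C * 3 + b).+1 < nC * 3 by clear -Cl bl; lia.
  have h2 : b == 2 = false by clear -bl; lia.
  by rewrite h0 h1 h2.
have HR : ~~ meh (R * 2 + a) (C * 3 + b) || ~~ P_of o g (false, R * 2 + a, C * 3 + b) =
    if b == 2 then (a != 0) || (~~ EH R C || ~~ o (false, R, C)) else ~~ nth false (g R C) (2 * a + b).
  rewrite /meh /EH /P_of d2 m2 d3 m3; case: eqP => [->|nb] /=.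
    have -> : ((C * 3 + 2).+1 < nC * 3) = (C.+1 < nC) by clear; lia.
    by case: (C.+1 < nC); case: (a == 0).
  have -> // : (C * 3 + b).+1 < nC * 3 by clear -Cl bl nb; lia.
have HT : ~~ top_active mev (R * 2 + a) (C * 3 + b) || P_of o g (true, (R * 2 + a).-1, C * 3 + b) =
    if a == 0 then (b != 1) || (~~ top_active EV R C || o (true, R.-1, C)) else nth false (g R C) (4 + b).
  rewrite /top_active /mev /EV /P_of d3 m3; case: a al d2 m2 {HL HR} => [|[|a]] // al d2 m2 /=.
    case: (posnP R) => [->|R0]; first by rewrite mul0n orbT.
    have -> : (R * 2 + 0).-1 = R.-1 * 2 + 1 by lia.
    have [-> ->] := divmod2 R.-1 (isT : 1 < 2).
    have h0 : 0 < R * 2 + 0 by clear -R0; lia.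
    have h1 : (R.-1 * 2 + 1).+1 < nR * 2 by clear -R0 Rl; lia.
    by rewrite h0 h1 prednK // Rl /=; case: (b == 1).
  have -> : (R * 2 + 1).-1 = R * 2 + 0 by lia.
  have [-> ->] := divmod2 R (isT : 0 < 2).
  have h0 : 0 < R * 2 + 1 by clear; lia.
  have h1 : (R * 2 + 0).+1 < nR * 2 by clear -Rl; lia.
  by rewrite h0 h1.
have HB : ~~ mev (R * 2 + a) (C * 3 + b) || ~~ P_of o g (true, R * 2 + a, C * 3 + b) =
    if a == 0 then ~~ nth false (g R C) (4 + b) else (b != 1) || (~~ EV R C || ~~ o (true, R, C)).
  rewrite /mev /EV /P_of d2 m2 d3 m3; case: a al d2 m2 {HL HR HT} => [|[|a]] // al d2 m2 /=.
    by have -> : (R * 2 + 0).+1 < nR * 2 by clear -Rl; lia.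
  have -> : ((R * 2 + 1).+1 < nR * 2) = (R.+1 < nR) by clear; lia.
  by case: (R.+1 < nR); case: (b == 1).
by rewrite /occs HL HR HT HB /inner_ports /=.
Qed.

Definition macro_valid_at R C p s : Prop := macro_valid (mk R C) p s.
Local Notation mPV := (PV nR nC EH EV macro_valid_at).

Lemma mPV_good o g : mPV o g -> pgood (P_of o g).
Proof.
move=> V r c rl cl; have [R [a [C [b [-> -> al bl [Rl Cl]]]]]] := macro_coord rl cl.
rewrite occs_P // /tile_allow' /tile_allow /mkd.
have [-> ->] := divmod2 R al; have [-> ->] := divmod3 C bl.
have /andP[_ /allP/(_ (a, b))] := V R C Rl Cl; apply.
by case: a b al bl => [|[|a]] [|[|[|b]]].
Qed.

Lemma good_mPV o g : pgood (P_of o g) -> (forall R C, size (g R C) = 7) -> mPV o g.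
Proof.
move=> Go sz R C Rl Cl; apply/andP; split; [by rewrite sz | apply/allP => -[a b] ab].
have [al bl] : a < 2 /\ b < 3 by move: ab; rewrite !inE !xpair_eqE; lia.
have [rl cl] : R * 2 + a < nR * 2 /\ C * 3 + b < nC * 3 by lia.
have := Go _ _ rl cl; rewrite occs_P // /tile_allow' /tile_allow /mkd.
by have [-> ->] := divmod2 R al; have [-> ->] := divmod3 C bl.
Qed.

Definition same (o o' : orientation) : Prop := forall e, pactive e -> o e = o' e.

Lemma same_good o o' : same o o' -> pgood o -> pgood o'.
Proof.
by move=> E G r c rl cl; rewrite -(eq_occs (@meh_lt) (@mev_lt) rl cl E); apply: G.
Qed.

Lemma same_flips o1 o2 o1' o2' e0 : same o1 o1' -> same o2 o2' ->
  flips (nR * 2) (nC * 3) meh mev e0 o1 o2 -> flips (nR * 2) (nC * 3) meh mev e0 o1' o2'.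
Proof. by move=> E1 E2 [ae F]; split => // e aae; rewrite -E1 // -E2 // F. Qed.

Lemma same_sym o o' : same o o' -> same o' o. Proof. by move=> E e ae; rewrite E. Qed.
Lemma same_trans o o' o'' : same o o' -> same o' o'' -> same o o''.
Proof. by move=> E E' e ae; rewrite E // E'. Qed.

(** Steps determine orientations on active edges only, so reachability is stated up to [same], for
    every starting point that agrees with [o]. *)
Definition path_to (o o' : orientation) : Prop :=
  forall o1, same o1 o -> exists2 o2, same o2 o' & clos_refl_trans _ pstep o1 o2.

Lemma path_refl o o' : same o o' -> path_to o o'.
Proof. by move=> E o1 E1; exists o1; [apply: same_trans E | apply: rt_refl]. Qed.
Lemma path_trans o o' o'' : path_to o o' -> path_to o' o'' -> path_to o o''.
Proof. by move=> P Q o1 /P[o2 /Q[o3 E3 R2] R1]; exists o3 => //; apply: rt_trans R1 R2. Qed.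
Lemma path_flip o o' e0 : pgood o' -> flips (nR * 2) (nC * 3) meh mev e0 o o' -> path_to o o'.
Proof.
move=> G F o1 E1; exists o' => //; apply: rt_step; split=> //.
by exists e0; apply: same_flips F => //; apply: same_sym.
Qed.

Definition mrel o g o' g' : Prop := path_to (P_of o g) (P_of o' g') /\ path_to (P_of o' g') (P_of o g).

Lemma flips_sym n1 n2 a b e0 o o' : flips n1 n2 a b e0 o o' -> flips n1 n2 a b e0 o' o.
Proof. by move=> [ae E]; split=> // e aae; rewrite E // addbA addbb. Qed.

Lemma flip_rel o g o' g' e0 : mPV o g -> mPV o' g' ->
  flips (nR * 2) (nC * 3) meh mev e0 (P_of o g) (P_of o' g') -> mrel o g o' g'.
Proof.
move=> /mPV_good G /mPV_good G' F.
by split; apply: path_flip; [|exact: F| |exact: flips_sym F].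
Qed.

Lemma agree_same o g g' : agree nR nC g g' -> same (P_of o g) (P_of o g').
Proof.
move=> E [[v r] c] /and3P[rl cl _]; rewrite /P_of.
have -> // : g (r %/ 2) (c %/ 3) = g' (r %/ 2) (c %/ 3).
by apply: E; rewrite ltn_divLR.
Qed.

Lemma mrel_refl o g g' : agree nR nC g g' -> mrel o g o g'.
Proof. by move=> E; split; apply: path_refl; apply: agree_same => // r c rl cl; rewrite E. Qed.
Lemma mrel_sym o g o' g' : mrel o g o' g' -> mrel o' g' o g. Proof. by case. Qed.
Lemma mrel_trans o g o' g' o'' g'' : mrel o g o' g' -> mrel o' g' o'' g'' -> mrel o g o'' g''.
Proof. by move=> [a b] [c d]; split; [apply: path_trans a c | apply: path_trans d b]. Qed.

(* The primitive border carrying a macro border. *)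
Definition lift (e : edge) : edge :=
  let: (v, R, C) := e in if v then (true, R * 2 + 1, C * 3 + 1) else (false, R * 2 + 0, C * 3 + 2).
Definition unlift (e : edge) : edge := let: (v, r, c) := e in (v, r %/ 2, c %/ 3).

Lemma liftK : cancel lift unlift.
Proof.
by case=> [[[] R] C] /=; rewrite (proj1 (divmod2 R _)) // (proj1 (divmod3 C _)).
Qed.

Lemma lift_active e : pactive (lift e) = mactive e.
Proof.
case: e => [[[] R] C]; rewrite /active /lift /meh /mev /EH /EV.
  have [_ ->] := divmod2 R (isT : 1 < 2); have [_ ->] := divmod3 C (isT : 1 < 3).
  by rewrite /= andbT; congr [&& _, _ & _]; lia.
have [_ ->] := divmod2 R (isT : 0 < 2); have [_ ->] := divmod3 C (isT : 2 < 3).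
by rewrite /= andbT; congr [&& _, _ & _]; lia.
Qed.

Lemma P_of_lift o g e : P_of o g (lift e) = o e.
Proof.
case: e => [[[] R] C]; rewrite /P_of /lift.
  by have [-> ->] := divmod2 R (isT : 1 < 2); have [-> ->] := divmod3 C (isT : 1 < 3).
by have [-> ->] := divmod2 R (isT : 0 < 2); have [-> ->] := divmod3 C (isT : 2 < 3).
Qed.

Lemma unlift_case v r c : pactive (v, r, c) ->
  lift (unlift (v, r, c)) = (v, r, c) \/
  (if v then r %% 2 == 0 else c %% 3 != 2).
Proof.
move=> /and3P[_ _]; rewrite /meh /mev => H.
have Er := divn_eq r 2; have Ec := divn_eq c 3.
have rm := ltn_pmod r (isT : 0 < 2); have cm := ltn_pmod c (isT : 0 < 3).
case: v H => /andP[_ H].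
  case: (boolP (r %% 2 == 0)) H => [|r1] /= H; first by right.
  by left; rewrite /lift /unlift; congr (_, _, _); lia.
case: (boolP (c %% 3 != 2)) H => [|r1] /= H; first by right.
by left; rewrite /lift /unlift; congr (_, _, _); lia.
Qed.

Definition inner (e : edge) : bool := let: (v, r, c) := e in if v then r %% 2 == 0 else c %% 3 != 2.
Definition bit_of (e : edge) : nat :=
  let: (v, r, c) := e in if v then 4 + c %% 3 else 2 * (r %% 2) + c %% 3.
Definition bit_edge (R C i : nat) : edge :=
  if i < 4 then (false, R * 2 + i %/ 2, C * 3 + i %% 2) else (true, R * 2 + 0, C * 3 + (i - 4)).

Lemma bit_edgeP R C i : i < 7 -> R < nR -> C < nC ->
  [/\ pactive (bit_edge R C i), inner (bit_edge R C i), bit_of (bit_edge R C i) = i &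
      (bit_edge R C i).1.2 %/ 2 = R /\ (bit_edge R C i).2 %/ 3 = C].
Proof.
move=> il Rl Cl; have H a b : a < 2 -> b < 3 ->
    [/\ (R * 2 + a) %/ 2 = R, (R * 2 + a) %% 2 = a, (C * 3 + b) %/ 3 = C & (C * 3 + b) %% 3 = b].
  by move=> al bl; have [-> ->] := divmod2 R al; have [-> ->] := divmod3 C bl.
rewrite /bit_edge /active /meh /mev /inner /bit_of.
case: i il => [|[|[|[|[|[|[|i]]]]]]] //= _; rewrite ?subSS ?subn0.
- by have [-> -> -> ->] := H 0 0 isT isT; split => //; lia.
- by have [-> -> -> ->] := H 0 1 isT isT; split => //; lia.
- by have [-> -> -> ->] := H 1 0 isT isT; split => //; lia.
- by have [-> -> -> ->] := H 1 1 isT isT; split => //; lia.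
- by have [-> -> -> ->] := H 0 0 isT isT; split => //; lia.
- by have [-> -> -> ->] := H 0 1 isT isT; split => //; lia.
- by have [-> -> -> ->] := H 0 2 isT isT; split => //; lia.
Qed.

Lemma bit_edgeK v r c : inner (v, r, c) -> bit_edge (r %/ 2) (c %/ 3) (bit_of (v, r, c)) = (v, r, c).
Proof.
have rm := ltn_pmod r (isT : 0 < 2); have cm := ltn_pmod c (isT : 0 < 3).
have Er := divn_eq r 2; have Ec := divn_eq c 3.
rewrite /inner /bit_of; case: v => H.
  have -> : bit_edge (r %/ 2) (c %/ 3) (4 + c %% 3) = (true, r %/ 2 * 2 + 0, c %/ 3 * 3 + c %% 3).
    by rewrite /bit_edge; case: ltnP; [lia | rewrite addKn].
  by congr (_, _, _); lia.
have bm : c %% 3 < 2 by lia.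
rewrite /bit_edge; case: ltnP; last by lia.
by rewrite mulnC divnMDl // modnMDl (divn_small bm) (modn_small bm) addn0 -Er -Ec.
Qed.

Lemma bit_lt e : inner e -> bit_of e < 7.
Proof.
case: e => [[v r] c]; have := ltn_pmod r (isT : 0 < 2); have := ltn_pmod c (isT : 0 < 3).
by rewrite /inner /bit_of; case: v; lia.
Qed.

Lemma P_of_inner o g e : inner e ->
  P_of o g e = nth false (g (e.1.2 %/ 2) (e.2 %/ 3)) (bit_of e).
Proof. by case: e => [[[] r] c]; rewrite /inner /P_of /bit_of; [move=> -> | move/negPf=> ->]. Qed.

Lemma lift_inner e : inner (lift e) = false.
Proof.
case: e => [[[] R] C]; rewrite /inner /lift.
  by have [_ ->] := divmod2 R (isT : 1 < 2).
by have [_ ->] := divmod3 C (isT : 2 < 3).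
Qed.

Lemma outer_lift e : pactive e -> inner e = false -> lift (unlift e) = e.
Proof. by case: e => [[v r] c] /unlift_case[] // H; rewrite /inner H. Qed.

Lemma mrel_flip o o' g e0 : flips nR nC EH EV e0 o o' -> o e0 = false -> mPV o g -> mPV o' g ->
  mrel o g o' g.
Proof.
move=> [ae E] _ V V'; apply: (flip_rel V V' (e0 := lift e0)); split; first by rewrite lift_active.
move=> e aae; case I: (inner e).
  by rewrite !P_of_inner //; case: eqP => // Ee; rewrite Ee lift_inner in I.
rewrite -(outer_lift aae I) !P_of_lift (can_eq liftK) E //.
by rewrite -lift_active outer_lift.
Qed.

Lemma bit_flip o g R C i b : R < nR -> C < nC -> i < 7 -> mPV o g ->
  macro_valid (mk R C) (occs EH EV o R C) (set_nth false (g R C) i b) ->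
  mrel o g o (put g R C (set_nth false (g R C) i b)).
Proof.
move=> Rl Cl il V Vs; have sz : size (g R C) = 7 by have /andP[/eqP] := V R C Rl Cl.
have [Eb|Nb] := eqVneq (nth false (g R C) i) b.
  apply: mrel_refl => r c rl cl; rewrite /put; case: andP => // -[/eqP-> /eqP->].
  apply: (@eq_from_nth _ false); first by rewrite size_set_nth sz; apply/esym/maxn_idPr.
  by move=> k kl; rewrite nth_set_nth /=; case: eqP => // ->.
have [ab ib bb [Rb Cb]] := bit_edgeP il Rl Cl.
apply: (flip_rel V (PV_put V (Vs : macro_valid_at R C _ _)) (e0 := bit_edge R C i)).
split=> // e ae; case I: (inner e); last first.
  rewrite -(outer_lift ae I) !P_of_lift; case: eqP => // Ee.
  by move: ib; rewrite -Ee lift_inner.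
rewrite !P_of_inner // /put; case: andP => [[/eqP Er /eqP Ec]|N].
  rewrite nth_set_nth /= Er Ec; case: (eqVneq (bit_of e) i) => Ei.
    have -> : e == bit_edge R C i.
      by apply/eqP; case: e Er Ec Ei I {ae} => [[v r] c] /= <- <- <- I; rewrite bit_edgeK.
    by move: Nb; rewrite Ei; case: nth; case: b {Vs}.
  by case: eqP => // Ee; rewrite Ee bb eqxx in Ei.
by case: eqP => // Ee; case: N; rewrite Ee Rb Cb !eqxx.
Qed.

Lemma run_rel o g R C t l : R < nR -> C < nC -> all (fun i => i < 7) l -> mPV o g ->
  let s := foldl (try_flip (mk R C) (occs EH EV o R C) t) (g R C) l in
  mrel o g o (put g R C s) /\ macro_valid (mk R C) (occs EH EV o R C) s.
Proof.
move=> Rl Cl; elim: l g => [|i l IH] g /=.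
  move=> _ V; split; last exact: V.
  by apply: mrel_refl => r c rl cl; rewrite /put; case: andP => // -[/eqP-> /eqP->].
case/andP=> il al V; case Vs: (macro_valid (mk R C) (occs EH EV o R C)
    (set_nth false (g R C) i (nth false t i))); last first.
  have -> : try_flip (mk R C) (occs EH EV o R C) t (g R C) i = g R C by rewrite /try_flip Vs.
  exact: IH.
set s' := set_nth false (g R C) i (nth false t i) in Vs.
have -> : try_flip (mk R C) (occs EH EV o R C) t (g R C) i = s' by rewrite /try_flip Vs.
have Ep : put g R C s' R C = s' by rewrite /put !eqxx.
have := IH _ al (PV_put V (Vs : macro_valid_at R C _ _)); rewrite /= Ep => -[R1 V1].
split => //; apply: mrel_trans (bit_flip Rl Cl il V Vs) _; apply: mrel_trans R1 _.
by apply: mrel_refl => r c rl cl; rewrite /put; case: (_ && _).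
Qed.

Definition macro_canonical R C p := macro_canon (mk R C) p.
Local Notation mcan := (can EH EV macro_canonical).

Lemma macro_reach o o' : mgood o -> clos_refl_trans _ mstep o o' ->
  mgood o' /\ mrel o (mcan o) o' (mcan o').
Proof.
have HV R C p : R < nR -> C < nC -> macro_allow R C p ->
    macro_valid_at R C p (macro_canonical R C p).
  by move=> _ _ A; have /allP/(_ p (all_setsP p))/implyP/(_ A)/andP[] := macro_canon_all (mk R C).
apply: (@canonical_reach _ _ _ _ EH_lt EV_lt macro_allow _ macro_valid_at mrel
  mrel_refl mrel_sym mrel_trans mrel_flip macro_canonical HV).
move=> o1 g R C e Rl Cl V p p' Eg A oe A'.
have /allP/(_ p (all_setsP p))/implyP/(_ A)/andP[_ /allP/(_ e)] := macro_canon_all (mk R C).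
have -> : e \in all_ports by case: (e) => [[] []].
rewrite oe (A' : macro_allowed (mk R C) (set_port p e true)) => /(_ isT)/eqP run.
move: run; rewrite -[macro_canon _ p]Eg /macro_run => run.
have := run_rel (macro_canon (mk R C) p') Rl Cl flip_order_lt V.
by cbv zeta; rewrite -/p run.
Qed.

Definition O_of (o : orientation) : orientation := fun e => o (lift e).
Definition g_of (o : orientation) R C : seq bool := [seq o (bit_edge R C i) | i <- iota 0 7].

Lemma same_of o : same o (P_of (O_of o) (g_of o)).
Proof.
move=> e ae; case I: (inner e); last by rewrite -(outer_lift ae I) P_of_lift.
rewrite P_of_inner // (nth_map 0) ?size_iota ?bit_lt // nth_iota ?bit_lt //.
by case: e I {ae} => [[v r] c] I; rewrite add0n bit_edgeK.
Qed.

Lemma O_of_good o : pgood o -> mPV (O_of o) (g_of o) /\ mgood (O_of o).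
Proof.
move=> G; have V : mPV (O_of o) (g_of o).
  by apply: good_mPV => [|R C]; [apply: same_good G; apply: same_of | rewrite size_map].
by split=> // R C Rl Cl; apply: macro_valid_allowed (V R C Rl Cl).
Qed.

(** A flip of an inner border is invisible above. A flip of an outer border is a step of the blocks,
    because the tiles of a block have been checked to impose its constraints. *)
Lemma O_of_reach o0 p0 o : mgood o0 -> pgood p0 -> (forall e, mactive e -> o0 e = O_of p0 e) ->
  clos_refl_trans _ pstep p0 o ->
  pgood o /\ exists2 O, clos_refl_trans _ mstep o0 O & forall e, mactive e -> O e = O_of o e.
Proof.
move=> G0 Gp E0 H; elim: (Operators_Properties.clos_rt_rtn1 _ _ _ _ H) => [|o1 o2].
  by split=> //; exists o0 => //; apply: rt_refl.
move=> [G2 [e0 [ae0 F]]] _ [G1 [O R1 EO]]; split => //.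
have [_ GO] := O_of_good G2.
case: (eqVneq (lift (unlift e0)) e0) => [L|L].
  exists (O_of o2) => //; apply: rt_trans R1 _; apply: rt_step; split=> //.
  exists (unlift e0); split=> [|e ae]; first by rewrite -lift_active L.
  by rewrite /O_of F ?lift_active // -{1}L (can_eq liftK) EO.
exists O => // e ae; rewrite EO // /O_of F ?lift_active //.
by case: eqP => // Ee; rewrite -Ee liftK eqxx in L.
Qed.

Theorem macro_game o0 RE : mgood o0 -> RE < nR -> 0 < nC -> mk RE 0 = mE ->
  let p0 := P_of o0 (mcan o0) in
  pgood p0 /\
  ((exists2 o, clos_refl_trans _ pstep p0 o & ~~ occ (occs meh mev o (RE * 2) 0) pR) <->
   (exists2 O, clos_refl_trans _ mstep o0 O & ~~ occ (occs EH EV O RE 0) pR)).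
Proof.
move=> G0 rl cl kE p0.
have Gp : pgood p0.
  apply: mPV_good; apply: can_PV G0 => R C p _ _ A.
  by have /allP/(_ p (all_setsP p))/implyP/(_ A)/andP[] := macro_canon_all (mk R C).
have occR O g : occ (occs meh mev (P_of O g) (RE * 2) 0) pR = ~~ nth false (g RE 0) 0.
  by have := occs_P O g rl cl (isT : 0 < 2) (isT : 0 < 3); rewrite addn0 mul0n => ->.
split=> //; split=> [[o R oR]|[O R oR]].
  have [Go [O RO EO]] : pgood o /\ exists2 O, clos_refl_trans _ mstep o0 O &
      forall e, mactive e -> O e = O_of o e.
    by apply: O_of_reach R => // e ae; rewrite /O_of /p0 P_of_lift.
  exists O => //; have [V _] := O_of_good Go.
  rewrite (eq_occs EH_lt EV_lt rl cl EO).
  have /allP/(_ _ (all_setsP (occs EH EV (O_of o) RE 0)))/allP/(_ (g_of o RE 0)) := macro_exit.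
  have := V RE 0 rl cl; rewrite /macro_valid_at kE => -> H.
  have sz : size (g_of o RE 0) = 7 by rewrite size_map.
  have /implyP/(_ isT)/implyP := H (mem_all_bits sz); apply.
  move: oR; rewrite (eq_occs (@meh_lt) (@mev_lt) _ _ (@same_of o)); try lia.
  by rewrite occR negbK.
have [GO [P _]] := macro_reach G0 R.
have [o2 E2 R2] := P p0 (fun _ _ => erefl).
exists o2 => //; rewrite (eq_occs (@meh_lt) (@mev_lt) _ _ E2); try lia.
by rewrite occR /can /macro_canonical kE /macro_canon (negPf oR).
Qed.

End Macro.

End Macros.

(** * A strip of blocks as wires with clauses *)

Module Logic.
Import Tiles Cells Orientations Boards Macros.

Section Logic.

Variables (n g goal : nat) (clauses : bool -> seq (nat * nat)) (W : nat).
Hypothesis n_gt0 : 0 < n.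
Hypothesis g_gt1 : 1 < g.
Hypothesis goal_lt : goal < g.
Hypothesis size_clauses : forall p, (size (clauses p)).+1 = W.
Hypothesis clausesP : forall p t b, (t, b) \in clauses p -> t < b < g * 2.

(* Row [a] carries the letter [a] of the even places and row [g + a] that of the odd ones.  Block [j] of [W]
   columns sees the wires of the places [j] and [j + 1]; in its last column the wires of place [j] end, and one
   of them is required to be on. *)
Definition owner (R C : nat) : nat := let j := C %/ W in j + (odd j != (g <= R)).
Definition letter (R : nat) : nat := if g <= R then R - g else R.
Definition row (i a : nat) : nat := odd i * g + a.
Definition wires := nat -> nat -> bool.

(** A place may hold several letters at a time, but never none. A clause names two rows of block
    [j], which may belong to the same place or to adjacent ones. *)
Definition satisfied (X : wires) : Prop :=
  [/\ forall i a, X i a -> i < n /\ a < g, forall i, i < n -> exists a, X i a &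
      forall j t b, j < n -> (t, b) \in clauses (odd j) ->
        ~ (X (j + (odd j != (g <= t))) (letter t) /\ X (j + (odd j != (g <= b))) (letter b))].
Definition xstep (X X' : wires) : Prop :=
  satisfied X' /\ exists i a, [/\ i < n, a < g &
    X' = fun i' a' => ((i' == i) && (a' == a)) (+) X i' a'].

(** The columns of block [j] run from [j * W + 1] to [(j + 1) * W], hence [C.-1]; column 0 is left
    for the exit. In [owner], however, [C] names the border to the right of a column and is divided
    as it stands. *)
Definition clause_at (C : nat) : nat * nat := nth (0, 1) (clauses (odd (C.-1 %/ W))) (C.-1 %% W).
Definition is_or (C : nat) : bool := C.-1 %% W == W.-1.
(** A wire is off at a border whose car lies on the right. Passing tiles never have both the left
    and the right port occupied, so off spreads to the right and on to the left. In a clause column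
    a wire that is on pushes the vertical borders down from row [t], or up from row [b], and the two
    are incompatible. In the last column of a block wires that are off pass a push downward; the
    bottom one cannot, so some wire is on. *)
Definition lmk (R C : nat) : macro :=
  if C == 0 then if R == goal then mE else mN
  else if C == (n * W).+1 then mN
  else if is_or C then
    if (g <= R) == odd (C.-1 %/ W) then
      if letter R == 0 then mOt else if letter R == g.-1 then mOb else mOR
    else mX
  else if R == (clause_at C).1 then mDT
  else if R == (clause_at C).2 then mUT else mX.

Local Notation nR := (g * 2).
Local Notation nC := (n * W).+2.
Lemma lmk_exit R C : lmk R C = mE -> C = 0.
Proof. by rewrite /lmk; case: eqP => // _; do ![case: ifP => // _]. Qed.

Local Notation LEH := (EH nC).
Local Notation LEV := (EV nR).
Local Notation lgood := (good nR nC LEH LEV (macro_allow lmk)).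
Local Notation lstep := (ostep nR nC LEH LEV (macro_allow lmk)).
Local Notation lflips := (flips nR nC LEH LEV).
Local Notation lactive := (active nR nC LEH LEV).
Local Notation loccs := (occs LEH LEV).

Lemma W_gt0 : 0 < W. Proof. by rewrite -(size_clauses true). Qed.

Lemma occL o R C : 0 < C -> C < nC -> occ (loccs o R C) pL = o (false, R, C.-1).
Proof. by move=> C0 Cl; rewrite /occs /left_active /EH /= C0 prednK // Cl. Qed.
Lemma occR o R C : C.+1 < nC -> occ (loccs o R C) pR = ~~ o (false, R, C).
Proof. by move=> Cl; rewrite /occs /EH /= Cl. Qed.
Lemma occT o R C : R < nR -> occ (loccs o R C) pT = (R == 0) || o (true, R.-1, C).
Proof. by case: R => [|R] Rl; rewrite /occs /top_active /EV //= Rl. Qed.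
Lemma occB o R C : R < nR -> occ (loccs o R C) pB = (R == nR.-1) || ~~ o (true, R, C).
Proof.
by move=> Rl; rewrite /occs /EV /=; case: eqP => [->|N]; [rewrite ltnNge | rewrite (_ : R.+1 < nR)] => //=; lia.
Qed.

Variant column_spec C : Prop :=
  | ClauseColumn j k of j < n & k < W.-1 & C = j * W + k.+1 & C %/ W = j & C.-1 %/ W = j &
      is_or C = false & clause_at C \in clauses (odd j)
  | OrColumn j of j < n & C = j.+1 * W & C %/ W = j.+1 & C.-1 %/ W = j & is_or C.

Lemma columnP C : 0 < C -> C.+1 < nC -> column_spec C.
Proof.
have W0 := W_gt0; move=> C0 Cl.
have jl : C.-1 %/ W < n by rewrite ltn_divLR //; lia.
have kl : C.-1 %% W < W by rewrite ltn_mod.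
have EC : C = C.-1 %/ W * W + (C.-1 %% W).+1 by rewrite addnS -divn_eq prednK.
have is_orE : is_or C = (C.-1 %% W == W.-1) by [].
have clE : clause_at C = nth (0, 1) (clauses (odd (C.-1 %/ W))) (C.-1 %% W) by [].
move: jl kl EC is_orE clE; have : C.-1 %/ W = C.-1 %/ W by [].
move: {2 3 4 5}(C.-1 %/ W) (C.-1 %% W) => j k dE jl kl EC is_orE clE.
case: (eqVneq k W.-1) => E.
  apply: (OrColumn (j := j)) => //; last by rewrite is_orE E eqxx.
    by rewrite EC E prednK // mulSn addnC.
  by rewrite EC E prednK // -mulSnr mulnK.
apply: (ClauseColumn (j := j) (k := k)) => //; first by clear -kl E W0; lia.
- by rewrite EC divnMDl // divn_small ?addn0 //; clear -kl E W0; lia.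
- by rewrite is_orE (negPf E).
by rewrite clE mem_nth // -ltnS size_clauses; clear -kl E W0; lia.
Qed.

Lemma row_lt i a : a < g -> row i a < nR.
Proof. by rewrite /row; case: (odd i) => /=; lia. Qed.
Lemma row_ge i a : a < g -> (g <= row i a) = odd i.
Proof. by rewrite /row; case: (odd i) => /=; lia. Qed.
Lemma letter_row i a : a < g -> letter (row i a) = a.
Proof. by move=> al; rewrite /letter row_ge // /row; case: (odd i) => /=; lia. Qed.

(** Where the wire of place [j] ends, its row is taken over by place [j + 2], which has the same
    parity. *)
Lemma owner_or j R : (g <= R) = odd j -> owner R (j.+1 * W) = j.+2.
Proof. by move=> E; rewrite /owner mulnK ?W_gt0 // E oddS; case: (odd j); rewrite /= addn1. Qed.

Lemma owner_or_pred j R : (g <= R) = odd j -> owner R (j.+1 * W).-1 = j.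
Proof.
have W0 := W_gt0; move=> E; rewrite /owner.
have -> : (j.+1 * W).-1 %/ W = j.
  by rewrite (_ : (j.+1 * W).-1 = j * W + W.-1) ?divnMDl ?divn_small ?addn0 //; lia.
by rewrite E eqxx addn0.
Qed.

(* A wire passes every tile except the roots of its own row. *)
Lemma owner_pred C R : 0 < C -> C.+1 < nC -> ~~ (is_or C && ((g <= R) == odd (C.-1 %/ W))) ->
  owner R C.-1 = owner R C.
Proof.
move=> C0 Cl; case: (columnP C0 Cl) => [j k jl kl EC d d' -> _ _|j jl EC d d' ->].
  by rewrite /owner d d'.
by rewrite /owner d d' /= => H; move: H; case: (odd j); case: (g <= R) => //= _; rewrite ?addn0 ?addn1.
Qed.

Lemma lmk_pass R C : 0 < C -> C.+1 < nC -> ~~ (is_or C && ((g <= R) == odd (C.-1 %/ W))) ->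
  [\/ lmk R C = mX, lmk R C = mDT | lmk R C = mUT].
Proof.
move=> C0 Cl; rewrite /lmk (gtn_eqF C0) (_ : C == (n * W).+1 = false); last by lia.
case: (is_or C) => /=; first by move/negPf=> ->; constructor 1.
by move=> _; do ![case: ifP => _]; [constructor 2 | constructor 3 | constructor 1].
Qed.

Lemma macro_not_all m p f : macro_allowed m p -> f \in macro_forbidden m -> all (occ p) f = false.
Proof. by move=> /hasPn H /H/negbTE. Qed.

Lemma pass o R C : lgood o -> R < nR -> 0 < C -> C.+1 < nC ->
  ~~ (is_or C && ((g <= R) == odd (C.-1 %/ W))) -> o (false, R, C.-1) -> o (false, R, C).
Proof.
move=> G Rl C0 Cl H oL.
have : ~~ (occ (loccs o R C) pL && occ (loccs o R C) pR).
  have := G R C Rl (ltnW Cl); rewrite /macro_allow /macro_allowed.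
  move=> A; apply/negP => /andP[hL hR].
  by case: (lmk_pass C0 Cl H) A => -> A; have := macro_not_all A (mem_head _ _);
    cbn [all]; rewrite hL hR.
by rewrite occL ?occR ?oL //=; [case: (o _) | apply: ltnW].
Qed.

Lemma occ_and o R C m f : lgood o -> R < nR -> C < nC -> lmk R C = m -> f \in macro_forbidden m ->
  all (occ (loccs o R C)) f = false.
Proof. by move=> G Rl Cl E; apply: macro_not_all; rewrite -E; apply: G. Qed.

Lemma owner_mono R C C' : C <= C' -> owner R C <= owner R C'.
Proof.
move=> le; rewrite /owner; have := leq_div2r W le.
rewrite leq_eqVlt => /orP[/eqP->//|lt].
by apply: leq_trans (leq_trans lt (leq_addr _ _)); rewrite -addn1 leq_add2l; case: (_ != _).
Qed.

Lemma root_owner R C : 0 < C -> C.+1 < nC -> is_or C && ((g <= R) == odd (C.-1 %/ W)) ->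
  owner R C.-1 < owner R C.
Proof.
move=> C0 Cl; case: (columnP C0 Cl) => [j k _ _ _ _ _ -> //|j jl EC d d' ->].
by rewrite d' => /eqP E; rewrite EC owner_or // owner_or_pred.
Qed.

Lemma wire_run o R C C' : lgood o -> R < nR -> C.+1 < nC -> C' <= C -> owner R C' = owner R C ->
  ~~ o (false, R, C) -> ~~ o (false, R, C').
Proof.
move=> G Rl; elim: C => [|C IH] Cl; first by rewrite leqn0 => /eqP->.
rewrite leq_eqVlt => /orP[/eqP->//|le] Eo oC.
have E1 : owner R C = owner R C.+1.
  by apply/eqP; rewrite eqn_leq owner_mono //= -Eo owner_mono.
apply: IH => //; [exact: ltnW | by rewrite E1 | apply: contra oC].
apply: (@pass o R C.+1) => //; apply/negP => /(root_owner (isT : 0 < C.+1) Cl).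
by rewrite /= E1 ltnn.
Qed.

Lemma row_owner R C : R < nR -> row (owner R C) (letter R) = R.
Proof.
move=> Rl; have -> : row (owner R C) (letter R) = (g <= R) * g + letter R.
  by rewrite /row /owner oddD; case: (odd _); case: (g <= R).
by rewrite /letter; case: ifP => /=; lia.
Qed.

Lemma letter_lt R : R < nR -> letter R < g.
Proof. by rewrite /letter; case: ifP; lia. Qed.

Lemma odd_owner R C : odd (owner R C) = (g <= R).
Proof. by rewrite /owner oddD; case: (odd _); case: (g <= R). Qed.

Lemma owner_end R C : owner R ((owner R C).+1 * W).-1 = owner R C.
Proof. by apply: owner_or_pred; rewrite odd_owner. Qed.

Lemma owner_ge R C : C < (owner R C).+1 * W.
Proof. by rewrite -ltn_divLR ?W_gt0 // ltnS leq_addr. Qed.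

Lemma col_end j : j < n -> (j.+1 * W).-1.+1 < nC.
Proof. by move=> jl; have := leq_mul jl (leqnn W); have := W_gt0; lia. Qed.

(** A wire is read at its root, the last border before its end: being on there, it is on along its
    whole length. *)
Definition X_of (o : orientation) : wires :=
  fun i a => [&& i < n, a < g & ~~ o (false, row i a, (i.+1 * W).-1)].

Lemma wire_on o R C : lgood o -> R < nR -> X_of o (owner R C) (letter R) -> ~~ o (false, R, C).
Proof.
move=> G Rl /and3P[il _]; rewrite row_owner // => H.
apply: (wire_run G Rl (col_end il)) H => //; last by rewrite owner_end.
by have := owner_ge R C; case: (_ * W).
Qed.

Lemma lmk_or j a : j < n -> a < g -> lmk (row j a) (j.+1 * W) =
  if a == 0 then mOt else if a == g.-1 then mOb else mOR.
Proof.
move=> jl al; have W0 := W_gt0; have E : (j.+1 * W).-1 = j * W + W.-1 by lia.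
have Cl := col_end jl.
have n0 : (j.+1 * W == 0) = false by rewrite mulSn; clear -W0; lia.
have le := leq_mul jl (leqnn W); have n1 : (j.+1 * W == (n * W).+1) = false by clear -le; lia.
have wl : W.-1 < W by clear -W0; lia.
have m1 : (j.+1 * W).-1 %% W = W.-1 by rewrite E modnMDl modn_small.
have d1 : (j.+1 * W).-1 %/ W = j by rewrite E divnMDl // divn_small // addn0.
by rewrite /lmk n0 n1 /is_or m1 d1 eqxx row_ge // eqxx letter_row.
Qed.

Lemma lmk_clause C : 0 < C -> C.+1 < nC -> is_or C = false ->
  let: (t, b) := clause_at C in
  [/\ t < b < nR, lmk t C = mDT, lmk b C = mUT &
      forall R, R != t -> R != b -> lmk R C = mX].
Proof.
move=> C0 Cl Hor; case: (columnP C0 Cl) => [j k _ _ _ _ _ _ cl|]; last by rewrite Hor.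
have n1 : (C == (n * W).+1) = false by clear -Cl; lia.
rewrite /lmk (gtn_eqF C0) n1 Hor; case: (clause_at C) cl => t b /clausesP tb; split=> //=; first by rewrite eqxx.
  by rewrite eqxx (gtn_eqF (_ : t < b)) //; case/andP: tb.
by move=> R /negPf-> /negPf->.
Qed.

Lemma X_of_satisfied o : lgood o -> satisfied (X_of o).
Proof.
move=> G; have W0 := W_gt0; split=> [i a /and3P[]//|i il|j t b jl cl].
  have H : ~ (forall a, a < g -> ~~ X_of o i a).
    move=> H; have L a : a < g -> o (false, row i a, (i.+1 * W).-1).
      by move=> al; have := H a al; rewrite /X_of il al negbK.
    have qn : (i.+1 * W).+1 < nC by have le := leq_mul il (leqnn W); clear -le; lia.
    have q0 : 0 < i.+1 * W by rewrite muln_gt0.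
    have oc a : a < g -> occ (loccs o (row i a) (i.+1 * W)) pL.
      by move=> al; rewrite occL ?L // ltnW.
    (* If all wires of the place are off, the vertical borders are pushed down one after another,
       and the bottom tile fails. *)
    have D a : a.+1 < g -> o (true, row i a, i.+1 * W).
      elim: a => [|a IH] al.
        have := occ_and G (row_lt i (ltnW al)) (ltnW qn) (lmk_or il (ltnW al)) (mem_head _ _).
        cbn [all]; rewrite oc ?(ltnW al) // occB ?row_lt ?(ltnW al) // !andbT => /negbT.
        by rewrite negb_or negbK => /andP[].
      have := IH (ltnW al); have := lmk_or il (ltnW al); have -> : (a.+1 == g.-1) = false by clear -al; lia.
      move=> E Ht; have := occ_and G (row_lt i (ltnW al)) (ltnW qn) E (mem_head _ _).
      cbn [all]; rewrite oc ?(ltnW al) // occB ?occT ?row_lt ?(ltnW al) // !andbT.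
      have -> : (row i a.+1).-1 = row i a by rewrite /row addnS.
      by rewrite Ht orbT /= => /negbT; rewrite negb_or negbK => /andP[].
    have gl : g.-1 < g by lia.
    have := lmk_or il gl; rewrite eqxx; have -> : (g.-1 == 0) = false by clear -g_gt1; lia.
    move=> E; have := occ_and G (row_lt i gl) (ltnW qn) E (mem_head _ _).
    have Eg : (row i g.-1).-1 = row i g.-2 by rewrite /row; clear -g_gt1; lia.
    have gl2 : (g.-2).+1 < g by clear -g_gt1; lia.
    by cbn [all]; rewrite oc // occT ?row_lt // Eg D // orbT.
  have [|N] := boolP (has (X_of o i) (iota 0 g)); first by case/hasP => a _; exists a.
  by case: H => a al; have /hasPn/(_ a) := N; rewrite mem_iota; apply.
have [tb bl] := andP (clausesP cl).
have [k kl Ek] : exists2 k, k < size (clauses (odd j)) & nth (0, 1) (clauses (odd j)) k = (t, b).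
  by exists (index (t, b) (clauses (odd j))); rewrite ?index_mem ?nth_index.
have kW : k.+1 < W by rewrite -(size_clauses (odd j)).
pose C := j * W + k.+1.
have C0 : 0 < C by rewrite /C addnS.
have Cl : C.+1 < nC by have := leq_mul jl (leqnn W); rewrite /C; lia.
have dC : C %/ W = j by rewrite /C divnMDl // divn_small ?addn0.
have EC : clause_at C = (t, b).
  by rewrite /clause_at /C addnS /= divnMDl // modnMDl divn_small ?modn_small ?addn0 //; apply: ltnW.
have Hor : is_or C = false by rewrite /is_or /C addnS /= modnMDl modn_small; [lia | apply: ltnW].
have := lmk_clause C0 Cl Hor; rewrite EC => -[_ Et Eb EX] [].
have ow R : j + (odd j != (g <= R)) = owner R C by rewrite /owner dC.
have tl : t < nR by apply: ltn_trans bl.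
have tn1 : (t == nR.-1) = false by clear -tb bl; lia.
rewrite !ow => /(wire_on G tl) ot /(wire_on G bl) ob.
(* The upper wire pushes the borders down as far as row [b], whose wire demands the opposite. *)
have D R : t <= R < b -> o (true, R, C).
  elim: R => [|R IH] /andP[tR Rb].
    have t0 : t = 0 by lia.
    have := occ_and G tl (ltnW Cl) Et (_ : [:: pR; pB] \in _); rewrite !inE eqxx orbT => /(_ isT).
    cbn [all]; rewrite occR // ot occB // tn1 andbT.
    by rewrite t0 => /negbFE.
  have [Et'|Nt] := eqVneq t R.+1.
    have := occ_and G tl (ltnW Cl) Et (_ : [:: pR; pB] \in _); rewrite !inE eqxx orbT => /(_ isT).
    cbn [all]; rewrite occR // ot occB // tn1 andbT.
    by rewrite -Et' => /negbFE.
  have Rl : R.+1 < nR by lia.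
  have E1 : lmk R.+1 C = mX by apply: EX; lia.
  have := occ_and G Rl (ltnW Cl) E1 (_ : [:: pT; pB] \in _); rewrite !inE eqxx orbT => /(_ isT).
  have Rn : (R.+1 == nR.-1) = false by clear -Rb bl; lia.
  have IHR : o (true, R, C) by apply: IH; clear -tR Rb Nt; lia.
  by cbn [all]; rewrite occT // occB // IHR Rn orbT andbT => /negbFE.
have := occ_and G bl (ltnW Cl) Eb (_ : [:: pR; pT] \in _); rewrite !inE eqxx orbT => /(_ isT).
have bp : t <= b.-1 < b by clear -tb; lia.
by cbn [all]; rewrite occR // ob occT // D // orbT.
Qed.

Definition root_edge (i a : nat) : edge := (false, row i a, (i.+1 * W).-1).

Lemma root_edge_inj i a i' a' : a < g -> a' < g -> root_edge i a = root_edge i' a' -> i = i' /\ a = a'.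
Proof.
move=> al al' [Er Ec]; split; last by rewrite -(letter_row i al) Er letter_row.
by apply/eqP; rewrite -(eqn_pmul2r W_gt0); have := W_gt0; lia.
Qed.

Lemma root_edge_active i a : i < n -> a < g -> lactive (root_edge i a).
Proof.
by move=> il al; have := col_end il; rewrite /root_edge /active /EH row_lt //= => H; rewrite (ltnW H).
Qed.

(** Only flips of root edges are visible in [X_of]. *)
Lemma X_of_step o o' e0 : lgood o' -> lflips e0 o o' ->
  X_of o' = X_of o \/ xstep (X_of o) (X_of o').
Proof.
move=> G [ae F]; pose i := owner e0.1.2 e0.2; pose a := letter e0.1.2.
have al : a < g by apply: letter_lt; case: (e0) ae => [[v r] c] /and3P[].
have [/andP[il /eqP E]|N] := boolP ((i < n) && (e0 == root_edge i a)).
  right; split; first exact: X_of_satisfied.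
  exists i, a; split=> //; apply: functional_extensionality => i'.
  apply: functional_extensionality => a'; rewrite /X_of.
  case: ltnP => il' /=; last by rewrite addbF; case: andP => // -[/eqP E']; lia.
  case: ltnP => al' /=; last by rewrite addbF; case: andP => // -[_ /eqP E']; lia.
  rewrite F -/(root_edge i' a') ?root_edge_active // E.
  case: eqP => [/(root_edge_inj al' al)[-> ->]|Ne]; first by rewrite !eqxx.
  by case: andP => // -[/eqP E1 /eqP E2]; case: Ne; rewrite E1 E2.
left; apply: functional_extensionality => i'; apply: functional_extensionality => a'.
rewrite /X_of; case: ltnP => il' //=; case: ltnP => al' //=.
rewrite F -/(root_edge i' a') ?root_edge_active //; case: eqP => // E; case/negP: N.
have Ei : i = i'.
  by rewrite /i -E /= owner_or_pred // row_ge.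
have Ea : a = a' by rewrite /a -E /= letter_row.
by rewrite Ei Ea il' E eqxx.
Qed.

Lemma X_of_reach o0 o : clos_refl_trans _ lstep o0 o -> clos_refl_trans _ xstep (X_of o0) (X_of o).
Proof.
elim=> [o1 o2 [G [e0 F]]|o1|o1 o2 o3 _ R1 _ R2]; [|exact: rt_refl|exact: rt_trans R1 R2].
by have [->|S] := X_of_step G F; [apply: rt_refl | apply: rt_step].
Qed.

Lemma X_of_goal o : lgood o -> ~~ occ (loccs o goal 0) pR -> X_of o 0 goal = false.
Proof.
move=> G; have gn : goal < nR by lia.
rewrite occR // negbK => H; apply/negbTE/negP => X0.
have := @wire_on o goal 0 G gn; rewrite /owner div0n /= (_ : g <= goal = false); last by lia.
by rewrite /letter ifF ?H; [move/(_ X0) | lia].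
Qed.

Definition conn (o o' : orientation) : Prop :=
  clos_refl_trans _ lstep o o' /\ clos_refl_trans _ lstep o' o.
Lemma conn_refl o : conn o o. Proof. by split; apply: rt_refl. Qed.
Lemma conn_sym o o' : conn o o' -> conn o' o. Proof. by case. Qed.
Lemma conn_trans o o' o'' : conn o o' -> conn o' o'' -> conn o o''.
Proof. by move=> [a b] [c d]; split; [apply: rt_trans a c | apply: rt_trans d b]. Qed.
Lemma conn_flip o o' e0 : lgood o -> lgood o' -> lflips e0 o o' -> conn o o'.
Proof.
move=> G G' F; split; apply: rt_step; split=> //; exists e0 => //; exact: flips_sym.
Qed.

Lemma conn_iter (f : nat -> orientation) a b : a <= b ->
  (forall m, a <= m < b -> conn (f m) (f m.+1)) -> conn (f a) (f b).
Proof.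
elim: b => [|b IH]; first by rewrite leqn0 => /eqP->; move=> _; apply: conn_refl.
rewrite leq_eqVlt => /orP[/eqP->|ab] H; first exact: conn_refl.
apply: conn_trans (IH ab _) (H b _); last by rewrite -ltnS ab ltnSn.
by move=> m /andP[am mb]; apply: H; rewrite am ltnW.
Qed.

(** A family containing all intermediate states that are needed. In a clause column, row [th]
    between [t] and [b] is the one with both vertical ports empty; a wire of the clause can be on
    only if [th] is its own row. For the last column of a block [ov] gives the vertical borders. *)
Definition Gen (rv : nat -> nat -> bool) (th : nat -> nat) (ov : nat -> nat -> bool) : orientation :=
  fun e => let: (v, R, C) := e in
  if v then if (C == 0) || (nC <= C.+1) then true
            else if is_or C then ov C R
            else (R < (clause_at C).1) || (th C <= R < (clause_at C).2)
  else rv R C.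

Definition row_ok (rv : nat -> nat -> bool) := forall R C, R < nR -> 0 < C -> C.+1 < nC ->
  ~~ (is_or C && ((g <= R) == odd (C.-1 %/ W))) -> rv R C.-1 -> rv R C.
Definition clause_ok (rv : nat -> nat -> bool) (th : nat -> nat) :=
  forall C, 0 < C -> C.+1 < nC -> is_or C = false ->
  let: (t, b) := clause_at C in [/\ t <= th C <= b, rv t C || (th C == t) & rv b C || (th C == b)].
Definition or_ok (rv ov : nat -> nat -> bool) := forall R C, R < nR -> 0 < C -> C.+1 < nC -> is_or C ->
  if (g <= R) == odd (C.-1 %/ W)
  then ~~ [&& (letter R == 0) || ov C R.-1, (letter R == g.-1) || ~~ ov C R & rv R C.-1]
  else ~~ (((R == 0) || ov C R.-1) && ((R == nR.-1) || ~~ ov C R)).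

Lemma macro_allowedI m p : (forall f, f \in macro_forbidden m -> ~~ all (occ p) f) -> macro_allowed m p.
Proof. by move=> H; apply/hasPn. Qed.

Lemma Gen_good rv th ov : row_ok rv -> clause_ok rv th -> or_ok rv ov -> lgood (Gen rv th ov).
Proof.
move=> Hr Hc Ho R C Rl Cl; rewrite /macro_allow.
have [C0|C0] := posnP C; first by rewrite /lmk C0 eqxx; case: ifP.
have [Ec|Nc] := eqVneq C (n * W).+1; first by rewrite /lmk (gtn_eqF C0) Ec eqxx.
have Cl' : C.+1 < nC by clear -Cl Nc; lia.
have nv : (C == 0) || (nC <= C.+1) = false by clear -C0 Cl'; lia.
have oL : occ (loccs (Gen rv th ov) R C) pL = rv R C.-1 by rewrite occL.
have oR : occ (loccs (Gen rv th ov) R C) pR = ~~ rv R C by rewrite occR.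
case Hor: (is_or C).
  have := Ho R C Rl C0 Cl' Hor; have := Hr R C Rl C0 Cl'; rewrite Hor /=.
  have oT : occ (loccs (Gen rv th ov) R C) pT = (R == 0) || ov C R.-1 by rewrite occT //= nv Hor.
  have oB : occ (loccs (Gen rv th ov) R C) pB = (R == nR.-1) || ~~ ov C R by rewrite occB //= nv Hor.
  rewrite /lmk (gtn_eqF C0) (negPf Nc) Hor; case: ifP => own H1 H2.
    case: ifP H2 => [l0|l0] /=.
      move=> H2; apply: macro_allowedI => f; rewrite inE => /eqP->; cbn [all].
      rewrite oL oB andbT; apply: contra H2 => /andP[H3 ->]; rewrite andbT.
      case/orP: H3 => [/eqP ER|->]; last by rewrite orbT.
      move: own l0; rewrite ER /letter; clear -g_gt1; case: ifP; lia.
    case: ifP => [lg|lg] /= H2; apply: macro_allowedI => f; rewrite inE => /eqP->; cbn [all].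
      rewrite oL oT andbT; apply: contra H2 => /andP[H3 ->]; rewrite andbT.
      case/orP: H3 => [/eqP ER|->] //; move: l0; rewrite ER /letter; clear -g_gt1; case: ifP; lia.
    rewrite oL oT oB andbT; apply: contra H2 => /and3P[H3 H4 ->]; rewrite andbT; apply/andP; split.
      case/orP: H3 => [/eqP ER|->] //; move: l0; rewrite ER /letter; clear -g_gt1; case: ifP; lia.
    case/orP: H4 => [/eqP ER|->] //; move: lg; rewrite ER /letter; clear -g_gt1; case: ifP; lia.
  apply: macro_allowedI => f; rewrite !inE => /orP[]/eqP->; cbn [all]; rewrite ?oL ?oR ?oT ?oB andbT.
    by apply/negP => /andP[/(H1 isT)->].
  exact: H2.
pose cv R' := (R' < (clause_at C).1) || (th C <= R' < (clause_at C).2).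
have oT : occ (loccs (Gen rv th ov) R C) pT = (R == 0) || cv R.-1 by rewrite occT //= nv Hor.
have oB : occ (loccs (Gen rv th ov) R C) pB = (R == nR.-1) || ~~ cv R by rewrite occB //= nv Hor.
have := Hr R C Rl C0 Cl'; rewrite Hor /= => /(_ isT) H1.
have := lmk_clause C0 Cl' Hor; have := Hc C C0 Cl' Hor; move: oT oB; rewrite /cv.
case: (clause_at C) => t b; cbn [fst snd] => oT oB [/andP[tth thb] Ht Hb] [/andP[tb bl] Et Eb EX].
have LR : ~~ (rv R C.-1 && ~~ rv R C) by apply/negP => /andP[/H1->].
have [E|Nt] := eqVneq R t.
  rewrite E Et; apply: macro_allowedI => f; rewrite !inE => /orP[]/eqP->; cbn [all]; rewrite -E ?oL ?oR ?oB andbT.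
    by rewrite andbC.
  apply/negP => /andP[H3 H4]; move: Ht; rewrite -E (negPf H3) /= => H5.
  by clear -H4 H5 E tb bl; lia.
have [E|Nb] := eqVneq R b.
  rewrite E Eb; apply: macro_allowedI => f; rewrite !inE => /orP[]/eqP->; cbn [all]; rewrite -E ?oL ?oR ?oT andbT.
    by rewrite andbC.
  apply/negP => /andP[H3 H4]; move: Hb; rewrite -E (negPf H3) /= => H5.
  by clear -H4 H5 E tb; lia.
rewrite EX //; apply: macro_allowedI => f; rewrite !inE => /orP[]/eqP->; cbn [all]; rewrite ?oL ?oR ?oT ?oB andbT //.
by apply/negP => /andP[H3 H4]; clear -H3 H4 tth thb tb bl Rl Nt Nb; lia.
Qed.

Definition rv_of (X : wires) R C := ~~ X (owner R C) (letter R).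
Definition th_of (X : wires) C := let: (t, b) := clause_at C in if rv_of X t C then b else t.
Definition top_wire (X : wires) j := find (X j) (iota 0 g).
(* Edge values of a root column while its pointer moves up from letter [f0] to
   letter [f1]. *)
Definition pointer (j f1 m f0 R : nat) : bool :=
  (R < odd j * g + f1) || (odd j * g + m <= R < odd j * g + f0).
Definition ov_of (X : wires) C R :=
  let j := C.-1 %/ W in R < odd j * g + top_wire X j.
Definition state_of (X : wires) : orientation := Gen (rv_of X) (th_of X) (ov_of X).

Lemma row_okX X : row_ok (rv_of X).
Proof. by move=> R C Rl C0 Cl H; rewrite /rv_of owner_pred. Qed.

Lemma clause_conflict X C : satisfied X -> 0 < C -> C.+1 < nC -> is_or C = false ->
  let: (t, b) := clause_at C in t < b < nR /\ (rv_of X t C || rv_of X b C).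
Proof.
move=> [_ _ S] C0 Cl Hor; case: (columnP C0 Cl) => [j k jl _ _ dC _ _ cl|]; last by rewrite Hor.
case: (clause_at C) cl => t b cl; split; first exact: clausesP cl.
have := S j t b jl cl; rewrite /rv_of /owner dC -negb_and => H; apply/negP => /andP[H1 H2].
by apply: H.
Qed.

Lemma clause_okX X : satisfied X -> clause_ok (rv_of X) (th_of X).
Proof.
move=> S C C0 Cl Hor; have := clause_conflict S C0 Cl Hor; rewrite /th_of.
case: (clause_at C) => t b [/andP[tb bl]]; case: ifP => /= Ht Hb.
  by rewrite leqnn (ltnW tb) eqxx orbT.
by rewrite Hb leqnn (ltnW tb) eqxx.
Qed.

(** Among the rows of the place at most two, [f1] and [f0], have both vertical ports occupied, and
    the wires of both are on. *)
Lemma pointer_ok X ov j f1 m f0 : satisfied X -> j < n -> X j f1 -> X j f0 -> f1 <= m <= f0 ->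
  (f1 = f0 \/ f1 < f0) -> forall R, R < nR -> is_or (j.+1 * W) ->
  ov (j.+1 * W) =1 pointer j f1 m f0 ->
  forall C, C = j.+1 * W ->
  if (g <= R) == odd (C.-1 %/ W)
  then ~~ [&& (letter R == 0) || ov C R.-1, (letter R == g.-1) || ~~ ov C R & rv_of X R C.-1]
  else ~~ (((R == 0) || ov C R.-1) && ((R == nR.-1) || ~~ ov C R)).
Proof.
move=> [Sb _ _] jl X1 X0 /andP[f1m mf0] Hf R Rl Hor Eo C EC.
have [_ f0g] := Sb _ _ X0; have W0 := W_gt0.
have d1 : C.-1 %/ W = j.
  have -> : C.-1 = j * W + W.-1 by rewrite EC mulSn; clear -W0; lia.
  by rewrite divnMDl // divn_small ?addn0 //; clear -W0; lia.
rewrite d1 [X in rv_of _ R X](_ : C.-1 = (j.+1 * W).-1) ?EC // !Eo /pointer; case: ifP => /eqP own.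
  rewrite /rv_of (owner_or_pred own); apply/negP => /and3P[H1 H2 H3].
  have : letter R = f1 \/ letter R = f0.
    move: H1 H2; rewrite /letter; move: own; case: (odd j) => own; rewrite own /=;
    clear -own f1m mf0 Hf f0g Rl g_gt1; lia.
  by case=> E; rewrite E ?X1 ?X0 in H3.
apply/negP => /andP[H1 H2]; move: own H1 H2; case: (odd j) => own /=;
  clear -own f1m mf0 Hf f0g Rl g_gt1; lia.
Qed.

Lemma top_wireP X j : satisfied X -> j < n -> X j (top_wire X j) /\
  (forall a, X j a -> top_wire X j <= a).
Proof.
move=> [Sb Se _] jl; have [a Xa] := Se j jl; have [_ al] := Sb _ _ Xa.
have H : has (X j) (iota 0 g) by apply/hasP; exists a => //; rewrite mem_iota.
have fl : top_wire X j < g by move: H; rewrite has_find size_iota.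
split; first by have := nth_find 0 H; rewrite nth_iota.
move=> b Xb; have [_ bl] := Sb _ _ Xb; rewrite leqNgt; apply/negP => lt.
by have := before_find 0 lt; rewrite nth_iota ?add0n ?Xb.
Qed.

Lemma or_okX X : satisfied X -> or_ok (rv_of X) (ov_of X).
Proof.
move=> S R C Rl C0 Cl Hor; case: (columnP C0 Cl) Hor => [j k _ _ _ _ _ -> //|j jl EC _ d1 _ Hor].
have [Xt _] := top_wireP S jl; rewrite EC in Hor *.
apply: (@pointer_ok X (ov_of X) j (top_wire X j) (top_wire X j) (top_wire X j)) => //; rewrite ?leqnn //.
  by left.
move=> R'; rewrite /ov_of -EC d1 /pointer; clear; lia.
Qed.

Lemma state_good X : satisfied X -> lgood (state_of X).
Proof. by move=> S; apply: Gen_good; [apply: row_okX | apply: clause_okX | apply: or_okX]. Qed.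

Lemma X_of_state X : satisfied X -> X_of (state_of X) = X.
Proof.
move=> [Sb _ _]; apply: functional_extensionality => i; apply: functional_extensionality => a.
rewrite /X_of /state_of /Gen /rv_of negbK.
apply/and3P/idP => [[il al]|Xa]; last have [il al] := Sb _ _ Xa; rewrite ?letter_row ?owner_or_pred ?row_ge //.
Qed.

Section Raise.

(** Turning one wire on: the thresholds of its clauses make room while it is still off, then its
    borders are flipped, then the pointer may move to it. Turning a wire off is the reverse, as
    [conn] is symmetric. *)
Variables (X X' : wires) (i a : nat).
Hypothesis SX : satisfied X.
Hypothesis SX' : satisfied X'.
Hypothesis il : i < n.
Hypothesis al : a < g.
Hypothesis Xia : X i a = false.
Hypothesis X'E : forall i' a', X' i' a' = ((i' == i) && (a' == a)) || X i' a'.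

Lemma rv_le R C : rv_of X' R C -> rv_of X R C.
Proof. by rewrite /rv_of X'E negb_or => /andP[]. Qed.

Lemma th_le C : 0 < C -> C.+1 < nC -> is_or C = false -> th_of X' C <= th_of X C.
Proof.
move=> C0 Cl Hor; have := clause_conflict SX C0 Cl Hor; rewrite /th_of.
case: (clause_at C) => t b [/andP[tb bl] _]; case: ifP => H; case: ifP => H' //; last exact: ltnW.
by rewrite (rv_le H) in H'.
Qed.

Lemma th_between th : (forall C, 0 < C -> C.+1 < nC -> is_or C = false -> th_of X' C <= th C <= th_of X C) ->
  clause_ok (rv_of X) th.
Proof.
move=> H C C0 Cl Hor; have := H C C0 Cl Hor; have := clause_conflict SX' C0 Cl Hor.
have := clause_okX SX C0 Cl Hor; rewrite /th_of; case: (clause_at C) => t b.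
move: (@rv_le t C) (@rv_le b C); case: (rv_of X t C) => Ht Hb [/andP[H1 H2] H3 H4] [/andP[tb bl] H5].
  case: (rv_of X' t C) H5 Ht => H5 Ht H6; split=> //=.
  - by clear -H6 tb; lia.
  - by rewrite (_ : th C = b) ?eqxx ?orbT //; clear -H6; lia.
  - by rewrite Hb.
case: (rv_of X' t C) H5 Ht => H5 Ht H6; first by have := Ht isT.
have E : th C = t by clear -H6; lia.
by rewrite E eqxx Hb // leqnn (ltnW tb).
Qed.

Lemma phase1 : conn (state_of X) (Gen (rv_of X) (th_of X') (ov_of X)).
Proof.
apply: conn_sym.
have good th : (forall C, 0 < C -> C.+1 < nC -> is_or C = false -> th_of X' C <= th C <= th_of X C) ->
    lgood (Gen (rv_of X) th (ov_of X)).
  by move=> H; apply: Gen_good; [apply: row_okX | apply: th_between | apply: or_okX].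
(* One column at a time, in reversed direction: column [m] rises from its threshold for [X'] to that
   for [X], the columns before it being done. *)
pose mix m k C := if C < m then th_of X C else if C == m then k else th_of X' C.
have mixE m : mix m (th_of X m) = mix m.+1 (th_of X' m.+1).
  apply: functional_extensionality => C; rewrite /mix ltnS.
  by case: (ltngtP C m) => [//|gt|->//]; case: eqP => // ->.
have col m : conn (Gen (rv_of X) (mix m (th_of X' m)) (ov_of X)) (Gen (rv_of X) (mix m (th_of X m)) (ov_of X)).
  have [/and3P[m0 ml /negbTE mo]|N] := boolP [&& 0 < m, m.+1 < nC & ~~ is_or m]; last first.
    have -> : Gen (rv_of X) (mix m (th_of X m)) (ov_of X) = Gen (rv_of X) (mix m (th_of X' m)) (ov_of X).
      apply: functional_extensionality => -[[[] R] C] //=; case: ifP => // nv; case: ifP => // Ho.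
      rewrite /mix; case: (eqVneq C m) => // E; case/negP: N; rewrite -E Ho andbT.
      by clear -nv; lia.
    exact: conn_refl.
  apply: (conn_iter (f := fun k => Gen (rv_of X) (mix m k) (ov_of X))); first exact: th_le.
  move=> k /andP[k0 k1].
  have G k' : th_of X' m <= k' <= th_of X m -> lgood (Gen (rv_of X) (mix m k') (ov_of X)).
    move=> kk; apply: good => C C0 Cl Ho; have le := th_le C0 Cl Ho.
    rewrite /mix; case: ltnP => _; first by rewrite le leqnn.
    by case: eqP => [->|_] //; rewrite leqnn le.
  have := clause_conflict SX' m0 ml mo => HC.
  have [kt kb] : (clause_at m).1 <= k /\ k < (clause_at m).2 < nR.
    move: HC k0 k1; rewrite /th_of; case: (clause_at m) => t b [/andP[tb bl] _] /=.
    by case: ifP => _; case: ifP => _; clear -tb bl; lia.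
  apply: (conn_flip (e0 := (true, k, m))); try (by apply: G; clear -k0 k1; lia).
  split; first by rewrite /active /EV; clear -kb ml; lia.
  move=> [[[] R] C] _ //=; case: ifP => nv.
    by rewrite (_ : _ == _ = false) //; apply/eqP => -[_ E]; move: nv; rewrite E; clear -m0 ml; lia.
  case: ifP => Ho.
    by rewrite (_ : _ == _ = false) //; apply/eqP => -[_ E]; move: Ho; rewrite E mo.
  rewrite !xpair_eqE /= /mix; case: (eqVneq C m) => [->|_]; last by rewrite andbF.
  by rewrite ltnn andbT; clear -kt kb; lia.
have -> : Gen (rv_of X) (th_of X') (ov_of X) = Gen (rv_of X) (mix 0 (th_of X' 0)) (ov_of X).
  by congr (Gen _ _ _); apply: functional_extensionality => -[|C].
have step m : conn (Gen (rv_of X) (mix 0 (th_of X' 0)) (ov_of X)) (Gen (rv_of X) (mix m (th_of X' m)) (ov_of X)).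
  elim: m => [|m IH]; first exact: conn_refl.
  by apply: conn_trans IH _; rewrite -mixE.
apply: conn_trans (step nC) _.
have -> : Gen (rv_of X) (mix nC (th_of X' nC)) (ov_of X) = state_of X.
  apply: functional_extensionality => -[[[] R] C] //=; case: ifP => // nv; case: ifP => // _.
  by rewrite /mix ifT //; clear -nv; lia.
exact: conn_refl.
Qed.

Lemma phase2 : conn (Gen (rv_of X) (th_of X') (ov_of X)) (Gen (rv_of X') (th_of X') (ov_of X)).
Proof.
(* The flips go from left to right, because a border may be on only if the borders of the wire
   before it are; those before column [w] are on already. *)
pose mix w R C := if [&& R == row i a, owner R C == i & C < w] then false else rv_of X R C.
have rvX' R C : rv_of X' R C = if (R == row i a) && (owner R C == i) then false else rv_of X R C.
  rewrite /rv_of X'E negb_or; case: (eqVneq (owner R C) i) => Eo; rewrite ?andbF //= andbT.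
  have -> : (letter R == a) = (R == row i a).
    have := odd_owner R C; rewrite Eo /letter /row => ->; case: leqP => H /=; clear -H al; lia.
  by case: eqP => //= _; rewrite andbT.
have le1 w R C : rv_of X' R C -> mix w R C by rewrite rvX' /mix; case: eqP => //= _; case: eqP => //= _; case: ifP.
have le2 w R C : mix w R C -> rv_of X R C by rewrite /mix; case: ifP.
have G w : lgood (Gen (mix w) (th_of X') (ov_of X)).
  apply: Gen_good.
  - move=> R C Rl C0 Cl H; rewrite /mix (owner_pred C0 Cl H) /rv_of (owner_pred C0 Cl H).
    by case: eqP => //= _; case: eqP => //= _; case: ltnP => //; case: ltnP => //; clear -C0; lia.
  - move=> C C0 Cl Ho; have := clause_okX SX' C0 Cl Ho; case: (clause_at C) => t b [H1 H2 H3].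
    split=> //; first by case/orP: H2 => [/(le1 w)->|->] //; rewrite orbT.
    by case/orP: H3 => [/(le1 w)->|->] //; rewrite orbT.
  move=> R C Rl C0 Cl Ho; have := or_okX SX Rl C0 Cl Ho; case: ifP => // _.
  by apply: contra => /and3P[-> -> /le2->].
have -> : rv_of X = mix 0.
  by apply: functional_extensionality => R; apply: functional_extensionality => C; rewrite /mix ltn0 !andbF.
have -> : rv_of X' = mix (i.+1 * W).
  apply: functional_extensionality => R; apply: functional_extensionality => C.
  rewrite rvX' /mix; case: eqP => //= _; case: eqP => //= E.
  by rewrite -E owner_ge.
apply: (conn_iter (f := fun w => Gen (mix w) (th_of X') (ov_of X))) => // w /andP[_ wl].
have wn : w.+1 < nC by have le := leq_mul il (leqnn W); clear -le wl; lia.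
have [E|N] := eqVneq (owner (row i a) w) i.
  apply: (conn_flip (e0 := (false, row i a, w)) (G _) (G _)).
  split; first by rewrite /active /EH row_lt // wn andbT; apply: ltnW.
  move=> [[[] R] C] _ //; rewrite !xpair_eqE /= /mix ltnS leq_eqVlt.
  case: (eqVneq R (row i a)) => //= ER; case: (ltngtP C w) => //= EC; rewrite ?andbF ?andbT //.
  by rewrite ER EC E eqxx /= /rv_of E letter_row // Xia.
have -> : mix w.+1 = mix w; last exact: conn_refl.
apply: functional_extensionality => R; apply: functional_extensionality => C.
rewrite /mix ltnS leq_eqVlt; case: (eqVneq R (row i a)) => //= ER; case: (eqVneq C w) => //= EC.
by rewrite ER EC (negPf N).
Qed.

Lemma phase3 : conn (Gen (rv_of X') (th_of X') (ov_of X)) (state_of X').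
Proof.
have W0 := W_gt0; pose q := i.+1 * W.
have top j : j != i -> top_wire X' j = top_wire X j.
  by move=> ji; apply: eq_find => b; rewrite X'E (negPf ji).
have [T1 T1m] := top_wireP SX' il; have [T0 T0m] := top_wireP SX il.
have X'0 : X' i (top_wire X i) by rewrite X'E T0 orbT.
have f10 := T1m _ X'0; set f1 := top_wire X' i in T1 f10; set f0 := top_wire X i in T0 X'0 f10.
(* For [m = f1] the pointer is at the old top wire [f0], for [m = f0] at the new one [f1]. *)
pose mix m C R := if C == q then pointer i f1 m f0 R else ov_of X' C R.
have dq : q.-1 %/ W = i.
  have -> : q.-1 = i * W + W.-1 by rewrite /q mulSn; clear -W0; lia.
  by rewrite divnMDl // divn_small ?addn0 //; clear -W0; lia.
have E1 : Gen (rv_of X') (th_of X') (ov_of X) = Gen (rv_of X') (th_of X') (mix f1).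
  apply: functional_extensionality => -[[[] R] C] //=; case: ifP => // nv; case: ifP => // Ho.
  rewrite /mix; case: eqP => [->|Nq].
    by rewrite /ov_of dq -/f0 /pointer; clear -f10; lia.
  rewrite /ov_of top //; apply/eqP => Ej; case: Nq.
  have [C0 Cl] : 0 < C /\ C.+1 < nC by clear -nv; lia.
  case: (columnP C0 Cl) => [j k _ _ _ _ _|j jl EC _ dj _]; first by rewrite Ho.
  by rewrite EC /q -Ej dj.
have E2 : state_of X' = Gen (rv_of X') (th_of X') (mix f0).
  congr (Gen _ _ _); apply: functional_extensionality => C; apply: functional_extensionality => R.
  rewrite /mix; case: eqP => [->|//].
  by rewrite /ov_of dq -/f1 /pointer; clear -f10; lia.
have G m : f1 <= m <= f0 -> lgood (Gen (rv_of X') (th_of X') (mix m)).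
  move=> Hm; apply: Gen_good; [exact: row_okX | exact: clause_okX |].
  move=> R C Rl C0 Cl Ho; have [EC|NC] := eqVneq C q.
    rewrite EC in Ho *; apply: (@pointer_ok X' (mix m) i f1 m f0) => //.
      by clear -f10; lia.
    by move=> R'; rewrite /mix eqxx.
  by have := or_okX SX' Rl C0 Cl Ho; rewrite /mix (negPf NC).
rewrite E1 E2; apply: (conn_iter (f := fun m => Gen (rv_of X') (th_of X') (mix m))) => // m /andP[m1 m0].
have [SX'b _ _] := SX'; have [_ f0g] := SX'b _ _ X'0.
have [q0 qn] : 0 < q /\ q.+1 < nC.
  by split; [rewrite muln_gt0 | have le := leq_mul il (leqnn W); clear -le; rewrite /q; lia].
have qor : is_or q.
  have -> : is_or q = ((i * W + W.-1) %% W == W.-1).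
    by rewrite /is_or; congr (_ %% W == _); rewrite /q mulSn; clear -W0; lia.
  by rewrite modnMDl modn_small //; clear -W0; lia.
apply: (conn_flip (e0 := (true, odd i * g + m, q))); try (by apply: G; clear -m1 m0; lia).
split.
  rewrite /active /EV; case: (odd i) => /=; clear -m0 f0g qn g_gt1; lia.
move=> [[[] R] C] _ //=; rewrite !xpair_eqE /=; case: ifP => nv.
  by rewrite (_ : (C == q) = false) ?andbF //; apply/eqP => E; move: nv; rewrite E; clear -q0 qn; lia.
case: ifP => Ho; last first.
  by rewrite (_ : (C == q) = false) ?andbF //; apply/eqP => E; rewrite E qor in Ho.
rewrite /mix; case: (eqVneq C q) => EC; rewrite ?andbF //= andbT /pointer.
by clear -m1 m0; lia.
Qed.

Lemma raise_conn : conn (state_of X) (state_of X').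
Proof. exact: conn_trans phase1 (conn_trans phase2 phase3). Qed.

End Raise.

Lemma xstep_conn X X' : satisfied X -> xstep X X' -> conn (state_of X) (state_of X').
Proof.
move=> SX [SX' [i [a [il al E]]]]; case Xia: (X i a).
  apply: conn_sym; apply: (@raise_conn X' X i a) => //; first by rewrite E !eqxx Xia.
  by move=> i' a'; rewrite E; case: eqP => //= ->; case: eqP => //= ->; rewrite Xia.
apply: (@raise_conn X X' i a) => // i' a'; rewrite E.
by case: eqP => //= ->; case: eqP => //= ->; rewrite Xia.
Qed.

Theorem logic_game X0 : satisfied X0 ->
  lgood (state_of X0) /\
  ((exists2 o, clos_refl_trans _ lstep (state_of X0) o & ~~ occ (loccs o goal 0) pR) <->
   (exists2 X, clos_refl_trans _ xstep X0 X & X 0 goal = false)).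
Proof.
move=> S0; have G0 := state_good S0; split=> //; split=> [[o R oR]|[X R Xg]].
  exists (X_of o); first by rewrite -{1}(X_of_state S0); apply: X_of_reach.
  apply: X_of_goal => //; elim: (Operators_Properties.clos_rt_rtn1 _ _ _ _ R) => // o1 o2 [].
  by [].
exists (state_of X).
  have [] : satisfied X /\ clos_refl_trans _ lstep (state_of X0) (state_of X); last by [].
  elim: (Operators_Properties.clos_rt_rtn1 _ _ _ _ R) => [|X1 X2 S12 _ [S1 R1]].
    by split=> //; apply: rt_refl.
  split; first by case: S12.
  by apply: rt_trans R1 _; case: (xstep_conn S1 S12).
rewrite occR // negbK /= /rv_of /owner div0n /= (_ : g <= goal = false); last by lia.
by rewrite /letter ifF ?Xg //; lia.
Qed.

End Logic.

End Logic.

(** * Token walks as undirected rewriting of words *)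

Module Words.
Import Cells Logic.

Section Words.

(* A token walks on a word of bases: [act b t] is the direction in which token
   [t] leaves base [b], the base that it leaves behind and the new token. *)
Variables (base tok : finType) (act : base -> tok -> option (bool * base * tok)).
Variables (first_base last_base : base).
Hypothesis act_first : forall t, act first_base t = None.
Hypothesis act_last : forall t b t', act last_base t <> Some (true, b, t').
Hypothesis act_class : forall b t d b' t', act b t = Some (d, b', t') ->
  ((b == first_base) = (b' == first_base)) /\ ((b == last_base) = (b' == last_base)).

Variable n : nat.
Hypothesis n_gt1 : 1 < n.

Record state := State { place : nat; token : tok; bases : nat -> base }.

Definition nstep (C : state) : option state :=
  if act (bases C (place C)) (token C) is Some (d, b, t) then
    Some (State (if d then (place C).+1 else (place C).-1) t (upd (bases C) (place C) b))
  else None.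

Definition plain := (base * option tok)%type.
(** A move of the token concerns two cells, but letters are rewritten one at a time. A letter in a
    stage carries the whole rule, so each of the two cells knows what the other must do. *)
Definition pair_rule := (bool * plain * plain * plain * plain)%type.
Definition letters := (plain + pair_rule * 'I_4)%type.

(** The condition on [a2.1] keeps the source cell, as seen from the destination, inside the word: no
    token arrives at the first place from its left or at the last one from its right. *)
Definition is_rule (r : pair_rule) : bool :=
  let: (d, a1, a2, c1, c2) := r in
  [&& a2.2 == None, c1.2 == None, c2.1 == a2.1, a2.1 != (if d then first_base else last_base) &
      if (a1.2, c2.2) is (Some t, Some t') then act a1.1 t == Some (d, c1.1, t') else false].

Definition stage (i : nat) : 'I_4 := inord i.
Definition source (r : pair_rule) : plain := let: (d, a1, a2, c1, c2) := r in a1.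
Definition dest (r : pair_rule) : plain := let: (d, a1, a2, c1, c2) := r in a2.
Definition left_behind (r : pair_rule) : plain := let: (d, a1, a2, c1, c2) := r in c1.
Definition arrived (r : pair_rule) : plain := let: (d, a1, a2, c1, c2) := r in c2.
Definition dir (r : pair_rule) : bool := let: (d, a1, a2, c1, c2) := r in d.

(* A rule rewrites its source cell through stages 0, 1 and its destination cell
   through stages 2, 3. *)
Definition half_edge (x y : letters) : bool :=
  match x, y with
  | inl a, inr (r, s) => is_rule r &&
      match nat_of_ord s with
      | 0 => a == source r
      | 1 => a == left_behind r
      | 2 => a == dest r
      | _ => a == arrived r
      end
  | inr (r, s), inr (r', s') => [&& is_rule r, r == r' & (s : nat, s' : nat) \in [:: (0, 1); (2, 3)]]
  | _, _ => false
  end.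
Definition change (x y : letters) : bool := half_edge x y || half_edge y x.

(** A handshake. The two cells run through (source, dest), (0, dest), (0, 2), (1, 2), (1, 3), (left
    behind, 3), (left behind, arrived), one letter at a time. A stage restricts only the neighbour
    on its partner's side. *)
Definition accepts (x : letters) (right : bool) (y : letters) : bool :=
  if x is inr (r, s) then
    if (if s < 2 then dir r else ~~ dir r) == right then
      match nat_of_ord s with
      | 0 => (y == inl (dest r)) || (y == inr (r, stage 2))
      | 1 => (y == inr (r, stage 2)) || (y == inr (r, stage 3))
      | 2 => (y == inr (r, stage 0)) || (y == inr (r, stage 1))
      | _ => (y == inr (r, stage 1)) || (y == inl (left_behind r))
      end
    else true
  else true.
Definition compatible (x y : letters) : bool := accepts x true y && accepts y false x.

Definition word := nat -> letters.
Definition legal (v : word) : Prop := forall i, i.+1 < n -> compatible (v i) (v i.+1).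
Definition wstep (v v' : word) : Prop :=
  legal v' /\ exists i l, [/\ i < n, change (v i) l & v' = upd v i l].

Definition word_of (C : state) : word :=
  fun i => inl (bases C i, if i == place C then Some (token C) else None).

Definition shaped (C : state) : Prop :=
  [/\ place C < n, forall i, i < n -> (bases C i == first_base) = (i == 0) &
      forall i, i < n -> (bases C i == last_base) = (i == n.-1)].

Definition other (r : pair_rule) (p : nat) : nat := if dir r then p.+1 else p.-1.

Definition mid (r : pair_rule) (p : nat) (C : state) (x y : letters) : word :=
  upd (upd (word_of C) p x) (other r p) y.

Definition applies (r : pair_rule) (C C' : state) : Prop :=
  [/\ is_rule r, shaped C, shaped C', nstep C = Some C' &
   let p := place C in let q := other r p in
   [/\ q < n, p != q, (if dir r then p.+1 == q else p == q.+1) &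
       [/\ word_of C p = inl (source r), word_of C q = inl (dest r) &
       word_of C' = mid r p C (inl (left_behind r)) (inl (arrived r))]]].

Lemma stageE i : i < 4 -> stage i = i :> nat.
Proof. by move=> H; rewrite /stage inordK. Qed.

Lemma apply_rule C C' : shaped C -> nstep C = Some C' -> exists r, applies r C C'.
Proof.
case: C => P t b [/= Pn Hf Hl]; rewrite /nstep /=.
case E: (act (b P) t) => [[[d b'] t']|] // [<-].
pose q := if d then P.+1 else P.-1.
have P0 : 0 < P.
  by rewrite lt0n; apply/eqP => P0; move: (Hf P Pn); rewrite P0 eqxx => /eqP E0; rewrite P0 E0 act_first in E.
have qn : q < n.
  rewrite /q; case: (d) E => E; last by lia.
  have : b P <> last_base by move=> El; rewrite El in E; case: (act_last E).
  by move=> /eqP; rewrite (Hl P Pn); lia.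
have qP : P != q by rewrite /q; case: (d); lia.
have [c1 c2] := act_class E.
exists (d, (b P, Some t), (b q, None), (b', None), (b q, Some t')); split.
- rewrite /is_rule /= !eqxx E eqxx andbT; case: (d) @q qn qP => q qn qP.
    by rewrite Hf.
  by rewrite Hl //; rewrite /q in qn qP *; lia.
- by split.
- by split=> //= i il; rewrite /upd; case: (eqVneq i P) => [->|_]; rewrite -?c1 -?c2 ?Hf ?Hl.
- by rewrite /nstep /= E.
rewrite /other /= -/q; split=> //.
  by rewrite /q; case: (d); rewrite ?eqxx // prednK ?eqxx.
split; first by rewrite /word_of /= eqxx.
  by rewrite /word_of /= eq_sym (negPf qP).
apply: functional_extensionality => i; rewrite /mid /other /= -/q /word_of /upd /=.
case: (eqVneq i q) => [->|iq]; first by rewrite eq_sym (negPf qP).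
by case: eqP.
Qed.

(** Rewriting may also undo a rule wherever its result occurs. The predecessor is rebuilt from the
    rule, and [act_class] keeps it shaped. *)
Lemma unapply_rule C r : shaped C -> is_rule r ->
  let p := if dir r then (place C).-1 else (place C).+1 in
  p < n -> (dir r -> 0 < place C) -> word_of C (place C) = inl (arrived r) ->
  word_of C p = inl (left_behind r) -> exists2 C0, applies r C0 C & place C0 = p.
Proof.
case: C r => [P t b] [[[[d a1] a2] c1] c2] [/= Pn Hf Hl] /and5P[/eqP a2N /eqP c1N /eqP c21 a2b].
case Ea1: a1.2 => [t0|] //; case Ec2: c2.2 => [t'|] // /eqP E pn dP.
rewrite /word_of /= eqxx => -[Ec].
have pP : (if d then P.-1 else P.+1) != P by case: (d) dP => [/(_ isT)|_]; lia.
rewrite (negPf pP) => -[Ec1]; set p := if d then _ else _ in pn pP Ec1 *.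
have [cl1 cl2] := act_class E.
have bp : b p = c1.1 by rewrite -Ec1.
have bP : b P = a2.1 by rewrite -c21 -Ec.
have tt' : t = t' by rewrite -Ec /= in Ec2; case: Ec2.
pose C0 := State p t0 (upd b p a1.1).
have oP : (if d then p.+1 else p.-1) = P by rewrite /p; case: (d) dP => [/(_ isT)|_]; lia.
have S0 : shaped C0.
  by split=> //= i il; rewrite /upd; case: (eqVneq i p) => [->|_] //; rewrite ?cl1 ?cl2 -?bp ?Hf ?Hl.
have N0 : nstep C0 = Some (State P t b).
  rewrite /nstep /= /upd eqxx E oP tt'; congr (Some (State _ _ _)).
  by apply: functional_extensionality => i; case: eqP => [->|].
exists C0 => //; split=> //.
  by rewrite /is_rule a2N c1N c21 a2b Ea1 Ec2 E !eqxx.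
rewrite /other /= oP; split=> //.
  by rewrite -oP; case: (d) @p pn pP Ec1 bp C0 oP S0 N0 => //= *; lia.
split; first by rewrite /word_of /= /upd !eqxx; rewrite -Ea1; case: (a1).
  by rewrite /word_of /= eq_sym (negPf pP) /upd eq_sym (negPf pP) bP -a2N; case: (a2).
apply: functional_extensionality => i; rewrite /mid /other /= oP /word_of /upd /=.
case: (eqVneq i P) => [->|iP]; first by rewrite Ec.
by case: (eqVneq i p) => [->|ip]; [rewrite Ec1 | rewrite /upd (negPf ip)].
Qed.

Definition nconn := clos_refl_sym_trans state (fun C C' => nstep C = Some C').

Definition mids (r : pair_rule) (p : nat) (C : state) (k : nat) : word :=
  match k with
  | 0 => word_of C
  | 1 => mid r p C (inr (r, stage 0)) (inl (dest r))
  | 2 => mid r p C (inr (r, stage 0)) (inr (r, stage 2))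
  | 3 => mid r p C (inr (r, stage 1)) (inr (r, stage 2))
  | 4 => mid r p C (inr (r, stage 1)) (inr (r, stage 3))
  | 5 => mid r p C (inl (left_behind r)) (inr (r, stage 3))
  | _ => mid r p C (inl (left_behind r)) (inl (arrived r))
  end.

Lemma word_of_legal C : legal (word_of C). Proof. by move=> i _. Qed.

(** Only the pair formed by the two cells needs a check, since their outward sides accept
    anything. *)
Lemma pair_legal r C C' x y : applies r C C' ->
  (exists p, x = inl p \/ exists s : 'I_4, s < 2 /\ x = inr (r, s)) ->
  (exists p, y = inl p \/ exists s : 'I_4, 2 <= s /\ y = inr (r, s)) ->
  accepts x (dir r) y -> accepts y (~~ dir r) x -> legal (mid r (place C) C x y).
Proof.
move=> [_ [Pn _ _] _ _ [qn pq dq _]] [px Hx] [py Hy] a1 a2 i il.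
have E1 : mid r (place C) C x y (place C) = x.
  by rewrite /mid /upd (negPf pq) eqxx.
have E2 : mid r (place C) C x y (other r (place C)) = y by rewrite /mid /upd eqxx.
have E3 j : j != place C -> j != other r (place C) -> mid r (place C) C x y j = word_of C j.
  by move=> n1 n2; rewrite /mid /upd (negPf n1) (negPf n2).
have accx w : accepts x (~~ dir r) w.
  case: Hx => [->//|[s [s2 ->]]]; rewrite /accepts s2.
  by case: (dir r).
have accy w : accepts y (dir r) w.
  case: Hy => [->//|[s [s2 ->]]]; rewrite /accepts ltnNge s2 /=.
  by case: (dir r).
have accw j d w : accepts (word_of C j) d w by [].
rewrite /compatible.
case: (eqVneq i (place C)) => [Ei|Ni].
  case D: (dir r) dq a1 a2 accx accy => /eqP dq a1 a2 accx accy.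
    by rewrite Ei dq E1 E2 a1 a2.
  have N1 : i.+1 != place C by rewrite Ei; lia.
  have N2 : i.+1 != other r (place C) by rewrite Ei; lia.
  by rewrite (E3 _ N1 N2) Ei E1 accx accw.
case: (eqVneq i (other r (place C))) => [Ei|Ni'].
  case D: (dir r) dq a1 a2 accx accy => /eqP dq a1 a2 accx accy.
    have N1 : i.+1 != place C by rewrite Ei; lia.
    have N2 : i.+1 != other r (place C) by rewrite Ei; lia.
    by rewrite (E3 _ N1 N2) Ei E2 accy accw.
  by rewrite Ei -dq E1 E2 a1 a2.
rewrite (E3 _ Ni Ni') accw /=.
case: (eqVneq i.+1 (place C)) => [Ei|N1].
  rewrite Ei E1; case D: (dir r) dq a1 a2 accx accy => /eqP dq a1 a2 accx accy; first exact: accx.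
  by case/eqP: Ni'; lia.
case: (eqVneq i.+1 (other r (place C))) => [Ei|N2]; last by rewrite E3.
rewrite Ei E2; case D: (dir r) dq a1 a2 accx accy => /eqP dq a1 a2 accx accy; last exact: accy.
by case/eqP: Ni; lia.
Qed.

Lemma stage_neq i j : i < 4 -> j < 4 -> (stage i == stage j) = (i == j).
Proof. by move=> il jl; rewrite -val_eqE /= !stageE. Qed.

Lemma mids_legal r C C' k : applies r C C' -> legal (mids r (place C) C k).
Proof.
move=> H; have X0 p : exists q : plain, inl p = inl q :> letters \/ exists s : 'I_4, s < 2 /\ inl p = inr (r, s) :> letters.
  by exists p; left.
have Y0 p : exists q : plain, inl p = inl q :> letters \/ exists s : 'I_4, 2 <= s /\ inl p = inr (r, s) :> letters.
  by exists p; left.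
have X1 i : i < 2 -> exists q : plain, inr (r, stage i) = inl q :> letters \/ exists s : 'I_4, s < 2 /\ inr (r, stage i) = inr (r, s) :> letters.
  by move=> il; exists (source r); right; exists (stage i); split=> //; rewrite stageE; lia.
have Y1 i : 2 <= i < 4 -> exists q : plain, inr (r, stage i) = inl q :> letters \/ exists s : 'I_4, 2 <= s /\ inr (r, stage i) = inr (r, s) :> letters.
  by move=> il; exists (source r); right; exists (stage i); split=> //; rewrite stageE; lia.
case: k => [|[|[|[|[|[|k]]]]]]; first exact: word_of_legal.
all: apply: (pair_legal H); rewrite /accepts ?stageE //=; auto.
all: by rewrite ?eqxx ?orbT ?if_same //; case: (dir r).
Qed.

Lemma mids_step r C C' k : applies r C C' -> k < 6 ->
  wstep (mids r (place C) C k) (mids r (place C) C k.+1) /\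
  wstep (mids r (place C) C k.+1) (mids r (place C) C k).
Proof.
move=> H k6; set p := place C; have [Ir [Pn _ _] _ _ [qn pq _ [Ws Wd _]]] := H.
set q := other r p in qn pq Wd.
have Ei (x y x' : letters) : upd (mid r p C x y) p x' = mid r p C x' y.
  apply: functional_extensionality => i; rewrite /mid /upd.
  by case: (eqVneq i p) => // ->; rewrite (negPf pq).
have Ei' (x y y' : letters) : upd (mid r p C x y) q y' = mid r p C x y'.
  by apply: functional_extensionality => i; rewrite /mid /upd -/q; case: eqP.
have E0 : word_of C = mid r p C (inl (source r)) (inl (dest r)).
  apply: functional_extensionality => i; rewrite /mid /upd -/q.
  by case: eqP => [->|_] //; case: eqP => [->|].
have mp x y : mid r p C x y p = x by rewrite /mid /upd (negPf pq) eqxx.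
have mq x y : mid r p C x y q = y by rewrite /mid /upd eqxx.
have ch x y : change x y -> change y x by rewrite /change orbC.
have mk x y x' : change x x' -> legal (mid r p C x' y) -> wstep (mid r p C x y) (mid r p C x' y).
  by move=> c L; split=> //; exists p, x'; rewrite mp Ei.
have mk' x y y' : change y y' -> legal (mid r p C x y') -> wstep (mid r p C x y) (mid r p C x y').
  by move=> c L; split=> //; exists q, y'; rewrite mq Ei'.
have c0 : change (inl (source r)) (inr (r, stage 0)) by rewrite /change /half_edge Ir stageE // eqxx.
have c1 : change (inr (r, stage 0)) (inr (r, stage 1)) by rewrite /change /half_edge Ir !stageE // eqxx.
have c2 : change (inr (r, stage 1)) (inl (left_behind r)) by rewrite /change /half_edge Ir !stageE // eqxx.
have d0 : change (inl (dest r)) (inr (r, stage 2)) by rewrite /change /half_edge Ir stageE // eqxx.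
have d1 : change (inr (r, stage 2)) (inr (r, stage 3)) by rewrite /change /half_edge Ir !stageE // eqxx.
have d2 : change (inr (r, stage 3)) (inl (arrived r)) by rewrite /change /half_edge Ir !stageE // eqxx.
have := mids_legal k H; have := mids_legal k.+1 H; rewrite -/p.
case: k k6 => [|[|[|[|[|[|k]]]]]] //= _; rewrite ?E0 => L1 L2; split; auto.
Qed.

(** Every reachable word is a configuration or a single rule halfway through. *)
Inductive sim (C0 : state) : word -> Prop :=
| SimPlain C : shaped C -> nconn C0 C -> sim C0 (word_of C)
| SimMid r C C' k : applies r C C' -> nconn C0 C -> 0 < k < 6 -> sim C0 (mids r (place C) C k).

Lemma applies_conn C0 r C C' : applies r C C' -> nconn C0 C -> nconn C0 C'.
Proof. by move=> [_ _ _ E _] H; apply: rst_trans H _; apply: rst_step. Qed.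

Lemma mids_end r C C' : applies r C C' -> mids r (place C) C 6 = word_of C'.
Proof. by move=> [_ _ _ _ [_ _ _ [_ _ ->]]]. Qed.

Lemma is_ruleP r : is_rule r -> [/\ exists t, (source r).2 = Some t, (dest r).2 = None,
  (left_behind r).2 = None & exists t, (arrived r).2 = Some t].
Proof.
case: r => [[[[d a1] a2] c1] c2] /and5P[/eqP a2N /eqP c1N _ _] /=.
by case E1: a1.2 => [t|] //; case E2: c2.2 => [t'|] // _; split=> //; [exists t | exists t'].
Qed.

Lemma legal_accepts v p q d : legal v -> p < n -> q < n -> (if d then p.+1 == q else p == q.+1) ->
  accepts (v p) d (v q).
Proof.
move=> L pn qn; case: d => /eqP E.
  by have := L p; rewrite E => /(_ qn) /andP[].
by have := L q; rewrite -E => /(_ pn) /andP[].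
Qed.

Lemma letter_eq (r r' : pair_rule) i j : i < 4 -> j < 4 ->
  (inr (r, stage i) == inr (r', stage j) :> letters) = (r == r') && (i == j).
Proof. by move=> il jl; rewrite -(stage_neq il jl). Qed.

Definition part (r : pair_rule) (i : nat) : plain :=
  match i with 0 => source r | 1 => left_behind r | 2 => dest r | _ => arrived r end.

Lemma change_inl a l : change (inl a) l -> exists r i, [/\ l = inr (r, stage i), is_rule r, i < 4 & a = part r i].
Proof.
case: l => [b|[r s]]; rewrite /change /half_edge //= orbF => /andP[Ir H].
exists r, s; split=> //; first by congr (inr (_, _)); apply: val_inj; rewrite /= stageE.
by case: s H => [[|[|[|[|?]]]] ?] //= /eqP.
Qed.

Definition twin i := match i with 0 => 1 | 1 => 0 | 2 => 3 | _ => 2 end.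

Lemma change_inr r i l : change (inr (r, stage i)) l -> i < 4 ->
  l = inl (part r i) \/ l = inr (r, stage (twin i)).
Proof.
move=> + il; rewrite /change; case: l => [a|[r' s]] /=.
  move=> /andP[_]; rewrite stageE // => H; left.
  by case: i il H => [|[|[|[|?]]]] //= _ /eqP->.
rewrite !stageE // => H; right.
have Es : s = stage s by apply: val_inj; rewrite /= stageE.
case/orP: H => /and3P[_ /eqP-> H]; rewrite Es; congr (inr (_, stage _));
  case: s Es H => [[|[|[|[|?]]]] ?] //= _; by case: i il => [|[|[|[|?]]]].
Qed.

(** As [act] is a function, the source and the destination determine the rule. *)
Lemma rule_same r r' : is_rule r -> is_rule r' -> source r = source r' ->
  dir r = dir r' /\ (dest r = dest r' -> r = r').
Proof.
case: r r' => [[[[d a1] a2] [c1 u1]] [c2 u2]] [[[[d' a1'] a2'] [c1' u1']] [c2' u2']].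
move=> /and5P[/= _ /eqP N1 /eqP N2 _]; case Ea: a1.2 => [t|] //; case: u2 => [t2|] // /eqP E.
move=> /and5P[/= _ /eqP N1' /eqP N2' _]; case Ea': a1'.2 => [t'|] //; case: u2' => [t2'|] // /eqP E' Es.
move: Ea' E'; rewrite -Es Ea => -[<-]; rewrite E => -[<- <- <-]; split=> // Ed.
by rewrite N2 N2' N1 N1' Ed.
Qed.

(** At the last place no partner can be on the right: [act_last] forbids leaving that way, and
    [is_rule] forbids arriving from there. *)
Lemma rule_range r i p : is_rule r -> p < n -> forall C, shaped C -> bases C p = (part r i).1 ->
  (if i < 2 then dir r else ~~ dir r) -> p.+1 < n.
Proof.
case: r => [[[[d a1] a2] c1] c2] /and5P[_ _ /eqP c21 a2b].
case Ea1: a1.2 => [t0|] //; case Ec2: c2.2 => [t'|] // /eqP E pn C [_ _ Hl] Eb H.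
rewrite ltn_neqAle pn andbT; apply/eqP => Ep.
have : bases C p = last_base by apply/eqP; rewrite Hl // -Ep.
rewrite {}Eb => Eb; have [_ cl] := act_class E.
case: i Eb H => [|[|i]] /=.
- by move=> Ea d1; rewrite Ea d1 in E; case: (act_last E).
- by move=> Ec d1; move: cl; rewrite Ec eqxx => /eqP Ea; rewrite Ea d1 in E; case: (act_last E).
have -> : (match i with 0 => a2 | _ => c2 end).1 = a2.1 by case: (i).
by move=> Ea dF; rewrite (negPf dF) Ea eqxx in a2b.
Qed.

Lemma rule_range' r i p : is_rule r -> p < n -> forall C, shaped C -> bases C p = (part r i).1 ->
  (if i < 2 then ~~ dir r else dir r) -> 0 < p.
Proof.
case: r => [[[[d a1] a2] c1] c2] /and5P[_ _ /eqP c21 a2b].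
case Ea1: a1.2 => [t0|] //; case Ec2: c2.2 => [t'|] // /eqP E pn C [_ Hf _] Eb H.
rewrite lt0n; apply/eqP => Ep.
have : bases C p = first_base by apply/eqP; rewrite Hf // Ep.
rewrite {}Eb => Eb; have [cl _] := act_class E.
case: i Eb H => [|[|i]] /=.
- by move=> Ea _; rewrite Ea act_first in E.
- by move=> Ec _; move: cl; rewrite Ec eqxx => /eqP Ea; rewrite Ea act_first in E.
have -> : (match i with 0 => a2 | _ => c2 end).1 = a2.1 by case: (i).
by move=> Ea dF; rewrite dF Ea eqxx in a2b.
Qed.

(* The direction in which the partner of a letter at stage [i] lies. *)
Definition toward (r : pair_rule) (i : nat) : bool := if i < 2 then dir r else ~~ dir r.
Definition beside (d : bool) (p : nat) : nat := if d then p.+1 else p.-1.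

Lemma partner_range r i p C : is_rule r -> p < n -> shaped C -> bases C p = (part r i).1 ->
  let q := beside (toward r i) p in
  q < n /\ (if toward r i then p.+1 == q else p == q.+1).
Proof.
move=> Ir pn SC E; rewrite /beside /toward; case D: (if i < 2 then _ else _).
  by rewrite (rule_range Ir pn SC E) // D.
have p0 : 0 < p by apply: (rule_range' Ir pn SC E); move: D; case: (i < 2); case: (dir r).
by split; [apply: leq_ltn_trans pn; apply: leq_pred | rewrite prednK].
Qed.

Lemma word_of_off C i a : i != place C -> word_of C i = inl a -> a.2 = None.
Proof. by rewrite /word_of => /negPf-> [<-]. Qed.

Lemma part_token r i : is_rule r -> (part r i).2 = None -> i = 1 \/ i = 2.
Proof.
move=> /is_ruleP[[t E] _ _ [t' E']]; case: i => [|[|[|i]]] //=; rewrite ?E ?E' //; auto.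
Qed.

(** Stages 1 and 2 demand a partner that is itself in a stage, so a configuration can only enter
    stage 0, which begins a rule, or stage 3, which begins to undo one. *)
Lemma sim_plain C0 C v' : shaped C -> nconn C0 C -> wstep (word_of C) v' -> sim C0 v'.
Proof.
move=> SC N [L [i [l [il ch E]]]].
have [r [s [El Ir s4 Ea]]] := change_inl ch.
have [qn dq] := partner_range Ir il SC (congr1 fst Ea).
set q := beside _ i in qn dq.
have qi : q != i by move: dq; case: (toward r s); lia.
have HA := legal_accepts L il qn dq; rewrite E /upd eqxx (negPf qi) El in HA.
move: HA; rewrite E /accepts stageE // -/(toward r s) eqxx.
have Wq : word_of C q = inl (bases C q, if q == place C then Some (token C) else None) by [].
have tok_place j : (part r s).2 = Some j -> i = place C.
  by rewrite -Ea; case: eqP.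
have [[t0 Et0] Ed Elb [t3 Et3]] := is_ruleP Ir.
case: s s4 El Ea tok_place @q qn dq qi Wq => [|[|[|[|?]]]] // _ El Ea tok_place q qn dq qi Wq; rewrite Wq ?orbF //=.
- move=> /eqP Eq; have iP := tok_place _ Et0.
  have [C' SN] : exists C', nstep C = Some C'.
    case: (r) Ir Ea => [[[[d a1] a2] c1] c2] /and5P[_ _ _ _] /=.
    case: a1 => b1 [t|] //=; case: c2.2 => // t' /eqP Eact [Eb Et].
    by move: Et; case: eqP => // _ [Et]; rewrite /nstep -iP Eb Et Eact; eexists.
  have [r' A] := apply_rule SC SN; have [Ir' _ _ _ [_ _ _ [Ws Wd _]]] := A.
  have Es : source r = source r'.
    by move: Ws; rewrite -iP => -[<-]; rewrite -[source r]/(part r 0) -Ea.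
  have [dd /(_ _)Er] := rule_same Ir Ir' Es.
  have Erd : r = r'.
    apply: Er; move: Wd; rewrite -iP /other -dd.
    rewrite (_ : (if dir r then _ else _) = q) // Wq => -[<-].
    by case: Eq => <-.
  subst r'; have -> : upd (word_of C) i l = mids r (place C) C 1.
    apply: functional_extensionality => j; rewrite /= /mid /upd -iP El.
    rewrite (_ : other r i = q) //; case: (eqVneq j q) => [->|//].
    by rewrite (negPf qi) Wq; case: Eq => <-.
  by apply: SimMid A N _.
- move=> /eqP Eq; have iP := tok_place _ Et3.
  have [||||C1 A E1] := @unapply_rule C r SC Ir; rewrite -?iP.
  + by move: qn; rewrite /q /toward /beside /=; case: (dir r).
  + by move=> dr; move: dq; rewrite /toward /= dr /=; lia.
  + by rewrite -[arrived r]/(part r 3) -Ea.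
  + rewrite (_ : (if dir r then _ else _) = q) ?Wq; last by rewrite /q /toward /beside /=; case: (dir r).
    by case: Eq => <-.
  rewrite (_ : upd _ _ _ = mids r (place C1) C1 5).
    apply: (SimMid A) => //; apply: rst_trans N _; apply: rst_sym; apply: rst_step.
    by case: A.
  apply: functional_extensionality => j; rewrite -(mids_end A) /= /mid /upd El E1.
  have -> : other r (if dir r then (place C).-1 else (place C).+1) = i.
    by rewrite -iP /other; move: dq; rewrite /toward /beside /q /=; case: (dir r); rewrite //=; lia.
  by case: eqP.
Qed.
Lemma mid_first r p C x y x' : p != other r p -> upd (mid r p C x y) p x' = mid r p C x' y.
Proof.
move=> pq; apply: functional_extensionality => i; rewrite /mid /upd.
by case: (eqVneq i p) => // ->; rewrite (negPf pq).
Qed.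

Lemma mid_second r p C x y y' : upd (mid r p C x y) (other r p) y' = mid r p C x y'.
Proof. by apply: functional_extensionality => i; rewrite /mid /upd; case: eqP. Qed.

Definition mid_x r k : letters :=
  if k < 3 then inr (r, stage 0) else if k < 5 then inr (r, stage 1) else inl (left_behind r).
Definition mid_y r k : letters :=
  if k < 2 then inl (dest r) else if k < 4 then inr (r, stage 2) else inr (r, stage 3).

Lemma midsE r p C k : 0 < k < 6 -> mids r p C k = mid r p C (mid_x r k) (mid_y r k).
Proof. by case: k => [|[|[|[|[|[|k]]]]]]. Qed.

(** During a rule no plain letter carries a token, so it can only enter stage 1 or 2. These demand a
    partner in a stage of the same rule, which singles out the two cells of the rule in progress. *)
Lemma sim_mid_plain C0 r C C' k i l v' a : applies r C C' -> nconn C0 C -> 0 < k < 6 ->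
  let v := mids r (place C) C k in
  legal v' -> i < n -> v i = inl a -> change (inl a) l -> v' = upd v i l -> sim C0 v'.
Proof.
move=> A N k6 v L il vi ch E; have [Ir SC SC' _ [qn pq dq [Ws Wd Wc]]] := A.
move: (qn) (pq) (dq) (Wd) (Wc); set p := place C; set q := other r p => qn' pq' dq' Wd' Wc'.
have Ev : v = mid r p C (mid_x r k) (mid_y r k) by rewrite /v midsE.
have vp : v p = mid_x r k by rewrite Ev /mid /upd (negPf pq') eqxx.
have vq : v q = mid_y r k by rewrite Ev /mid /upd eqxx.
have voff j : j != p -> j != q -> v j = word_of C j by move=> j1 j2; rewrite Ev /mid /upd (negPf j1) (negPf j2).
have [_ Ed Elb _] := is_ruleP Ir.
have [C2 SC2 /andP[/eqP W2 /eqP a2]] : exists2 C2, shaped C2 & (word_of C2 i == inl a) && (a.2 == None).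
  case: (eqVneq i p) => [Ei|ip].
    exists C' => //; move: vi; rewrite Ei vp /mid_x; do 2! case: ifP => // _.
    by move=> -[<-]; rewrite Elb eqxx andbT Wc' /mid /upd (negPf pq') eqxx.
  case: (eqVneq i q) => [Ei|iq].
    exists C => //; move: vi; rewrite Ei vq /mid_y; case: ifP => // _; last by case: ifP.
    by move=> -[<-]; rewrite Ed eqxx andbT Wd'.
  by exists C => //; rewrite -vi (voff _ ip iq) eqxx (word_of_off ip (etrans (esym (voff _ ip iq)) vi)).
have [r' [s [El Ir' s4 Ea]]] := change_inl ch.
have Eb : bases C2 i = (part r' s).1 by move: W2; rewrite /word_of -Ea => -[<-].
have [qn2 dq2] := partner_range Ir' il SC2 Eb.
set q' := beside _ i in qn2 dq2.
have qi : q' != i by move: dq2; case: (toward r' s); lia.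
have HA := legal_accepts L il qn2 dq2; rewrite E /upd eqxx (negPf qi) El in HA.
have inr_at j r1 s1 : s1 < 4 -> v j = inr (r1, stage s1) -> r1 = r /\
    (if s1 < 2 then j = p else j = q).
  move=> s14; case: (eqVneq j p) => [->|jp].
    rewrite vp /mid_x; case: ifP => _; [|case: ifP => // _];
      by move=> /eqP; rewrite letter_eq // => /andP[/eqP-> /eqP<-].
  case: (eqVneq j q) => [->|jq]; last by rewrite voff.
  rewrite vq /mid_y; case: ifP => // _; case: ifP => _;
      by move=> /eqP; rewrite letter_eq // => /andP[/eqP-> /eqP<-].
have /part_token : (part r' s).2 = None by rewrite -Ea.
move=> /(_ Ir')[] Es; subst s; move: HA; rewrite /accepts stageE // -/(toward r' _) eqxx /=.
  have key : r' = r /\ q' = q -> sim C0 v'.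
    move=> [Er Eq]; have ip : i = p by move: dq2 dq'; rewrite /toward /= Eq Er; clear; move: q => q; case: (dir r) => /= /eqP ? /eqP ?; lia.
    have k5 : k = 5.
      move: vi; rewrite ip vp /mid_x; case: ifP => // k3; case: ifP => // k5 _; lia.
    rewrite E (_ : upd v i l = mids r (place C) C 4); first exact: SimMid A N _.
    by rewrite Ev ip El Er k5 mid_first.
  by case/orP=> /eqP /inr_at-/(_ isT)[] ? ?; apply: key.
have key : r' = r /\ q' = p -> sim C0 v'.
  move=> [Er Eq]; have iq : i = q by move: dq2 dq'; rewrite /toward /= Eq Er; clear; move: q => q; case: (dir r) => /= /eqP ? /eqP ?; lia.
  have k1 : k = 1.
    move: vi; rewrite iq vq /mid_y; case: ifP => // k2; last by case: ifP.
    lia.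
  rewrite E (_ : upd v i l = mids r (place C) C 2); first exact: SimMid A N _.
  by rewrite Ev iq El Er k1 mid_second.
by case/orP=> /eqP /inr_at-/(_ isT)[] ? ?; apply: key.
Qed.

Lemma sim_mid C0 r C C' k v' : applies r C C' -> nconn C0 C -> 0 < k < 6 ->
  wstep (mids r (place C) C k) v' -> sim C0 v'.
Proof.
move=> A N k6 [L [i [l [il ch E]]]]; have [Ir SC SC' _ [qn pq dq [Ws Wd Wc]]] := A.
case Evi: (mids r (place C) C k i) => [a|[r' s]].
  by rewrite Evi in ch; apply: (sim_mid_plain A N k6 L il Evi ch E).
set p := place C in E Evi ch dq pq qn Wd Ws Wc; pose q := other r p.
have accP := legal_accepts L (let: And3 a _ _ := SC in a) qn dq.
have accQ : accepts (v' q) (~~ dir r) (v' p).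
  apply: (legal_accepts L qn); first by case: SC.
  by move: dq; rewrite -/q; case: (dir r) => /= /eqP->.
rewrite -/p -/q in accP.
have ends j : 0 < j < 6 -> sim C0 (mid r p C (mid_x r j) (mid_y r j)).
  by move=> j6; rewrite -midsE //; apply: SimMid A N j6.
have end0 : sim C0 (mid r p C (inl (source r)) (inl (dest r))).
  rewrite (_ : mid _ _ _ _ _ = word_of C); first exact: SimPlain.
  apply: functional_extensionality => j; rewrite /mid /upd -/q.
  by case: eqP => [->|_] //; case: eqP => [->|].
have end6 : sim C0 (mid r p C (inl (left_behind r)) (inl (arrived r))).
  by rewrite -Wc; apply: SimPlain => //; apply: applies_conn A N.
have e1 := ends 1 isT; have e2 := ends 2 isT; have e3 := ends 3 isT; have e4 := ends 4 isT; have e5 := ends 5 isT.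
rewrite midsE // in E Evi ch.
have mp x y : mid r p C x y p = x by rewrite /mid /upd (negPf pq) eqxx.
have mq x y : mid r p C x y q = y by rewrite /mid /upd eqxx.
have [Ei|Ei] : i = p \/ i = q.
  case: (eqVneq i p) => [|ip]; first by left.
  case: (eqVneq i q) => [|iq]; first by right.
  by move: Evi; rewrite /mid /upd -/q (negPf ip) (negPf iq).
- move: ch E; rewrite Ei mp mid_first // => ch E; move: accP accQ; rewrite E mp mq.
  move: E ch; rewrite /mid_x /mid_y.
  rewrite Ei mp in Evi; case: k k6 Evi => [|[|[|[|[|[|k]]]]]] //= _ _ E ch a1 a2;
    move: (ch) => /change_inr-/(_ isT)[] El; rewrite El in a1 a2; rewrite El //;
    by move: a1 a2; rewrite /accepts ?stageE //= ?letter_eq ?andbF ?orbF //=; case: (dir r).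
move: ch E; rewrite Ei mid_second mq // => ch E; move: accP accQ; rewrite E mp mq.
move: E ch; rewrite /mid_x /mid_y.
rewrite Ei mq in Evi; case: k k6 Evi => [|[|[|[|[|[|k]]]]]] //= _ _ E ch a1 a2;
    move: (ch) => /change_inr-/(_ isT)[] El; rewrite El in a1 a2; rewrite El //;
    by move: a1 a2; rewrite /accepts ?stageE //= ?letter_eq ?andbF ?orbF //=; case: (dir r).
Qed.

Lemma sim_reach C0 v : shaped C0 -> clos_refl_trans _ wstep (word_of C0) v -> sim C0 v.
Proof.
move=> S0 R; elim: (Operators_Properties.clos_rt_rtn1 _ _ _ _ R) => [|v1 v2 W _ IH].
  by apply: SimPlain => //; apply: rst_refl.
case: IH W => [C1 S1 N1|r C1 C2 k A N k6]; first exact: sim_plain S1 N1.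
exact: sim_mid A N k6.
Qed.

Fixpoint nsteps k C := if k is k'.+1 then if nstep C is Some C' then nsteps k' C' else None else Some C.

Lemma nstepsD i j C C' : nsteps i C = Some C' -> nsteps (i + j) C = nsteps j C'.
Proof. by elim: i C => [|i IH] C /=; [case=> -> | case: (nstep C) => // C1; apply: IH]. Qed.

Lemma nstepsS k C C1 : nsteps k C = Some C1 -> nsteps k.+1 C = nstep C1.
Proof. by move=> H; rewrite -addn1 (nstepsD 1 H) /=; case: (nstep C1). Qed.

(** The Church-Rosser property of a deterministic relation. *)
Lemma nconn_join C C' : nconn C C' -> exists i j C2, nsteps i C = Some C2 /\ nsteps j C' = Some C2.
Proof.
elim=> {C C'} [C C' E|C|C C' _ [i [j [C2 [E1 E2]]]]|C C1 C2 _ [i [j [D1 [E1 E2]]]] _ [i' [j' [D2 [E3 E4]]]]].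
- by exists 1, 0, C'; rewrite /= E.
- by exists 0, 0, C.
- by exists j, i, C2.
case: (leqP j i') => H.
  exists (i + (i' - j)), j', D2; split=> //.
  by rewrite (nstepsD _ E1) -(nstepsD _ E2) subnKC.
exists i, (j' + (j - i')), D1; split=> //.
by rewrite (nstepsD _ E4) -(nstepsD _ E3) subnKC // ltnW.
Qed.

Lemma nsteps_reach k C C' : shaped C -> nsteps k C = Some C' ->
  shaped C' /\ clos_refl_trans _ wstep (word_of C) (word_of C').
Proof.
elim: k C => [|k IH] C SC /=; first by case=> <-; split=> //; apply: rt_refl.
case E: (nstep C) => [C1|] // H; have [r A] := apply_rule SC E; have [_ _ S1 _ _] := A.
have [S' R] := IH _ S1 H; split=> //; apply: rt_trans R.
rewrite -(mids_end A) -[word_of C]/(mids r (place C) C 0).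
have mid_reach m : m <= 6 -> clos_refl_trans _ wstep (mids r (place C) C 0) (mids r (place C) C m).
  elim: m => [|m IHm] m6; first exact: rt_refl.
  by apply: rt_trans (IHm (ltnW m6)) _; apply: rt_step; case: (mids_step A m6).
exact: mid_reach.
Qed.

Theorem word_game C0 : shaped C0 ->
  ((exists2 v, clos_refl_trans _ wstep (word_of C0) v & v 0 <> inl (first_base, None)) <->
   (exists k C, nsteps k C0 = Some C /\ place C = 0)).
Proof.
move=> S0; have n0 : 0 < n by lia.
have at0 C : shaped C -> bases C 0 = first_base by move=> [_ Hf _]; apply/eqP; rewrite Hf.
split=> [[v /(sim_reach S0) Sv v0]|[k [C [E P0]]]]; last first.
  have [SC R] := nsteps_reach S0 E; exists (word_of C) => //.
  by rewrite /word_of P0 eqxx.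
have [C [SC N P0]] : exists C, [/\ shaped C, nconn C0 C & place C = 0].
  case: Sv v0 => [C SC N|r C C' k A N k6] v0.
    exists C; split=> //; case: (eqVneq 0 (place C)) => // H.
    by case: v0; rewrite /word_of (negPf H) at0.
  have [Ir SC SC' E [qn pq dq [Ws Wd Wc]]] := A.
  have p0 : 0 != place C.
    by apply/eqP => P0; move: E; rewrite /nstep -P0 at0 // act_first.
  (* If place 0 is the destination of the rule in progress, the successor has the token there. *)
  case: (eqVneq 0 (other r (place C))) => q0.
    exists C'; split=> //; first by apply: (applies_conn A N).
    have [_ _ _ [t Et]] := is_ruleP Ir.
    have := congr1 (fun w => w 0) Wc; rewrite /mid /upd -q0 eqxx /word_of => -[H].
    by move: Et; rewrite -H /=; case: (eqVneq 0 (place C')) => // E0; rewrite -?E0.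
  by case: v0; rewrite midsE // /mid /upd (negPf q0) (negPf p0) /word_of (negPf p0) at0.
(* A token at place 0 is stuck, so the common successor is [C] itself, reached by forward steps
   only. This is where undirected reachability becomes directed. *)
have [i [j [C2 [E1 E2]]]] := nconn_join N.
exists i, C; split=> //; rewrite E1 -E2.
by case: j E2 => //= j'; rewrite /nstep P0 at0 // act_first.
Qed.
End Words.

End Words.

(** * Words as wires *)

Module WordLogic.
Import Cells Logic Words.

Section WordLogic.

Variables (base tok : finType) (act : base -> tok -> option (bool * base * tok)).
Variables (first_base last_base : base) (n : nat).
Local Notation letter := (letters base tok).
Local Notation change := (@change base tok act first_base last_base).
Local Notation wstep := (wstep act first_base last_base n).
Local Notation legal := (@legal base tok n).

Definition g : nat := #|{: letter}|.
Definition rank (l : letter) : nat := enum_rank l.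
Definition l0 : letter := inl (first_base, None).
Definition unrank (a : nat) : letter := nth l0 (enum {: letter}) a.
Definition goal_letter : nat := rank l0.

Lemma rank_lt l : rank l < g. Proof. exact: ltn_ord. Qed.
Lemma rankK l : unrank (rank l) = l.
Proof. by rewrite /unrank /rank -[RHS]enum_rankK /enum_val; apply: set_nth_default; rewrite -cardE. Qed.
Lemma unrankK a : a < g -> rank (unrank a) = a.
Proof.
move=> al; have {2}-> : a = Ordinal al by []. 
rewrite /rank -[Ordinal al]enum_valK; congr (nat_of_ord (enum_rank _)).
by rewrite /unrank /enum_val; apply: set_nth_default; rewrite -cardE.
Qed.
Lemma rank_inj : injective rank. Proof. by move=> a b E; rewrite -[a]rankK E rankK. Qed.
Lemma changeC x y : change x y = change y x. Proof. by rewrite /Words.change orbC. Qed.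

Definition pairs : seq (nat * nat) := [seq (a, b) | a <- iota 0 g, b <- iota 0 g].
(** Two letters may be on at one place only if one can be rewritten into the other, and letters on
    at adjacent places must be compatible. For odd places the right neighbour is even and so has the
    upper rows. Either parity has the same number of clauses, so all blocks are equally wide. *)
Definition clauses (p : bool) : seq (nat * nat) :=
  [seq (p * g + ab.1, p * g + ab.2) | ab <- pairs & (ab.1 < ab.2) && ~~ change (unrank ab.1) (unrank ab.2)] ++
  [seq if p then (ab.2, g + ab.1) else (ab.1, g + ab.2) | ab <- pairs & ~~ compatible (unrank ab.1) (unrank ab.2)].
Definition W : nat := (size (clauses false)).+1.

Lemma size_clauses p : (size (clauses p)).+1 = W.
Proof. by rewrite /W /clauses !size_cat !size_map. Qed.

Lemma mem_pairs a b : ((a, b) \in pairs) = (a < g) && (b < g).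
Proof.
apply/allpairsP/andP => [[[x y] /= [+ + [-> ->]]]|[H1 H2]]; rewrite ?mem_iota //.
by exists (a, b); rewrite !mem_iota.
Qed.

Lemma clausesP p t b : (t, b) \in clauses p -> t < b < g * 2.
Proof.
rewrite mem_cat => /orP[] /mapP[[x y]]; rewrite mem_filter mem_pairs /=.
  by move=> /andP[/andP[xy _] /andP[xg yg]] [-> ->]; case: (p) => /=; lia.
by move=> /andP[_ /andP[xg yg]]; case: (p) => -[-> ->]; lia.
Qed.

Local Notation satisfied := (satisfied n g clauses).
Local Notation xstep := (xstep n g clauses).

Lemma satisfiedP (X : wires) : satisfied X <->
  [/\ forall i a, X i a -> i < n /\ a < g, forall i, i < n -> exists a, X i a,
      forall i a b, X i a -> X i b -> a < b -> change (unrank a) (unrank b) &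
      forall i a b, X i a -> X i.+1 b -> compatible (unrank a) (unrank b)].
Proof.
split=> [[H1 H2 H3]|[H1 H2 H3 H4]].
  split=> // i a b Xa Xb.
    move=> ab; apply/negP => /negP N; have [il ag] := H1 _ _ Xa; have [_ bg] := H1 _ _ Xb.
    have := H3 i (odd i * g + a) (odd i * g + b) il; case; last first.
      have la c : c < g -> Logic.letter g (odd i * g + c) = c by move=> cg; rewrite /Logic.letter; case: (odd i) => /=; case: leqP; lia.
      have le c : c < g -> (g <= odd i * g + c) = odd i by move=> cg; case: (odd i) => /=; lia.
      by rewrite !la // !le // eqxx addn0.
    rewrite mem_cat; apply/orP; left; apply/mapP; exists (a, b) => //.
    by rewrite mem_filter mem_pairs /= ab N ag bg.
  apply/negP => /negP N; have [il ag] := H1 _ _ Xa; have [il' bg] := H1 _ _ Xb.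
  have M : (if odd i then (b, g + a) else (a, g + b)) \in clauses (odd i).
    rewrite mem_cat; apply/orP; right; apply/mapP; exists (a, b) => //.
    by rewrite mem_filter mem_pairs /= N ag bg.
  case E: (odd i) M => M; have := H3 i _ _ il; rewrite E => /(_ _ _ M); case; rewrite /Logic.letter.
    have -> : (g <= b) = false by lia.
    have -> : (g <= g + a) by lia.
    by rewrite /= addn0 addn1 addKn.
  have -> : (g <= a) = false by lia.
  have -> : (g <= g + b) by lia.
  by rewrite /= addn0 addn1 addKn.
split=> // j t b jn; rewrite mem_cat => /orP[] /mapP[[x y]]; rewrite mem_filter mem_pairs /=.
  move=> /andP[/andP[xy N] /andP[xg yg]] [-> ->] [X1 X2]; case/negP: N.
  have la c : c < g -> Logic.letter g (odd j * g + c) = c by move=> cg; rewrite /Logic.letter; case: (odd j) => /=; case: leqP; lia.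
  have le c : c < g -> (g <= odd j * g + c) = odd j by move=> cg; case: (odd j) => /=; lia.
  by move: X1 X2; rewrite !la // !le // eqxx addn0 => X1 X2; apply: H3 X1 X2 xy.
move=> /andP[N /andP[xg yg]] E [X1 X2]; case/negP: N; move: E X1 X2; rewrite /Logic.letter.
case: (odd j) => -[-> ->].
  have -> : (g <= y) = false by lia.
  have -> : (g <= g + x) by lia.
  by rewrite /= addn0 addn1 addKn => X1 X2; apply: H4 X2 X1.
have -> : (g <= x) = false by lia.
have -> : (g <= g + y) by lia.
by rewrite /= addn0 addn1 addKn => X1 X2; apply: H4 X1 X2.
Qed.

Definition x_of (v : word base tok) : wires := fun i a => (i < n) && (a == rank (v i)).

Lemma x_of_sat v : legal v -> satisfied (x_of v).
Proof.
move=> L; apply/satisfiedP; split=> [i a /andP[il /eqP->]|i il|i a b /andP[_ /eqP->] /andP[_ /eqP->]|i a b /andP[_ /eqP->] /andP[il /eqP->]].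
- by rewrite rank_lt.
- by exists (rank (v i)); rewrite /x_of il eqxx.
- by rewrite ltnn.
by rewrite !rankK; apply: L.
Qed.

(** A word [v] is kept among the letters that are on. It changes only when one of its own letters is
    turned off: another letter is then on at that place, and the first kind of clause makes the
    replacement a rewriting. *)
Lemma x_sound v0 X : legal v0 -> clos_refl_trans _ xstep (x_of v0) X ->
  satisfied X /\ exists2 v, clos_refl_trans _ wstep v0 v & forall i, i < n -> X i (rank (v i)).
Proof.
move=> L0 R; elim: (Operators_Properties.clos_rt_rtn1 _ _ _ _ R) => [|X1 X2 [S2 [i [a [il ag E]]]] _ [S1 [v Rv Hv]]].
  split; first exact: x_of_sat.
  by exists v0 => [|i il]; [apply: rt_refl | rewrite /x_of il eqxx].
split=> //; have /satisfiedP[A1 A2 A3 A4] := S1; have /satisfiedP[B1 B2 B3 B4] := S2.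
case: (eqVneq a (rank (v i))) => [Ea|Na]; last first.
  exists v => // j jn; rewrite E; case: (eqVneq j i) => [->|] /=; last by rewrite Hv.
  by rewrite eq_sym (negPf Na) Hv.
have [b Xb] := B2 i il.
have Nb : b != a by apply/eqP => Eb; move: Xb; rewrite E Eb !eqxx Ea Hv.
have Xb1 : X1 i b by move: Xb; rewrite E (negPf Nb) andbF.
have [_ bg] := B1 _ _ Xb.
have V' j : j < n -> X2 j (rank (upd v i (unrank b) j)).
  move=> jn; rewrite /upd; case: (eqVneq j i) => [->|ji]; first by rewrite unrankK.
  by rewrite E (negPf ji) Hv.
exists (upd v i (unrank b)) => //; apply: rt_trans Rv _; apply: rt_step; split.
  by move=> j jn; have := B4 j _ _ (V' j (ltnW jn)) (V' j.+1 jn); rewrite !rankK.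
exists i, (unrank b); split=> //.
have Xa1 : X1 i (rank (v i)) by apply: Hv.
case: (ltngtP b (rank (v i))) => H; last by rewrite H Ea eqxx in Nb.
  by have := A3 _ _ _ Xb1 Xa1 H; rewrite rankK changeC.
by have := A3 _ _ _ Xa1 Xb1 H; rewrite rankK.
Qed.

(** The new letter is turned on, then the old one off; in between, both words are legal and differ
    at one place. *)
Lemma x_complete v v' : legal v -> wstep v v' -> clos_refl_trans _ xstep (x_of v) (x_of v').
Proof.
move=> L [L' [i [l [il ch E]]]]; case: (eqVneq l (v i)) => [El|Nl].
  rewrite (_ : v' = v); first exact: rt_refl.
  by rewrite E El; apply: functional_extensionality => j; rewrite /upd; case: eqP => [->|].
pose X : wires := fun j a => x_of v j a || x_of v' j a.
have Nr : rank (v i) != rank l by apply: contraNneq Nl => /rank_inj->.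
have S : satisfied X.
  apply/satisfiedP; split=> [j a|j jn|j a b|j a b].
  - by rewrite /X /x_of => /orP[] /andP[-> /eqP->]; rewrite rank_lt.
  - by exists (rank (v j)); rewrite /X /x_of jn eqxx.
  - rewrite /X /x_of E /upd; case: (j < n) => //=; case: (eqVneq j i) => [->|_].
      move=> /orP[] /eqP-> /orP[] /eqP->; rewrite ?ltnn // !rankK // changeC //.
    by rewrite !orbb => /eqP-> /eqP->; rewrite ltnn.
  have vE k : k != i -> v' k = v k by move=> ki; rewrite E /upd (negPf ki).
  rewrite /X /x_of => H1 H2; have jn : j.+1 < n by case/orP: H2 => /andP[].
  have Lj := L j jn; have Lj' := L' j jn.
  case: (eqVneq j i) => ji.
    have N : j.+1 != i by lia.
    move: H1 H2 Lj'; rewrite (vE _ N) orbb => H1 /andP[_ /eqP->] Lj'.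
    by case/orP: H1 => /andP[_ /eqP->]; rewrite !rankK.
  move: H1 Lj'; rewrite (vE _ ji) orbb => /andP[_ /eqP->] Lj'.
  by case/orP: H2 => /andP[_ /eqP->]; rewrite !rankK.
apply: (rt_trans _ _ _ X); apply: rt_step.
  split=> //; exists i, (rank l); split=> //; first exact: rank_lt.
  apply: functional_extensionality => j; apply: functional_extensionality => a.
  rewrite /X /x_of E /upd; case: (eqVneq j i) => [->|_]; rewrite ?orbb // il /=.
  by case: (eqVneq a (rank l)) => [->|] //=; rewrite ?orbT ?orbF // eq_sym (negPf Nr).
split; first exact: x_of_sat.
exists i, (rank (v i)); split=> //; first exact: rank_lt.
apply: functional_extensionality => j; apply: functional_extensionality => a.
rewrite /X /x_of E /upd; case: (eqVneq j i) => [->|_]; rewrite ?orbb // il /=.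
by case: (eqVneq a (rank (v i))) => [->|] //=; rewrite (negPf Nr).
Qed.

Hypothesis act_first : forall t, act first_base t = None.
Hypothesis act_last : forall t b t', act last_base t <> Some (true, b, t').
Hypothesis act_class : forall b t d b' t', act b t = Some (d, b', t') ->
  ((b == first_base) = (b' == first_base)) /\ ((b == last_base) = (b' == last_base)).
Hypothesis n_gt1 : 1 < n.

Theorem token_logic C0 : shaped first_base last_base n C0 ->
  satisfied (x_of (word_of C0)) /\
  ((exists2 X, clos_refl_trans _ xstep (x_of (word_of C0)) X & X 0 goal_letter = false) <->
   (exists k C, nsteps act k C0 = Some C /\ place C = 0)).
Proof.
move=> S0; have L0 : legal (word_of C0) := word_of_legal C0.
split; first exact: x_of_sat.
rewrite -(word_game act_first act_last act_class n_gt1 S0); split=> [[X R X0]|[v R v0]].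
  have [_ [v Rv Hv]] := x_sound L0 R; exists v => // v0.
  by have := Hv 0 (ltnW n_gt1); rewrite v0 X0.
exists (x_of v); last first.
  by rewrite /x_of (ltnW n_gt1) /=; apply/eqP => /rank_inj E; case: v0.
have [//] : legal v /\ clos_refl_trans _ xstep (x_of (word_of C0)) (x_of v).
elim: (Operators_Properties.clos_rt_rtn1 _ _ _ _ R) => [|v1 v2 W _ [L1 R1]]; first by split=> //; apply: rt_refl.
by split; [case: W | apply: rt_trans R1 (x_complete L1 W)].
Qed.

End WordLogic.

End WordLogic.

(** * Stack programs compiled to Turing machines *)

Module Programs.
Import Cells.

Section Language.

Variable A : finType.
Definition store := nat -> seq A.

Inductive cmd :=
| Skip
| Push of nat & A
| Pop of nat
| Seq of cmd & cmd
| If of nat & pred (option A) & cmd & cmd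
| While of nat & pred (option A) & cmd.

Fixpoint uses (K : nat) (c : cmd) : bool :=
  match c with
  | Skip => true
  | Push i _ | Pop i => i < K
  | Seq c1 c2 => uses K c1 && uses K c2
  | If i _ c1 c2 => [&& i < K, uses K c1 & uses K c2]
  | While i _ c1 => (i < K) && uses K c1
  end.

(* [m] bounds the sizes of the stacks during the execution. *)
Inductive ev (m : nat) : cmd -> store -> store -> nat -> Prop :=
| ev_skip s : ev m Skip s s 0
| ev_push i a s : size (s i) < m -> ev m (Push i a) s (upd s i (a :: s i)) 1
| ev_pop i s : ev m (Pop i) s (upd s i (behead (s i))) 1
| ev_seq c1 c2 s s1 s2 t1 t2 : ev m c1 s s1 t1 -> ev m c2 s1 s2 t2 -> ev m (Seq c1 c2) s s2 (t1 + t2)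
| ev_if_true i (P : pred (option A)) c1 c2 s s' t : P (ohead (s i)) -> ev m c1 s s' t -> ev m (If i P c1 c2) s s' t.+2
| ev_if_false i (P : pred (option A)) c1 c2 s s' t : ~~ P (ohead (s i)) -> ev m c2 s s' t -> ev m (If i P c1 c2) s s' t.+2
| ev_while_stop i (P : pred (option A)) c s : ~~ P (ohead (s i)) -> ev m (While i P c) s s 1
| ev_while_go i (P : pred (option A)) c s s1 s2 t1 t2 : P (ohead (s i)) -> ev m c s s1 t1 ->
    ev m (While i P c) s1 s2 t2 -> ev m (While i P c) s s2 (t1 + t2).+2.

Inductive instr :=
| IPush of nat & A
| IPop of nat
| ITest of nat & pred (option A) & nat
| IJump of nat
| ILoad
| IStore.

Fixpoint code_size (c : cmd) : nat :=
  match c with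
  | Skip => 0
  | Push _ _ | Pop _ => 1
  | Seq c1 c2 => code_size c1 + code_size c2
  | If _ _ c1 c2 => (code_size c1 + code_size c2).+2
  | While _ _ c1 => (code_size c1).+2
  end.

Fixpoint code (c : cmd) (b : nat) : seq instr :=
  match c with
  | Skip => [::]
  | Push i a => [:: IPush i a]
  | Pop i => [:: IPop i]
  | Seq c1 c2 => code c1 b ++ code c2 (b + code_size c1)
  | If i P c1 c2 => ITest i P (b + (code_size c1).+2) :: code c1 b.+1 ++
      IJump (b + (code_size c1 + code_size c2).+2) :: code c2 (b + (code_size c1).+2)
  | While i P c1 => ITest i P (b + (code_size c1).+2) :: code c1 b.+1 ++ [:: IJump b]
  end.

Lemma size_code c b : size (code c b) = code_size c.
Proof.
elim: c b => //= [c1 IH1 c2 IH2|i P c1 IH1 c2 IH2|i P c1 IH1] b; rewrite ?size_cat /= ?IH1 ?IH2 //.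
  by rewrite addnS.
by rewrite addn1.
Qed.

Variables (K : nat) (bit : bool -> A) (unbit : A -> bool).
Hypothesis K_gt1 : 1 < K.

Section Run.

Variable p : seq instr.
Local Notation Tapes := ('I_K.+1 -> symbol A).
(** Tape 0 is the input and output tape, and stack [i] lives on tape [i + 1]. *)
Definition tp (i : nat) : 'I_K.+1 := inord i.+1.
Definition keep (sc : {ffun Tapes}) : 'I_K.+1 -> symbol A * direction := fun j => (sc j, Stay).
Definition act (sc : {ffun Tapes}) (i : 'I_K.+1) (x : symbol A * direction) :
    'I_K.+1 -> symbol A * direction := fun j => if j == i then x else (sc j, Stay).
Definition top_of (x : symbol A) : option A := if x is Some (inr a) then Some a else None.

(** Two program counters past the end, [size p] and [(size p).+1], halt the machine; a decider
    accepts in the first and rejects in the second. The bit marks the second phase of an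
    instruction. *)
Definition mstate := ('I_(size p).+2 * bool)%type.
Definition at_pc (n : nat) : mstate := (inord n, false).
Definition mdelta (q : mstate) (sc : {ffun Tapes}) :
    option (mstate * ('I_K.+1 -> symbol A * direction)) :=
  let n := nat_of_ord q.1 in
  if n < size p then
    match nth ILoad p n with
    | IPush i a => Some (at_pc n.+1, act sc (tp i) (Some (inr a), Right))
    | IPop i =>
        if q.2 then Some (at_pc n.+1, act sc (tp i)
                      (sc (tp i), if sc (tp i) is None then Right else Stay))
        else Some ((q.1, true), act sc (tp i) (sc (tp i), Left))
    | ITest i P k =>
        if q.2 then Some (at_pc (if P (top_of (sc (tp i))) then n.+1 else k),
                          act sc (tp i) (sc (tp i), Right))
        else Some ((q.1, true), act sc (tp i) (sc (tp i), Left))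
    | IJump k => Some (at_pc k, keep sc)
    | ILoad =>
        if q.2 then
          if sc ord0 is Some (inl b)
          then Some (q, fun j => if j == ord0 then (sc ord0, Right)
                                 else if j == tp 0 then (Some (inr (bit b)), Right) else (sc j, Stay))
          else Some (at_pc n.+1, keep sc)
        else Some ((q.1, true), fun j => if j == ord0 then (sc j, Stay) else (None, Right))
    | IStore =>
        if q.2 then
          if sc (tp 1) is Some (inr a)
          then Some (q, fun j => if j == ord0 then (Some (inl (unbit a)), Left)
                                 else if j == tp 1 then (sc j, Left) else (sc j, Stay))
          else Some (at_pc n.+1, act sc ord0 (sc ord0, Right))
        else Some ((q.1, true), act sc (tp 1) (sc (tp 1), Left))
    end
  else None.

Definition mach (acc : pred mstate) : machine := @Machine K mstate A (at_pc 0) acc mdelta.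

Variable acc : pred mstate.
Local Notation M := (mach acc).
Local Notation conf := (configuration M).
Definition mstep (c : conf) : conf := odflt c (next c).

Definition steps (B n : nat) (c c' : conf) : Prop :=
  iter n mstep c = c' /\ forall j, j <= n -> space (iter j mstep c) <= B.

Lemma steps0 B c : space c <= B -> steps B 0 c c.
Proof. by move=> H; split=> // j; rewrite leqn0 => /eqP->. Qed.

Lemma steps_trans B n1 n2 c1 c2 c3 : steps B n1 c1 c2 -> steps B n2 c2 c3 -> steps B (n1 + n2) c1 c3.
Proof.
move=> [E1 H1] [E2 H2]; split=> [|j]; first by rewrite addnC iterD E1.
have [le _|lt le] := leqP j n1; first exact: H1.
have -> : j = (j - n1) + n1 by lia.
by rewrite iterD E1; apply: H2; lia.
Qed.

Lemma steps1 B c c' : next c = Some c' -> space c <= B -> space c' <= B -> steps B 1 c c'.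
Proof.
by move=> E H H'; split=> [|[|[|j]]] //=; rewrite /mstep E.
Qed.

Definition tapes_t := {ffun 'I_K.+1 -> tape A}.
Definition cfg (n : nat) (ph : bool) (f : tapes_t) : conf := @Configuration M (inord n, ph) f.

(** The head rests on the free cell above the top of the stack. The blank below the bottom is left
    by the first step of [ILoad] and makes emptiness visible. *)
Definition rep (s : store) (f : tapes_t) : Prop :=
  forall i, i < K -> before (f (tp i)) = [seq Some (inr a) | a <- s i] ++ [:: None].
Definition bounded (m z : nat) (f : tapes_t) : Prop :=
  tape_space (f ord0) <= z /\ forall i, i < K -> size (before (f (tp i))) + size (after (f (tp i))) <= m.+1.

Lemma tp_neq0 i : i < K -> (tp i == ord0) = false.
Proof. by move=> H; apply/eqP => /(congr1 val); rewrite /= inordK. Qed.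
Lemma tp_eq i j : i < K -> j < K -> (tp i == tp j) = (i == j).
Proof. by move=> H H'; apply/eqP/eqP => [/(congr1 val)|->] //; rewrite /= !inordK // => -[]. Qed.

Lemma bounded_space m z n ph f : bounded m z f -> space (cfg n ph f) <= z + K * m.+2.
Proof.
move=> [H0 H]; rewrite /space /= big_ord_recl leq_add //.
have -> : K * m.+2 = \sum_(i < K) m.+2 by rewrite sum_nat_const card_ord.
apply: leq_sum => i _; have := H i (ltn_ord i); rewrite /tape_space ltnS.
have -> // : lift ord0 i = tp i.
by apply: val_inj; rewrite /= /bump leq0n add1n inordK // ltnS.
Qed.

Lemma next_cfg n ph (f : tapes_t) q' a : n < size p ->
  mdelta (inord n, ph) [ffun i => scanned (f i)] = Some (q', a) ->
  next (cfg n ph f) = Some (@Configuration M q' [ffun i => write_move (f i) (a i)]).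
Proof. by move=> nl E; rewrite /next /= E. Qed.

Definition at_code (n : nat) (l : seq instr) : Prop :=
  exists p1 p2, p = p1 ++ l ++ p2 /\ size p1 = n.

Lemma at_code_cat n l1 l2 : at_code n (l1 ++ l2) -> at_code n l1 /\ at_code (n + size l1) l2.
Proof.
move=> [p1 [p2 [E S]]]; split; first by exists p1, (l2 ++ p2); split=> //; rewrite E -!catA.
by exists (p1 ++ l1), p2; rewrite size_cat S; split=> //; rewrite E -!catA.
Qed.

Lemma at_code_cons n x l : at_code n (x :: l) ->
  [/\ n < size p, nth ILoad p n = x & at_code n.+1 l].
Proof.
move=> [p1 [p2 [E S]]]; split.
- by rewrite E size_cat /= S; lia.
- by rewrite E nth_cat S ltnn subnn.
by exists (rcons p1 x), p2; rewrite size_rcons S cat_rcons.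
Qed.

Lemma inord_pc n : n < size p -> nat_of_ord (inord n : 'I_(size p).+2) = n.
Proof. by move=> H; rewrite inordK //; lia. Qed.

Lemma write_stay (t : tape A) : write_move t (scanned t, Stay) = t.
Proof. by case: t. Qed.

Lemma act_tapes (f : tapes_t) i x : [ffun j => write_move (f j) (act [ffun j => scanned (f j)] i x j)] =
  [ffun j => if j == i then write_move (f j) x else f j].
Proof. by apply/ffunP => j; rewrite !ffunE /act; case: ifP => // _; rewrite ffunE write_stay. Qed.

Lemma act_bounded m z (f : tapes_t) i x : i < K -> bounded m z f ->
  size (before (write_move (f (tp i)) x)) + size (after (write_move (f (tp i)) x)) <= m.+1 ->
  bounded m z [ffun j => if j == tp i then write_move (f j) x else f j].
Proof.
move=> il [b0 b] H; split; first by rewrite ffunE eq_sym tp_neq0.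
move=> j jl; rewrite ffunE tp_eq //; case: eqP => [->|_] //; exact: b.
Qed.

Lemma step_push m z B n i a s f : z + K * m.+2 <= B -> i < K -> at_code n [:: IPush i a] ->
  size (s i) < m -> rep s f -> bounded m z f ->
  exists f', [/\ steps B 1 (cfg n false f) (cfg n.+1 false f'), rep (upd s i (a :: s i)) f',
                 bounded m z f' & f' ord0 = f ord0].
Proof.
move=> zB il /at_code_cons[nl En _] sl R Bd.
pose f' : tapes_t := [ffun j => if j == tp i then write_move (f j) (Some (inr a), Right) else f j].
have Bd' : bounded m z f'.
  apply: act_bounded => //=; have [_ /(_ i il)] := Bd.
  by rewrite (R i il) size_cat size_map size_behead /=; lia.
exists f'; split => //.
- apply: steps1; try (apply: leq_trans zB; exact: bounded_space).
  rewrite (next_cfg nl (q' := at_pc n.+1) (a := act [ffun j => scanned (f j)] (tp i) (Some (inr a), Right))).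
    by rewrite act_tapes.
  by rewrite /mdelta inord_pc // nl En.
- move=> j jl; rewrite ffunE tp_eq // /upd; case: eqP => [->|_]; last exact: R.
  by rewrite /= R.
by rewrite ffunE eq_sym tp_neq0.
Qed.

(* The head moves from the free cell above the stack onto its top symbol. *)
Lemma step_down m z B n i l s f : z + K * m.+2 <= B -> i < K -> n < size p ->
  (forall sc, mdelta (inord n, false) sc = Some ((inord n, true), act sc (tp i) (sc (tp i), Left))) ->
  rep s f -> bounded m z f -> l = s i ->
  exists f', [/\ steps B 1 (cfg n false f) (cfg n true f'), bounded m z f', f' ord0 = f ord0,
    (forall j, j < K -> j != i -> before (f' (tp j)) = before (f (tp j))) &
    [/\ scanned (f' (tp i)) = (if l is a :: _ then Some (inr a) else None),
     before (f' (tp i)) = (if l is a :: l' then [seq Some (inr b) | b <- l'] ++ [:: None] else [::]) &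
     size (before (f' (tp i))) + size (after (f' (tp i))) = size (before (f (tp i))) + size (after (f (tp i)))]].
Proof.
move=> zB il nl En R Bd El.
pose x := (scanned (f (tp i)), Left).
pose f' : tapes_t := [ffun j => if j == tp i then write_move (f j) x else f j].
have Ef : f' (tp i) = write_move (f (tp i)) x by rewrite ffunE eqxx.
have sz : size (before (f' (tp i))) + size (after (f' (tp i))) =
    size (before (f (tp i))) + size (after (f (tp i))).
  by rewrite Ef /= size_behead (R i il) size_cat size_map /=; lia.
have Bd' : bounded m z f' by apply: act_bounded => //; rewrite -Ef sz; case: Bd => _; apply.
exists f'; split => //.
- apply: steps1; try (apply: leq_trans zB; exact: bounded_space).
  rewrite (next_cfg nl (En _)) ffunE act_tapes.
  by [].
- by rewrite ffunE eq_sym tp_neq0.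
- by move=> j jl ji; rewrite ffunE tp_eq // (negPf ji).
by split=> //; rewrite Ef /= R // El; case: (s i).
Qed.

Lemma step_pop m z B n i s f : z + K * m.+2 <= B -> i < K -> at_code n [:: IPop i] ->
  rep s f -> bounded m z f ->
  exists f', [/\ steps B 2 (cfg n false f) (cfg n.+1 false f'), rep (upd s i (behead (s i))) f',
                 bounded m z f' & f' ord0 = f ord0].
Proof.
move=> zB il /at_code_cons[nl En _] R Bd.
have [sc|f1 [S1 Bd1 f10 Rj [Sc Be sz]]] := step_down zB il nl _ R Bd erefl.
  by rewrite /mdelta inord_pc // nl En.
pose x := (scanned (f1 (tp i)), if s i is [::] then Right else Stay).
pose f' : tapes_t := [ffun j => if j == tp i then write_move (f1 j) x else f1 j].
have Bd' : bounded m z f'.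
  apply: act_bounded => //; have [_ /(_ i il)] := Bd1; move: Sc Be.
  rewrite /x; case: (s i) => [|a l] Sc Be; rewrite /= ?Be ?size_behead /=; last by [].
  by have := sz; rewrite Be /= (R i il) size_cat size_map /=; lia.
exists f'; split=> //.
- rewrite -[2]/(1 + 1); apply: steps_trans S1 _.
  apply: steps1; try (apply: leq_trans zB; exact: bounded_space).
  rewrite (next_cfg nl (q' := at_pc n.+1) (a := act [ffun j => scanned (f1 j)] (tp i) x)).
    by rewrite act_tapes.
  rewrite /mdelta inord_pc // nl En /= ffunE /x Sc; by case: (s i).
- move=> j jl; rewrite ffunE tp_eq // /upd; case: eqP => [->|/eqP ji]; last by rewrite Rj // R.
  by rewrite /x; case: (s i) Sc Be => [|a l] Sc Be; rewrite /= Be ?Sc.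
by rewrite ffunE eq_sym tp_neq0.
Qed.

Lemma step_test m z B n i P k s f : z + K * m.+2 <= B -> i < K -> at_code n [:: ITest i P k] ->
  rep s f -> bounded m z f ->
  exists f', [/\ steps B 2 (cfg n false f) (cfg (if P (ohead (s i)) then n.+1 else k) false f'),
                 rep s f', bounded m z f' & f' ord0 = f ord0].
Proof.
move=> zB il /at_code_cons[nl En _] R Bd.
have [sc|f1 [S1 Bd1 f10 Rj [Sc Be sz]]] := step_down zB il nl _ R Bd erefl.
  by rewrite /mdelta inord_pc // nl En.
pose x := (scanned (f1 (tp i)), Right).
pose f' : tapes_t := [ffun j => if j == tp i then write_move (f1 j) x else f1 j].
have Bd' : bounded m z f'.
  apply: act_bounded => //; have [_ /(_ i il)] := Bd1; rewrite /= size_behead.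
  have := sz; rewrite (R i il) size_cat size_map /= Be; case: (s i) => [|a l] /=.
    by lia.
  by rewrite size_cat size_map /=; have := proj2 Bd i il; rewrite (R i il) size_cat size_map /=; lia.
exists f'; split=> //.
- rewrite -[2]/(1 + 1); apply: steps_trans S1 _.
  apply: steps1; try (apply: leq_trans zB; exact: bounded_space).
  rewrite (next_cfg nl (q' := at_pc (if P (ohead (s i)) then n.+1 else k))
    (a := act [ffun j => scanned (f1 j)] (tp i) x)).
    by rewrite act_tapes.
  rewrite /mdelta inord_pc // nl En /= ffunE /x Sc; by case: (s i).
- move=> j jl; rewrite ffunE tp_eq //; case: eqP => [->|/eqP ji]; last by rewrite Rj // R.
  by rewrite /= Be Sc; case: (s i).
by rewrite ffunE eq_sym tp_neq0.
Qed.

Lemma step_jump m z B n k f : z + K * m.+2 <= B -> at_code n [:: IJump k] -> bounded m z f ->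
  steps B 1 (cfg n false f) (cfg k false f).
Proof.
move=> zB /at_code_cons[nl En _] Bd.
apply: steps1; try (apply: leq_trans zB; exact: bounded_space).
rewrite (next_cfg nl (q' := at_pc k) (a := keep [ffun j => scanned (f j)])).
  by congr Some; congr Configuration; apply/ffunP => j; rewrite !ffunE /keep ffunE write_stay.
by rewrite /mdelta inord_pc // nl En.
Qed.

(** The factor 2 covers pops and tests, which take two steps; pushes and jumps take one. *)
Lemma code_run m z B c s s' t : z + K * m.+2 <= B -> ev m c s s' t -> forall n f,
  uses K c -> at_code n (code c n) -> rep s f -> bounded m z f ->
  exists2 t', t' <= 2 * t & exists f', [/\ steps B t' (cfg n false f) (cfg (n + code_size c) false f'),
    rep s' f', bounded m z f' & f' ord0 = f ord0].
Proof.
move=> zB; elim=> {c s s' t}.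
- move=> s n f _ _ R Bd; exists 0 => //; exists f; rewrite addn0; split=> //.
  by apply: steps0; apply: leq_trans zB; apply: bounded_space.
- move=> i a s sl n f /= il C R Bd; exists 1 => //.
  by rewrite addn1; apply: step_push Bd => //.
- move=> i s n f /= il C R Bd; exists 2 => //.
  by rewrite addn1; apply: step_pop Bd => //.
- move=> c1 c2 s s1 s2 t1 t2 _ IH1 _ IH2 n f /= /andP[u1 u2] /at_code_cat[C1 C2] R Bd.
  have [t1' l1 [f1 [S1 R1 Bd1 E1]]] := IH1 n f u1 C1 R Bd.
  rewrite size_code in C2; have [t2' l2 [f2 [S2 R2 Bd2 E2]]] := IH2 _ f1 u2 C2 R1 Bd1.
  exists (t1' + t2'); first by lia.
  exists f2; split=> //; last by rewrite E2.
  by rewrite addnA; apply: steps_trans S1 S2.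
- move=> i P c1 c2 s s' t Pt _ IH n f /= /and3P[il u1 u2].
  rewrite -cat1s => /at_code_cat[C1 /at_code_cat[C2 C3]] R Bd.
  have [f1 [S1 R1 Bd1 E1]] := step_test zB il C1 R Bd; rewrite Pt in S1.
  rewrite addn1 in C2 C3; have [t2' l2 [f2 [S2 R2 Bd2 E2]]] := IH _ f1 u1 C2 R1 Bd1.
  rewrite size_code -cat1s in C3; have [C4 _] := at_code_cat C3.
  exists (2 + (t2' + 1)); first by lia.
  exists f2; split=> //; last by rewrite E2.
  by apply: steps_trans S1 _; apply: steps_trans S2 _; apply: step_jump C4 Bd2.
- move=> i P c1 c2 s s' t Pt _ IH n f /= /and3P[il u1 u2].
  rewrite -cat1s => /at_code_cat[C1 /at_code_cat[C2 C3]] R Bd.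
  have [f1 [S1 R1 Bd1 E1]] := step_test zB il C1 R Bd; rewrite (negPf Pt) in S1.
  rewrite size_code in C3; have [_ _ C4] := at_code_cons C3.
  have En : (n + size [:: ITest i P (n + (code_size c1).+2)] + code_size c1).+1 =
    n + (code_size c1).+2 by rewrite /=; lia.
  rewrite En in C4; have [t2' l2 [f2 [S2 R2 Bd2 E2]]] := IH _ f1 u2 C4 R1 Bd1.
  exists (2 + t2'); first by lia.
  exists f2; split=> //; last by rewrite E2.
  apply: steps_trans S1 _; move: S2; congr (steps _ _ _ (cfg _ _ _)); lia.
- move=> i P c s Pt n f /= /andP[il u1]; rewrite -cat1s => /at_code_cat[C1 _] R Bd.
  have [f1 [S1 R1 Bd1 E1]] := step_test zB il C1 R Bd; rewrite (negPf Pt) in S1.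
  by exists 2 => //; exists f1.
move=> i P c s s1 s2 t1 t2 Pt _ IH1 _ IH2 n f /= u C R Bd.
have /andP[il u1] := u; have := C; rewrite -cat1s => /at_code_cat[C1 /at_code_cat[C2 C3]].
have [f1 [S1 R1 Bd1 E1]] := step_test zB il C1 R Bd; rewrite Pt in S1.
rewrite addn1 in C2 C3; have [t1' l1 [f2 [S2 R2 Bd2 E2]]] := IH1 _ f1 u1 C2 R1 Bd1.
rewrite size_code in C3.
have [t2' l2 [f3 [S3 R3 Bd3 E3]]] := IH2 n f2 u C R2 Bd2.
exists (2 + (t1' + (1 + t2'))); first by lia.
exists f3; split=> //; last by rewrite E3 E2.
apply: steps_trans S1 _; apply: steps_trans S2 _.
by apply: steps_trans S3; apply: step_jump C3 Bd2.
Qed.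

End Run.

(** Loading pushes the bits from first to last, so the last one ends on top. *)
Definition bits_of (x : seq bool) : seq A := rev [seq bit b | b <- x].
Definition input_store (x : seq bool) : store := upd (fun _ => [::]) 0 (bits_of x).

Section Load.

Variables (p : seq instr) (acc : pred (mstate p)).
Hypothesis p_load : at_code p 0 [:: ILoad].
Local Notation M := (mach acc).
Local Notation mstep := (@mstep p acc).
Local Notation cfg := (@cfg p acc).

Definition in_tape (x1 x2 : seq bool) : tape A :=
  let s := [seq Some (inl b) | b <- x2] in
  Tape (rev [seq Some (inl b) | b <- x1]) (head None s) (behead s).

Lemma initial_cfg x : initial M x =
  cfg 0 false [ffun i => input_tape A (if i == ord0 then x else [::])].
Proof. by []. Qed.

Lemma load_loop m B x x2 x1 f : x = x1 ++ x2 -> (size x).+1 + K * m.+2 <= B -> size x <= m ->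
  rep (input_store x1) f -> bounded m (size x).+1 f -> f ord0 = in_tape x1 x2 ->
  exists f', [/\ steps B (size x2).+1 (cfg 0 true f) (cfg 1 false f'),
    rep (input_store x) f', bounded m (size x).+1 f' & f' ord0 = in_tape x [::]].
Proof.
have [pl En _] := at_code_cons p_load.
elim: x2 x1 f => [|b x2 IH] x1 f Ex zB xm R Bd E0.
  exists f; rewrite cats0 in Ex; subst x1; split => //.
  apply: steps1; try (apply: leq_trans zB; exact: bounded_space).
  rewrite (next_cfg _ pl (q' := at_pc p 1) (a := keep [ffun j => scanned (f j)])).
    by congr Some; congr Configuration; apply/ffunP => j; rewrite !ffunE /keep ffunE write_stay.
  by rewrite /mdelta inord_pc // pl En ffunE E0.
pose a j : symbol A * direction := if j == ord0 then (Some (inl b), Right)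
  else if j == tp 0 then (Some (inr (bit b)), Right) else (scanned (f j), Stay).
pose f1 : tapes_t := [ffun j => write_move (f j) (a j)].
have K0 : 0 < K by apply: ltnW.
have f10 : f1 ord0 = in_tape (rcons x1 b) x2.
  by rewrite ffunE E0 /in_tape /a eqxx /= map_rcons rev_rcons.
have R1 : rep (input_store (rcons x1 b)) f1.
  move=> i il; rewrite ffunE /a tp_neq0 // tp_eq // /input_store /upd.
  case: (eqVneq i 0) => [E|ne].
    by subst i; rewrite /= R // /input_store /upd eqxx /bits_of map_rcons rev_rcons.
  by rewrite write_stay R // /input_store /upd (negPf ne).
have sx : size x1 < m by rewrite Ex size_cat /= in xm; lia.
have Bd1 : bounded m (size x).+1 f1.
  split.
    rewrite f10 /tape_space /= size_rev !size_map size_rcons size_behead size_map Ex size_cat /=; lia.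
  move=> i il; rewrite ffunE /a tp_neq0 // tp_eq //; have [_ /(_ i il)] := Bd.
  case: (eqVneq i 0) => [E|ne]; last by rewrite write_stay.
  subst i; rewrite /= size_behead R // /input_store /upd eqxx size_cat size_map size_rev size_map /=; lia.
have Ex' : x = rcons x1 b ++ x2 by rewrite cat_rcons.
have [f' [S R' Bd' E']] := IH (rcons x1 b) f1 Ex' zB xm R1 Bd1 f10.
exists f'; split => //; rewrite -[(size (b :: x2)).+1]add1n; apply: steps_trans S.
apply: steps1; try (apply: leq_trans zB; exact: bounded_space).
rewrite (next_cfg _ pl (q' := (inord 0, true)) (a := fun j => if j == ord0
    then ([ffun j => scanned (f j)] ord0, Right)
    else if j == tp 0 then (Some (inr (bit b)), Right) else ([ffun j => scanned (f j)] j, Stay))).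
  congr Some; congr Configuration; apply/ffunP => j; rewrite !ffunE /a.
  by case: eqP => // _; rewrite E0.
by rewrite /mdelta inord_pc // pl En ffunE E0.
Qed.

Lemma load m B x : (size x).+1 + K * m.+2 <= B -> size x <= m ->
  exists f', [/\ steps B (size x).+2 (initial M x) (cfg 1 false f'),
    rep (input_store x) f', bounded m (size x).+1 f' & f' ord0 = in_tape x [::]].
Proof.
have [pl En _] := at_code_cons p_load; move=> zB xm; rewrite initial_cfg.
set f := finfun _; have K0 : 0 < K by apply: ltnW.
pose f1 : tapes_t := [ffun j => if j == ord0 then f j else write_move (f j) (None, Right)].
have Bd : bounded m (size x).+1 f.
  split.
    by rewrite ffunE eqxx /tape_space /= size_behead size_map; lia.
  by move=> i il; rewrite ffunE tp_neq0.
have R1 : rep (input_store [::]) f1.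
  move=> i il; rewrite !ffunE tp_neq0 // /input_store /upd /=; by case: eqP.
have Bd1 : bounded m (size x).+1 f1.
  split; first by rewrite ffunE eqxx; case: Bd.
  by move=> i il; rewrite !ffunE tp_neq0.
have f10 : f1 ord0 = in_tape [::] x by rewrite ffunE eqxx ffunE eqxx.
have [f' [S R' Bd' E']] := @load_loop m B x x [::] f1 erefl zB xm R1 Bd1 f10.
exists f'; split => //; rewrite -[(size x).+2]add1n; apply: steps_trans S.
apply: steps1; try (apply: leq_trans zB; exact: bounded_space).
rewrite (next_cfg _ pl (q' := (inord 0, true)) (a := fun j => if j == ord0
    then ([ffun j => scanned (f j)] j, Stay) else (None, Right))).
  congr Some; congr Configuration; apply/ffunP => j; rewrite !ffunE.
  by case: eqP => // ->; rewrite ffunE eqxx write_stay.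
by rewrite /mdelta inord_pc // pl En.
Qed.

End Load.

Section Decider.

Variables (c : cmd) (P : pred (option A)).
Hypothesis c_uses : uses K c.

Definition dprog : seq instr :=
  ILoad :: code c 1 ++ [:: ITest 1 P (code_size c).+3].
Definition dacc : pred (mstate dprog) := fun q => q.1 == (code_size c).+2 :> nat.

Lemma size_dprog : size dprog = (code_size c).+2.
Proof. by rewrite /= size_cat size_code /= addn1. Qed.

Lemma decider_run m x s t : ev m c (input_store x) s t -> size x <= m ->
  exists n, halted (run (mach dacc) x n) /\
    (accepting (control (run (mach dacc) x n)) = P (ohead (s 1))) /\
    forall j, space (run (mach dacc) x j) <= (size x).+1 + K * m.+2.
Proof.
move=> Hev xm; set B := (size x).+1 + K * m.+2.
have C0 : at_code dprog 0 [:: ILoad] by exists [::], (code c 1 ++ [:: ITest 1 P (code_size c).+3]).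
have C1 : at_code dprog 1 (code c 1) by exists [:: ILoad], [:: ITest 1 P (code_size c).+3].
have C2 : at_code dprog (1 + code_size c) [:: ITest 1 P (code_size c).+3].
  by exists (ILoad :: code c 1), [::]; rewrite /= size_code.
have [f1 [S1 R1 Bd1 _]] := load dacc C0 (leqnn B) xm.
have [t2 _ [f2 [S2 R2 Bd2 _]]] := code_run dacc (leqnn B) Hev c_uses C1 R1 Bd1.
have [f3 [S3 _ Bd3 _]] := step_test dacc (leqnn B) K_gt1 C2 R2 Bd2.
have [E H] := steps_trans S1 (steps_trans S2 S3).
set n := _ + (_ + _) in E H; rewrite -/(run (mach dacc) x n) in E.
have Hl : next (run (mach dacc) x n) = None.
  rewrite E /next /= /mdelta inordK ?size_dprog; last by case: ifP; lia.
  rewrite ifF //; apply/negbTE; rewrite -leqNgt size_dprog; case: ifP => _ //; lia.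
exists n; split; first exact: Hl.
split.
  rewrite E /= /dacc /= inordK; last by rewrite size_cat size_code /=; case: ifP; lia.
  by case: (P _); lia.
move=> j; have [le|lt] := leqP j n; first exact: H.
have -> : run (mach dacc) x j = run (mach dacc) x n.
  rewrite -(subnKC (ltnW lt)); elim: (j - n) => [|d IH]; first by rewrite addn0.
  by rewrite addnS /run iterS -/(run _ _ _) IH Hl.
exact: H.
Qed.

End Decider.

Section Transducer.

Variable c : cmd.
Hypothesis c_uses : uses K c.
Hypothesis bitK : cancel bit unbit.

Definition tprog : seq instr := ILoad :: code c 1 ++ [:: IStore].
Local Notation tacc := (pred0 : pred (mstate tprog)).
Local Notation M := (mach tacc).

Lemma size_tprog : size tprog = (code_size c).+2.
Proof. by rewrite /= size_cat size_code /= addn1. Qed.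

(** The output is written leftwards, starting at the cell after the input, so the top of the stack
    becomes the last bit. The blank at the start of [w] ends the word. *)
Lemma store_loop l y u n (f : tapes_t) : at_code tprog n [:: IStore] ->
  scanned (f (tp 1)) = (if l is a :: _ then Some (inr a) else None) ->
  before (f (tp 1)) = (if l is a :: l' then [seq Some (inr b) | b <- l'] ++ [:: None] else u) ->
  (exists2 w, after (f ord0) = [seq Some (inl b) | b <- y] ++ w & head None w = None) ->
  exists f' : tapes_t,
    iter (size l).+1 (@mstep tprog tacc) (@cfg tprog tacc n true f) = cfg tacc n.+1 false f' /\
    leading_bits (scanned (f' ord0) :: after (f' ord0)) = catrev [seq unbit a | a <- l] y.
Proof.
move=> C; have [pl En _] := at_code_cons C.
elim: l y u f => [|a l IH] y u f Sc Be E0.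
  pose f' : tapes_t := [ffun j => if j == ord0 then write_move (f j) (scanned (f ord0), Right) else f j].
  exists f'; split.
    rewrite /= /mstep (next_cfg tacc pl (q' := at_pc tprog n.+1)
      (a := act [ffun j => scanned (f j)] ord0 (scanned (f ord0), Right))).
      by rewrite act_tapes.
    by rewrite /mdelta inord_pc // pl En /= ffunE Sc ffunE.
  rewrite ffunE eqxx /=; case: E0 => [[|a w] -> //= Ew].
    by rewrite cats0; case: y => //= b y; congr (_ :: _); elim: y => //= b' y ->.
  by rewrite Ew; case: y => //= b y; congr (_ :: _); elim: y => //= b' y ->.
pose act' j : symbol A * direction := if j == ord0 then (Some (inl (unbit a)), Left)
  else if j == tp 1 then (scanned (f j), Left) else (scanned (f j), Stay).
pose f1 : tapes_t := [ffun j => write_move (f j) (act' j)].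
have n1 : (tp 1 == ord0) = false by apply: tp_neq0.
have [f' [E' L']] : exists f' : tapes_t,
    iter (size l).+1 (@mstep tprog tacc) (@cfg tprog tacc n true f1) = cfg tacc n.+1 false f' /\
    leading_bits (scanned (f' ord0) :: after (f' ord0)) = catrev [seq unbit b | b <- l] (unbit a :: y).
  apply: (IH _ [::]).
  - by rewrite ffunE /act' n1 eqxx /= Be; case: l {IH Be}.
  - by rewrite ffunE /act' n1 eqxx /= Be; case: l {IH Be}.
  by rewrite ffunE /act' eqxx /=; case: E0 => w -> Ew; exists w.
exists f'; split=> //; rewrite -E' [in LHS]iterSr; congr (iter _ _ _).
rewrite /mstep (next_cfg tacc pl (q' := (inord n, true)) (a := fun j => if j == ord0
    then (Some (inl (unbit a)), Left)
    else if j == tp 1 then ([ffun j => scanned (f j)] j, Left) else ([ffun j => scanned (f j)] j, Stay))).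
  congr Configuration; apply/ffunP => j; rewrite !ffunE /act' //.
by rewrite /mdelta inord_pc // pl En /= ffunE Sc.
Qed.

Lemma transducer_run m x s t : ev m c (input_store x) s t -> size x <= m ->
  exists n, [/\ n <= size x + 2 * t + size (s 1) + 4, halted (run M x n) &
    output (run M x n) = rev [seq unbit a | a <- s 1]].
Proof.
move=> Hev xm; set B := (size x).+1 + K * m.+2.
have C0 : at_code tprog 0 [:: ILoad] by exists [::], (code c 1 ++ [:: IStore]).
have C1 : at_code tprog 1 (code c 1) by exists [:: ILoad], [:: IStore].
have C2 : at_code tprog (1 + code_size c) [:: IStore].
  by exists (ILoad :: code c 1), [::]; rewrite /= size_code.
have [f1 [S1 R1 Bd1 E1]] := load tacc C0 (leqnn B) xm.
have [t2 le2 [f2 [S2 R2 Bd2 E2]]] := code_run tacc (leqnn B) Hev c_uses C1 R1 Bd1.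
have [pl En _] := at_code_cons C2.
have [sc|f3 [S3 _ E3 _ [Sc Be _]]] := step_down tacc (leqnn B) K_gt1 pl _ R2 Bd2 erefl.
  by rewrite /mdelta inord_pc // pl En.
have [|f4 [E4 L4]] := store_loop (y := [::]) C2 Sc Be; first by exists [::] => //; rewrite E3 E2 E1.
have [E _] := steps_trans S1 (steps_trans S2 S3); set n := _ + (_ + _) in E.
have Er : run M x ((size (s 1)).+1 + n) = cfg tacc (1 + code_size c).+1 false f4.
  by rewrite /run iterD -/(run M x n) -[run M x n]/(iter n (@mstep tprog tacc) (initial M x)) E -E4.
exists ((size (s 1)).+1 + n); split; first by rewrite /n; lia.
  have sz := size_tprog; rewrite Er /halted /next.
  have -> // : delta (control (cfg tacc (1 + code_size c).+1 false f4))
    [ffun i => scanned (tapes (cfg tacc (1 + code_size c).+1 false f4) i)] = None.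
  rewrite [LHS]/= /mdelta [fst _]/= inordK ?sz; last by lia.
  by rewrite ifF //; apply/negbTE; rewrite -leqNgt; lia.
by rewrite Er /output L4 catrevE cats0.
Qed.

End Transducer.

End Language.

End Programs.

(** * Arithmetic expressions and their evaluation in unary *)

Module Expressions.
Import Cells Programs.

(** [Sum] binds register 0 and shifts the others. The value of a fixed expression is polynomial in
    the sizes of the words and the registers, so unary evaluation is affordable. *)
Inductive expr :=
| Cst of nat
| Reg of nat
| Len of nat
| At of nat & expr
| Plus of expr & expr
| Times of expr & expr
| Minus of expr & expr
| Sum of expr & expr.

Fixpoint eval (ws : nat -> seq bool) (rs : seq nat) (e : expr) : nat :=
  match e with
  | Cst n => n
  | Reg i => nth 0 rs i
  | Len w => size (ws w)
  | At w a => nth false (ws w) (eval ws rs a)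
  | Plus a b => eval ws rs a + eval ws rs b
  | Times a b => eval ws rs a * eval ws rs b
  | Minus a b => eval ws rs a - eval ws rs b
  | Sum a b => \sum_(i < eval ws rs a) eval ws (nat_of_ord i :: rs) b
  end.

Fixpoint words_below (k : nat) (e : expr) : bool :=
  match e with
  | Cst _ | Reg _ => true
  | Len w => w < k
  | At w a => (w < k) && words_below k a
  | Plus a b | Times a b | Minus a b | Sum a b => words_below k a && words_below k b
  end.

Fixpoint regs_below (k : nat) (e : expr) : bool :=
  match e with
  | Cst _ | Len _ => true
  | Reg i => i < k
  | At w a => regs_below k a
  | Plus a b | Times a b | Minus a b => regs_below k a && regs_below k b
  | Sum a b => regs_below k a && regs_below k.+1 b
  end.

(** The second bit is the content of a symbol in a word. The first one serves the evaluation of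
    quantifiers. *)
Definition sym := (bool * bool)%type.
Definition one : sym := (false, false).
Notation scmd := (cmd sym).
Notation sstore := (store sym).

Section Cost.

(** The bound on the stacks is hidden; [ev_bound] recovers it from the time, as a push costs one
    unit. *)
Definition runs (c : scmd) (s s' : sstore) (B : nat) : Prop :=
  exists m t, t <= B /\ ev m c s s' t.

Lemma ev_mono m m' c s s' t : m <= m' -> @ev sym m c s s' t -> ev m' c s s' t.
Proof.
move=> H; elim=> {c s s' t}; try by move=> *; econstructor; eauto.
by move=> i a s Hs; apply: ev_push; apply: leq_trans Hs H.
Qed.

Lemma ev_bound m0 m c s s' t : @ev sym m0 c s s' t -> (forall j, size (s j) + t <= m) ->
  ev m c s s' t /\ forall j, size (s' j) <= size (s j) + t.
Proof.
elim=> {c s s' t} [s|i a s _|i s|c1 c2 s s1 s2 t1 t2 _ IH1 _ IH2|i P c1 c2 s s' t HP _ IH|i P c1 c2 s s' t HP _ IH|i P c s HP|i P c s s1 s2 t1 t2 HP _ IH1 _ IH2] H.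
- by split=> [|j]; [apply: ev_skip | rewrite addn0].
- split=> [|j]; first by apply: ev_push; rewrite -addn1.
  by rewrite /upd; case: eqP => [->|_] /=; lia.
- split=> [|j]; first exact: ev_pop.
  by rewrite /upd; case: eqP => [->|_] /=; rewrite ?size_behead; lia.
- have [E1 B1] : ev m c1 s s1 t1 /\ forall j, size (s1 j) <= size (s j) + t1.
    by apply: IH1 => j; have := H j; lia.
  have [E2 B2] : ev m c2 s1 s2 t2 /\ forall j, size (s2 j) <= size (s1 j) + t2.
    by apply: IH2 => j; have := H j; have := B1 j; lia.
  by split=> [|j]; [apply: ev_seq E1 E2 | have := B1 j; have := B2 j; lia].
- have [|E1 B1] := IH; first by move=> j; have := H j; lia.
  by split=> [|j]; [apply: ev_if_true | have := B1 j; lia].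
- have [|E1 B1] := IH; first by move=> j; have := H j; lia.
  by split=> [|j]; [apply: ev_if_false | have := B1 j; lia].
- by split=> [|j]; [apply: ev_while_stop | lia].
have [E1 B1] : ev m c s s1 t1 /\ forall j, size (s1 j) <= size (s j) + t1.
  by apply: IH1 => j; have := H j; lia.
have [E2 B2] : ev m (While i P c) s1 s2 t2 /\ forall j, size (s2 j) <= size (s1 j) + t2.
  by apply: IH2 => j; have := H j; have := B1 j; lia.
by split=> [|j]; [apply: ev_while_go E1 E2 | have := B1 j; have := B2 j; lia].
Qed.

Lemma runs_bound c s s' B m : runs c s s' B -> (forall j, size (s j) + B <= m) ->
  exists2 t, t <= B & ev m c s s' t.
Proof.
move=> [m0 [t [tB E]]] H; exists t => //.
by case: (ev_bound (m := m) E) => // j; have := H j; lia.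
Qed.

Lemma runs_eq c s s1 s2 B : runs c s s1 B -> s1 = s2 -> runs c s s2 B.
Proof. by move=> H <-. Qed.
Lemma runs_mono c s s' B B' : runs c s s' B -> B <= B' -> runs c s s' B'.
Proof. by move=> [m [t [H E]]] BB; exists m, t; split=> //; apply: leq_trans BB. Qed.
Lemma runs_skip s : runs (@Skip sym) s s 0.
Proof. by exists 0, 0; split=> //; apply: ev_skip. Qed.
Lemma runs_push i a s : runs (Push i a) s (upd s i (a :: s i)) 1.
Proof. by exists (size (s i)).+1, 1; split=> //; apply: ev_push. Qed.
Lemma runs_pop i s : runs (@Pop sym i) s (upd s i (behead (s i))) 1.
Proof. by exists 0, 1; split=> //; apply: ev_pop. Qed.
Lemma runs_seq c1 c2 s s1 s2 B1 B2 : runs c1 s s1 B1 -> runs c2 s1 s2 B2 -> runs (Seq c1 c2) s s2 (B1 + B2).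
Proof.
move=> [m1 [t1 [H1 E1]]] [m2 [t2 [H2 E2]]]; exists (maxn m1 m2), (t1 + t2); split; first exact: leq_add.
by apply: (ev_seq (s1 := s1)); [apply: ev_mono E1; apply: leq_maxl | apply: ev_mono E2; apply: leq_maxr].
Qed.
Lemma runs_if i (P : pred (option sym)) c1 c2 s s' B :
  runs (if P (ohead (s i)) then c1 else c2) s s' B -> runs (If i P c1 c2) s s' B.+2.
Proof.
by case E: (P _) => -[m [t [H Ev]]]; exists m, t.+2; split=> //;
  [apply: ev_if_true | apply: ev_if_false; rewrite ?E].
Qed.
Lemma runs_while i (P : pred (option sym)) c (S : nat -> sstore) k B :
  (forall j, j < k -> P (ohead (S j i)) /\ runs c (S j) (S j.+1) B) -> ~~ P (ohead (S k i)) ->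
  runs (While i P c) (S 0) (S k) (k * B.+2).+1.
Proof.
elim: k S => [|k IH] S H Pk; first by exists 0, 1; split=> //; apply: ev_while_stop.
have [P0 [m1 [t1 [H1 E1]]]] := H 0 isT.
have [||m2 [t2 [H2 E2]]] := IH (fun j => S j.+1) => //; first by move=> j jk; apply: H.
exists (maxn m1 m2), (t1 + t2).+2; split; first by rewrite mulSn; lia.
by apply: (ev_while_go (s1 := S 1)) => //; [apply: ev_mono E1; apply: leq_maxl | apply: ev_mono E2; apply: leq_maxr].
Qed.

End Cost.

Definition nonempty : pred (option sym) := isSome.
Definition top_is (a : sym) : pred (option sym) := fun x => x == Some a.

(** Commands cannot remember a symbol, so there is one copy of the continuation for each of the
    four. *)
Definition Case (i : nat) (k : sym -> scmd) : scmd :=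
  If i nonempty
    (If i (top_is (false, false)) (Seq (Pop sym i) (k (false, false)))
    (If i (top_is (false, true)) (Seq (Pop sym i) (k (false, true)))
    (If i (top_is (true, false)) (Seq (Pop sym i) (k (true, false)))
       (Seq (Pop sym i) (k (true, true)))))) (Skip sym).

Lemma runs_case i k s a l s' B : s i = a :: l -> runs (k a) (upd s i l) s' B ->
  runs (Case i k) s s' B.+1.+2.+2.+2.+2.
Proof.
move=> E H.
have P : runs (Seq (Pop sym i) (k a)) s s' B.+1.
  by rewrite -add1n; apply: runs_seq H; have := runs_pop i s; rewrite E.
apply: runs_if; rewrite E /=.
case: a {H} E P => [[] []] E P; apply: runs_if; rewrite E /=; last by apply: runs_mono P _; lia.
all: apply: runs_if; rewrite E /=; try by apply: runs_mono P _; lia.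
all: by apply: runs_if; rewrite E /=; apply: runs_mono P _; lia.
Qed.

Lemma runs_case0 i k s : s i = [::] -> runs (Case i k) s s 2.
Proof. by move=> E; apply: runs_if; rewrite E; apply: runs_skip. Qed.

Definition mv (i j : nat) (c : scmd) : scmd := While i nonempty (Case i (fun a => Seq (Push j a) c)).

Lemma upd_id (s : sstore) i : upd s i (s i) = s.
Proof. by apply: functional_extensionality => j; rewrite /upd; case: eqP => [->|]. Qed.
Lemma upd_upd (s : sstore) i a b : upd (upd s i a) i b = upd s i b.
Proof. by apply: functional_extensionality => j; rewrite /upd; case: eqP. Qed.

Lemma updE (s : sstore) i a : upd s i a i = a. Proof. by rewrite /upd eqxx. Qed.
Lemma updN (s : sstore) i j a : j != i -> upd s i a j = s j. Proof. by rewrite /upd => /negPf->. Qed.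

Ltac stores := apply: functional_extensionality => ?; rewrite /upd;
  repeat (let E := fresh "E" in case: eqVneq => [E|?]; [try (exfalso; lia); rewrite ?E|try (exfalso; lia)] => //=).

Ltac look := rewrite /upd; repeat (let E := fresh "E" in case: eqVneq => [E|?]; [try (exfalso; lia)|try (exfalso; lia)] => //=).

(** The base is at least 2, so sums, products and constant factors can all be absorbed in the
    exponent. *)
Definition pow (N d : nat) : nat := N.+2 ^ d.

Lemma powS N d : pow N d.+1 = N.+2 * pow N d. Proof. by rewrite /pow expnS. Qed.
Lemma pow_gt0 N d : 0 < pow N d. Proof. by rewrite expn_gt0. Qed.
Lemma pow_le N a b : a <= b -> pow N a <= pow N b. Proof. by move=> H; rewrite leq_pexp2l. Qed.
Lemma pow_mul N a b x y : x <= pow N a -> y <= pow N b -> x * y <= pow N (a + b).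
Proof. by rewrite /pow expnD; apply: leq_mul. Qed.
Lemma pow_base N M d : N <= M -> pow N d <= pow M d.
Proof. by case: d => // d H; rewrite /pow leq_exp2r. Qed.
Lemma pow_two N k : 2 ^ k <= pow N k. Proof. by elim: k => [|k IH] //; rewrite powS expnS leq_mul. Qed.
Lemma pow_scale N k a c x : c <= 2 ^ k -> x <= c * pow N a -> x <= pow N (a + k).
Proof.
move=> H1 H2; rewrite addnC; apply: leq_trans H2 (pow_mul _ (leqnn _)).
exact: leq_trans (pow_two _ _).
Qed.
Lemma pow_add N a b x y : x <= pow N a -> y <= pow N b -> x + y <= pow N (a + b).+1.
Proof.
move=> H1 H2; rewrite powS -[pow N (a + b)]mul1n.
have := pow_mul (leqnn (pow N a)) (leqnn (pow N b)); have := pow_gt0 N a; have := pow_gt0 N b.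
by move: (pow N a) (pow N b) (pow N (a + b)) H1 H2 => X Y Z; nia.
Qed.
Lemma pow_comp N a d : pow (pow N a.+1) d <= pow N (a.+2 * d).
Proof.
case: d => [|d]; first by rewrite muln0.
rewrite {1}/pow {2}/pow expnM leq_exp2r //.
by rewrite -/(pow N a.+2) powS; have := pow_gt0 N a; rewrite !powS; nia.
Qed.
Lemma pow_lin N c : c <= 2 ^ 5 -> c * N.+2 <= pow N 6.
Proof. by move=> H; rewrite (@pow_scale N 5 1 c) // /pow expn1. Qed.

(** Inside a sum the index may be as large as the value of [a]; the bound for [b] is taken over the
    base [pow N (vexp a).+1] and brought back by [pow_comp]. *)
Fixpoint vexp (e : expr) : nat :=
  match e with
  | Cst n => n
  | Reg _ | Len _ => 1
  | At _ _ => 0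
  | Plus a b => (vexp a + vexp b).+1
  | Times a b => vexp a + vexp b
  | Minus a _ => vexp a
  | Sum a b => vexp a + (vexp a).+2 * vexp b
  end.

Lemma eval_pow ws e rs N : (forall w, size (ws w) <= N) -> (forall i, nth 0 rs i <= N) ->
  eval ws rs e <= pow N (vexp e).
Proof.
elim: e rs N => [n|i|w|w a _|a IHa b IHb|a IHa b IHb|a IHa b IHb|a IHa b IHb] rs N Hw Hr /=.
- by apply: leq_trans (pow_two _ _); apply: ltnW; apply: ltn_expl.
- by rewrite /pow expn1; apply: leq_trans (Hr i) _; lia.
- by rewrite /pow expn1; apply: leq_trans (Hw w) _; lia.
- exact: leq_b1.
- by apply: pow_add; auto.
- by apply: pow_mul; auto.
- by apply: leq_trans (leq_subr _ _) (IHa _ _ Hw Hr).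
have Ha := IHa _ _ Hw Hr; set V := eval ws rs a in Ha *.
apply: (@leq_trans (\sum_(i < V) pow N ((vexp a).+2 * vexp b))).
  apply: leq_sum => i _; apply: leq_trans (pow_comp N (vexp a) (vexp b)).
  apply: IHb => [w|[|j]] /=.
  + by apply: leq_trans (Hw w) _; rewrite powS; have := pow_gt0 N (vexp a); nia.
  + by have := ltn_ord i; rewrite powS; have := pow_gt0 N (vexp a); nia.
  + by apply: leq_trans (Hr j) _; rewrite powS; have := pow_gt0 N (vexp a); nia.
by rewrite sum_nat_const card_ord; apply: pow_mul.
Qed.

Lemma runs_mv i j s : i != j -> runs (mv i j (Skip sym)) s (upd (upd s j (rev (s i) ++ s j)) i [::]) (size (s i) * 14).+1.
Proof.
move=> ij; pose S := fun k => upd (upd s j (rev (take k (s i)) ++ s j)) i (drop k (s i)).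
have E0 : S 0 = s by rewrite /S take0 drop0 /=; stores.
have Ek : S (size (s i)) = upd (upd s j (rev (s i) ++ s j)) i [::] by rewrite /S take_size drop_size.
rewrite -Ek -[X in runs _ X]E0.
apply: (@runs_mono _ _ _ (size (s i) * 12.+2).+1); last by lia.
apply: runs_while; last by rewrite /S updE drop_size.
move=> k kl; rewrite {1}/S updE (drop_nth one kl); split=> //.
apply: (runs_mono (B := (1 + 0).+1.+2.+2.+2.+2)) => //.
apply: (runs_case (a := nth one (s i) k) (l := drop k.+1 (s i))); first by rewrite /S updE (drop_nth one kl).
apply: runs_seq; first exact: runs_push.
apply: (runs_eq (runs_skip _)).
by rewrite /S (take_nth one kl) rev_rcons; stores.
Qed.

(** Register [i] is on stack [nth 0 rg i], stacks from [f] on are free and empty, and the value is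
    pushed in unary on [o]. Words and registers are restored after use. *)
Fixpoint comp (rg : seq nat) (f o : nat) (e : expr) : scmd :=
  match e with
  | Cst n => iter n (Seq (Push o one)) (Skip sym)
  | Reg i => let r := nth 0 rg i in
      Seq (While r nonempty (Seq (Pop sym r) (Seq (Push f one) (Push o one)))) (mv f r (Skip sym))
  | Len w => Seq (mv w f (Push o one)) (mv f w (Skip sym))
  | At w a => Seq (comp rg f.+1 f a)
      (Seq (While f nonempty (Seq (Pop sym f) (Case w (fun x => Push f.+1 x))))
      (Seq (If w (fun x => if x is Some (_, b) then b else false) (Push o one) (Skip sym))
           (mv f.+1 w (Skip sym))))
  | Plus a b => Seq (comp rg f o a) (comp rg f o b)
  | Times a b => Seq (comp rg f.+1 f a) (While f nonempty (Seq (Pop sym f) (comp rg f.+1 o b)))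
  | Minus a b => Seq (comp rg f.+1 f a) (Seq (comp rg f.+2 f.+1 b)
      (Seq (While f.+1 nonempty (Seq (Pop sym f.+1) (Pop sym f))) (mv f o (Skip sym))))
  | Sum a b => Seq (comp rg f.+1 f a)
      (Seq (While f nonempty (Seq (Pop sym f) (Seq (comp (f.+1 :: rg) f.+2 o b) (Push f.+1 one))))
           (While f.+1 nonempty (Pop sym f.+1)))
  end.

(** The added constants are exponents [k] such that [2 ^ k] dominates a constant factor in
    [comp_runs]; see [pow_scale]. *)
Fixpoint texp (e : expr) : nat :=
  match e with
  | Cst n => n
  | Reg _ | Len _ => 6
  | At _ a => ((texp a + (vexp a + 5)).+1 + 6).+1
  | Plus a b => (texp a + texp b).+1
  | Times a b => (texp a + (vexp a + (texp b + 3))).+1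
  | Minus a b => (((texp a + texp b).+1 + (vexp b + 3)).+1 + (vexp a + 4)).+1
  | Sum a b => ((texp a + (vexp a + ((vexp a).+2 * texp b + 3))).+1 + (vexp a + 2)).+1
  end.

Section Compile.

Variables (nw : nat) (ws : nat -> seq bool).

Definition layout (rg : seq nat) (f : nat) : Prop :=
  nw <= f /\ forall i, i < size rg -> nw <= nth 0 rg i < f.
Definition free_for (rg : seq nat) (f o : nat) : Prop :=
  [/\ nw <= o, o < f & forall i, i < size rg -> nth 0 rg i != o].
Definition holds (rg rs : seq nat) (f N : nat) (s : sstore) : Prop :=
  [/\ forall w, w < nw -> [seq x.2 | x <- s w] = ws w,
      forall i, i < size rg -> s (nth 0 rg i) = nseq (nth 0 rs i) one &
      forall j, f <= j -> s j = [::]] /\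
  (forall w, size (ws w) <= N) /\ (forall i, nth 0 rs i <= N).

Lemma holds_out rg rs f o N s l : free_for rg f o -> holds rg rs f N s -> holds rg rs f N (upd s o l).
Proof.
move=> [wo of_ ro] [[Hw Hr Hf] HN]; split=> //; split=> [w wl|i il|j jf]; rewrite updN ?Hw ?Hr ?Hf //.
- by apply/eqP; lia.
- exact: ro.
- by apply/eqP; lia.
Qed.

Lemma holds_fresh rg rs f N s l : layout rg f -> holds rg rs f N s -> holds rg rs f.+1 N (upd s f l).
Proof.
move=> [wf rf] [[Hw Hr Hf] HN]; split=> //; split=> [w wl|i il|j jf]; rewrite updN ?Hw ?Hr ?Hf //.
- by apply/eqP; lia.
- by have := rf _ il; apply: contraTneq => ->; lia.
- by lia.
- by apply/eqP; lia.
Qed.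

Lemma layoutS rg f : layout rg f -> layout rg f.+1.
Proof. by move=> [w r]; split=> [|i il]; [lia | have := r _ il; lia]. Qed.
Lemma free_forS rg f o : free_for rg f o -> free_for rg f.+1 o.
Proof. by move=> [w r H]; split=> //; lia. Qed.
Lemma free_fresh rg f : layout rg f -> free_for rg f.+1 f.
Proof. by move=> [w r]; split=> // i il; have := r _ il; lia. Qed.

Lemma comp_runs e rg rs f o N s : layout rg f -> free_for rg f o -> holds rg rs f N s ->
  words_below nw e -> regs_below (size rg) e ->
  runs (comp rg f o e) s (upd s o (nseq (eval ws rs e) one ++ s o)) (pow N (texp e)).
Proof.
elim: e rg rs f o N s => [n|i|w|w a IHa|a IHa b IHb|a IHa b IHb|a IHa b IHb|a IHa b IHb] rg rs f o N s Lf Fo H /= Wb Rb.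
- apply: (runs_mono (B := n)); last by apply: leq_trans (pow_two _ _); apply: ltnW; apply: ltn_expl.
  elim: n s {H} => [|n IH] s /=; first by rewrite upd_id; apply: runs_skip.
  rewrite -add1n; apply: (runs_seq (runs_push o one s)); apply: (runs_eq (IH _)).
  by rewrite upd_upd updE; congr upd; elim: (n) => //= k ->.
- have [[_ Hr Hf] [_ HN]] := H; set r := nth 0 rg i; set V := nth 0 rs i.
  have Er : s r = nseq V one by apply: Hr.
  have Ef : s f = [::] by apply: Hf.
  have [of_ ro rf] : [/\ o < f, r != o & r < f] by case: Lf Fo => ? /(_ _ Rb) ? [? ? /(_ _ Rb)]; split=> //; lia.
  pose S := fun k => upd (upd (upd s r (nseq (V - k) one)) f (nseq k one)) o (nseq k one ++ s o).
  apply: (runs_mono (B := (V * (1 + (1 + 1)).+2).+1 + (size (S V f) * 14).+1)); last first.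
    by rewrite /S; look; rewrite size_nseq; apply: leq_trans (pow_lin N (c := 19) isT); have := HN i; rewrite -/V; lia.
  apply: (runs_seq (s1 := S V)).
    rewrite -[X in runs _ X](_ : S 0 = s); last by rewrite /S subn0 /=; stores.
    apply: runs_while => [k kV|]; last by rewrite /S; look; rewrite subnn.
    have Sr : S k r = one :: nseq (V - k.+1) one.
      by rewrite /S; look; rewrite -subnSK.
    rewrite Sr; split=> //.
    apply: (runs_seq (runs_pop _ _)); apply: (runs_seq (runs_push _ _ _)).
    apply: (runs_eq (runs_push _ _ _)).
    by rewrite Sr /S /=; stores.
  have fr : f != r by lia.
  apply: (runs_eq (runs_mv (S V) fr)).
  rewrite /S subnn; stores; rewrite ?rev_nseq ?cats0 //=.
- have [[Hw _ Hf] [HN _]] := H.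
  have Ef : s f = [::] by apply: Hf.
  have [of_ wf wo] : [/\ o < f, w < f & w < o] by case: Lf Fo => ? _ [? ? _]; split=> //; lia.
  set V := size (ws w); have EV : size (s w) = V by rewrite /V -(Hw _ Wb) size_map.
  pose S := fun k => upd (upd (upd s w (drop k (s w))) f (rev (take k (s w)))) o (nseq k one ++ s o).
  apply: (runs_mono (B := (V * ((1 + 1).+1.+2.+2.+2.+2).+2).+1 + (size (S V f) * 14).+1)); last first.
    rewrite /S; look; rewrite size_rev -EV take_size EV; apply: leq_trans (pow_lin N (c := 27) isT); have := HN w; rewrite -/V; lia.
  apply: (runs_seq (s1 := S V)).
    rewrite -[X in runs _ X](_ : S 0 = s); last by rewrite /S take0 drop0 /=; stores.
    apply: runs_while => [k kV|]; last by rewrite /S; look; rewrite -EV drop_size.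
    have Sr : S k w = nth one (s w) k :: drop k.+1 (s w).
      by rewrite /S; look; rewrite -drop_nth ?EV.
    rewrite Sr; split=> //; apply: (runs_case Sr).
    apply: (runs_seq (runs_push _ _ _)); apply: (runs_eq (runs_push _ _ _)).
    by rewrite /S (take_nth one) ?EV // rev_rcons; stores.
  have fr : f != w by lia.
  apply: (runs_eq (runs_mv (S V) fr)).
  rewrite /S -EV drop_size take_size; stores; rewrite ?revK ?cats0 //=.
- have [[Hw _ Hf] [HN HR]] := H; move: Wb => /andP[wn Wa].
  have Ef : s f = [::] by apply: Hf.
  have Ef' : s f.+1 = [::] by apply: Hf.
  have [of_ wf wo] : [/\ o < f, w < f & w < o] by case: Lf Fo => ? _ [? ? _]; split=> //; lia.
  set V := eval ws rs a; have Vp : V <= pow N (vexp a) by apply: eval_pow.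
  have EW : size (s w) <= N by rewrite -(size_map snd) Hw.
  (* After [k] rounds the first [k] symbols of the word are parked on [f.+1]. *)
  pose S := fun k => upd (upd (upd s f (nseq (V - k) one)) w (drop k (s w))) f.+1 (rev (take k (s w))).
  apply: (runs_mono (B := pow N (texp a) + ((V * (1 + 10).+2).+1 + (3 + (size (S V f.+1) * 14).+1)))).
    apply: runs_seq.
      have H1 := holds_fresh (s f) Lf H; rewrite upd_id in H1.
      exact: (IHa rg rs f.+1 f N s (layoutS Lf) (free_fresh Lf) H1 Wa Rb).
    apply: (runs_seq (s1 := S V)).
      rewrite -[X in runs _ X](_ : S 0 = _); last by rewrite /S subn0 take0 drop0 /= -/V Ef cats0; stores.
      apply: runs_while => [k kV|]; last by rewrite /S; look; rewrite subnn.
      have Sr : S k f = one :: nseq (V - k.+1) one.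
        by rewrite /S; look; rewrite -subnSK.
      have Sw : S k w = drop k (s w) by rewrite /S; look.
      rewrite Sr; split=> //; apply: (runs_seq (runs_pop _ _)); rewrite Sr /=.
      case: (ltnP k (size (s w))) => kw.
        apply: (runs_case (a := nth one (s w) k) (l := drop k.+1 (s w))).
          by look; rewrite Sw -drop_nth.
        apply: (runs_eq (runs_push _ _ _)).
        by rewrite /S (take_nth one) // rev_rcons; stores.
      (* Past the end of the word a round only counts down; the test will then see an empty stack,
         in agreement with the default of [nth]. *)
      apply: (runs_mono (B := 2)) => //.
      have Ek : S k.+1 = upd (S k) f (nseq (V - k.+1) one).
        by rewrite /S ![drop _ (s w)]drop_oversize ?[take _ (s w)]take_oversize //; [stores | lia | lia].
      by rewrite Ek; apply: runs_case0; look; rewrite Sw drop_oversize.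
    apply: (runs_seq (s1 := upd (S V) o (nseq (nth false (ws w) V) one ++ s o))).
      apply: runs_if; rewrite (_ : S V w = drop V (s w)); last by rewrite /S; look.
      rewrite -(Hw _ wn); case: (ltnP V (size (s w))) => kw.
        rewrite (drop_nth one kw) /= (nth_map one) //.
        case: (nth one (s w) V) => [a1 []] /=; first by apply: (runs_eq (runs_push _ _ _)); rewrite /S; stores.
        by apply: (runs_mono (B := 0)) => //; apply: (runs_eq (runs_skip _)); rewrite /S; stores.
      rewrite drop_oversize // nth_default ?size_map //=.
      by apply: (runs_mono (B := 0)) => //; apply: (runs_eq (runs_skip _)); rewrite /S; stores.
    have fw : f.+1 != w by lia.
    have EV1 : upd (S V) o (nseq (nth false (ws w) V) one ++ s o) f.+1 = S V f.+1 by look.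
    rewrite -EV1; apply: (runs_eq (runs_mv _ fw)).
    rewrite EV1 /S subnn; stores; by rewrite ?revK ?cat_take_drop.
  rewrite [X in X <= _]addnA; apply: pow_add; first apply: pow_add => //.
    by apply: (@pow_scale N 5 (vexp a) 16) => //; have := pow_gt0 N (vexp a); lia.
  rewrite /S updE size_rev size_take_min; apply: leq_trans (pow_lin N (c := 16) isT).
  by have := geq_minr V (size (s w)); lia.
- have [Wa Wb'] := andP Wb; have [Ra Rb'] := andP Rb.
  have H2 := holds_out (nseq (eval ws rs a) one ++ s o) Fo H.
  apply: runs_mono (pow_add (leqnn _) (leqnn _)).
  apply: (runs_seq (IHa _ _ _ _ _ _ Lf Fo H Wa Ra)); apply: (runs_eq (IHb _ _ _ _ _ _ Lf Fo H2 Wb' Rb')).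
  by rewrite upd_upd updE catA -nseqD addnC.
- have [Wa Wb'] := andP Wb; have [Ra Rb'] := andP Rb.
  have [[Hw _ Hf] [HN HR]] := H.
  have Ef : s f = [::] by apply: Hf.
  have of_ : o < f by case: Fo.
  set V := eval ws rs a; have Vp : V <= pow N (vexp a) by apply: eval_pow.
  set U := eval ws rs b.
  pose S := fun k => upd (upd s f (nseq (V - k) one)) o (nseq (k * U) one ++ s o).
  apply: (runs_mono (B := pow N (texp a) + (V * (1 + pow N (texp b)).+2).+1)).
    apply: runs_seq.
      have H1 := holds_fresh (s f) Lf H; rewrite upd_id in H1.
      exact: (IHa rg rs f.+1 f N s (layoutS Lf) (free_fresh Lf) H1 Wa Ra).
    apply: (runs_eq (s1 := S V)); last by rewrite /S subnn; stores.
    rewrite -[X in runs _ X](_ : S 0 = _); last by rewrite /S subn0 mul0n /= -/V Ef cats0; stores.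
    apply: runs_while => [k kV|]; last by rewrite /S; look; rewrite subnn.
    have Sr : S k f = one :: nseq (V - k.+1) one.
      by rewrite /S; look; rewrite -subnSK.
    rewrite Sr; split=> //; apply: (runs_seq (runs_pop _ _)).
    have HS : holds rg rs f.+1 N (upd (S k) f (behead (S k f))).
      have -> : upd (S k) f (behead (S k f)) = upd (upd s o (S k o)) f (behead (S k f)) by rewrite /S; stores.
      by apply: holds_fresh => //; apply: holds_out.
    apply: (runs_eq (IHb _ _ _ _ _ _ (layoutS Lf) (free_forS Fo) HS Wb' Rb')).
    rewrite -/U Sr /S /=; stores; by rewrite catA -nseqD mulSn.
  have gb := pow_gt0 N (texp b); have ga := pow_gt0 N (vexp a).
  apply: pow_add => //; apply: (@leq_trans (pow N (vexp a) * (4 * pow N (texp b) + 1))); first by nia.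
  apply: (@leq_trans (pow N (vexp a) * pow N (texp b + 3))); last by rewrite /pow -expnD addnA.
  by rewrite leq_mul2l; apply/orP; right; apply: (@pow_scale N 3 (texp b) 5) => //; lia.
- have [Wa Wb'] := andP Wb; have [Ra Rb'] := andP Rb.
  have [[Hw _ Hf] [HN HR]] := H.
  have Ef : s f = [::] by apply: Hf.
  have Ef' : s f.+1 = [::] by apply: Hf.
  have of_ : o < f by case: Fo.
  set V := eval ws rs a; have Vp : V <= pow N (vexp a) by apply: eval_pow.
  set U := eval ws rs b; have Up : U <= pow N (vexp b) by apply: eval_pow.
  pose S := fun k => upd (upd s f (nseq (V - k) one)) f.+1 (nseq (U - k) one).
  apply: (runs_mono (B := pow N (texp a) + (pow N (texp b) + ((U * (1 + 1).+2).+1 + (size (S U f) * 14).+1)))).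
    have H1 := holds_fresh (s f) Lf H; rewrite upd_id in H1.
    apply: (runs_seq (IHa rg rs f.+1 f N s (layoutS Lf) (free_fresh Lf) H1 Wa Ra)).
    have H2 := holds_fresh (nseq V one ++ s f) Lf H.
    have H3 := holds_fresh (upd s f (nseq V one ++ s f) f.+1) (layoutS Lf) H2; rewrite upd_id in H3.
    apply: (runs_seq (IHb rg rs f.+2 f.+1 N _ (layoutS (layoutS Lf)) (free_fresh (layoutS Lf)) H3 Wb' Rb')).
    apply: (runs_seq (s1 := S U)).
      rewrite -[X in runs _ X](_ : S 0 = _); last first.
        by rewrite /S !subn0 -/V -/U; stores; rewrite ?Ef ?Ef' ?cats0.
      apply: runs_while => [k kV|]; last by rewrite /S updE ?subnn.
      have Sr : S k f.+1 = one :: nseq (U - k.+1) one by rewrite /S updE -subnSK.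
      rewrite Sr; split=> //; apply: (runs_seq (runs_pop _ _)); apply: (runs_eq (runs_pop _ _)).
      have Eb : behead (nseq (V - k) one) = nseq (V - k.+1) one by rewrite subnS; case: (V - k).
      by rewrite Sr /S /=; stores; rewrite -?Eb.
    have fo : f != o by lia.
    apply: (runs_eq (runs_mv _ fo)).
    have SU : S U f = nseq (V - U) one by rewrite /S; look.
    by rewrite SU rev_nseq /S subnn; stores.
  have SU : size (S U f) <= V by rewrite /S; look; rewrite size_nseq leq_subr.
  have gb := pow_gt0 N (vexp b); have ga := pow_gt0 N (vexp a).
  rewrite [X in X <= _]addnA [X in X <= _]addnA; apply: pow_add; first apply: pow_add; first exact: pow_add.
    by apply: (@pow_scale N 3 (vexp b) 8) => //; lia.
  by apply: (@pow_scale N 4 (vexp a) 16) => //; lia.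
have [Wa Wb'] := andP Wb; have [Ra Rb'] := andP Rb.
have [[Hw Hr Hf] [HN HR]] := H.
have Ef : s f = [::] by apply: Hf.
have Ef' : s f.+1 = [::] by apply: Hf.
have of_ : o < f by case: Fo.
set V := eval ws rs a; have Vp : V <= pow N (vexp a) by apply: eval_pow.
pose U := fun k => eval ws (k :: rs) b.
(* After [k] rounds: the rounds to come on [f], the index on [f.+1], the partial sum on [o]. *)
pose S := fun k => upd (upd (upd s f (nseq (V - k) one)) f.+1 (nseq k one)) o (nseq (\sum_(i < k) U i) one ++ s o).
pose T := (vexp a).+2 * texp b.
have gp := pow_gt0 N T; have ga := pow_gt0 N (vexp a).
apply: (runs_mono (B := pow N (texp a) + ((V * (1 + (pow N T + 1)).+2).+1 + (V * 1.+2).+1))); last first.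
  rewrite [X in X <= _]addnA; apply: pow_add; first apply: pow_add => //.
    have h1 : V * pow N T <= pow N (vexp a) * pow N T by rewrite leq_mul2r Vp orbT.
    have h2 : pow N (vexp a) <= pow N (vexp a) * pow N T by rewrite leq_pmulr.
    apply: (@leq_trans (pow N (vexp a) * (6 * pow N T))); first by lia.
    apply: (@leq_trans (pow N (vexp a) * pow N (T + 3))); last by rewrite /pow -expnD addnA.
    by rewrite leq_mul2l (@pow_scale N 3 T 6) ?orbT.
  by apply: (@pow_scale N 2 (vexp a) 4) => //; lia.
have H1 := holds_fresh (s f) Lf H; rewrite upd_id in H1.
apply: (runs_seq (IHa rg rs f.+1 f N s (layoutS Lf) (free_fresh Lf) H1 Wa Ra)).
apply: (runs_seq (s1 := S V)).
  rewrite -[X in runs _ X](_ : S 0 = _); last by rewrite /S subn0 big_ord0 -/V Ef cats0 /=; stores.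
  apply: runs_while => [k kV|]; last by rewrite /S; look; rewrite subnn.
  have Sr : S k f = one :: nseq (V - k.+1) one.
    by rewrite /S; look; rewrite -subnSK.
  rewrite Sr; split=> //; apply: (runs_seq (runs_pop _ _)).
  set s1 := upd _ _ _.
  have E1 : s1 = upd (upd (upd s o (S k o)) f (nseq (V - k.+1) one)) f.+1 (nseq k one).
    by rewrite /s1 Sr /S /=; stores.
  (* The index may exceed [N], so the body is run with a larger bound. *)
  have HS : holds (f.+1 :: rg) (k :: rs) f.+2 (pow N (vexp a).+1) s1.
    have [[Hw2 Hr2 Hf2] _] := holds_fresh (nseq k one) (layoutS Lf) (holds_fresh (nseq (V - k.+1) one) Lf (holds_out (S k o) Fo H)).
    have NP : N <= pow N (vexp a).+1 by rewrite powS; nia.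
    split; [rewrite E1; split=> // -[|i] il /=; [by rewrite updE | exact: Hr2]|].
    split=> [w|[|i]] /=; [exact: leq_trans (HN w) NP | | exact: leq_trans (HR i) NP].
    by apply: leq_trans (ltnW kV) _; rewrite powS; nia.
  have LS : layout (f.+1 :: rg) f.+2.
    by have [l1 l2] := Lf; split=> [|[|i] il] /=; [lia | lia | have := l2 i il; lia].
  have FS : free_for (f.+1 :: rg) f.+2 o.
    by have [l1 l2 l3] := Fo; split=> // [|[|i] il] /=; [lia | lia | exact: l3].
  apply: (runs_seq (runs_mono (IHb _ _ _ _ _ _ LS FS HS Wb' Rb') (pow_comp _ _ _))).
  apply: (runs_eq (runs_push _ _ _)).
  rewrite E1 /S big_ord_recr /=; stores.
  by rewrite catA -nseqD addnC.
pose S2 := fun k => upd (upd s o (S V o)) f.+1 (nseq (V - k) one).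
apply: (runs_eq (s1 := S2 V)); last by rewrite /S2 /S subnn; stores.
rewrite -[X in runs _ X](_ : S2 0 = _); last by rewrite /S2 /S subnn subn0; stores.
apply: runs_while => [k kV|]; last by rewrite /S2 updE ?subnn.
have Sr : S2 k f.+1 = one :: nseq (V - k.+1) one by rewrite /S2 updE -subnSK.
rewrite Sr; split=> //; apply: (runs_eq (runs_pop _ _)).
by rewrite Sr /S2 /=; stores.
Qed.

End Compile.

End Expressions.

(** * Quantified Boolean formulas in polynomial space *)

Module Quantified.
Import Cells Programs Expressions.

Definition word_expr (ws : nat -> seq bool) (L B : expr) : seq bool :=
  mkseq (fun i => eval ws [:: i] B == 1) (eval ws [::] L).

(** The bit is stored twice, so that a word can be read through second bits as contents or through
    first bits as quantifiers. *)
Definition pair_bit (b : bool) : sym := (b, b).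

(** A bit is set when [B] is exactly 1, hence the two nested tests. The word comes out with its last
    bit on top. *)
Definition emit (f o : nat) (L B : expr) : scmd :=
  Seq (comp [::] f.+1 f L)
  (Seq (While f nonempty (Seq (Pop sym f) (Seq (comp [:: f.+1] f.+3 f.+2 B)
    (Seq (Seq (If f.+2 nonempty (Seq (Pop sym f.+2) (If f.+2 nonempty (Push o (pair_bit false)) (Push o (pair_bit true)))) (Push o (pair_bit false)))
              (While f.+2 nonempty (Pop sym f.+2)))
         (Push f.+1 one)))))
   (While f.+1 nonempty (Pop sym f.+1))).

Lemma runs_clear i s : runs (While i nonempty (Pop sym i)) s (upd s i [::]) (size (s i) * 3).+1.
Proof.
pose S := fun k => upd s i (drop k (s i)).
apply: (runs_eq (s1 := S (size (s i)))); last by rewrite /S drop_size.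
rewrite -[X in runs _ X](_ : S 0 = _); last by rewrite /S drop0 upd_id.
apply: runs_while => [k kV|]; last by rewrite /S updE drop_size.
rewrite {1}/S updE (drop_nth one kV); split=> //; apply: (runs_eq (runs_pop _ _)).
by rewrite /S updE (drop_nth one kV) /= upd_upd.
Qed.

Lemma emit_runs nw ws f o L B N s : nw <= o < f -> (forall w, w < nw -> [seq x.2 | x <- s w] = ws w) ->
  (forall w, size (ws w) <= N) -> (forall j, f <= j -> s j = [::]) -> nw <= f ->
  words_below nw L -> words_below nw B -> regs_below 0 L -> regs_below 1 B ->
  let W := word_expr ws L B in
  runs (emit f o L B) s (upd s o (rev (map pair_bit W) ++ s o))
    (pow (pow N (vexp L).+1) (texp L + texp B + vexp B + 20)).
Proof.
move=> nf Hw HN Hf nwf WL WB RL RB W.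
set V := eval ws [::] L; have Vp : V <= pow N (vexp L) by apply: eval_pow => // i; rewrite nth_nil.
set N' := pow N (vexp L).+1; have NN : N <= N' by rewrite /N' powS; have := pow_gt0 N (vexp L); nia.
have VN : V < N' by rewrite /N' powS; have := pow_gt0 N (vexp L); nia.
pose bt := fun i => eval ws [:: i] B.
have btp i : i < V -> bt i <= pow N' (vexp B).
  move=> iV; apply: eval_pow => [w|[|j]] /=; [exact: leq_trans NN | by apply: ltnW; apply: ltn_trans VN | by rewrite nth_nil].
pose S := fun k => upd (upd (upd s f (nseq (V - k) one)) f.+1 (nseq k one)) o
  (rev (map pair_bit (mkseq (fun i => bt i == 1) k)) ++ s o).
have Ef j : f <= j -> s j = [::] by apply: Hf.
have Ef0 := Ef f (leqnn f); have Ef1 : s f.+1 = [::] by apply: Ef; lia.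
have Ef2 : s f.+2 = [::] by apply: Ef; lia.
pose C := pow N' (texp B) + (6 + (pow N' (vexp B) * 3).+1 + 1).
apply: (runs_mono (B := pow N' (texp L) + ((V * (1 + C).+2).+1 + (V * 3).+1))); last first.
  have g1 := pow_gt0 N' (texp L + texp B + vexp B); have g2 := pow_gt0 N' (texp B); have g3 := pow_gt0 N' (vexp B).
  have C1 : C <= pow N' (texp L + texp B + vexp B + 4).
    apply: (@pow_scale _ 4 _ 16) => //.
    have l1 : pow N' (texp B) <= pow N' (texp L + texp B + vexp B) by apply: pow_le; lia.
    have l2 : pow N' (vexp B) <= pow N' (texp L + texp B + vexp B) by apply: pow_le; lia.
    by rewrite /C; lia.
  have VC : V * C <= pow N' (texp L + texp B + vexp B + 5).
    rewrite [_ + 5]addnS powS; apply: leq_mul => //; lia.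
  have V1 : V <= pow N' (texp L + texp B + vexp B + 5).
    apply: leq_trans (_ : pow N' 1 <= _); [rewrite /pow expn1; lia | apply: pow_le; lia].
  have L1 : pow N' (texp L) <= pow N' (texp L + texp B + vexp B + 5) by apply: pow_le; lia.
  have -> : texp L + texp B + vexp B + 20 = texp L + texp B + vexp B + 5 + 15 by lia.
  apply: (@pow_scale _ 15 _ 20) => //.
  move: (pow N' (texp L + texp B + vexp B + 5)) (pow_gt0 N' (texp L + texp B + vexp B + 5)) VC V1 L1 => Z; nia.
have H0 : holds nw ws [::] [::] f N s by split=> //; split=> // i; rewrite nth_nil.
have LL : layout nw [::] f by split.
have H1 := holds_fresh (s f) LL H0; rewrite upd_id in H1.
apply: (runs_seq (s1 := upd s f (nseq V one))).
  apply: (runs_eq (runs_mono (comp_runs (layoutS LL) (free_fresh LL) H1 WL RL) _)); last by rewrite Ef ?cats0.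
  exact: pow_base.
apply: (runs_seq (s1 := S V)).
  rewrite -[X in runs _ X](_ : S 0 = _); last by rewrite /S subn0 /= ; stores; rewrite ?Ef0 ?Ef1.
  apply: runs_while => [k kV|]; last by rewrite /S; look; rewrite subnn.
  have Sr : S k f = one :: nseq (V - k.+1) one by rewrite /S; look; rewrite -subnSK.
  rewrite Sr; split=> //; apply: (runs_seq (runs_pop _ _)).
  set s1 := upd _ _ _.
  have E1 : s1 = upd (upd (upd s o (S k o)) f (nseq (V - k.+1) one)) f.+1 (nseq k one).
    by rewrite /s1 Sr /S /=; stores.
  have LF : layout nw [:: f.+1] f.+3 by split=> [|[|i] //=]; lia.
  have FF : free_for nw [:: f.+1] f.+3 f.+2 by split=> [| |[|i] //=]; lia.
  have HS : holds nw ws [:: f.+1] [:: k] f.+3 N' s1.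
    rewrite E1; split; [split=> [w wl|[|i] //= _|j jf] | split=> [w|[|i]] /=].
    - by look; rewrite Hw.
    - by look.
    - by look; rewrite Ef //; lia.
    - exact: leq_trans (HN w) NN.
    - by lia.
    - by rewrite nth_nil.
  apply: (runs_seq (comp_runs LF FF HS WB RB)).
  rewrite -/(bt k); set s2 := upd s1 _ _.
  have E2 : s2 f.+2 = nseq (bt k) one by rewrite /s2 E1; look; rewrite Ef2 cats0.
  pose s3 := upd (upd s1 o (pair_bit (bt k == 1) :: s1 o)) f.+2 (nseq (bt k).-1 one).
  pose s4 := upd s1 o (pair_bit (bt k == 1) :: s1 o).
  apply: (runs_seq (s1 := s4)); last first.
    apply: (runs_eq (runs_push _ _ _)); rewrite /s4 E1 /S mkseqS map_rcons rev_rcons; stores.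
  have s1z : s1 f.+2 = [::] by rewrite E1; look.
  apply: (runs_seq (s1 := s3)).
    apply: (runs_mono (B := (1 + 1.+2).+2)) => //; apply: runs_if; rewrite E2 /s3.
    case Eb: (bt k) => [|b] /=.
      apply: (runs_mono (B := 1)) => //; apply: (runs_eq (runs_push _ _ _)).
      by rewrite /s2 Eb /=; stores; rewrite s1z.
    apply: (runs_seq (runs_pop _ _)); apply: runs_if; rewrite E2 Eb updE /=.
    case: b Eb => [|b] Eb /=; apply: (runs_eq (runs_push _ _ _)); rewrite /s2 Eb; stores.
  apply: (runs_mono (B := (size (s3 f.+2) * 3).+1)).
    by apply: (runs_eq (runs_clear _ _)); rewrite /s3 /s4; stores; rewrite s1z.
  by rewrite /s3 updE size_nseq; have := btp _ kV; lia.
apply: (runs_mono (B := (size (S V f.+1) * 3).+1)).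
  apply: (runs_eq (runs_clear _ _)); rewrite /S subnn; stores; rewrite ?Ef0 ?Ef1 //.
by rewrite /S; look; rewrite size_nseq.
Qed.

(** The quantifier true is existential. The path lists the latest choice first, as a stack does. *)
Fixpoint qbf (qs : seq bool) (phi : seq bool -> bool) (path : seq bool) : bool :=
  match qs with
  | [::] => phi path
  | q :: qs' => if q then qbf qs' phi (false :: path) || qbf qs' phi (true :: path)
                else qbf qs' phi (false :: path) && qbf qs' phi (true :: path)
  end.

Section Qbf.
Variables (phi : expr).
Hypothesis phi_words : words_below 2 phi.
Hypothesis phi_regs : regs_below 0 phi.

Definition up (b : bool) : sym := (true, b).
Definition down : sym := (false, false).

(** One step of a depth-first evaluation: stack 0 holds the input, 1 the path, 2 the quantifiers to
    come, 3 the mode. Going down opens the branch false, or evaluates the leaf. Going up with a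
    value, a node is closed if the value decides its quantifier or its second branch is done;
    otherwise that branch is opened. At the root the result goes to stack 1 and the loop ends. *)
Definition qbf_body : scmd :=
  If 3 (top_is down)
    (If 2 nonempty (Case 2 (fun q => Push 1 (q.1, false)))
      (Seq (comp [::] 5 4 phi) (Seq (Pop sym 3)
        (Seq (If 4 nonempty (Push 3 (up true)) (Push 3 (up false))) (While 4 nonempty (Pop sym 4))))))
    (If 1 nonempty
      (Case 3 (fun m => Case 1 (fun p =>
         if (p.1 == m.2) || p.2 then Seq (Push 2 (pair_bit p.1)) (Push 3 m)
         else Seq (Push 1 (p.1, true)) (Push 3 down))))
      (Case 3 (fun m => Push 1 m))).

Definition board (x p : seq sym) (todo : seq bool) (mode : seq sym) : sstore :=
  fun j => match j with 0 => x | 1 => p | 2 => map pair_bit todo | 3 => mode | _ => [::] end.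

Variables (N m : nat).
Definition phi_at (x p : seq sym) : bool :=
  0 < eval (fun w => if w == 0 then map snd x else if w == 1 then map snd p else [::]) [::] phi.

Lemma body_down x p q qs : runs qbf_body (board x p (q :: qs) [:: down]) (board x ((q, false) :: p) qs [:: down]) 20.
Proof.
apply: (runs_mono (B := (1.+1.+2.+2.+2.+2).+2.+2)) => //; apply: runs_if => /=; apply: runs_if => /=.
apply: runs_case => //; apply: (runs_eq (runs_push _ _ _)).
by apply: functional_extensionality => -[|[|[|[|j]]]].
Qed.

Lemma body_leaf x p : size x <= N -> size p <= N ->
  runs qbf_body (board x p [::] [:: down]) (board x p [::] [:: up (phi_at x p)])
    (pow N (texp phi) + 3 * pow N (vexp phi) + 20).
Proof.
move=> xN pN.
set ws := fun w => if w == 0 then map snd x else if w == 1 then map snd p else [::].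
have L : layout 2 [::] 5 by split.
have F : free_for 2 [::] 5 4 by split.
have H : holds 2 ws [::] [::] 5 N (board x p [::] [:: down]).
  split; first by split=> [[|[|w]]| |[|[|[|[|[|j]]]]]].
  split=> [[|[|w]]|i]; rewrite /ws /= ?size_map ?nth_nil //.
have V := eval_pow phi (ws := ws) (rs := [::]) (N := N).
have Vp : eval ws [::] phi <= pow N (vexp phi) by case: H => _ [h1 h2]; apply: V.
apply: (runs_mono (B := (pow N (texp phi) + (1 + (1.+2 + (eval ws [::] phi * 3).+1))).+2.+2)); last by lia.
apply: runs_if => /=; apply: runs_if => /=.
apply: (runs_seq (comp_runs L F H phi_words phi_regs)).
apply: (runs_seq (runs_pop _ _)).
set v := eval ws [::] phi.
set s1 := upd _ _ _.
have s14 : s1 4 = nseq v one by rewrite /s1 /= cats0.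
apply: (runs_seq (s1 := upd s1 3 [:: up (0 < v)])).
  apply: runs_if; rewrite s14; case Ev: v => [|v'] /=; apply: (runs_eq (runs_push _ _ _)) => //.
apply: (runs_mono (B := (size (upd s1 3 [:: up (0 < v)] 4) * 3).+1)).
  apply: (runs_eq (runs_clear _ _)).
  by apply: functional_extensionality => -[|[|[|[|[|j]]]]].
by rewrite updN // s14 size_nseq.
Qed.

Lemma body_up x p q b v qs : runs qbf_body (board x ((q, b) :: p) qs [:: up v])
  (if (q == v) || b then board x p (q :: qs) [:: up v] else board x ((q, true) :: p) qs [:: down]) 30.
Proof.
apply: (runs_mono (B := ((2.+1.+2.+2.+2.+2).+1.+2.+2.+2.+2).+2.+2)) => //; apply: runs_if => /=; apply: runs_if => /=.
apply: runs_case => //; apply: runs_case => //=.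
by case: ifP => _; (apply: runs_mono; first apply: (runs_seq (runs_push _ _ _)); 
   [apply: (runs_eq (runs_push _ _ _)); apply: functional_extensionality => -[|[|[|[|j]]]] | ]).
Qed.

Lemma body_end x v qs : runs qbf_body (board x [::] qs [:: up v]) (board x [:: up v] qs [::]) 20.
Proof.
apply: (runs_mono (B := (1.+1.+2.+2.+2.+2).+2.+2)) => //; apply: runs_if => /=; apply: runs_if => /=.
apply: runs_case => //; apply: (runs_eq (runs_push _ _ _)).
by apply: functional_extensionality => -[|[|[|[|j]]]].
Qed.

Hypothesis m_big : N + (pow N (texp phi) + 3 * pow N (vexp phi) + 30) <= m.
Hypothesis N_gt0 : 0 < N.

(** Iterations of the loop without their cost: there may be exponentially many, and only the stacks
    have to stay small. *)
Inductive chain : sstore -> sstore -> Prop :=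
| Chain0 s : chain s s
| ChainS s s1 s2 t : nonempty (ohead (s 3)) -> ev m qbf_body s s1 t -> chain s1 s2 -> chain s s2.

Lemma chain_trans s1 s2 s3 : chain s1 s2 -> chain s2 s3 -> chain s1 s3.
Proof. by move=> H; elim: H => // s s' s'' t n E _ IH H'; apply: (ChainS n E); apply: IH. Qed.

Lemma chain1 x p qs a s' B : size x <= N -> size p + size qs <= N ->
  runs qbf_body (board x p qs [:: a]) s' B -> B <= pow N (texp phi) + 3 * pow N (vexp phi) + 30 ->
  chain (board x p qs [:: a]) s'.
Proof.
move=> xN pN R Bm; have [j|t _ E] := runs_bound (m := m) R; last by apply: (ChainS _ E (Chain0 _)).
apply: leq_trans m_big; apply: leq_add => //.
case: j => [|[|[|[|j]]]] //=; first by apply: leq_trans pN; apply: leq_addr.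
by rewrite size_map; apply: leq_trans pN; apply: leq_addl.
Qed.

Lemma chain_qbf x qs p : size x <= N -> size p + size qs <= N ->
  chain (board x p qs [:: down])
        (board x p qs [:: up (qbf qs (fun bs => phi_at x [seq pair_bit b | b <- bs]) (map snd p))]).
Proof.
have phiE p' : phi_at x [seq pair_bit b | b <- [seq y.2 | y <- p']] = phi_at x p'.
  by rewrite /phi_at -!map_comp (eq_map (_ : _ =1 snd)).
move=> xN; elim: qs p => [|q qs IH] p pN.
  rewrite /= phiE; apply: chain1 (body_leaf _ _) _ => //; lia.
have B0 := @chain1 x p (q :: qs) down _ _ xN pN (body_down x p q qs).
have sz b : size ((q, b) :: p) + size qs <= N by rewrite /= addSnnS.
apply: (chain_trans (B0 _)); first lia.
apply: (chain_trans (IH _ (sz false))); set v := qbf _ _ _.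
have B1 := @chain1 x _ qs _ _ _ xN (sz false) (body_up x p q false v qs).
apply: (chain_trans (B1 _)); first lia.
(* The first branch decides if it is true under an existential quantifier or false under a universal
   one. *)
rewrite orbF /=; case: (eqVneq q v) => [qv|qv].
  rewrite (_ : (if q then _ else _) = v); first exact: Chain0.
  by rewrite -/v; case: (q) qv => <-.
apply: (chain_trans (IH _ (sz true))); rewrite [map snd _]/=; set v' := qbf qs _ (true :: _).
have B2 := @chain1 x _ qs _ _ _ xN (sz true) (body_up x p q true v' qs).
apply: (chain_trans (B2 _)); first lia.
rewrite orbT (_ : (if q then _ else _) = v'); first exact: Chain0.
by move: qv; rewrite -/v; case: (q) (v) => [] [].
Qed.

Lemma chain_while s s' : chain s s' -> ~~ nonempty (ohead (s' 3)) ->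
  exists t, ev m (While 3 nonempty qbf_body) s s' t.
Proof.
elim=> {s s'} [s n|s s1 s2 t n E _ IH n']; first by exists 1; apply: ev_while_stop.
by have [t' E'] := IH n'; exists (t + t').+2; apply: ev_while_go E E'.
Qed.

Lemma qbf_loop x qs : size x <= N -> size qs <= N ->
  exists t, ev m (While 3 nonempty qbf_body) (board x [::] qs [:: down])
    (board x [:: up (qbf qs (fun bs => phi_at x [seq pair_bit b | b <- bs]) [::])] qs [::]) t.
Proof.
move=> xN qN; apply: chain_while => //; apply: (chain_trans (chain_qbf (p := [::]) xN qN)).
by apply: chain1 (body_end _ _ _) _ => //; lia.
Qed.

End Qbf.

Fixpoint max_stack (c : scmd) : nat :=
  match c with
  | Skip => 0
  | Push i _ | Pop i => i
  | Seq c1 c2 => maxn (max_stack c1) (max_stack c2)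
  | If i _ c1 c2 => maxn i (maxn (max_stack c1) (max_stack c2))
  | While i _ c1 => maxn i (max_stack c1)
  end.

Lemma uses_max c K : max_stack c < K -> uses K c.
Proof.
elim: c => //= [c1 IH1 c2 IH2|i P c1 IH1 c2 IH2|i P c1 IH1]; rewrite !gtn_max.
- by move=> /andP[/IH1-> /IH2].
- by move=> /and3P[-> /IH1-> /IH2].
by move=> /andP[-> /IH1].
Qed.

Definition one_word (x : seq bool) : nat -> seq bool := fun w => if w == 0 then x else [::].
Definition two_words (x y : seq bool) : nat -> seq bool :=
  fun w => if w == 0 then x else if w == 1 then y else [::].

Lemma poly_pow c d n : exists p : {poly nat}, forall N, p.[N]%R = c * (N + n) ^ d.
Proof.
exists (c *: ('X + n%:P) ^+ d)%R => N.
by rewrite hornerZ horner_exp hornerD hornerX hornerC.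
Qed.

(* An odd number of moves leaves the first bit of the input on top. *)
Definition setup : scmd := Seq (mv 0 5 (Skip sym)) (Seq (mv 5 6 (Skip sym)) (mv 6 0 (Skip sym))).

Lemma setup_runs x : runs setup (input_store pair_bit x) (upd (fun _ => [::]) 0 (map pair_bit x)) (size x * 42 + 3).
Proof.
apply: (runs_mono (B := (size x * 14).+1 + ((size x * 14).+1 + (size x * 14).+1))); last by lia.
pose b := map pair_bit x; have sb : size x = size b by rewrite size_map.
pose S i l : sstore := upd (fun _ => [::]) i l.
have step i j l : i != j -> runs (mv i j (Skip sym)) (S i l) (S j (rev l)) (size l * 14).+1.
  move=> ij; have H := runs_mv (S i l) ij; have Si : S i l i = l by rewrite /S updE.
  rewrite Si in H; apply: (runs_eq H).
  rewrite /S; apply: functional_extensionality => k; rewrite /upd.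
  case: (eqVneq k i) => [->|ki]; first by rewrite (negPf ij).
  by case: (eqVneq k j) => [_|//]; rewrite eq_sym (negPf ij) cats0.
have s1 : size (rev b) = size x by rewrite size_rev.
apply: (runs_seq (s1 := S 5 b)); first by rewrite -s1; apply: (runs_eq (step _ _ _ _)); rewrite ?revK.
apply: (runs_seq (s1 := S 6 (rev b))); first by rewrite sb; apply: step.
by rewrite -s1; apply: (runs_eq (step _ _ _ _)); rewrite ?revK.
Qed.

(** The prefix is computed from the input by [D] and [Q]. The search stores a single path, no longer
    than the prefix. *)
Theorem qbf_PSPACE (L : language) (D Q phi : expr) :
  words_below 1 D -> words_below 1 Q -> words_below 2 phi ->
  regs_below 0 D -> regs_below 1 Q -> regs_below 0 phi ->
  (forall x, L x <-> qbf (word_expr (one_word x) D Q)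
      (fun path => 0 < eval (two_words x path) [::] phi) [::]) -> PSPACE L.
Proof.
move=> WD WQ Wp RD RQ Rp HL.
pose c := Seq setup (Seq (emit 8 7 D Q) (Seq (mv 7 2 (Skip sym)) (Seq (Push 3 down) (While 3 nonempty (qbf_body phi))))).
pose K := (maxn 1 (max_stack c)).+1.
have Uc : uses K c by apply: uses_max; rewrite ltnS leq_maxr.
have K1 : 1 < K by rewrite ltnS leq_maxl.
pose acc : pred (option sym) := fun o => if o is Some (_, b) then b else false.
pose d1 := texp D + texp Q + vexp Q + 20.
pose NN n := pow n (vexp D).+1.
(* The first two terms serve the search. The last one is the time of the preparation, which bounds
   its space as well. *)
pose mm n := NN n + (pow (NN n) (texp phi) + 3 * pow (NN n) (vexp phi) + 30) +
  (n * 42 + 3 + (pow (NN n) d1 + ((NN n * 14).+1 + 1))).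
have run_c x : exists s t, ev (mm (size x)) c (input_store pair_bit x) s t /\ acc (ohead (s 1)) = qbf (word_expr (one_word x) D Q) (fun path => 0 < eval (two_words x path) [::] phi) [::].
  set W := word_expr _ _ _; set n := size x.
  pose X := map pair_bit x.
  have ws0 w : size (one_word x w) <= n by rewrite /one_word; case: ifP.
  have nN : n <= NN n by rewrite /NN powS; have := pow_gt0 n (vexp D); nia.
  have WN : size W <= NN n.
    rewrite size_mkseq; apply: leq_trans (pow_le _ (leqnSn _)); apply: eval_pow => // i.
    by rewrite nth_nil.
  pose s1 : sstore := upd (fun _ => [::]) 0 X.
  have R2 : runs (emit 8 7 D Q) s1 (upd s1 7 (rev (map pair_bit W) ++ s1 7)) (pow (NN n) d1).
    apply: (@emit_runs 1) => // [w|[|[|j]]] //; rewrite ltnS leqn0 => /eqP->.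
    by rewrite /s1 updE -map_comp (eq_map (_ : _ =1 id)) // map_id.
  have R3 : runs (mv 7 2 (Skip sym)) (upd s1 7 (rev (map pair_bit W) ++ s1 7))
      (board X [::] W [::]) (NN n * 14).+1.
    have n72 : 7 != 2 by [].
    have H := runs_mv (upd s1 7 (rev (map pair_bit W) ++ s1 7)) n72.
    apply: (@runs_mono _ _ _ ((size (upd s1 7 (rev (map pair_bit W) ++ s1 7) 7) * 14).+1)).
      apply: (runs_eq H); apply: functional_extensionality => j; rewrite /upd /s1 /upd /=.
      by case: j => [|[|[|[|[|[|[|[|j]]]]]]]] //=; rewrite !cats0 revK.
    by rewrite updE cats0 size_rev size_map ltnS leq_mul2r WN orbT.
  have R4 := runs_push 3 down (board X [::] W [::]).
  have R := runs_seq (setup_runs x) (runs_seq R2 (runs_seq R3 R4)).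
  have [j|t1 _ E1] := runs_bound (m := mm n) R.
    have Hj : size (input_store pair_bit x j) <= n.
      by rewrite /input_store /upd; case: eqP => // _; rewrite /bits_of size_rev size_map.
    by apply: leq_add => //; apply: leq_trans Hj (leq_trans nN (leq_addr _ _)).
  have E2 : upd (board X [::] W [::]) 3 [:: down] = board X [::] W [:: down].
    by apply: functional_extensionality => -[|[|[|[|j]]]].
  have mB : NN n + (pow (NN n) (texp phi) + 3 * pow (NN n) (vexp phi) + 30) <= mm n by apply: leq_addr.
  have xN : size X <= NN n by rewrite size_map.
  have [t2 E3] := qbf_loop Wp Rp mB (pow_gt0 _ _) xN WN.
  rewrite -E2 in E3.
  have E4 (a b cc d e : scmd) (sa sb sc : sstore) t tt : ev (mm n) (Seq a (Seq b (Seq cc d))) sa sb t ->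
     ev (mm n) e sb sc tt -> exists t', ev (mm n) (Seq a (Seq b (Seq cc (Seq d e)))) sa sc t'.
    move=> H H9; inversion_clear H as [| | |? ? ? sx ? ? ? H1 H2| | | |].
    inversion_clear H2 as [| | |? ? ? sy ? ? ? H3 H4| | | |].
    inversion_clear H4 as [| | |? ? ? sz ? ? ? H5 H6| | | |].
    by eexists; apply: (ev_seq H1); apply: (ev_seq H3); apply: (ev_seq H5); apply: (ev_seq H6 H9).
  have [t E] := E4 _ _ _ _ _ _ _ _ _ _ E1 E3.
  exists (board X [:: up (qbf W (fun bs => phi_at phi X [seq pair_bit b | b <- bs]) [::])] W [::]), t; split=> //=.
  have Ephi p : phi_at phi X [seq pair_bit b | b <- p] = (0 < eval (two_words x p) [::] phi).
    rewrite /phi_at; congr (0 < eval _ _ _); apply: functional_extensionality => w; rewrite /two_words.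
    by rewrite -!map_comp !(eq_map (_ : _ =1 id)) // !map_id.
  by elim: (W) ([::] : seq bool) => [|q qs IH] p //=; rewrite !IH.
have [p Hp] : exists p : {poly nat}, forall n, n.+1 + K * (mm n).+2 <= p.[n]%R.
  pose e := (vexp D).+3 * (texp phi + vexp phi + d1).+1.
  have [p Hp] := poly_pow (1 + K * 200) e 2; exists p => n; rewrite Hp addn2.
  have nN : n.+1 <= NN n by rewrite /NN powS; have := pow_gt0 n (vexp D); nia.
  pose Z := pow (NN n) (texp phi + vexp phi + d1).+1.
  have Z1 : NN n <= Z.
    by apply: leq_trans (_ : pow (NN n) 1 <= _); [rewrite /pow expn1; lia | apply: pow_le; lia].
  have Z2 : pow (NN n) (texp phi) <= Z by apply: pow_le; lia.
  have Z3 : pow (NN n) (vexp phi) <= Z by apply: pow_le; lia.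
  have Z4 : pow (NN n) d1 <= Z by apply: pow_le; lia.
  have Z5 : Z <= n.+2 ^ e.
    apply: leq_trans (pow_comp n (vexp D) _) _; apply: pow_le; rewrite leq_mul2r; apply/orP; right; lia.
  have mmZ : (mm n).+2 <= 200 * Z by have := pow_gt0 (NN n) (texp phi + vexp phi + d1).+1; rewrite -/Z /mm; lia.
  apply: leq_trans (_ : (1 + K * 200) * Z <= _); last by rewrite leq_mul2l Z5 orbT.
  by rewrite mulnDl mul1n -mulnA leq_add ?leq_mul2l ?mmZ ?orbT //; lia.
exists (mach K pair_bit (@snd bool bool) (@dacc sym c acc)), p; split=> [x|x t].
  have [s [t [E Ea]]] := run_c x.
  have [|n [Hh [Ha _]]] := decider_run (bit := pair_bit) snd K1 acc Uc E.
    by rewrite /mm; lia.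
  by exists n => //; rewrite Ha Ea HL.
have [s [t' [E _]]] := run_c x.
have [|n [_ [_ Hs]]] := decider_run (bit := pair_bit) snd K1 acc Uc E; first by rewrite /mm; lia.
exact: leq_trans (Hs t) (Hp _).
Qed.

End Quantified.

(** * Closure properties of expressible functions *)

Module Closure.
Import Cells Programs Expressions.

Notation fn T := ((nat -> seq bool) -> seq nat -> T).

Section Closure.
Variable nw : nat.

(** Expressibility is derived by closure properties of functions, so that no large expression is
    ever written down. *)
Definition num (k : nat) (f : fn nat) : Prop :=
  exists e, [/\ words_below nw e, regs_below k e &
    forall ws rs, size rs = k -> eval ws rs e = f ws rs].
Definition dec (k : nat) (P : fn bool) : Prop := num k (fun ws rs => nat_of_bool (P ws rs)).

Lemma num_ext k f g : (forall ws rs, size rs = k -> f ws rs = g ws rs) -> num k f -> num k g.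
Proof. by move=> H [e [W R E]]; exists e; split=> // ws rs s; rewrite E ?H. Qed.
Lemma dec_ext k P Q : (forall ws rs, size rs = k -> P ws rs = Q ws rs) -> dec k P -> dec k Q.
Proof. by move=> H; apply: num_ext => ws rs s; rewrite H. Qed.

Lemma num_cst k n : num k (fun _ _ => n). Proof. by exists (Cst n). Qed.
Lemma num_reg k i : i < k -> num k (fun _ rs => nth 0 rs i). Proof. by exists (Reg i). Qed.
Lemma num_len k w : w < nw -> num k (fun ws _ => size (ws w)). Proof. by exists (Len w). Qed.
Lemma num_add k f g : num k f -> num k g -> num k (fun ws rs => f ws rs + g ws rs).
Proof.
by move=> [a [W1 R1 E1]] [b [W2 R2 E2]]; exists (Plus a b); split=> [||ws rs s] /=; rewrite ?W1 ?R1 ?E1 ?E2.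
Qed.
Lemma num_mul k f g : num k f -> num k g -> num k (fun ws rs => f ws rs * g ws rs).
Proof.
by move=> [a [W1 R1 E1]] [b [W2 R2 E2]]; exists (Times a b); split=> [||ws rs s] /=; rewrite ?W1 ?R1 ?E1 ?E2.
Qed.
Lemma num_sub k f g : num k f -> num k g -> num k (fun ws rs => f ws rs - g ws rs).
Proof.
by move=> [a [W1 R1 E1]] [b [W2 R2 E2]]; exists (Minus a b); split=> [||ws rs s] /=; rewrite ?W1 ?R1 ?E1 ?E2.
Qed.
Lemma num_sum k f g : num k f -> num k.+1 g -> num k (fun ws rs => \sum_(i < f ws rs) g ws (nat_of_ord i :: rs)).
Proof.
move=> [a [W1 R1 E1]] [b [W2 R2 E2]]; exists (Sum a b); split=> [||ws rs s] /=; rewrite ?W1 ?R1 ?E1 //.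
by apply: eq_bigr => i _; rewrite E2 //= s.
Qed.
Lemma dec_bit k w f : w < nw -> num k f -> dec k (fun ws rs => nth false (ws w) (f ws rs)).
Proof. by move=> wl [a [W1 R1 E1]]; exists (At w a); split=> [||ws rs s] /=; rewrite ?wl ?E1. Qed.

Fixpoint rename (r : seq nat) (e : expr) : expr :=
  match e with
  | Cst n => Cst n
  | Reg i => Reg (nth 0 r i)
  | Len w => Len w
  | At w a => At w (rename r a)
  | Plus a b => Plus (rename r a) (rename r b)
  | Times a b => Times (rename r a) (rename r b)
  | Minus a b => Minus (rename r a) (rename r b)
  | Sum a b => Sum (rename r a) (rename (0 :: map succn r) b)
  end.

Lemma num_ren k k' (r : seq nat) f : num k f -> size r = k -> all (fun i => i < k') r ->
  num k' (fun ws rs => f ws [seq nth 0 rs i | i <- r]).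
Proof.
move=> [e [W R E]] sr ar; exists (rename r e).
have {E} H ws rs : size rs = k' -> eval ws rs (rename r e) = eval ws [seq nth 0 rs i | i <- r] e -> 
  eval ws rs (rename r e) = f ws [seq nth 0 rs i | i <- r] by move=> _ ->; rewrite E // size_map.
suff [H1 H2 H3] : [/\ words_below nw (rename r e), regs_below k' (rename r e) &
    forall ws rs, size rs = k' -> eval ws rs (rename r e) = eval ws [seq nth 0 rs i | i <- r] e].
  by split=> // ws rs s; apply: H => //; apply: H3.
elim: e k k' r W R sr ar {H f} => //= [i|w a IHa|a IHa b IHb|a IHa b IHb|a IHa b IHb|a IHa b IHb] k k' r W R sr ar.
- split=> //; first by move/all_nthP: ar; apply; rewrite sr.
  by move=> ws rs s; rewrite (nth_map 0) ?sr.
- case/andP: W => wl W; have [H1 H2 H3] := IHa _ _ _ W R sr ar.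
  by rewrite wl; split=> // ws rs s; rewrite H3.
- case/andP: W => W W'; case/andP: R => R R'.
  have [-> -> H3] := IHa _ _ _ W R sr ar; have [-> -> H3'] := IHb _ _ _ W' R' sr ar.
  by split=> // ws rs s; rewrite H3 ?H3'.
- case/andP: W => W W'; case/andP: R => R R'.
  have [-> -> H3] := IHa _ _ _ W R sr ar; have [-> -> H3'] := IHb _ _ _ W' R' sr ar.
  by split=> // ws rs s; rewrite H3 ?H3'.
- case/andP: W => W W'; case/andP: R => R R'.
  have [-> -> H3] := IHa _ _ _ W R sr ar; have [-> -> H3'] := IHb _ _ _ W' R' sr ar.
  by split=> // ws rs s; rewrite H3 ?H3'.
case/andP: W => W W'; case/andP: R => R R'.
have [-> -> H3] := IHa _ _ _ W R sr ar.
have [||-> -> H3'] := IHb k.+1 k'.+1 (0 :: map succn r) W' R'; first by rewrite /= size_map sr.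
  by rewrite /= all_map.
split=> // ws rs s; rewrite H3 //; apply: eq_bigr => i _; rewrite H3' /= ?s //.
by rewrite -map_comp.
Qed.

Lemma nth_iota_map (rs : seq nat) m : [seq nth 0 rs i | i <- iota m (size rs - m)] = drop m rs.
Proof.
apply: (@eq_from_nth _ 0); first by rewrite size_map size_iota size_drop.
by move=> i; rewrite size_map size_iota => il; rewrite (nth_map 0) ?size_iota // nth_iota // nth_drop.
Qed.

Lemma num_drop m k f : num k f -> num (m + k) (fun ws rs => f ws (drop m rs)).
Proof.
move=> H; have := @num_ren k (m + k) (iota m k) f H (size_iota _ _).
move=> H'; apply: num_ext (H' _) => [ws rs s|]; last by apply/allP => i; rewrite mem_iota; lia.
by rewrite -nth_iota_map s addKn.
Qed.

Lemma num_let k a b : num k a -> num k.+1 b -> num k (fun ws rs => b ws (a ws rs :: rs)).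
Proof.
move=> Ha Hb.
(* A local definition is a sum with one nonzero term: the first factor is 1 just for [i = a]. *)
have H : num k (fun ws rs => \sum_(i < a ws rs + 1) (1 - (i - a ws rs) - (a ws rs - i)) * b ws (nat_of_ord i :: rs)).
  have HS := @num_sum k (fun ws rs => a ws rs + 1)
    (fun ws rs => (1 - (nth 0 rs 0 - a ws (drop 1 rs)) - (a ws (drop 1 rs) - nth 0 rs 0)) * b ws rs).
  apply: num_ext (HS _ _) => [ws rs _||].
  - by apply: eq_bigr => i _ /=; rewrite drop0.
  - by apply: num_add => //; apply: num_cst.
  have Ha' := num_drop 1 Ha; have H0 : num k.+1 (fun _ rs => nth 0 rs 0) by apply: num_reg.
  by apply: num_mul => //; do ![apply: num_sub => //]; apply: num_cst.
apply: num_ext H => ws rs s; rewrite addn1 big_ord_recr /= subnn !subn0 mul1n big1 ?add0n // => i _.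
by rewrite (_ : 1 - (i - a ws rs) - (a ws rs - i) = 0) //; have := ltn_ord i; lia.
Qed.

(* [b] is applied to the value of [a] and to the registers from [m] on. *)
Lemma num_app m k a b : num (m + k) a -> num k.+1 b ->
  num (m + k) (fun ws rs => b ws (a ws rs :: drop m rs)).
Proof.
move=> Ha Hb; have Hb' := @num_ren k.+1 (m + k).+1 (0 :: iota m.+1 k) b Hb.
have {}Hb' : num (m + k).+1 (fun ws rs => b ws (nth 0 rs 0 :: drop m.+1 rs)).
  apply: num_ext (Hb' _ _) => [ws rs s||] /=; last by apply/allP => i; rewrite mem_iota; lia.
    by congr (b ws (_ :: _)); rewrite -nth_iota_map s subSS addKn.
  by rewrite size_iota.
by have := num_let Ha Hb'; apply: num_ext.
Qed.

Lemma dec_not k P : dec k P -> dec k (fun ws rs => ~~ P ws rs).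
Proof. by move=> H; apply: num_ext (num_sub (num_cst k 1) H) => ws rs _; case: (P ws rs). Qed.
Lemma dec_and k P Q : dec k P -> dec k Q -> dec k (fun ws rs => P ws rs && Q ws rs).
Proof. by move=> H1 H2; apply: num_ext (num_mul H1 H2) => ws rs _; case: (P ws rs); case: (Q ws rs). Qed.
Lemma dec_or k P Q : dec k P -> dec k Q -> dec k (fun ws rs => P ws rs || Q ws rs).
Proof.
move=> H1 H2; apply: dec_ext (dec_not (dec_and (dec_not H1) (dec_not H2))) => ws rs _.
by rewrite negb_and !negbK.
Qed.
Lemma dec_cst k b : dec k (fun _ _ => b). Proof. exact: num_cst. Qed.
Lemma dec_le k f g : num k f -> num k g -> dec k (fun ws rs => f ws rs <= g ws rs).
Proof. by move=> H1 H2; apply: num_ext (num_sub (num_cst k 1) (num_sub H1 H2)) => ws rs _; case: leqP => /=; lia. Qed.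
Lemma dec_lt k f g : num k f -> num k g -> dec k (fun ws rs => f ws rs < g ws rs).
Proof. by move=> H1 H2; apply: dec_le => //; apply: num_ext (num_add H1 (num_cst k 1)) => ws rs _; rewrite addn1. Qed.
Lemma dec_eq k f g : num k f -> num k g -> dec k (fun ws rs => f ws rs == g ws rs).
Proof. by move=> H1 H2; apply: dec_ext (dec_and (dec_le H1 H2) (dec_le H2 H1)) => ws rs _; rewrite eqn_leq. Qed.
Lemma dec_has k f P : num k f -> dec k.+1 P -> dec k (fun ws rs => has (fun i => P ws (i :: rs)) (iota 0 (f ws rs))).
Proof.
move=> Hf HP; apply: dec_ext (dec_lt (num_cst k 0) (num_sum Hf HP)) => ws rs s.
rewrite -(big_mkord xpredT (fun i => nat_of_bool (P ws (i :: rs)))) /index_iota subn0 lt0n.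
by rewrite sum_nat_seq_neq0 /=; apply: eq_has => i; rewrite eqb0 negbK.
Qed.
Lemma dec_all k f P : num k f -> dec k.+1 P -> dec k (fun ws rs => all (fun i => P ws (i :: rs)) (iota 0 (f ws rs))).
Proof.
move=> Hf HP; apply: dec_ext (dec_not (dec_has Hf (dec_not HP))) => ws rs s.
by rewrite -all_predC; apply: eq_all => i /=; rewrite negbK.
Qed.
Lemma num_if k P f g : dec k P -> num k f -> num k g -> num k (fun ws rs => if P ws rs then f ws rs else g ws rs).
Proof.
move=> HP Hf Hg; apply: num_ext (num_add (num_mul HP Hf) (num_mul (dec_not HP) Hg)) => ws rs _.
by case: (P ws rs); rewrite /= ?mul1n ?addn0.
Qed.
Lemma dec_if k P Q R : dec k P -> dec k Q -> dec k R -> dec k (fun ws rs => if P ws rs then Q ws rs else R ws rs).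
Proof. by move=> HP HQ HR; apply: num_ext (num_if HP HQ HR) => ws rs _; case: (P ws rs). Qed.
Lemma num_div k f d : 0 < d -> num k f -> num k (fun ws rs => f ws rs %/ d).
Proof.
move=> d0 Hf.
(* The quotient counts the positive multiples of [d] up to the value. *)
have H : num k (fun ws rs => \sum_(i < f ws rs) ((nat_of_ord i).+1 * d <= f ws rs)).
  have HS := @num_sum k f (fun ws rs => ((nth 0 rs 0).+1 * d <= f ws (drop 1 rs))) Hf.
  apply: num_ext (HS _) => [ws rs _|].
    by apply: eq_bigr => i _ /=; rewrite drop0.
  apply: dec_le; last exact: (num_drop 1 Hf).
  apply: num_mul (num_cst _ _); apply: num_ext (num_add (num_reg (k := k.+1) (i := 0) isT) (num_cst _ 1)) => ws rs _.
  by rewrite addn1.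
apply: num_ext H => ws rs _; move: (f ws rs) => x.
rewrite (eq_bigr (fun i : 'I_x => nat_of_bool (i < x %/ d))); last by move=> i _; rewrite leq_divRL.
rewrite -(big_mkord xpredT (fun i => nat_of_bool (i < x %/ d))) (@big_cat_nat _ _ _ (x %/ d)) //= ?leq_div //.
rewrite big_nat_cond (eq_bigr (fun=> 1)) => [|i /andP[/andP[_ ->]]] //.
rewrite -big_nat_cond sum_nat_const_nat subn0 muln1 big_nat_cond big1 ?addn0 // => i /andP[/andP[H _] _].
by rewrite ltnNge H.
Qed.
Lemma num_mod k f d : 0 < d -> num k f -> num k (fun ws rs => f ws rs %% d).
Proof.
move=> d0 Hf; apply: num_ext (num_sub Hf (num_mul (num_div d0 Hf) (num_cst k d))) => ws rs _.
by rewrite {1}(divn_eq (f ws rs) d) addKn.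
Qed.

(** Functions with finitely many values, in any type with equality. Arbitrary maps may be applied to
    them, being tables. *)
Definition tab (k : nat) (T : eqType) (f : fn T) : Prop :=
  (exists s : seq T, forall ws rs, size rs = k -> f ws rs \in s) /\ forall t, dec k (fun ws rs => f ws rs == t).

Lemma tab_ext k (T : eqType) (f g : fn T) : (forall ws rs, size rs = k -> f ws rs = g ws rs) -> tab k f -> tab k g.
Proof.
move=> H [[s Hs] D]; split; first by exists s => ws rs sr; rewrite -H ?Hs.
by move=> t; apply: dec_ext (D t) => ws rs sr; rewrite H.
Qed.
Lemma num_case k (T : eqType) (f : fn T) (F : T -> fn nat) : tab k f -> (forall t, num k (F t)) ->
  num k (fun ws rs => F (f ws rs) ws rs).
Proof.
move=> [[s Hs] D] HF.
have H : num k (fun ws rs => \sum_(t <- undup s) (f ws rs == t) * F t ws rs).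
  elim: (undup s) => [|t l IH]; first by apply: num_ext (num_cst k 0) => ws rs _; rewrite big_nil.
  apply: num_ext (num_add (num_mul (D t) (HF t)) IH) => ws rs _; rewrite big_cons //.
apply: num_ext H => ws rs sr; rewrite (bigD1_seq (f ws rs)) ?undup_uniq ?mem_undup ?Hs //= eqxx mul1n.
by rewrite big1 ?addn0 // => t; rewrite eq_sym => /negPf->.
Qed.
Lemma dec_case k (T : eqType) (f : fn T) (F : T -> fn bool) : tab k f -> (forall t, dec k (F t)) ->
  dec k (fun ws rs => F (f ws rs) ws rs).
Proof. by move=> H HF; apply: (num_case (F := fun t ws rs => nat_of_bool (F t ws rs)) H). Qed.
Lemma tab_map k (T U : eqType) (F : T -> U) (f : fn T) : tab k f -> tab k (fun ws rs => F (f ws rs)).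
Proof.
move=> H; have [[s Hs] D] := H; split; first by exists (map F s) => ws rs sr; apply: map_f; apply: Hs.
by move=> u; apply: (dec_case (F := fun t _ _ => F t == u) H) => t; apply: dec_cst.
Qed.
Lemma tab_pair k (T U : eqType) (f : fn T) (g : fn U) : tab k f -> tab k g -> tab k (fun ws rs => (f ws rs, g ws rs)).
Proof.
move=> [[s Hs] D] [[s' Hs'] D']; split.
  by exists [seq (a, b) | a <- s, b <- s'] => ws rs sr; apply: allpairs_f; [apply: Hs | apply: Hs'].
by case=> a b; apply: dec_ext (dec_and (D a) (D' b)).
Qed.
Lemma tab_cst k (T : eqType) (t : T) : tab k (fun _ _ => t).
Proof. by split=> [|u]; [exists [:: t] => *; rewrite inE | apply: dec_cst]. Qed.
Lemma tab_if k (T : eqType) P (f g : fn T) : dec k P -> tab k f -> tab k g -> tab k (fun ws rs => if P ws rs then f ws rs else g ws rs).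
Proof.
move=> HP [[s Hs] D] [[s' Hs'] D']; split.
  by exists (s ++ s') => ws rs sr; rewrite mem_cat; case: ifP => _; rewrite ?Hs ?Hs' ?orbT.
by move=> t; apply: dec_ext (dec_if HP (D t) (D' t)) => ws rs _; case: (P ws rs).
Qed.
Lemma tab_num k f m : num k f -> (forall ws rs, size rs = k -> f ws rs < m) -> tab k f.
Proof.
move=> Hf H; split; first by exists (iota 0 m) => ws rs sr; rewrite mem_iota /= H.
by move=> t; apply: dec_eq => //; apply: num_cst.
Qed.
Lemma tab_dec k P : dec k P -> tab k P.
Proof.
move=> HP; split; first by exists [:: true; false] => ws rs _; case: (P ws rs).
case; first by apply: dec_ext HP => ws rs _; rewrite eqb_id.
by apply: dec_ext (dec_not HP) => ws rs _; rewrite eqbF_neg.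
Qed.

Definition wrd (k : nat) (w : fn (seq bool)) : Prop :=
  num k (fun ws rs => size (w ws rs)) /\
  dec k.+1 (fun ws rs => nth false (w ws (drop 1 rs)) (nth 0 rs 0)).

Lemma wrd_ext k (w w' : fn (seq bool)) : (forall ws rs, size rs = k -> w ws rs = w' ws rs) -> wrd k w -> wrd k w'.
Proof.
move=> H [H1 H2]; split; first by apply: num_ext H1 => ws rs s; rewrite H.
by apply: dec_ext H2 => ws rs s; rewrite H // size_drop s subn1.
Qed.

Lemma wrd_nth m k w f : wrd k w -> num (m + k) f -> dec (m + k) (fun ws rs => nth false (w ws (drop m rs)) (f ws rs)).
Proof.
by move=> [_ H] Hf; apply: num_ext (num_app Hf H) => ws rs s /=; rewrite drop0.
Qed.

Lemma wrd_bits k f P : num k f -> dec k.+1 P -> wrd k (fun ws rs => mkseq (fun i => P ws (i :: rs)) (f ws rs)).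
Proof.
move=> Hf HP; split; first by apply: num_ext Hf => ws rs _; rewrite size_mkseq.
apply: dec_ext (dec_and (dec_lt (num_reg (k := k.+1) (i := 0) isT) (num_drop 1 Hf)) HP) => ws [|i rs] // _.
rewrite /= drop0; case: ltnP => il; first by rewrite nth_mkseq.
by rewrite nth_default // size_mkseq.
Qed.

Lemma wrd_seq1 k P : dec k P -> wrd k (fun ws rs => [:: P ws rs]).
Proof.
move=> HP; apply: wrd_ext (wrd_bits (num_cst k 1) (num_drop 1 HP)) => ws rs _.
by rewrite /mkseq /= drop0.
Qed.

Lemma wrd_cat k v w : wrd k v -> wrd k w -> wrd k (fun ws rs => v ws rs ++ w ws rs).
Proof.
move=> Hv Hw; have [Sv Bv] := Hv; have [Sw Bw] := Hw; split.
  by apply: num_ext (num_add Sv Sw) => ws rs _; rewrite size_cat.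
have R0 := num_reg (k := k.+1) (i := 0) isT; have Sv' := num_drop 1 Sv.
apply: dec_ext (dec_if (dec_lt R0 Sv') Bv (wrd_nth (m := 1) Hw (num_sub R0 Sv'))) => ws rs _.
by rewrite nth_cat.
Qed.

(** At most one piece covers position [i], so summing over all pieces selects its bit. *)
Lemma nth_flatten_iota (F : nat -> seq bool) n i :
  nat_of_bool (nth false (flatten [seq F j | j <- iota 0 n]) i) =
  \sum_(j < n) (let o := \sum_(l < j) size (F l) in
     (o <= i) && (i < o + size (F j)) && nth false (F j) (i - o)).
Proof.
have sz m : size (flatten [seq F j | j <- iota 0 m]) = \sum_(l < m) size (F l).
  elim: m => [|m IH]; first by rewrite big_ord0.
  by rewrite -[m.+1]addn1 iotaD map_cat flatten_cat size_cat IH addn1 big_ord_recr /= cats0.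
elim: n => [|n IH]; first by rewrite big_ord0 nth_nil.
rewrite -[in LHS]addn1 iotaD map_cat flatten_cat nth_cat sz add0n big_ord_recr /= -IH cats0.
case: ltnP => H; first by rewrite addn0.
rewrite [nth false (flatten _) i]nth_default ?sz //= add0n; case: ltnP => //= H'.
by rewrite nth_default //; lia.
Qed.

Lemma wrd_flatten k f w : num k f -> wrd k.+1 w ->
  wrd k (fun ws rs => flatten [seq w ws (j :: rs) | j <- iota 0 (f ws rs)]).
Proof.
move=> Hf [Sw Bw]; split.
  apply: num_ext (num_sum Hf Sw) => ws rs _; rewrite size_flatten /shape -map_comp sumnE big_map.
  by rewrite -(big_mkord xpredT (fun i => size (w ws (i :: rs)))) /index_iota subn0.
pose off ws (rs : seq nat) := \sum_(l < nth 0 rs 0) size (w ws (nat_of_ord l :: drop 2 rs)).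
have Hoff : num k.+2 off.
  have S3 : num k.+3 (fun ws rs => size (w ws (nth 0 rs 0 :: drop 3 rs))).
    exact: (num_app (m := 3) (k := k) (num_reg (k := k.+3) (i := 0) isT) Sw).
  by apply: num_ext (num_sum (num_reg (k := k.+2) (i := 0) isT) S3).
have Sj : num k.+2 (fun ws rs => size (w ws (nth 0 rs 0 :: drop 2 rs))).
  exact: (num_app (m := 2) (k := k) (num_reg (k := k.+2) (i := 0) isT) Sw).
have R1 := num_reg (k := k.+2) (i := 1) isT.
have Bj : dec k.+2 (fun ws rs => nth false (w ws (nth 0 rs 0 :: drop 2 rs)) (nth 0 rs 1 - off ws rs)).
  have B3 : num k.+3 (fun ws rs => nat_of_bool (nth false (w ws (nth 0 rs 1 :: drop 3 rs)) (nth 0 rs 0))).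
    have := @num_ren k.+2 k.+3 (0 :: 1 :: iota 3 k) _ Bw; rewrite /= size_iota => /(_ erefl) H.
    apply: num_ext (H _) => [ws rs s|]; last by apply/allP => i; rewrite mem_iota; lia.
    by rewrite -(nth_iota_map rs 3) s !subSS subn0.
  by apply: num_ext (num_let (num_sub R1 Hoff) B3) => ws rs _.
have T := dec_and (dec_and (dec_le Hoff R1) (dec_lt R1 (num_add Hoff Sj))) Bj.
apply: num_ext (num_sum (num_drop 1 Hf) T) => ws [|i rs] // _.
by rewrite /= drop0 nth_flatten_iota; apply: eq_bigr => j _; rewrite /off /= drop0.
Qed.

End Closure.

End Closure.

(** * A Turing machine simulated by a token *)

Module Tokens.
Import Cells Words.

Section Token.

Variable M : machine.
Local Notation I := ('I_(extra_tapes M).+1).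
Local Notation sym := (option (bool + aux M)).

(* A cell holds, for each tape, the symbols at a given distance to the left and
   to the right of the head.  The three other bases are the place in front of the
   word and its two end markers. *)
Definition base := (({ffun I -> sym} * {ffun I -> sym}) + 'I_3)%type.
(* The walking direction, the state, the directions in which the tapes move and
   the carried symbols; [None] announces acceptance. *)
Definition tok := option (bool * Defs.state M * {ffun I -> option bool} * {ffun I -> sym}).

Definition front : base := inr (inord 0).
Definition left_end : base := inr (inord 1).
Definition right_end : base := inr (inord 2).

Definition dir_bit (d : direction) : option bool :=
  match d with Left => Some false | Stay => None | Right => Some true end.

(* Walking right, the carried symbol is pushed on one of the two stacks of each
   moving tape; walking left, it is popped from the other one. *)
Definition act (b : base) (t : tok) : option (bool * base * tok) :=
  match b, t with
  | inl (x, y), Some (r, q, d, c) => Some (r,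
      inl ([ffun i => if d i == Some r then c i else x i],
           [ffun i => if d i == Some (~~ r) then c i else y i]),
      Some (r, q, d, [ffun i => if d i is Some m then if m == r then x i else y i else c i]))
  | inr j, Some (r, q, d, c) =>
      if (j == 1 :> nat) && ~~ r then
        if delta q c is Some (q', a) then
          Some (true, left_end, Some (true, q', [ffun i => dir_bit (a i).2], [ffun i => (a i).1]))
        else if accepting q then Some (false, left_end, None) else None
      else if (j == 2 :> nat) && r then Some (false, right_end, Some (false, q, d, c)) else None
  | _, None => None
  end.

Lemma act_front t : act front t = None.
Proof. by case: t => [[[[r q] d] c]|] //=; rewrite /front inordK. Qed.
Lemma act_right_end t b t' : act right_end t <> Some (true, b, t').
Proof. by case: t => [[[[r q] d] c]|] //=; rewrite /right_end inordK //=; case: r. Qed.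
Lemma act_class b t d b' t' : act b t = Some (d, b', t') ->
  ((b == front) = (b' == front)) /\ ((b == right_end) = (b' == right_end)).
Proof.
case: t => [[[[r q] dd] c]|]; last by case: b => [[x y]|j].
case: b => [[x y]|j] /=; first by move=> [_ <- _].
case: ifP => [/andP[/eqP j1 _]|_].
  have -> : (inr j : base) = left_end by congr inr; apply: val_inj; rewrite /= inordK.
  case: (delta q c) => [[q' a]|]; first by move=> [_ <- _].
  by case: ifP => // _ [_ <- _].
case: ifP => [/andP[/eqP j1 _]|_] // [_ <- _].
by have -> : (inr j : base) = right_end by congr inr; apply: val_inj; rewrite /= inordK.
Qed.

Variable S : nat.
Local Notation n := (S + 3).
Definition row_of (b a : I -> seq sym) (k : nat) : base :=
  inl ([ffun i => nth None (b i) k], [ffun i => nth None (a i) k]).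
(** The cells lie between two end markers, and the front precedes them; hence [S + 3] places. The
    token enters the front only on acceptance. *)
Definition word_bases (cell : nat -> base) (k : nat) : base :=
  if k == 0 then front else if k == 1 then left_end else if k - 2 < S then cell (k - 2) else right_end.

(** Between two machine steps the token is on the left marker, walking left and carrying the scanned
    symbols; [d] is left over from the step before. *)
Definition state_of (cf : configuration M) (d : {ffun I -> option bool}) : Words.state base tok :=
  State 1 (Some (false, control cf, d, [ffun i => scanned (tapes cf i)]))
    (word_bases (row_of (fun i => before (tapes cf i)) (fun i => after (tapes cf i)))).

Lemma base_neq i j : i < 3 -> j < 3 -> i != j -> (inr (inord i) : base) != inr (inord j).
Proof. by move=> il jl; apply: contraNneq => -[] /(congr1 val); rewrite /= !inordK // => ->. Qed.

Lemma state_shaped cf d : shaped front right_end n (state_of cf d).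
Proof.
split=> [|i il|i il] /=; first by lia.
- rewrite /word_bases; case: (eqVneq i 0) => [_|i0]; first by rewrite eqxx.
  by case: ifP => _; [|case: ifP => _ //]; apply: negPf; apply: base_neq.
rewrite /word_bases; case: (eqVneq i 0) => [->|i0].
  by rewrite (negPf (base_neq _ _ _)) //; apply/esym/negP; lia.
case: (eqVneq i 1) => [->|i1]; first by rewrite (negPf (base_neq _ _ _)) //; apply/esym/negP; lia.
case: ifP => iS; first by rewrite [LHS](_ : _ = false) //; apply/esym/eqP; lia.
by rewrite eqxx; apply/esym/eqP; lia.
Qed.

Definition small (cf : configuration M) : Prop :=
  forall i, size (before (tapes cf i)) <= S /\ size (after (tapes cf i)) <= S.

Lemma upd_word f j b : upd (word_bases f) j.+2 b = word_bases (upd f j b) \/ S <= j.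
Proof.
case: (leqP S j) => jS; [by right | left]; apply: functional_extensionality => k; rewrite /upd /word_bases.
case: (eqVneq k j.+2) => [->|kj]; first by rewrite subSS subSS subn0 eqxx jS.
case: (eqVneq k 0) => // k0; case: (eqVneq k 1) => // k1.
by rewrite (_ : (k - 2 == j) = false) //; apply/eqP; lia.
Qed.

Section Move.
Variables (cf : configuration M) (q : Defs.state M) (a : I -> sym * direction).
Hypothesis E : delta (control cf) [ffun i => scanned (tapes cf i)] = Some (q, a).
Let cf' : configuration M := Configuration q [ffun i => write_move (tapes cf i) (a i)].
Hypothesis small_cf : small cf.
Hypothesis small_cf' : small cf'.

Let d : {ffun I -> option bool} := [ffun i => dir_bit (a i).2].
Let half (m : bool) (i : I) := if m then before (tapes cf i) else after (tapes cf i).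
(** A moving tape pushes the written symbol on one side and pops the other: [pb] and [pa] are the
    sides after the pushes of the sweep to the right, [qb] and [qa] after the pops of the sweep
    back. *)
Let pb i := if d i == Some true then (a i).1 :: before (tapes cf i) else before (tapes cf i).
Let pa i := if d i == Some false then (a i).1 :: after (tapes cf i) else after (tapes cf i).
Let qb i := if d i == Some false then behead (before (tapes cf i)) else pb i.
Let qa i := if d i == Some true then behead (after (tapes cf i)) else pa i.

Let right_state (j : nat) : Words.state base tok :=
  State j.+2 (Some (true, q, d, [ffun i => if d i is Some m then nth None ((a i).1 :: half m i) j else (a i).1]))
   (word_bases (fun k => if k < j then row_of pb pa k else row_of (half true) (half false) k)).
Let left_state (j : nat) : Words.state base tok :=
  State j.+1 (Some (false, q, d, [ffun i => if d i is Some m then nth None (half (~~ m) i) j else (a i).1]))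
   (word_bases (fun k => if k < j then row_of pb pa k else row_of qb qa k)).

Lemma move_start d0 : nstep act (state_of cf d0) = Some (right_state 0).
Proof.
rewrite /nstep /= {1}/word_bases /= inordK //= E; congr (Some (State _ _ _)).
  congr (Some (_, _, _, _)); apply/ffunP => i; rewrite !ffunE.
  by case: (dir_bit _).
apply: functional_extensionality => k; rewrite /upd /word_bases.
by case: (eqVneq k 1) => [->|].
Qed.

Lemma move_right j : j < S -> nstep act (right_state j) = Some (right_state j.+1).
Proof.
move=> jS; rewrite /nstep /= {1}/word_bases /= subSS subSS subn0 jS ltnn /row_of.
congr (Some (State _ _ _)).
  congr (Some (_, _, _, _)); apply/ffunP => i; rewrite !ffunE /half.
  by case: (dir_bit _) => [[]|].
have [->|] := upd_word (fun k => if k < j then row_of pb pa k else row_of (half true) (half false) k) j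
  (inl ([ffun i => if d i == Some true then [ffun i0 => if d i0 is Some m then nth None ((a i0).1 :: half m i0) j else (a i0).1] i else [ffun i0 => nth None (half true i0) j] i],
        [ffun i => if d i == Some (~~ true) then [ffun i0 => if d i0 is Some m then nth None ((a i0).1 :: half m i0) j else (a i0).1] i else [ffun i0 => nth None (half false i0) j] i])); last by lia.
congr word_bases; apply: functional_extensionality => k; rewrite /upd.
case: (eqVneq k j) => [->|kj]; last by rewrite ltnS (leq_eqVlt k) (negPf kj).
rewrite ltnSn /row_of; congr (inl (_, _)); apply/ffunP => i; rewrite !ffunE /pb /pa /half !ffunE;
  by case: (dir_bit _) => [[]|].
Qed.

(** Nothing is lost at the right marker: as both configurations are small, a moving tape carries a
    blank there, before and after the turn. *)
Lemma move_turn : nstep act (right_state S) = Some (left_state S).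
Proof.
rewrite /nstep /= {1}/word_bases /= subSS subSS subn0 ltnn /= inordK //=; congr (Some (State _ _ _)).
  congr (Some (_, _, _, _)); apply/ffunP => i; rewrite !ffunE /half.
  have := small_cf' i; have := small_cf i; rewrite /= ffunE /write_move.
  by case: (a i) => x [] //= [h1 h2] [h3 h4]; rewrite !nth_default //=.
apply: functional_extensionality => k; rewrite /upd /word_bases.
case: (eqVneq k S.+2) => [->|_]; first by rewrite subSS subSS subn0 ltnn.
by case: ifP => // _; case: ifP => // _; case: ifP => // ->.
Qed.

Lemma move_left j : j < S -> nstep act (left_state j.+1) = Some (left_state j).
Proof.
move=> jS; rewrite /nstep /= {1}/word_bases /= subSS subSS subn0 jS ltnSn /row_of.
congr (Some (State _ _ _)).
  congr (Some (_, _, _, _)); apply/ffunP => i; rewrite !ffunE /half /pb /pa !ffunE.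
  by case: (dir_bit _) => [[]|].
match goal with |- upd (word_bases ?f) _ ?b = _ => have [->|] := upd_word f j b end; last by lia.
congr word_bases; apply: functional_extensionality => k; rewrite /upd.
case: (eqVneq k j) => [->|kj]; last by rewrite ltnS (leq_eqVlt k) (negPf kj).
rewrite ltnn /row_of; congr (inl (_, _)); apply/ffunP => i; rewrite !ffunE /qb /qa /pb /pa /half !ffunE;
  by case: (dir_bit _) => [[]|] //=; rewrite nth_behead.
Qed.

(** [S] steps for each sweep, and one at each marker. *)
Lemma move_steps d0 : nsteps act (S + S).+2 (state_of cf d0) = Some (state_of cf' d).
Proof.
have R j : j <= S -> nsteps act j.+1 (state_of cf d0) = Some (right_state j).
  elim: j => [|j IH] jS; first by rewrite /= move_start.
  by rewrite (nstepsS (IH (ltnW jS))) move_right.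
have L j : j <= S -> nsteps act (S + j).+2 (state_of cf d0) = Some (left_state (S - j)).
  elim: j => [|j IH] jS; first by rewrite addn0 (nstepsS (R S (leqnn S))) move_turn subn0.
  by rewrite addnS (nstepsS (IH (ltnW jS))) -subnSK // move_left //; lia.
rewrite (L S) // subnn /left_state /state_of /=; congr (Some (State _ _ _)).
  congr (Some (_, _, _, _)); apply/ffunP => i; rewrite !ffunE /half /write_move.
  by case: (a i) => x [] //=; rewrite nth0.
congr word_bases; apply: functional_extensionality => k; rewrite /row_of; congr (inl (_, _));
  apply/ffunP => i; rewrite !ffunE /qb /qa /pb /pa /write_move !ffunE; by case: (a i) => x [].
Qed.

End Move.

Lemma terminal_unique C i j C1 C2 : nsteps act i C = Some C1 -> nstep act C1 = None ->
  nsteps act j C = Some C2 -> nstep act C2 = None -> C1 = C2.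
Proof.
move=> H1 T1 H2 T2; case: (leqP i j) => ij.
  move: H2; rewrite -(subnKC ij) (nstepsD _ H1); case: (j - i) => [|k] /=; first by case.
  by rewrite T1.
move: H1; rewrite -(subnKC (ltnW ij)) (nstepsD _ H2); case: (i - j) => [|k] /=; first by case.
by rewrite T2.
Qed.

Theorem token_run x T : halted (run M x T) -> (forall t, small (run M x t)) ->
  (accepting (control (run M x T)) <->
   exists k C, nsteps act k (state_of (initial M x) [ffun=> None]) = Some C /\ place C = 0).
Proof.
move=> HT Sm.
have [k [d Hk]] : exists k d, nsteps act k (state_of (initial M x) [ffun=> None]) = Some (state_of (run M x T) d).
  elim: T {HT} => [|t [k [d Hk]]]; first by exists 0, [ffun=> None].
  have Et : run M x t.+1 = odflt (run M x t) (next (run M x t)) by rewrite /run iterS.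
  case En : (next (run M x t)) => [cf'|]; last by exists k, d; rewrite Et En.
  move: En; rewrite /next; case E: (delta _ _) => [[q a]|] // [Ec].
  exists (k + (S + S).+2); eexists; rewrite (nstepsD _ Hk).
  have Em : run M x t.+1 = Configuration q [ffun i => write_move (tapes (run M x t) i) (a i)].
    by rewrite Et /next E.
  rewrite Em; apply: (move_steps E) => //; by have := Sm t.+1; rewrite Em.
have Hs : nstep act (state_of (run M x T) d) =
    if accepting (control (run M x T)) then Some (State 0 None (bases (state_of (run M x T) d))) else None.
  rewrite /nstep /= {1}/word_bases /= inordK //=.
  move: HT; rewrite /halted /next; case: (delta _ _) => [[]|] // _; case: ifP => // _.
  congr (Some (State _ _ _)); apply: functional_extensionality => j; rewrite /upd.
  by case: (eqVneq j 1) => [->|j1] //; rewrite /word_bases (negPf j1).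
split=> [ac|[k' [C [HC C0]]]].
  rewrite ac in Hs; exists k.+1, (State 0 (None : tok) (bases (state_of (run M x T) d))).
  by split=> //; rewrite (nstepsS Hk).
(* A rejecting run leaves the token stuck at place 1, and a token at place 0 is stuck too; by
   determinism there is only one such end. *)
apply: contraT => na; rewrite (negPf na) in Hs.
have TC : nstep act C = None.
  have n1 : 1 < n by lia.
  have [[_ Hf _] _] := nsteps_reach act_front act_right_end act_class n1 (state_shaped (initial M x) [ffun=> None]) HC.
  rewrite /nstep C0; have /eqP-> : bases C 0 == front by rewrite Hf ?addn3.
  by rewrite act_front.
by move: C0; rewrite -(terminal_unique Hk Hs HC TC).
Qed.

End Token.

End Tokens.

(** * The board of an input, and its expressibility *)

Module Generator.
Import Tiles Cells Orientations Boards Macros Logic Words WordLogic Tokens Expressions Closure.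

(** The numberings give [kind] and [macro] decidable equality, so that they can be values of a
    [tab]. *)
Definition kinds : seq kind := [:: D; Dm; Dv; Y; Yv; O; Or; Z; Zm; Zv; H; V; N; E].
Definition kind_code (k : kind) : nat :=
  match k with D => 0 | Dm => 1 | Dv => 2 | Y => 3 | Yv => 4 | O => 5 | Or => 6 | Z => 7 | Zm => 8
  | Zv => 9 | H => 10 | V => 11 | N => 12 | E => 13 end.
Lemma kind_codeK : cancel kind_code (nth D kinds). Proof. by case. Qed.
HB.instance Definition _ := Equality.copy kind (can_type kind_codeK).
Definition macros : seq macro := [:: mX; mDT; mUT; mOR; mOt; mOb; mE; mN].
Definition macro_code (m : macro) : nat :=
  match m with mX => 0 | mDT => 1 | mUT => 2 | mOR => 3 | mOt => 4 | mOb => 5 | mE => 6 | mN => 7 end.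
Lemma macro_codeK : cancel macro_code (nth mX macros). Proof. by case. Qed.
HB.instance Definition _ := Equality.copy macro (can_type macro_codeK).

Notation fn T := ((nat -> seq bool) -> seq nat -> T).

Section More.
Variable nw : nat.
Local Notation num := (num nw).
Local Notation dec := (dec nw).
Local Notation tab := (tab nw).
Local Notation wrd := (wrd nw).

Lemma dec_tab k (P : fn bool) : tab k P -> dec k P.
Proof. by move=> [_ D]; apply: dec_ext (D true) => ws rs _; rewrite eqb_id. Qed.
Lemma tab_seq k (I : Type) (l : seq I) (P : I -> fn bool) : (forall a, dec k (P a)) ->
  tab k (fun ws rs => [seq P a ws rs | a <- l]).
Proof.
move=> HP; elim: l => [|a l IH]; first exact: tab_cst.
exact: (tab_map (fun x => x.1 :: x.2) (tab_pair (tab_dec (HP a)) IH)).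
Qed.
Lemma tab_mod k f d : 0 < d -> num k f -> tab k (fun ws rs => f ws rs %% d).
Proof. by move=> d0 Hf; apply: (tab_num (m := d)); [apply: num_mod | move=> *; rewrite ltn_mod]. Qed.
Lemma dec_odd k f : num k f -> dec k (fun ws rs => odd (f ws rs)).
Proof. by move=> Hf; apply: num_ext (num_mod (isT : 0 < 2) Hf) => ws rs _; rewrite modn2. Qed.
Lemma num_succ k f : num k f -> num k (fun ws rs => (f ws rs).+1).
Proof. by move=> Hf; apply: num_ext (num_add Hf (num_cst nw k 1)) => ws rs _; rewrite addn1. Qed.
Lemma num_pred k f : num k f -> num k (fun ws rs => (f ws rs).-1).
Proof. by move=> Hf; apply: num_ext (num_sub Hf (num_cst nw k 1)) => ws rs _; rewrite subn1. Qed.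
Lemma tab_drop m k (T : eqType) (f : fn T) : tab k f -> tab (m + k) (fun ws rs => f ws (drop m rs)).
Proof.
move=> [[s Hs] D]; split; last by move=> t; apply: (num_drop m (D t)).
by exists s => ws rs sr; apply: Hs; rewrite size_drop sr addKn.
Qed.
Lemma wrd_case k (T : eqType) (f : fn T) (F : T -> fn (seq bool)) : tab k f -> (forall t, wrd k (F t)) ->
  wrd k (fun ws rs => F (f ws rs) ws rs).
Proof.
move=> Hf HF; split.
  by apply: (num_case (F := fun t ws rs => size (F t ws rs)) Hf) => t; case: (HF t).
apply: (dec_case (f := fun ws rs => f ws (drop 1 rs)) (F := fun t ws rs => nth false (F t ws (drop 1 rs)) (nth 0 rs 0))).
  exact: (tab_drop 1 Hf).
by move=> t; case: (HF t).
Qed.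
Lemma wrd_nil k : wrd k (fun _ _ => [::]).
Proof. by split; [apply: num_cst | apply: (dec_ext (P := fun _ _ => false)) (dec_cst _ _ _) => ws rs _; rewrite nth_nil]. Qed.
Lemma wrd_if k P w w' : dec k P -> wrd k w -> wrd k w' -> wrd k (fun ws rs => if P ws rs then w ws rs else w' ws rs).
Proof.
move=> HP Hw Hw'; apply: (wrd_case (f := P) (F := fun b ws rs => if b then w ws rs else w' ws rs)).
  exact: tab_dec.
by case.
Qed.
Lemma wrd_encode_nat k f : num k f -> wrd k (fun ws rs => encode_nat (f ws rs)).
Proof.
move=> Hf; have B := dec_lt (num_reg nw (isT : 0 < k.+1)) (num_drop 1 Hf).
apply: wrd_ext (wrd_cat (wrd_bits Hf (dec_cst nw k.+1 true)) (wrd_seq1 (dec_cst nw k false))) => ws rs _.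
rewrite /encode_nat -cats1; congr (_ ++ _).
by apply: (@eq_from_nth _ false); rewrite ?size_mkseq ?size_nseq // => i il; rewrite nth_mkseq // nth_nseq il.
Qed.
Lemma wrd_flatten_const k (I : Type) (l : seq I) (w : I -> fn (seq bool)) : (forall i, wrd k (w i)) ->
  wrd k (fun ws rs => flatten [seq w i ws rs | i <- l]).
Proof. by move=> Hw; elim: l => [|i l IH] /=; [apply: wrd_nil | apply: wrd_cat]. Qed.
Lemma wrd_encode_car k h l f p : dec k h -> dec k l -> num k f -> num k p ->
  wrd k (fun ws rs => encode_car (Car (h ws rs) (l ws rs) (f ws rs) (p ws rs))).
Proof.
move=> Hh Hl Hf Hp.
exact: (wrd_cat (wrd_seq1 Hh) (wrd_cat (wrd_seq1 Hl) (wrd_cat (wrd_encode_nat Hf) (wrd_encode_nat Hp)))).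
Qed.
End More.

Lemma flatten_if (I J A : Type) (s : seq I) (h : I -> J) (P' : pred J) (f' : J -> seq A) (P : pred I) (f : I -> seq A) :
  (forall i, P i = P' (h i)) -> (forall i, f i = f' (h i)) ->
  flatten [seq (if P i then f i else [::]) | i <- s] = flatten [seq f' j | j <- [seq h i | i <- s] & P' j].
Proof. by move=> HP Hf; elim: s => //= i s ->; rewrite HP; case: ifP; rewrite /= ?Hf. Qed.
Lemma flatten_filter (I J A : Type) (s : seq I) (h : I -> seq J) (P' : pred J) (f' : J -> seq A) (F : I -> seq A) :
  (forall i, F i = flatten [seq f' j | j <- h i & P' j]) ->
  flatten [seq F i | i <- s] = flatten [seq f' j | j <- flatten [seq h i | i <- s] & P' j].
Proof. by move=> H; elim: s => //= i s ->; rewrite H filter_cat map_cat flatten_cat. Qed.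

Section Generator.

(** [Sp] bounds the space on an input. It has to be expressible, as it determines the length of the
    board. *)
Variables (M : machine) (Sp : seq bool -> nat).
Hypothesis Sp_num : forall k, num 1 k (fun ws _ => Sp (ws 0)).
Local Notation num := (num 1).
Local Notation dec := (dec 1).
Local Notation tab := (tab 1).
Local Notation wrd := (wrd 1).

Local Notation act := (@Tokens.act M).
Local Notation first := (front M).
Local Notation last := (right_end M).
Definition lg : nat := WordLogic.g (Tokens.base M) (Tokens.tok M).
Definition lgoal : nat := @WordLogic.goal_letter (Tokens.base M) (Tokens.tok M) first.
Definition lclauses : bool -> seq (nat * nat) := WordLogic.clauses act first last.
Definition lW : nat := WordLogic.W act first last.
Definition len (x : seq bool) : nat := Sp x + 3.
Definition token0 (x : seq bool) := Tokens.state_of (Sp x) (initial M x) [ffun=> None].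
Definition wires0 (x : seq bool) : wires := WordLogic.x_of (len x) (word_of (token0 x)).
Definition gmk (x : seq bool) := lmk (len x) lg lgoal lclauses lW.
Definition gR : nat := lg * 2.
Definition gC (x : seq bool) : nat := (len x * lW).+2.
Definition gO (x : seq bool) : orientation := Logic.state_of (len x) lg lclauses lW (wires0 x).
Definition gP (x : seq bool) : orientation :=
  P_of (gO x) (can (EH (gC x)) (EV gR) (macro_canonical (gmk x)) (gO x)).
Definition gkd (x : seq bool) := mkd (gmk x).
Definition geh (x : seq bool) := meh (gC x).
Definition gev := mev gR.
Definition grE : nat := lgoal * 2.
Definition gtgt : ident := (grE, 0, 4).
Definition gK : nat := 4 + \max_(k <- kinds) size (locals (tile_of k)).
Definition gRK : seq (nat * nat) := [seq (r, k) | r <- iota 0 (gR * 2), k <- iota 0 gK].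
(** Column by column: rows and car numbers form a constant list, so the encoding concatenates, over
    a variable number of columns, a fixed number of pieces. *)
Definition gids (x : seq bool) : seq ident :=
  flatten [seq [seq (rk.1, c, rk.2) | rk <- gRK] | c <- iota 0 (gC x * 3)].
Definition gids' (x : seq bool) : seq ident :=
  [seq i <- gids x | is_ident (gR * 2) (gC x * 3) (gkd x) (geh x) gev i && (i != gtgt)].
Definition gF (x : seq bool) := F_of (gkd x) (geh x) gev (gP x) (can (geh x) gev (canonical (gkd x)) (gP x)).
Definition game_for (x : seq bool) : game :=
  game_of (gR * 2) (gC x * 3) (gkd x) (geh x) gev gtgt (gids' x) (grE * 17 + 7, 0) (gF x).

Lemma letters_gt1 : 1 < lg.
Proof.
have N : (inl (first, None) : letters (Tokens.base M) (Tokens.tok M)) != inl (first, Some None) by apply/eqP => -[].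
rewrite /lg /WordLogic.g; have := subset_leq_card (subset_predT (pred2 (inl (first, None) : letters (Tokens.base M) (Tokens.tok M)) (inl (first, Some None)))).
by rewrite card2 N.
Qed.
Lemma lgoal_lt : lgoal < lg. Proof. exact: rank_lt. Qed.

Lemma game_for_correct x T : halted (run M x T) -> (forall t, small (Sp x) (run M x t)) ->
  valid (game_for x) /\ (solvable (game_for x) <-> accepting (control (run M x T))).
Proof.
move=> HT Sm.
have n1 : 1 < len x by rewrite /len; lia.
have sh : shaped first last (len x) (token0 x) by apply: state_shaped.
have [Xs Xg] := token_logic (@act_front M) (@act_right_end M) (@act_class M) n1 sh.
have [Lg Lr] := logic_game (ltnW n1) letters_gt1 lgoal_lt (size_clauses act first last) (@clausesP _ _ act first last) Xs.
have rl : lgoal < lg * 2 by have := lgoal_lt; lia.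
have kE : gmk x lgoal 0 = mE by rewrite /gmk /lmk !eqxx.
have [Pg Pr] := macro_game Lg rl isT kE.
have kdE : gkd x grE 0 = E by rewrite /gkd /mkd /grE mulnK // modnMl div0n kE.
have idsP i : (i \in gtgt :: gids' x) = is_ident (gR * 2) (gC x * 3) (gkd x) (geh x) gev i.
  rewrite inE mem_filter; case: (eqVneq i gtgt) => [->|_] /=.
    have r1 : grE < gR * 2 by rewrite /grE /gR; have := lgoal_lt; lia.
    by rewrite /is_ident /gtgt r1 kdE.
  rewrite andbT; case I : (is_ident _ _ _ _ _ i) => //=; move: I; case: i => [[r c] k] /and3P[rl' cl' kl].
  apply/flatten_mapP; exists c; first by rewrite mem_iota.
  apply/mapP; exists (r, k) => //; apply/allpairsP; exists (r, k); rewrite !mem_iota; split=> //=.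
  rewrite add0n /gK; case: k kl => [|[|[|[|k]]]] // kl; rewrite !ltnS in kl *.
  apply: leq_trans kl _; apply: (@leq_bigmax_seq _ kinds xpredT (fun k => size (locals (tile_of k)))) => //.
  by case: (gkd x r c).
have idsU : uniq (gtgt :: gids' x).
  rewrite /= mem_filter eqxx andbF /=; apply: filter_uniq.
  rewrite /gids; have U : uniq gRK by apply: allpairs_uniq; rewrite ?iota_uniq // => -[? ?] [? ?] _ _ [-> ->].
  elim: (iota 0 (gC x * 3)) (iota_uniq 0 (gC x * 3)) => //= c l IH /andP[cl ul].
  rewrite cat_uniq IH // andbT map_inj_uniq ?U /=; last by move=> [? ?] [? ?] [-> ->].
  apply/hasPn => -[[r c'] k] /flatten_mapP[c1 c1l /mapP[rk _ [_ -> _]]].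
  by apply/negP => /mapP[rk' _ [_ E _]]; rewrite -E c1l in cl.
have eh_lt r c : geh x r c -> c.+1 < gC x * 3 by case/andP.
have ev_lt r c : gev r c -> r.+1 < gR * 2 by case/andP.
have exc r c : gkd x r c = E -> c = 0.
  (* Only the upper left tile of the block [mE] is of kind [E]. *)
  rewrite /gkd /mkd => Ek; have [Em Er Ec] : [/\ gmk x (r %/ 2) (c %/ 3) = mE, r %% 2 = 0 & c %% 3 = 0].
    move: Ek; have := ltn_mod r 2; have := ltn_mod c 3.
    by case: (gmk _ _ _); case: (r %% 2) => [|[|a]] //; case: (c %% 3) => [|[|[|b]]] //.
  by have := lmk_exit Em; have := divn_eq c 3; rewrite Ec => ->; lia.
have rE_lt : grE < gR * 2 by rewrite /grE /gR; lia.
have [V R] := tile_game eh_lt ev_lt exc erefl idsU idsP rE_lt (isT : 0 < gC x * 3) kdE erefl erefl (erefl (gF x)) Pg.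
split=> //; rewrite (iff_trans R (iff_trans Pr (iff_trans Lr Xg))).
by apply: iff_sym; apply: token_run.
Qed.

Lemma len_num k : num k (fun ws _ => len (ws 0)).
Proof. by apply: num_add; [apply: Sp_num | apply: num_cst]. Qed.
Lemma gC_num k : num k (fun ws _ => gC (ws 0)).
Proof. by apply: num_succ; apply: num_succ; apply: num_mul; [apply: len_num | apply: num_cst]. Qed.

(** The initial token depends on the input only through its first bit, if there is one. *)
Lemma token_tab k : tab k (fun ws _ => token (token0 (ws 0))).
Proof.
have H : tab k (fun ws rs => (0 < size (ws 0), nth false (ws 0) 0)).
  apply: tab_pair; apply: tab_dec; first by apply: dec_lt; [apply: num_cst | apply: num_len].
  by apply: dec_bit => //; apply: num_cst.
apply: tab_ext (tab_map (fun ob => Some (false, start M, [ffun=> None],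
   [ffun i : 'I_(extra_tapes M).+1 => if (i == ord0) && ob.1 then Some (inl ob.2) else None]) : Tokens.tok M) H) => ws rs _.
congr (Some (_, _, _, _)); apply/ffunP => i; rewrite !ffunE /=.
by case: eqP => //= _; case: (ws 0).
Qed.

(** Place [f] shows bit [f - 1] of the input: two places precede the cells, and the first bit is
    under the head. *)
Lemma bases_tab k f : num k f -> tab k (fun ws rs => bases (token0 (ws 0)) (f ws rs)).
Proof.
move=> Hf; have H2 := num_sub Hf (num_cst 1 k 2).
apply: tab_if; first by apply: dec_eq => //; apply: num_cst.
  exact: tab_cst.
apply: tab_if; first by apply: dec_eq => //; apply: num_cst.
  exact: tab_cst.
apply: tab_if; [by apply: dec_lt => //; apply: Sp_num | | exact: tab_cst].
have H3 := num_succ H2.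
have H : tab k (fun ws rs => ((f ws rs - 2).+1 < size (ws 0), nth false (ws 0) (f ws rs - 2).+1)).
  apply: tab_pair; apply: tab_dec; first by apply: dec_lt => //; apply: num_len.
  exact: dec_bit.
apply: tab_ext (tab_map (fun ob => inl ([ffun=> None],
   [ffun i : 'I_(extra_tapes M).+1 => if (i == ord0) && ob.1 then Some (inl ob.2) else None]) : Tokens.base M) H) => ws rs _.
congr (inl (_, _)); apply/ffunP => i; rewrite !ffunE /= ?nth_nil //.
case: eqP => _ /=; last by rewrite nth_nil.
rewrite nth_behead; case: ltnP => h; first by rewrite (nth_map false).
by rewrite nth_default // size_map.
Qed.

Lemma wires_dec k f a : num k f -> dec k (fun ws rs => wires0 (ws 0) (f ws rs) a).
Proof.
move=> Hf; apply: dec_and; first by apply: dec_lt => //; apply: len_num.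
have H1 : tab k (fun ws rs => (bases (token0 (ws 0)) (f ws rs), (f ws rs == 1, token (token0 (ws 0))))).
  apply: tab_pair; first exact: bases_tab.
  by apply: tab_pair (token_tab k); apply: tab_dec; apply: dec_eq => //; apply: num_cst.
exact: (dec_tab (tab_map (fun y => a == WordLogic.rank (inl (y.1, if y.2.1 then Some y.2.2 else None))) H1)).
Qed.

Lemma lW_gt0 : 0 < lW. Proof. by rewrite /lW /WordLogic.W. Qed.

Lemma clause_tab k f : num k f -> tab k (fun ws rs => clause_at lclauses lW (f ws rs)).
Proof.
move=> Hf; have Hp := num_pred Hf.
exact: (tab_map (fun y => nth (0, 1) (lclauses y.1) y.2)
  (tab_pair (tab_dec (dec_odd (num_div lW_gt0 Hp))) (tab_mod lW_gt0 Hp))).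
Qed.
Lemma is_or_dec k f : num k f -> dec k (fun ws rs => is_or lW (f ws rs)).
Proof. by move=> Hf; apply: dec_eq (num_cst _ _ _); apply: num_mod lW_gt0 (num_pred Hf). Qed.
Lemma owner_num k f R : num k f -> num k (fun ws rs => owner lg lW R (f ws rs)).
Proof.
move=> Hf; have Hd := num_div lW_gt0 Hf; apply: num_add => //.
by apply: (dec_tab (tab_map (fun b => b != (lg <= R)) (tab_dec (dec_odd Hd)))).
Qed.
Lemma rv_dec k f R : num k f -> dec k (fun ws rs => rv_of lg lW (wires0 (ws 0)) R (f ws rs)).
Proof. by move=> Hf; apply: dec_not; apply: wires_dec; apply: owner_num. Qed.

(** Rows are constants and only the column is a variable, since the strip has constantly many rows.
    The same pattern recurs for all parts of the board. *)
Lemma gO_dec k f v R : num k f -> dec k (fun ws rs => gO (ws 0) (v, R, f ws rs)).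
Proof.
move=> Hf; case: v; last exact: rv_dec.
apply: dec_if; first by apply: dec_or; [apply: dec_eq => //; apply: num_cst | apply: dec_le; [apply: gC_num | apply: num_succ]].
  exact: dec_cst.
apply: dec_if; first exact: is_or_dec.
  have Hp := num_div lW_gt0 (num_pred Hf).
  (* The topmost wire is looked up in the finite table of values of all letters at the place. *)
  apply: dec_ext (dec_tab (tab_map (fun y : bool * seq bool => R < y.1 * lg + find id y.2) (tab_pair (tab_dec (dec_odd Hp))
    (tab_seq (iota 0 lg) (fun a => wires_dec a Hp))))) => ws rs _.
  by rewrite /ov_of /top_wire /= find_map.
have HF := dec_case (F := fun tb ws rs => (R < tb.1) || ((if rv_of lg lW (wires0 (ws 0)) tb.1 (f ws rs) then tb.2 else tb.1) <= R < tb.2)) (clause_tab Hf).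
apply: dec_ext (HF _) => [ws rs _|[t b]]; first by rewrite /th_of; case: (clause_at _ _ _).
apply: dec_or; first exact: dec_cst.
apply: dec_and (dec_cst _ _ _); apply: dec_le (num_cst _ _ _).
by apply: num_if (num_cst _ _ _) (num_cst _ _ _); apply: rv_dec.
Qed.

Lemma gmk_tab k f R : num k f -> tab k (fun ws rs => gmk (ws 0) R (f ws rs)).
Proof.
move=> Hf; have Hp := num_div lW_gt0 (num_pred Hf).
apply: tab_if; [by apply: dec_eq => //; apply: num_cst | exact: tab_cst |].
apply: tab_if; [apply: dec_eq => // | exact: tab_cst |].
  by apply: num_succ; apply: num_mul; [apply: len_num | apply: num_cst].
apply: tab_if; [exact: is_or_dec | |].
  apply: tab_if; [|exact: tab_cst | exact: tab_cst].
  exact: (dec_tab (tab_map (fun b => (lg <= R) == b) (tab_dec (dec_odd Hp)))).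
exact: (tab_map (fun c => if R == c.1 then mDT else if R == c.2 then mUT else mX) (clause_tab Hf)).
Qed.

Lemma occs_tab k (eh ev : seq bool -> nat -> nat -> bool) (o : seq bool -> orientation) R f : num k f ->
  (forall h r, num k h -> dec k (fun ws rs => eh (ws 0) r (h ws rs))) ->
  (forall h r, num k h -> dec k (fun ws rs => ev (ws 0) r (h ws rs))) ->
  (forall h v r, num k h -> dec k (fun ws rs => o (ws 0) (v, r, h ws rs))) ->
  tab k (fun ws rs => occs (eh (ws 0)) (ev (ws 0)) (o (ws 0)) R (f ws rs)).
Proof.
move=> Hf He Hv Ho; have Hp := num_pred Hf.
have H0 : dec k (fun ws rs => 0 < f ws rs) by apply: dec_lt => //; apply: num_cst.
apply: tab_pair; [apply: tab_pair; [apply: tab_pair|]|]; apply: tab_dec; apply: dec_or.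
- by apply: dec_not; apply: dec_and; [|apply: He].
- exact: Ho.
- by apply: dec_not; apply: He.
- by apply: dec_not; apply: Ho.
- by apply: dec_not; apply: dec_and (dec_cst _ _ _) _; apply: Hv.
- exact: Ho.
- by apply: dec_not; apply: Hv.
- by apply: dec_not; apply: Ho.
Qed.

Lemma gcan_tab k f R : num k f ->
  tab k (fun ws rs => can (EH (gC (ws 0))) (EV gR) (macro_canonical (gmk (ws 0))) (gO (ws 0)) R (f ws rs)).
Proof.
move=> Hf; apply: (tab_map (fun y => macro_canon y.1 y.2) (tab_pair (gmk_tab R Hf) _)).
apply: (occs_tab (eh := fun x => EH (gC x)) (ev := fun _ => EV gR)) => // [h r Hh|h r Hh|h v r].
- by apply: dec_lt; [apply: num_succ | apply: gC_num].
- exact: dec_cst.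
exact: gO_dec.
Qed.

Lemma gP_dec k f v r : num k f -> dec k (fun ws rs => gP (ws 0) (v, r, f ws rs)).
Proof.
move=> Hf; have Hd := num_div (isT : 0 < 3) Hf; have Hm := tab_mod (isT : 0 < 3) Hf.
have Hc := gcan_tab (r %/ 2) Hd; case: v.
  apply: dec_if; [exact: dec_cst | | exact: gO_dec].
  exact: (dec_tab (tab_map (fun y => nth false y.1 (4 + y.2)) (tab_pair Hc Hm))).
apply: dec_if; [exact: (dec_tab (tab_map (fun y => y == 2) Hm)) | exact: gO_dec |].
exact: (dec_tab (tab_map (fun y => nth false y.1 (2 * (r %% 2) + y.2)) (tab_pair Hc Hm))).
Qed.

Lemma gkd_tab k f r : num k f -> tab k (fun ws rs => gkd (ws 0) r (f ws rs)).
Proof.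
move=> Hf; have Hd := num_div (isT : 0 < 3) Hf; have Hm := tab_mod (isT : 0 < 3) Hf.
have H := tab_map (fun y => Macros.layout y.1 (r %% 2) y.2) (tab_pair (gmk_tab (r %/ 2) Hd) Hm).
by apply: tab_ext H.
Qed.
Lemma geh_dec k f r : num k f -> dec k (fun ws rs => geh (ws 0) r (f ws rs)).
Proof.
move=> Hf; have Hm := tab_mod (isT : 0 < 3) Hf; apply: dec_and.
  by apply: dec_lt; [apply: num_succ | apply: num_mul; [apply: gC_num | apply: num_cst]].
exact: (dec_tab (tab_map (fun y => (y != 2) || (r %% 2 == 0)) Hm)).
Qed.
Lemma gev_dec k f r : num k f -> dec k (fun ws rs => gev r (f ws rs)).
Proof.
move=> Hf; have Hm := tab_mod (isT : 0 < 3) Hf; apply: dec_and; first exact: dec_cst.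
exact: (dec_tab (tab_map (fun y => (r %% 2 == 0) || (y == 1)) Hm)).
Qed.

(* Everything that determines the cars of one tile. *)
Definition tile_data := (kind * bool * bool * bool * bool * seq nat * bool * bool)%type.
Definition data_of (x : seq bool) (r c : nat) : tile_data :=
  (gkd x r c, geh x r c, gev r c, left_active (geh x) r c, top_active gev r c,
   can (geh x) gev (canonical (gkd x)) (gP x) r c, gP x (false, r, c), gP x (true, r, c)).

Lemma data_tab k f r : num k f -> tab k (fun ws rs => data_of (ws 0) r (f ws rs)).
Proof.
move=> Hf; have H0 : dec k (fun ws rs => 0 < f ws rs) by apply: dec_lt => //; apply: num_cst.
do ![apply: tab_pair].
- exact: gkd_tab.
- by apply: tab_dec; apply: geh_dec.
- by apply: tab_dec; apply: gev_dec.
- by apply: tab_dec; apply: dec_and => //; apply: geh_dec; apply: num_pred.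
- by apply: tab_dec; apply: dec_and (dec_cst _ _ _) _; apply: gev_dec.
- apply: (tab_map (fun y => canon (tile_of y.1) y.2) (tab_pair (gkd_tab r Hf) _)).
  apply: (occs_tab (eh := geh) (ev := fun _ => gev)) => // [h r' Hh|h r' Hh|h v r'].
  + exact: geh_dec.
  + exact: gev_dec.
  exact: gP_dec.
- by apply: tab_dec; apply: gP_dec.
by apply: tab_dec; apply: gP_dec.
Qed.

Definition data_slid (t : tile_data) (k : nat) : slider :=
  let: (kd, eh, ev, _, _, _, _, _) := t in
  match k with
  | 0 => Slider true eh 8 15 (15 + eh)
  | 1 => Slider false ev 8 15 (15 + ev)
  | 2 => Slider true false 8 0 0
  | 3 => Slider false false 8 0 0
  | k'.+4 => nth (h2 0 0 0) (locals (tile_of kd)) k'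
  end.
Definition data_pos (t : tile_data) (k : nat) : nat :=
  let: (kd, eh, ev, _, _, s, or, ob) := t in
  match k with
  | 0 => 15 + (eh && or)
  | 1 => 15 + (ev && ob)
  | 2 | 3 => 0
  | k'.+4 => if k' < size (movers (tile_of kd)) then nth 0 s k' else lo (data_slid t k)
  end.
Definition data_in (t : tile_data) (k : nat) : bool :=
  let: (kd, _, _, la, ta, _, _, _) := t in
  match k with
  | 0 | 1 => true
  | 2 => ~~ la
  | 3 => ~~ ta
  | k'.+4 => k' < size (locals (tile_of kd))
  end.
Definition data_car (t : tile_data) (r c k : nat) : car :=
  let s := data_slid t k in
  Car (is_h s) (is_long s) ((if is_h s then r else c) * 17 + track s)
    ((if is_h s then c else r) * 17 + data_pos t k).

Lemma data_carE x r c k : at_pos (gs (gkd x) (geh x) gev (r, c, k)) (gF x (r, c, k)) = data_car (data_of x r c) r c k.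
Proof.
have Es : slid (gkd x) (geh x) gev (r, c, k) = data_slid (data_of x r c) k by case: k => [|[|[|[|k]]]].
have Ep : lpos (gkd x) (geh x) gev (can (geh x) gev (canonical (gkd x)) (gP x)) (r, c, k) (gP x) = data_pos (data_of x r c) k.
  by case: k {Es} => [|[|[|[|k]]]].
rewrite /gF /F_of Ep /gbase /gs Es /data_car /shift /base.
by case: (data_slid _ _) => [[] l t a b].
Qed.

Lemma data_car_wrd f r k : num 1 f -> wrd 1 (fun ws rs => encode_car (data_car (data_of (ws 0) r (f ws rs)) r (f ws rs) k)).
Proof.
move=> Hf; apply: (wrd_case (F := fun t ws rs => encode_car (data_car t r (f ws rs) k)) (data_tab r Hf)) => t.
apply: wrd_encode_car; try exact: dec_cst.
  apply: num_add; last exact: num_cst.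
  by apply: num_mul (num_cst _ _ _); case: (is_h _); [apply: num_cst |].
apply: num_add; last exact: num_cst.
by apply: num_mul (num_cst _ _ _); case: (is_h _); [|apply: num_cst].
Qed.

(** An identifier that is the target or names no car contributes the empty word, which turns the
    filter of [gids'] into a conditional. *)
Theorem game_for_wrd : wrd 0 (fun ws _ => encode (game_for (ws 0))).
Proof.
have C3 : num 0 (fun ws _ => gC (ws 0) * 3) by apply: num_mul; [apply: gC_num | apply: num_cst].
have Hr := num_reg 1 (isT : 0 < 1).
have T0 : wrd 0 (fun ws rs => encode_car (data_car (data_of (ws 0) grE 0) grE 0 4)).
  apply: (wrd_case (F := fun t ws rs => encode_car (data_car t grE 0 4)) (data_tab grE (num_cst 1 0 0))) => t.
  by apply: wrd_encode_car; [apply: dec_cst | apply: dec_cst | apply: num_cst | apply: num_cst].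
have B : wrd 1 (fun ws rs => flatten [seq (if [&& rk.1 < gR * 2, nth 0 rs 0 < gC (ws 0) * 3,
      data_in (data_of (ws 0) rk.1 (nth 0 rs 0)) rk.2 & (rk.1, nth 0 rs 0, rk.2) != gtgt]
    then encode_car (data_car (data_of (ws 0) rk.1 (nth 0 rs 0)) rk.1 (nth 0 rs 0) rk.2) else [::]) | rk <- gRK]).
  apply: wrd_flatten_const => -[r k] /=; apply: wrd_if; [|exact: data_car_wrd | exact: wrd_nil].
  apply: dec_and; first exact: dec_cst.
  apply: dec_and; first by apply: dec_lt => //; apply: num_mul; [apply: gC_num | apply: num_cst].
  apply: dec_and; first exact: (dec_tab (tab_map (fun t => data_in t k) (data_tab r Hr))).
  apply: dec_not; apply: (dec_ext (P := fun ws rs => ((r == grE) && (k == 4)) && (nth 0 rs 0 == 0))).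
    by move=> ws rs _; rewrite !xpair_eqE andbAC.
  by apply: dec_and (dec_cst _ _ _) _; apply: dec_eq => //; apply: num_cst.
apply: wrd_ext (wrd_cat (wrd_encode_nat (num_cst 1 0 (gR * 2 * 17))) (wrd_cat (wrd_encode_nat (num_mul C3 (num_cst 1 0 17)))
  (wrd_cat (wrd_encode_nat (num_cst 1 0 (grE * 17 + 7))) (wrd_cat (wrd_encode_nat (num_cst 1 0 0))
  (wrd_cat T0 (wrd_flatten C3 B)))))) => ws rs _.
rewrite -data_carE; set t := encode_car _.
have -> : encode (game_for (ws 0)) = encode_nat (gR * 2 * 17) ++ encode_nat (gC (ws 0) * 3 * 17) ++
    encode_nat (grE * 17 + 7) ++ encode_nat 0 ++ t ++ flatten [seq encode_car c | c <-
      [seq at_pos (gs (gkd (ws 0)) (geh (ws 0)) gev i) (gF (ws 0) i) | i <- gids' (ws 0)]] by [].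
congr (_ ++ (_ ++ (_ ++ (_ ++ (_ ++ _))))).
rewrite -map_comp /gids' /gids; apply: flatten_filter => c.
apply: flatten_if => -[r k]; last by rewrite /= -data_carE.
have -> : is_ident (gR * 2) (gC (ws 0) * 3) (gkd (ws 0)) (geh (ws 0)) gev (r, c, k) =
  [&& r < gR * 2, c < gC (ws 0) * 3 & data_in (data_of (ws 0) r c) k] by case: k => [|[|[|[|k]]]].
by rewrite -!andbA.
Qed.

End Generator.

End Generator.

(** * Reachability by halving, for configurations of a game *)

Module Savitch.
Import Cells.

Section Savitch.

Variables (C : Type) (near : C -> C -> bool) (width : nat) (decode : seq bool -> C).
Hypothesis near_refl : forall A B, near A B -> near A A /\ near B B.
(** Configurations will be functions on all numbers, so a word represents one only up to its
    behaviour under [near]. *)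
Hypothesis near_word : forall A, near A A -> exists2 w, size w = width &
  forall B, (near A B = near (decode w) B) /\ (near B A = near B (decode w)).

Fixpoint halving (d : nat) (A B : C) : Prop :=
  if d is d'.+1 then exists2 w, size w = width & halving d' A (decode w) /\ halving d' (decode w) B
  else near A B.

Lemma halving_reach d A B : halving d A B -> clos_refl_trans _ near A B.
Proof.
elim: d A B => [|d IH] A B /=; first exact: rt_step.
by move=> [w _ [/IH H1 /IH H2]]; apply: rt_trans H1 H2.
Qed.

Lemma halving_eqv d A A' B B' : (forall D, near A D = near A' D) -> (forall D, near D B = near D B') ->
  halving d A B -> halving d A' B'.
Proof.
elim: d A A' B B' => [|d IH] A A' B B' HA HB /=; first by rewrite -HB -HA.
by move=> [w sw [H1 H2]]; exists w => //; split; [apply: IH H1 | apply: IH H2].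
Qed.

(** Short paths need no padding by hand: [near] is reflexive on the points of a path, so either half
    may be empty. *)
Lemma path_halving d (x : width.-tuple bool) (p : seq (width.-tuple bool)) :
  near (decode x) (decode x) -> path (fun u v : width.-tuple bool => near (decode u) (decode v)) x p ->
  size p <= 2 ^ d -> halving d (decode x) (decode (last x p)).
Proof.
elim: d x p => [|d IH] x p nx; first by case: p => [|y [|z p]] //= /andP[].
rewrite -{1}(cat_take_drop (2 ^ d) p) cat_path => /andP[P1 P2] sp /=.
set y := last x (take (2 ^ d) p) in P2.
have ny : near (decode y) (decode y).
  rewrite /y; case/lastP: (take _ _) P1 => //= q z; rewrite last_rcons rcons_path => /andP[_ H].
  by case: (near_refl H).
exists y; first by rewrite size_tuple.
split; first by apply: IH => //; rewrite size_take_min geq_minl.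
rewrite -(cat_take_drop (2 ^ d) p) last_cat -/y; apply: IH => //.
by rewrite size_drop; move: sp; rewrite expnS; lia.
Qed.

(** A path without repetitions visits at most [2 ^ width] words, so [width] halvings suffice. *)
Lemma reach_halving A B : near A A -> clos_refl_trans _ near A B -> halving width A B.
Proof.
move=> nA R; have [w sw Hw] := near_word nA.
pose t0 : width.-tuple bool := Tuple (introT eqP sw).
pose e (u v : width.-tuple bool) := near (decode u) (decode v).
have [u [nB cu Hu]] : exists u : width.-tuple bool, [/\ near B B, connect e t0 u &
    forall D, (near B D = near (decode u) D) /\ (near D B = near D (decode u))].
  elim: (Operators_Properties.clos_rt_rtn1 _ _ _ _ R) => [|B1 B2 n12 _ [u [n1 cu Hu]]].
    by exists t0; split=> //; apply: connect0.
  have [_ n2] := near_refl n12; have [w2 sw2 Hw2] := near_word n2.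
  exists (Tuple (introT eqP sw2)); split=> //.
  by apply: connect_trans cu (connect1 _); rewrite /e /= -(Hu _).1 -(Hw2 _).2.
have nt : near (decode t0) (decode t0) by rewrite /= -(Hw _).1 -(Hw _).2.
case/connectP: cu => p0 pp0 Eu; case/shortenP: pp0 Eu => p pp up _ Eu.
apply: (halving_eqv (A := decode t0) (B := decode u)) => [D|D|]; [by rewrite -(Hw D).1 | by rewrite -(Hu D).2|].
rewrite Eu; apply: path_halving => //.
have := max_card (mem (t0 :: p)); rewrite (card_uniqP up) card_tuple card_bool /=; exact: ltnW.
Qed.

End Savitch.

Section Config.

Variable G : game.
Local Notation cars := (target G :: others G).
Local Notation m := (size cars).
Definition conf := nat -> nat.
Definition with_pos (A : conf) : seq car := [seq slide_to (nth (target G) cars j) (A j) | j <- iota 0 m].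
(** A single car moves by one cell, or none moves; the latter makes the relation reflexive on legal
    placements. *)
Definition near (A B : conf) : bool :=
  [&& placement G (with_pos A), placement G (with_pos B) &
      \sum_(j < m) ((A j - B j) + (B j - A j)) <= 1].
Definition start_conf : conf := fun j => pos (nth (target G) cars j).

Lemma slide_pos c : slide_to c (pos c) = c. Proof. by case: c. Qed.
Lemma slide_slide c p q : slide_to (slide_to c p) q = slide_to c q. Proof. by []. Qed.

Lemma with_start : with_pos start_conf = cars.
Proof.
rewrite /with_pos (eq_map (g := nth (target G) cars)) => [|j]; last exact: slide_pos.
exact: (mkseq_nth (target G) cars).
Qed.

Lemma with_split A j p : j < m -> with_pos (upd A j p) =
  [seq slide_to (nth (target G) cars i) (A i) | i <- iota 0 j] ++ slide_to (nth (target G) cars j) p ::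
  [seq slide_to (nth (target G) cars i) (A i) | i <- iota j.+1 (m - j.+1)].
Proof.
move=> jm; rewrite /with_pos -{1}(subnKC (ltnW jm)) iotaD map_cat add0n -(subnSK jm) /= /upd eqxx.
congr (_ ++ _ :: _); apply/eq_in_map => i; rewrite mem_iota => H; rewrite ifN //; apply/eqP; lia.
Qed.

Lemma near_refl A B : near A B -> near A A /\ near B B.
Proof.
move=> /and3P[p1 p2 _]; rewrite /near p1 p2 /=.
by split; rewrite big1 // => i _; rewrite subnn.
Qed.

Lemma dist_upd A j p q : j < m -> \sum_(i < m) ((upd A j p i - upd A j q i) + (upd A j q i - upd A j p i)) =
  (p - q) + (q - p).
Proof.
move=> jm; rewrite (bigD1 (Ordinal jm)) //= big1 ?addn0 => [|i]; first by rewrite /upd eqxx.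
by rewrite -val_eqE /= /upd => /negPf->; rewrite subnn.
Qed.

Lemma near_walk A j q : j < m ->
  (forall p, minn (A j) q <= p <= maxn (A j) q -> placement G (with_pos (upd A j p))) ->
  clos_refl_trans _ near A (upd A j q).
Proof.
move=> jm H; have HA : upd A j (A j) = A by apply: functional_extensionality => i; rewrite /upd; case: eqP => [->|].
have step p p' : minn (A j) q <= p <= maxn (A j) q -> minn (A j) q <= p' <= maxn (A j) q ->
    (p - p') + (p' - p) <= 1 -> near (upd A j p) (upd A j p').
  by move=> h1 h2 h3; rewrite /near !H // dist_upd.
rewrite -{1}HA; case: (leqP (A j) q) => Aq.
  have up k : A j + k <= q -> clos_refl_trans _ near (upd A j (A j)) (upd A j (A j + k)).
    elim: k => [|k IH] kq; first by rewrite addn0; apply: rt_refl.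
    by apply: rt_trans (IH _) _; [lia | apply: rt_step; apply: step; lia].
  by have := up (q - A j); rewrite subnKC //; apply.
have down k : k <= A j - q -> clos_refl_trans _ near (upd A j (A j)) (upd A j (A j - k)).
  elim: k => [|k IH] kq; first by rewrite subn0; apply: rt_refl.
  by apply: rt_trans (IH _) _; [lia | apply: rt_step; apply: step; lia].
by have := down (A j - q) (leqnn _); rewrite subKn // ltnW.
Qed.

Lemma near_move A B : near A B -> clos_refl_trans _ (move G) (with_pos A) (with_pos B).
Proof.
move=> /and3P[p1 p2 H].
case: (boolP [forall i : 'I_m, A i == B i]) => [/forallP E|].
  rewrite (_ : with_pos B = with_pos A); first exact: rt_refl.
  apply/eq_in_map => i; rewrite mem_iota /= => il; have /eqP := E (Ordinal il).
  by move=> /= ->.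
rewrite negb_forall => /existsP[j Nj].
rewrite (bigD1 j) //= in H.
set Sg := \sum_(i < _ | _) _ in H.
have d0 : 0 < (A j - B j) + (B j - A j) by move: Nj; rewrite neq_ltn addn_gt0 !subn_gt0 orbC.
have Sg0 : Sg == 0 by rewrite -leqn0 -(leq_add2l ((A j - B j) + (B j - A j))) addn0; apply: leq_trans H _.
have {}H : (A j - B j) + (B j - A j) <= 1 by apply: leq_trans H; apply: leq_addr.
have E i : i < m -> i != j :> nat -> A i = B i.
  move=> il ij; move: Sg0; rewrite /Sg sum_nat_eq0 => /forallP/(_ (Ordinal il))/implyP.
  by rewrite -val_eqE /= => /(_ ij)/eqP; lia.
have jm := ltn_ord j.
have EA : with_pos A = with_pos (upd A j (A j)).
  by apply/eq_in_map => i _; rewrite /upd; case: eqP => [->|].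
have EB : with_pos B = with_pos (upd A j (B j)).
  apply/eq_in_map => i; rewrite mem_iota /= => il; rewrite /upd; case: eqP => [->|/eqP ij] //.
  by rewrite -E.
apply: rt_step; rewrite EA EB !with_split //; do 4! eexists; split; [reflexivity | reflexivity |].
move=> p Hp; rewrite slide_slide -with_split //.
have [->|->] : p = A j \/ p = B j by move: Hp H; rewrite /=; lia.
  by rewrite -EA.
by rewrite -EB.
Qed.

Lemma solvable_near : placement G cars -> (solvable G <->
  exists B, clos_refl_trans _ near start_conf B /\ exit G \in cells (slide_to (target G) (B 0))).
Proof.
move=> P0; split=> [[t [s [R et]]]|[B [R eB]]]; last first.
  exists (slide_to (target G) (B 0)), (behead (with_pos B)); split=> //.
  rewrite -[_ :: behead _]/(with_pos B) -{1}with_start.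
  elim: (Operators_Properties.clos_rt_rtn1 _ _ _ _ R) => [|B1 B2 n12 _ IH]; first exact: rt_refl.
  exact: rt_trans IH (near_move n12).
have [A [EA RA _]] : exists A, [/\ t :: s = with_pos A, clos_refl_trans _ near start_conf A & placement G (with_pos A)].
  elim: (Operators_Properties.clos_rt_rtn1 _ _ _ _ R) => [|s1 s2 [l1 [c [l2 [q [E1 E2 H]]]]] _ [A [EA RA PA]]].
    by exists start_conf; rewrite with_start; split=> //; apply: rt_refl.
  have sz : size (with_pos A) = m by rewrite size_map size_iota.
  have jm : size l1 < m by rewrite -sz -EA E1 size_cat /= addnS ltnS leq_addr.
  have HA : upd A (size l1) (A (size l1)) = A by apply: functional_extensionality => i; rewrite /upd; case: eqP => [->|].
  have S := with_split A (A (size l1)) jm; rewrite HA -EA E1 in S.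
  have [El [Ec E3]] : l1 = [seq slide_to (nth (target G) cars i) (A i) | i <- iota 0 (size l1)] /\
     c = slide_to (nth (target G) cars (size l1)) (A (size l1)) /\
     l2 = [seq slide_to (nth (target G) cars i) (A i) | i <- iota (size l1).+1 (m - (size l1).+1)].
    have e1 := congr1 (take (size l1)) S; rewrite !take_size_cat ?size_map ?size_iota // in e1.
    have e2 := congr1 (drop (size l1)) S; rewrite !drop_size_cat ?size_map ?size_iota // in e2.
    by case: e2.
  have Ep p : l1 ++ slide_to c p :: l2 = with_pos (upd A (size l1) p).
    by rewrite with_split // -El -E3 Ec slide_slide.
  exists (upd A (size l1) q); rewrite -Ep E2; split=> //.
    apply: rt_trans RA (near_walk jm _) => p; rewrite -Ep => Hp; apply: H.
    by rewrite Ec.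
  by apply: H; rewrite leq_max leqnn orbT geq_min leqnn orbT.
by exists A; split=> //; case: EA => <-.
Qed.

End Config.

End Savitch.

(** * Guessing a game and its configurations as a bit string *)

Module Guessing.
Import Cells Quantified Savitch.

(* Numbers are guessed in unary: a block of [n] bits stands for its number of ones. *)
Definition ones (n : nat) (u : seq bool) (a : nat) : nat := \sum_(b < n) nth false u (a + b).

Lemma ones_le n u a : ones n u a <= n.
Proof.
rewrite -[X in _ <= X]card_ord -sum1_card; apply: leq_sum => i _; exact: leq_b1.
Qed.

Lemma ones_cat n u v a : a + n <= size u -> ones n (u ++ v) a = ones n u a.
Proof. by move=> H; apply: eq_bigr => i _; rewrite nth_cat ifT //; have := ltn_ord i; lia. Qed.

Definition block (n v : nat) : seq bool := nseq v true ++ nseq (n - v) false.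

Lemma size_block n v : v <= n -> size (block n v) = n.
Proof. by move=> H; rewrite size_cat !size_nseq subnKC. Qed.

Lemma size_blocks n (s : seq nat) : all (leq^~ n) s -> size (flatten [seq block n v | v <- s]) = size s * n.
Proof. by elim: s => //= v s IH /andP[vn /IH E]; rewrite size_cat size_block // E mulSn. Qed.

Lemma ones_blocks n (s : seq nat) t : all (leq^~ n) s -> t < size s ->
  ones n (flatten [seq block n v | v <- s]) (t * n) = nth 0 s t.
Proof.
elim: s t => //= v s IH [|t] /andP[vn sn] tl.
  rewrite mul0n ones_cat ?size_block // /ones /=.
  have -> : \sum_(b < n) nth false (block n v) (0 + b) = \sum_(0 <= b < n) (b < v).
    rewrite big_mkord; apply: eq_bigr => i _; rewrite add0n nth_cat size_nseq nth_nseq.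
    by case: ltnP => // h; rewrite nth_nseq if_same.
  rewrite (@big_cat_nat _ _ _ v) //= big_nat_cond (eq_bigr (fun=> 1)) => [|i /andP[/andP[_ ->]]] //.
  rewrite -big_nat_cond sum_nat_const_nat subn0 muln1 big_nat_cond big1 ?addn0 // => i /andP[/andP[h _] _].
  by rewrite ltnNge h.
rewrite [RHS]/= -IH //; apply: eq_bigr => i _; rewrite nth_cat size_block // mulSn.
by rewrite ifN -?leqNgt; [congr (nat_of_bool (nth _ _ _)); lia | lia].
Qed.

Section Guess.

Variable n : nat.

(** The guess is a row of blocks of [n] bits: rows, columns, the two exit coordinates, the number of
    cars, four numbers for each of up to [n] cars, and [n] final positions. *)
Definition car_of (u : seq bool) (j : nat) : car :=
  Car (0 < ones n u ((5 + 4 * j) * n)) (0 < ones n u ((5 + 4 * j + 1) * n))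
      (ones n u ((5 + 4 * j + 2) * n)) (ones n u ((5 + 4 * j + 3) * n)).
Definition cars_num (u : seq bool) : nat := ones n u (4 * n).
Definition game_of (u : seq bool) : game :=
  Game (ones n u 0) (ones n u n) (ones n u (2 * n), ones n u (3 * n)) (car_of u 0)
    [seq car_of u j | j <- iota 1 (cars_num u).-1].
Definition first_conf (u : seq bool) : conf := fun j => ones n u ((5 + 4 * j + 3) * n).
Definition goal_conf (u : seq bool) : conf := fun j => ones n u ((5 + 4 * n + j) * n).
Definition decode (w : seq bool) : conf := fun j => ones n w (j * n).
Definition head_size : nat := (5 + 5 * n) * n.
(** A midpoint of [n] blocks of [n] bits, and the bit that chooses a half. *)
Definition level_size : nat := n * n + 1.

Lemma cars_game u : 0 < cars_num u -> target (game_of u) :: others (game_of u) = [seq car_of u j | j <- iota 0 (cars_num u)].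
Proof. by rewrite /game_of /=; case: (cars_num u). Qed.
Lemma size_cars_game u : 0 < cars_num u -> size (target (game_of u) :: others (game_of u)) = cars_num u.
Proof. by move=> m0; rewrite cars_game // size_map size_iota. Qed.
Lemma nth_cars_game u j : j < cars_num u -> nth (target (game_of u)) (target (game_of u) :: others (game_of u)) j = car_of u j.
Proof. by move=> jm; rewrite cars_game ?(leq_ltn_trans _ jm) // (nth_map 0) ?size_iota // nth_iota. Qed.

Lemma near_eq G A A' B B' : (forall j, j < size (target G :: others G) -> A j = A' j) ->
  (forall j, j < size (target G :: others G) -> B j = B' j) -> near G A B = near G A' B'.
Proof.
move=> HA HB; rewrite /near.
have W A1 A2 : (forall j, j < size (target G :: others G) -> A1 j = A2 j) -> with_pos G A1 = with_pos G A2.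
  by move=> H; apply/eq_in_map => j; rewrite mem_iota => jl; rewrite H.
rewrite (W A A') // (W B B') //; congr [&& _, _ & _ <= 1]; apply: eq_bigr => i _; rewrite HA ?HB //.
Qed.

Lemma game_of_cat u v : size u = head_size ->
  [/\ game_of (u ++ v) = game_of u, cars_num (u ++ v) = cars_num u,
      forall j, j < n -> first_conf (u ++ v) j = first_conf u j &
      forall j, j < n -> goal_conf (u ++ v) j = goal_conf u j].
Proof.
move=> su; have H t : t < 5 + 5 * n -> ones n (u ++ v) (t * n) = ones n u (t * n).
  by move=> tl; apply: ones_cat; rewrite su /head_size -mulSnr leq_mul2r; apply/orP; right.
have Em : cars_num (u ++ v) = cars_num u by apply: H; lia.
have C j : (j < n) || (j == 0) -> car_of (u ++ v) j = car_of u j.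
  case: (posnP n) => [n0|n0] jn; first by rewrite /car_of /ones n0 !big_ord0.
  by rewrite /car_of !H //; lia.
split=> // [|j jn|j jn]; [|by apply: H; lia|by apply: H; lia].
rewrite /game_of Em C ?orbT //; have H0 := H 0; have H1 := H 1; rewrite mul0n mul1n in H0 H1.
rewrite H0 // H1 // !H //; congr Game; apply/eq_in_map => j; rewrite mem_iota => jl; apply: C.
by have := ones_le n u (4 * n); rewrite -/(cars_num u); lia.
Qed.

(** [ok] restricts the number of rows, to a fixed value or not at all. *)
Variables (ok : pred nat) (x : seq bool).
Hypothesis size_x : size x = n.

Definition head_ok (u : seq bool) : bool :=
  [&& 0 < cars_num u, x == encode (game_of u), valid (game_of u), ok (rows (game_of u)) &
      exit (game_of u) \in cells (slide_to (target (game_of u)) (goal_conf u 0))].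

Definition language_of (y : seq bool) : Prop := exists G, [/\ y = encode G, valid G, ok (rows G) & solvable G].

Lemma near_bound G A j : near G A A -> j < size (target G :: others G) -> A j < maxn (rows G) (cols G).
Proof.
move=> /and3P[/andP[+ _] _ _] jm; move/allP => H.
have : (if horizontal (nth (target G) (target G :: others G) j) then (lane (nth (target G) (target G :: others G) j), A j)
   else (A j, lane (nth (target G) (target G :: others G) j))) \in flatten [seq cells c | c <- with_pos G A].
  rewrite /with_pos -map_comp; apply/flatten_mapP; exists j; first by rewrite mem_iota.
  by rewrite /cells /=; case: (long _); rewrite inE eqxx.
by move/H; rewrite /on_board leq_max; case: ifP => _ /= /andP[h1 h2]; rewrite ?h1 ?h2 ?orbT.
Qed.

Lemma near_word u : 0 < cars_num u -> forall A, near (game_of u) A A -> exists2 w, size w = n * n &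
  forall B, (near (game_of u) A B = near (game_of u) (decode w) B) /\
            (near (game_of u) B A = near (game_of u) B (decode w)).
Proof.
move=> m0 A nA; pose s := mkseq (fun j => if j < cars_num u then A j else 0) n.
have An j : j < cars_num u -> A j <= n.
  move=> jm; have := near_bound nA (j := j); rewrite size_cars_game // => /(_ jm) H.
  have h1 := ones_le n u 0; have h2 := ones_le n u n.
  by rewrite ltnW // (leq_trans H) // geq_max /= h1 h2.
have sn : all (leq^~ n) s by apply/(all_nthP 0) => j; rewrite size_mkseq => jn; rewrite nth_mkseq //; case: ifP => // /An.
exists (flatten [seq block n v | v <- s]); first by rewrite size_blocks // size_mkseq.
have E j : j < size (target (game_of u) :: others (game_of u)) -> A j = decode (flatten [seq block n v | v <- s]) j.
  rewrite size_cars_game // => jm; have jn : j < n by apply: leq_trans jm (ones_le _ _ _).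
  by rewrite /decode ones_blocks ?size_mkseq // nth_mkseq // jm.
by move=> B; split; apply: near_eq.
Qed.

Lemma guess_sound u : head_ok u -> halving (near (game_of u)) (n * n) decode (n * n) (first_conf u) (goal_conf u) ->
  language_of x.
Proof.
move=> /and5P[m0 /eqP Ex V Ok Eg] Hv; have R := halving_reach Hv; exists (game_of u); split=> //.
have P0 : placement (game_of u) (target (game_of u) :: others (game_of u)) by case/andP: V.
apply/(solvable_near P0); exists (goal_conf u); split=> //.
have S j : j < size (target (game_of u) :: others (game_of u)) -> start_conf (game_of u) j = first_conf u j.
  by rewrite size_cars_game // => jm; rewrite /start_conf nth_cars_game.
have nS : near (game_of u) (start_conf (game_of u)) (first_conf u).
  rewrite (near_eq (A' := start_conf (game_of u)) (B' := start_conf (game_of u))) => // [|j jl]; last by rewrite S.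
  rewrite /near !with_start P0 /= big1 // => i _; by rewrite subnn.
exact: rt_trans (rt_step _ _ _ _ nS) R.
Qed.

Lemma size_encode_nat v : size (encode_nat v) = v.+1. Proof. by rewrite size_rcons size_nseq. Qed.

(** Numbers are encoded in unary, so each of them, and the number of cars, is at most the length [n]
    of the input; this is why blocks of [n] bits suffice. *)
Lemma encode_bounds G : x = encode G ->
  [/\ rows G <= n, cols G <= n, (exit G).1 <= n, (exit G).2 <= n & size (target G :: others G) <= n] /\
  forall j, j < size (target G :: others G) -> lane (nth (target G) (target G :: others G) j) <= n /\
     pos (nth (target G) (target G :: others G) j) <= n.
Proof.
move=> E; have S : n = (rows G).+1 + ((cols G).+1 + ((exit G).1.+1 + ((exit G).2.+1 +
    size (flatten [seq encode_car c | c <- target G :: others G])))).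
  by rewrite -size_x E /encode !size_cat !size_encode_nat.
have F s : size s <= size (flatten [seq encode_car c | c <- s]) /\ forall j, j < size s ->
   lane (nth (target G) s j) + pos (nth (target G) s j) <= size (flatten [seq encode_car c | c <- s]).
  elim: s => [//|c s [IH1 IH2]] /=; rewrite !size_cat !size_encode_nat.
  split=> [|[|j] jl] /=; first by lia.
    by lia.
  by have := IH2 j jl; lia.
move: S; have [F1 F2] := F (target G :: others G); move: (size (flatten _)) F1 F2 => Z F1 F2 S.
split; first by split; lia.
by move=> j /F2; lia.
Qed.

Lemma guess_complete : language_of x -> exists u, [/\ size u = head_size, head_ok u &
  halving (near (game_of u)) (n * n) decode (n * n) (first_conf u) (goal_conf u)].
Proof.
move=> [G [Ex V Ok So]]; have P0 : placement G (target G :: others G) by case/andP: V.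
have [[b1 b2 b3 b4 b5] bc] := encode_bounds Ex.
have /(solvable_near P0)[B [R eB]] := So.
have nS : near G (start_conf G) (start_conf G).
  by rewrite /near !with_start P0 /= big1 // => i _; rewrite subnn.
have nB : near G B B.
  by elim: (Operators_Properties.clos_rt_rtn1 _ _ _ _ R) => [|B1 B2 n12 _ _] //; case: (near_refl n12).
set cs := target G :: others G in b5 bc *; set m := size cs in b5 bc.
have m0 : 0 < m by [].
have Bn j : j < m -> B j <= n.
  by move=> jm; apply: ltnW; apply: leq_trans (near_bound nB jm) _; rewrite geq_max b1 b2.
pose cv j : seq nat := let c := nth (target G) cs j in
  if j < m then [:: nat_of_bool (horizontal c); nat_of_bool (long c); lane c; pos c] else [:: 0; 0; 0; 0].
pose val t := if t < 5 then nth 0 [:: rows G; cols G; (exit G).1; (exit G).2; m] t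
  else if t < 5 + 4 * n then nth 0 (cv ((t - 5) %/ 4)) ((t - 5) %% 4)
  else if t - (5 + 4 * n) < m then B (t - (5 + 4 * n)) else 0.
pose s := mkseq val (5 + 5 * n).
have n0 : 0 < n by apply: leq_trans b5.
have sn : all (leq^~ n) s.
  apply/(all_nthP 0) => t; rewrite size_mkseq => tl; rewrite nth_mkseq // /val.
  case: ifP => [|_]; first by case: t {tl} => [|[|[|[|[|t]]]]] //=.
  case: ifP => _; last by case: ifP => // /Bn.
  rewrite /cv; case: ifP => [jm|_]; last by case: (_ %% _) => [|[|[|[|[|?]]]]].
  have [c1 c2] := bc _ jm.
  case: (_ %% 4) => [|[|[|[|k]]]] /=; rewrite ?nth_nil ?c1 ?c2 //; exact: leq_trans (leq_b1 _) n0.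
pose u := flatten [seq block n v | v <- s].
have su : size u = head_size by rewrite size_blocks // size_mkseq.
have ou t : t < 5 + 5 * n -> ones n u (t * n) = val t.
  by move=> tl; rewrite ones_blocks ?size_mkseq // nth_mkseq.
have Em : cars_num u = m by rewrite /cars_num ou //; lia.
have ou4 j i : j < m -> i < 4 -> ones n u ((5 + 4 * j + i) * n) = nth 0 (cv j) i.
  move=> jm i4; rewrite ou; last by lia.
  have c1 : (5 + 4 * j + i < 5) = false by lia.
  have c2 : 5 + 4 * j + i < 5 + 4 * n by lia.
  rewrite /val c1 c2 (_ : 5 + 4 * j + i - 5 = j * 4 + i); last by lia.
  by rewrite divnMDl // modnMDl divn_small // modn_small // addn0.
have Ec j : j < m -> car_of u j = nth (target G) cs j.
  move=> jm; have h0 := ou4 j 0 jm isT; rewrite addn0 in h0.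
  rewrite /car_of h0 !ou4 // /cv jm /=; case: (nth _ _ _) => [[] []] //.
have EG : game_of u = G.
  have cons_cs : [seq car_of u j | j <- iota 0 m] = cs.
    rewrite -[RHS](mkseq_nth (target G)); apply/eq_in_map => j; rewrite mem_iota => jl; exact: Ec.
  have [E1 E2] : car_of u 0 = target G /\ [seq car_of u j | j <- iota 1 m.-1] = others G.
    by move: cons_cs; rewrite /m /cs /=; case.
  have v0 : ones n u 0 = rows G by rewrite -[X in ones _ _ X](mul0n n) ou.
  have v1 : ones n u n = cols G by rewrite -[X in ones _ _ X](mul1n n) ou //; lia.
  have v2 : ones n u (2 * n) = (exit G).1 by rewrite ou //; lia.
  have v3 : ones n u (3 * n) = (exit G).2 by rewrite ou //; lia.
  rewrite /game_of Em v0 v1 v2 v3 E1 E2 -surjective_pairing; by case: (G).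
have Eg j : j < m -> goal_conf u j = B j.
  move=> jm; rewrite /goal_conf ou; last by lia.
  have c1 : (5 + 4 * n + j < 5) = false by lia.
  have c2 : (5 + 4 * n + j < 5 + 4 * n) = false by lia.
  by rewrite /val c1 c2 addKn jm.
have Ef j : j < m -> first_conf u j = start_conf G j.
  by move=> jm; rewrite /first_conf ou4 // /cv jm.
exists u; split=> //.
  by rewrite /head_ok Em m0 EG -Ex eqxx V Ok Eg.
have nw := near_word (u := u); rewrite Em EG in nw.
have H := reach_halving (@near_refl G) (nw m0) nS R.
by rewrite EG; apply: halving_eqv H => D; apply: near_eq => // j jm; rewrite ?Ef ?Eg.
Qed.

End Guess.

End Guessing.

(** * Quantifier levels, and reading a branch of the recursion *)

Module Levels.
Import Cells Expressions Quantified Closure Generator Savitch Guessing.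

Notation fn T := ((nat -> seq bool) -> seq nat -> T).

Lemma qbf_exists b qs phi p : qbf (nseq b true ++ qs) phi p <-> exists2 w, size w = b & qbf qs phi (rev w ++ p).
Proof.
elim: b p => [|b IH] p /=; first by split=> [H|[[|//] _ H]] //; exists [::].
split=> [/orP[] /IH[w <- H]|[[|c w] //= [sw] H]].
- by exists (false :: w); rewrite // rev_cons cat_rcons.
- by exists (true :: w); rewrite // rev_cons cat_rcons.
move: H; rewrite rev_cons cat_rcons => H; apply/orP.
by case: c H => H; [right | left]; apply/IH; exists w.
Qed.

Definition levels_word (lv : seq (seq bool * bool)) : seq bool := flatten [seq rcons l.1 l.2 | l <- lv].

Section Levels.
Variables (N : nat) (C : Type) (near : C -> C -> bool) (decode : seq bool -> C) (leaf : seq bool -> bool) (u : seq bool).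

(** The bit true selects the half after the midpoint, which becomes the left end; false selects the
    half before it, where it becomes the right end. So each end of the current interval is the
    latest midpoint with the corresponding bit, and a leaf can find both without following the
    recursion. *)
Definition last_at (P : bool) (st : C) (lv : seq (seq bool * bool)) : C :=
  foldl (fun A l => if l.2 == P then decode l.1 else A) st lv.
Definition wide (lv : seq (seq bool * bool)) : bool := all (fun l => size l.1 == N) lv.

Variables (st go : C) (total : nat).
Hypothesis leafE : forall lv, wide lv -> size lv = total ->
  leaf (rev (u ++ levels_word lv)) = near (last_at true st lv) (last_at false go lv).

Lemma qbf_levels d lv : wide lv -> size lv + d = total ->
  qbf (flatten [seq rcons (nseq N true) false | _ <- iota 0 d]) leaf (rev (u ++ levels_word lv)) <->
  halving near N decode d (last_at true st lv) (last_at false go lv).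
Proof.
elim: d lv => [|d IH] lv wl sl; first by rewrite /= leafE // -sl addn0.
have -> : flatten [seq rcons (nseq N true) false | _ <- iota 0 d.+1] =
    nseq N true ++ false :: flatten [seq rcons (nseq N true) false | _ <- iota 0 d].
  have K k a b : [seq rcons (nseq N true) false | _ <- iota a k] = [seq rcons (nseq N true) false | _ <- iota b k].
    by elim: k a b => //= k IHk a b; rewrite (IHk _ b.+1).
  by rewrite /= cat_rcons (K d 1 0).
have E w c : c :: rev w ++ rev (u ++ levels_word lv) = rev (u ++ levels_word (rcons lv (w, c))).
  have LW : levels_word (rcons lv (w, c)) = levels_word lv ++ rcons w c by rewrite /levels_word map_rcons flatten_rcons.
  by rewrite LW catA [in RHS]rev_cat rev_rcons.
have HI w c : size w = N -> qbf (flatten [seq rcons (nseq N true) false | _ <- iota 0 d]) leaf (c :: rev w ++ rev (u ++ levels_word lv)) <->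
    halving near N decode d (last_at true st (rcons lv (w, c))) (last_at false go (rcons lv (w, c))).
  move=> sw; rewrite E; apply: IH; last by rewrite size_rcons addSnnS.
  by rewrite /wide all_rcons /= sw eqxx.
have R P s w c : last_at P s (rcons lv (w, c)) = if c == P then decode w else last_at P s lv.
  by rewrite /last_at -cats1 foldl_cat.
rewrite qbf_exists /=; split=> [[w sw /andP[/HI-/(_ sw) H1 /HI-/(_ sw) H2]]|[w sw [H1 H2]]].
  by move: H1 H2; rewrite !R /= => H1 H2; exists w.
by exists w => //; apply/andP; split; apply/HI => //; rewrite !R.
Qed.
End Levels.

Section Index.
Variable P : bool.
(** One more than the last [l < k] with [c l == P], and 0 if there is none. As a sum it counts the
    [l] at or after which such an index occurs. *)
Definition index_of (k : nat) (c : nat -> bool) : nat :=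
  \sum_(l < k) has (fun l' => (l <= l') && (c l' == P)) (iota 0 k).

Lemma index_ofS k c : index_of k.+1 c = if c k == P then k.+1 else index_of k c.
Proof.
rewrite /index_of; case: ifP => E.
  rewrite (eq_bigr (fun=> 1)) ?sum1_card ?card_ord // => i _.
  apply/eqP; rewrite eqb1; apply/hasP; exists k; first by rewrite mem_iota add0n ltnSn.
  by rewrite E -ltnS ltn_ord.
have H (l : nat) : has (fun l' => (l <= l') && (c l' == P)) (iota 0 k.+1) = has (fun l' => (l <= l') && (c l' == P)) (iota 0 k).
  by rewrite -addn1 iotaD has_cat /= add0n E andbF !orbF.
rewrite (eq_bigr (fun l : 'I_k.+1 => nat_of_bool (has (fun l' => (l <= l') && (c l' == P)) (iota 0 k)))) => [|i _]; last by rewrite H.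
rewrite big_ord_recr /= [X in _ + X](_ : _ = 0) ?addn0 //.
by apply/eqP; rewrite eqb0; apply/hasPn => l'; rewrite mem_iota add0n /= ltnNge => /negPf->.
Qed.

Lemma last_at_index (C : Type) (decode : seq bool -> C) st lv (c : nat -> bool) :
  (forall l, l < size lv -> c l = nth false (map snd lv) l) ->
  last_at decode P st lv = (let i := index_of (size lv) c in
    if i == 0 then st else decode (nth ([::], false) lv i.-1).1) /\ index_of (size lv) c <= size lv.
Proof.
elim/last_ind: lv => [|lv [w b] IH] H; first by rewrite /= /index_of big_ord0.
have [|IH1 IH2] := IH.
  move=> l ll; rewrite H ?size_rcons ?ltnS 1?ltnW // map_rcons nth_rcons size_map ll //.
have Hc : c (size lv) = b.
  by rewrite H ?size_rcons // map_rcons nth_rcons size_map ltnn eqxx.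
rewrite size_rcons index_ofS Hc /last_at -cats1 foldl_cat /=; case: eqP => _.
  by rewrite /= nth_cat ltnn subnn.
rewrite -/(last_at decode P st lv) IH1; split; last exact: leqW.
rewrite /=; case: (eqVneq (index_of (size lv) c) 0) => // i0; rewrite nth_cat ifT //; lia.
Qed.
End Index.

Section Leaf.

Variables (n : nat) (ok : pred nat) (x : seq bool).
(** While no midpoint has been chosen, the ends are the positions stored with the cars and the final
    positions. *)
Definition start_at (P : bool) (j : nat) : nat := if P then (5 + 4 * j + 3) * n else (5 + 4 * n + j) * n.
Definition mark (U : seq bool) (l : nat) : bool := nth false U (head_size n + l * level_size n + n * n).
Definition conf_at (P : bool) (U : seq bool) : conf := fun j =>
  let i := index_of P (n * n) (mark U) in
  ones n U (if i == 0 then start_at P j else head_size n + i.-1 * level_size n + j * n).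
Definition leaf (U : seq bool) : bool :=
  head_ok n ok x U && near (game_of n U) (conf_at true U) (conf_at false U).

Lemma nth_levels lv i a : wide (n * n) lv -> i < size lv -> a < level_size n ->
  nth false (levels_word lv) (i * level_size n + a) = nth false (rcons (nth ([::], false) lv i).1 (nth ([::], false) lv i).2) a.
Proof.
elim: lv i => // l lv IH [|i] /andP[/eqP sl wl] il al;
  rewrite (_ : levels_word (l :: lv) = rcons l.1 l.2 ++ levels_word lv) // nth_cat size_rcons sl.
  by rewrite mul0n add0n; move: al; rewrite /level_size addn1 => ->.
rewrite mulSn -addnA ifN -?leqNgt; last by rewrite /level_size; lia.
by rewrite -IH //; congr nth; rewrite /level_size; lia.
Qed.

Lemma far_side h a c b : (h + a + c + b < h) = false.
Proof. by lia. Qed.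

Lemma far_sub h a c b : h + a + c + b - h = a + (c + b).
Proof. by lia. Qed.

Lemma leaf_levels u lv : size u = head_size n -> wide (n * n) lv -> size lv = n * n ->
  leaf (u ++ levels_word lv) = head_ok n ok x u &&
    near (game_of n u) (last_at (decode n) true (first_conf n u) lv) (last_at (decode n) false (goal_conf n u) lv).
Proof.
move=> su wl sl; have [E1 E2 E3 E4] := game_of_cat (levels_word lv) su.
have Eh : head_ok n ok x (u ++ levels_word lv) = head_ok n ok x u.
  rewrite /head_ok E1 E2; case: posnP => //= m0; rewrite E4 //.
  by apply: leq_trans m0 (ones_le _ _ _).
rewrite /leaf Eh E1; case H: (head_ok n ok x u) => //=.
have m0 : 0 < cars_num n u by case/and5P: H.
have Em l : l < size lv -> mark (u ++ levels_word lv) l = nth false (map snd lv) l.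
  move=> ll; rewrite /mark nth_cat su ifN -?leqNgt; last by lia.
  rewrite (_ : _ - _ = l * level_size n + n * n); last by lia.
  rewrite nth_levels //; last by rewrite /level_size addn1.
  have /allP/(_ _ (mem_nth ([::], false) ll))/eqP s1 := wl.
  by rewrite nth_rcons s1 ltnn eqxx (nth_map ([::], false)).
have K P st j : j < n -> st j = ones n (u ++ levels_word lv) (start_at P j) ->
    conf_at P (u ++ levels_word lv) j = last_at (decode n) P st lv j.
  move=> jn Es; have [L1 L2] := @last_at_index P _ (decode n) st lv _ Em.
  rewrite L1 /conf_at; rewrite -sl; case: eqP => [//|i0].
  set i := index_of _ _ _ in L2 i0 *; have il : i.-1 < size lv by lia.
  have /allP/(_ _ (mem_nth ([::], false) il))/eqP s1 := wl.
  have key b : b < n -> nth false (u ++ levels_word lv) (head_size n + i.-1 * level_size n + j * n + b) =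
      nth false (nth ([::], false) lv i.-1).1 (j * n + b).
    move=> bl; have jb : j * n + b < n * n by have : j.+1 * n <= n * n; [rewrite leq_mul2r jn orbT | rewrite mulSn; lia].
    rewrite nth_cat su far_side far_sub nth_levels //; last by rewrite /level_size; move: jb; clear; lia.
    by rewrite nth_rcons s1 jb.
  rewrite /decode /ones; apply: eq_bigr => b _; by rewrite key.
apply: near_eq => j; rewrite size_cars_game // => jm; have jn : j < n by apply: leq_trans jm (ones_le _ _ _).
  by apply: K => //; rewrite -E3.
by apply: K => //; rewrite -E4.
Qed.

End Leaf.

Lemma uniq_pairs (I : eqType) (J : eqType) (f : I -> J) (s : seq I) : uniq s ->
  uniq [seq f i | i <- s] = all (fun i => all (fun i' => (f i == f i') ==> (i == i')) s) s.
Proof.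
move=> us; apply/idP/allP => [U i si|H].
  apply/allP => i' si'; apply/implyP => /eqP E.
  have := U => /(uniqP (f i))/(_ (index i s) (index i' s)).
  rewrite !inE size_map !index_mem => /(_ si si').
  rewrite !(nth_map i) ?index_mem // !nth_index // => /(_ E) Ei.
  by apply/eqP; rewrite -(nth_index i si) Ei nth_index.
rewrite map_inj_in_uniq // => i i' si si' E.
by have /allP/(_ i' si')/implyP := H i si; rewrite E eqxx => /(_ isT)/eqP.
Qed.

Definition cell_at (c : car) (t : nat) : cell := if horizontal c then (lane c, pos c + t) else (pos c + t, lane c).
Definition car_len (c : car) : nat := if long c then 3 else 2.

(** Legality as bounded quantification over cars and over the at most three cells of each, the form
    in which it becomes an expression. *)
Lemma placement_seq G (c : nat -> car) m : placement G [seq c j | j <- iota 0 m] =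
  all (fun j => all (fun t => (t < car_len (c j)) ==> on_board G (cell_at (c j) t)) (iota 0 3)) (iota 0 m) &&
  all (fun j => all (fun t => all (fun j' => all (fun t' =>
    [&& t < car_len (c j), t' < car_len (c j'), (cell_at (c j) t).1 == (cell_at (c j') t').1 &
     (cell_at (c j) t).2 == (cell_at (c j') t').2] ==> (j == j') && (t == t'))
     (iota 0 3)) (iota 0 m)) (iota 0 3)) (iota 0 m).
Proof.
have AC j s : [seq (j', t) | j' <- j :: s, t <- iota 0 3] =
  [seq (j, t) | t <- iota 0 3] ++ [seq (j', t) | j' <- s, t <- iota 0 3] by [].
pose L : seq (nat * nat) := [seq jt <- [seq (j, t) | j <- iota 0 m, t <- iota 0 3] | jt.2 < car_len (c jt.1)].
have cellsE (d : car) : cells d = [seq cell_at d t | t <- [seq t <- iota 0 3 | t < car_len d]].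
  by case: d => [[] [] l p]; rewrite /cells /cell_at /= !addn0 ?addn1 ?addn2.
have E : flatten [seq cells d | d <- [seq c j | j <- iota 0 m]] = [seq cell_at (c jt.1) jt.2 | jt <- L].
  rewrite /L; elim: (iota 0 m) => // j s IH.
  rewrite map_cons [LHS]/= IH AC filter_cat map_cat cellsE; congr (_ ++ _).
  by rewrite filter_map -!map_comp.
have UL : uniq L by apply: filter_uniq; apply: allpairs_uniq; rewrite ?iota_uniq // => -[? ?] [? ?] _ _ [-> ->].
have memL Q : all Q L = all (fun j => all (fun t => (t < car_len (c j)) ==> Q (j, t)) (iota 0 3)) (iota 0 m).
  rewrite /L all_filter; elim: (iota 0 m) => // j s IH; rewrite AC all_cat IH all_map; congr andb.
rewrite /placement E uniq_pairs // all_map !memL; congr (_ && _).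
apply: eq_all => j; apply: eq_all => t; rewrite memL.
have PE (a b : cell) : (a == b) = (a.1 == b.1) && (a.2 == b.2) by case: a b => [? ?] [? ?]; rewrite xpair_eqE.
case: (t < car_len (c j)); rewrite ?implyTb ?implyFb; last by apply/esym/allP => j' _; apply/allP.
apply: eq_all => j'; apply: eq_all => t'; rewrite PE xpair_eqE.
by case: (t' < _).
Qed.

End Levels.

(** * Rush Hour is in PSPACE *)

Module Membership.
Import Cells Expressions Quantified Closure Generator Savitch Guessing Levels.

Notation fn T := ((nat -> seq bool) -> seq nat -> T).

Lemma wrd_exprs nw w : wrd nw 0 w -> exists L B, [/\ words_below nw L, words_below nw B, regs_below 0 L,
  regs_below 1 B & forall ws, word_expr ws L B = w ws [::]].
Proof.
move=> [[L [WL RL EL]] [B [WB RB EB]]]; exists L, B; split=> // ws.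
apply: (@eq_from_nth _ false); rewrite size_mkseq EL // => i il.
by rewrite /word_expr nth_mkseq ?EL // EB //= eqb1.
Qed.

Lemma dec_eq_wrd nw (w w' : fn (seq bool)) : wrd nw 0 w -> wrd nw 0 w' -> dec nw 0 (fun ws rs => w ws rs == w' ws rs).
Proof.
move=> Hw Hw'; have [Sw Bw] := Hw; have [Sw' Bw'] := Hw'.
have HE := @dec_eq nw 1 _ _ Bw Bw'.
apply: dec_ext (dec_and (dec_eq Sw Sw') (dec_all Sw HE)) => ws rs /size0nil ->.
apply/andP/eqP => [[/eqP s1 /allP H]|->]; last by split=> //; apply/allP.
apply: (@eq_from_nth _ false) => // i il; have := H i; rewrite mem_iota => /(_ il) /= /eqP.
by case: (nth _ _ i); case: (nth _ _ i).
Qed.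

Section Leaf.

Variable ok : pred nat.
Hypothesis ok_dec : forall k f, num 2 k f -> dec 2 k (fun ws rs => ok (f ws rs)).
Local Notation num := (num 2).
Local Notation dec := (dec 2).

Definition nn (ws : nat -> seq bool) : nat := size (ws 0).
Definition total (n : nat) : nat := head_size n + n * n * level_size n.
(** The path has the latest choice first, so it is read backwards. *)
Definition guess (ws : nat -> seq bool) : seq bool :=
  mkseq (fun i => nth false (ws 1) (total (nn ws) - 1 - i)) (total (nn ws)).

Lemma nn_num k : num k (fun ws _ => nn ws). Proof. exact: num_len. Qed.
Lemma nn_affine k a b f : num k f -> num k (fun ws rs => (a + b * f ws rs) * nn ws).
Proof. by move=> Hf; apply: num_mul (nn_num k); apply: num_add (num_cst _ _ _) _; apply: num_mul Hf; apply: num_cst. Qed.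
Lemma head_num k : num k (fun ws _ => head_size (nn ws)).
Proof. exact: (nn_affine 5 5 (nn_num k)). Qed.
Lemma sq_num k : num k (fun ws _ => nn ws * nn ws). Proof. exact: num_mul (nn_num k) (nn_num k). Qed.
Lemma level_num k : num k (fun ws _ => level_size (nn ws)). Proof. exact: num_add (sq_num k) (num_cst _ _ _). Qed.
Lemma total_num k : num k (fun ws _ => total (nn ws)).
Proof. exact: num_add (head_num k) (num_mul (sq_num k) (level_num k)). Qed.

Lemma bit_dec k f : num k f -> dec k (fun ws rs => nth false (guess ws) (f ws rs)).
Proof.
move=> Hf; have T := total_num k.
apply: dec_ext (dec_and (dec_lt Hf T) (dec_bit (isT : 1 < 2) (num_sub (num_sub T (num_cst _ _ 1)) Hf))) => ws rs _.
rewrite /guess; case: (ltnP (f ws rs) (total (nn ws))) => h; first by rewrite nth_mkseq.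
by rewrite /= nth_default // size_mkseq.
Qed.

Lemma ones_num k f : num k f -> num k (fun ws rs => ones (nn ws) (guess ws) (f ws rs)).
Proof.
move=> Hf; have H := bit_dec (num_add (num_drop 1 Hf) (num_reg 2 (isT : 0 < k.+1))).
by apply: num_ext (num_sum (nn_num k) H) => ws rs _; apply: eq_bigr => i _; rewrite /= drop0.
Qed.

Lemma affine4 k c f : num k f -> num k (fun ws rs => (5 + 4 * f ws rs + c) * nn ws).
Proof.
move=> Hf; apply: num_mul (nn_num k); apply: num_add (num_cst _ _ _); apply: num_add (num_cst _ _ _) _.
by apply: num_mul Hf; apply: num_cst.
Qed.
Lemma horiz_dec k f : num k f -> dec k (fun ws rs => horizontal (car_of (nn ws) (guess ws) (f ws rs))).
Proof. by move=> Hf; apply: dec_lt (num_cst _ _ _) _; apply: ones_num; apply: nn_affine. Qed.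
Lemma long_dec k f : num k f -> dec k (fun ws rs => long (car_of (nn ws) (guess ws) (f ws rs))).
Proof. by move=> Hf; apply: dec_lt (num_cst _ _ _) _; apply: ones_num; apply: affine4. Qed.
Lemma lane_num k f : num k f -> num k (fun ws rs => lane (car_of (nn ws) (guess ws) (f ws rs))).
Proof. by move=> Hf; apply: ones_num; apply: affine4. Qed.
Lemma first_num k f : num k f -> num k (fun ws rs => first_conf (nn ws) (guess ws) (f ws rs)).
Proof. by move=> Hf; apply: ones_num; apply: affine4. Qed.
Lemma goal_num k f : num k f -> num k (fun ws rs => goal_conf (nn ws) (guess ws) (f ws rs)).
Proof.
move=> Hf; apply: ones_num; apply: num_mul (nn_num k); apply: num_add Hf.
by apply: num_add (num_cst _ _ _) _; apply: num_mul (nn_num k); apply: num_cst.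
Qed.
Lemma times_nn k c : num k (fun ws _ => c * nn ws). Proof. exact: num_mul (num_cst _ _ _) (nn_num k). Qed.
Lemma cars_num_num k : num k (fun ws _ => cars_num (nn ws) (guess ws)).
Proof. exact: (ones_num (times_nn k 4)). Qed.
Local Notation G ws := (game_of (nn ws) (guess ws)).
Lemma rows_num k : num k (fun ws _ => rows (G ws)). Proof. exact: (ones_num (num_cst 2 k 0)). Qed.
Lemma cols_num k : num k (fun ws _ => cols (G ws)). Proof. exact: (ones_num (nn_num k)). Qed.
Lemma exit1_num k : num k (fun ws _ => (exit (G ws)).1). Proof. exact: (ones_num (times_nn k 2)). Qed.
Lemma exit2_num k : num k (fun ws _ => (exit (G ws)).2). Proof. exact: (ones_num (times_nn k 3)). Qed.

Lemma index_num P k : num k (fun ws _ => index_of P (nn ws * nn ws) (mark (nn ws) (guess ws))).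
Proof.
have r0 := num_reg 2 (isT : 0 < k.+2); have r1 := num_reg 2 (isT : 1 < k.+2).
have M : dec k.+2 (fun ws rs => mark (nn ws) (guess ws) (nth 0 rs 0)).
  by apply: bit_dec; apply: num_add (sq_num _); apply: num_add (head_num _) _; apply: num_mul r0 (level_num _).
have H := dec_and (dec_le r1 r0) (dec_tab (tab_map (fun b => b == P) (tab_dec M))).
by apply: num_ext (num_sum (sq_num k) (dec_has (sq_num k.+1) H)) => ws rs _.
Qed.

Lemma conf_num P k f : num k f -> num k (fun ws rs => conf_at (nn ws) P (guess ws) (f ws rs)).
Proof.
move=> Hf; have I := index_num P k; apply: ones_num; apply: num_if.
- by apply: dec_eq I (num_cst _ _ _).
- case: P {I}; first exact: affine4.
  by apply: num_mul (nn_num k); apply: num_add Hf; apply: num_add (num_cst _ _ _) _; apply: times_nn.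
apply: num_add; last by apply: num_mul Hf (nn_num k).
by apply: num_add (head_num k) _; apply: num_mul (level_num k); apply: num_pred.
Qed.

Section Placement.
Variable A : (nat -> seq bool) -> conf.
Hypothesis A_num : forall k f, num k f -> num k (fun ws rs => A ws (f ws rs)).
Definition car_at (ws : nat -> seq bool) (j : nat) : car := slide_to (car_of (nn ws) (guess ws) j) (A ws j).

Lemma car_len_num k f : num k f -> num k (fun ws rs => car_len (car_at ws (f ws rs))).
Proof. by move=> Hf; apply: num_if (num_cst _ _ _) (num_cst _ _ _); apply: long_dec. Qed.
Lemma cell1_num k f t : num k f -> num k t -> num k (fun ws rs => (cell_at (car_at ws (f ws rs)) (t ws rs)).1).
Proof.
move=> Hf Ht; have H := num_if (horiz_dec Hf) (lane_num Hf) (num_add (A_num Hf) Ht).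
by apply: num_ext H => ws rs _; rewrite /cell_at /=; case: ifP.
Qed.
Lemma cell2_num k f t : num k f -> num k t -> num k (fun ws rs => (cell_at (car_at ws (f ws rs)) (t ws rs)).2).
Proof.
move=> Hf Ht; have H := num_if (horiz_dec Hf) (num_add (A_num Hf) Ht) (lane_num Hf).
by apply: num_ext H => ws rs _; rewrite /cell_at /=; case: ifP.
Qed.
Lemma dec_imp k P Q : dec k P -> dec k Q -> dec k (fun ws rs => P ws rs ==> Q ws rs).
Proof. by move=> HP HQ; apply: dec_ext (dec_or (dec_not HP) HQ) => ws rs _; rewrite implybE. Qed.

Lemma placement_dec : dec 0 (fun ws _ => placement (G ws) [seq car_at ws j | j <- iota 0 (cars_num (nn ws) (guess ws))]).
Proof.
have R k i : i < k -> num k (fun _ rs => nth 0 rs i) by apply: num_reg.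
have B : dec 2 (fun ws rs => (nth 0 rs 0 < car_len (car_at ws (nth 0 rs 1))) ==> on_board (G ws) (cell_at (car_at ws (nth 0 rs 1)) (nth 0 rs 0))).
  apply: dec_imp; first by apply: dec_lt; [exact: R | apply: car_len_num; exact: R].
  by apply: dec_and; apply: dec_lt; [apply: cell1_num; exact: R | exact: rows_num | apply: cell2_num; exact: R | exact: cols_num].
have B1 := dec_all (cars_num_num 0) (dec_all (num_cst 2 1 3) B).
have D : dec 4 (fun ws rs => [&& nth 0 rs 2 < car_len (car_at ws (nth 0 rs 3)), nth 0 rs 0 < car_len (car_at ws (nth 0 rs 1)),
    (cell_at (car_at ws (nth 0 rs 3)) (nth 0 rs 2)).1 == (cell_at (car_at ws (nth 0 rs 1)) (nth 0 rs 0)).1 &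
    (cell_at (car_at ws (nth 0 rs 3)) (nth 0 rs 2)).2 == (cell_at (car_at ws (nth 0 rs 1)) (nth 0 rs 0)).2] ==>
    (nth 0 rs 3 == nth 0 rs 1) && (nth 0 rs 2 == nth 0 rs 0)).
  apply: dec_imp; last by apply: dec_and; apply: dec_eq; exact: R.
  apply: dec_and; first by apply: dec_lt; [exact: R | apply: car_len_num; exact: R].
  apply: dec_and; first by apply: dec_lt; [exact: R | apply: car_len_num; exact: R].
  by apply: dec_and; apply: dec_eq; (apply: cell1_num || apply: cell2_num); exact: R.
have D1 := dec_all (cars_num_num 0) (dec_all (num_cst 2 1 3) (dec_all (cars_num_num 2) (dec_all (num_cst 2 3 3) D))).
by apply: dec_ext (dec_and B1 D1) => ws rs _; rewrite placement_seq.
Qed.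
End Placement.

Lemma near_game n U A B : 0 < cars_num n U -> near (game_of n U) A B =
  [&& placement (game_of n U) [seq slide_to (car_of n U j) (A j) | j <- iota 0 (cars_num n U)],
      placement (game_of n U) [seq slide_to (car_of n U j) (B j) | j <- iota 0 (cars_num n U)] &
      \sum_(j < cars_num n U) ((A j - B j) + (B j - A j)) <= 1].
Proof.
move=> m0; rewrite /near size_cars_game //.
have W C : with_pos (game_of n U) C = [seq slide_to (car_of n U j) (C j) | j <- iota 0 (cars_num n U)].
  rewrite /with_pos size_cars_game //; apply/eq_in_map => j; rewrite mem_iota => jm.
  by rewrite nth_cars_game.
by rewrite !W.
Qed.

(** The condition on the number of cars is needed for [near_game]: [game_of] has a target even when
    the guess announces no car. *)
Lemma near_dec : dec 0 (fun ws _ => (0 < cars_num (nn ws) (guess ws)) &&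
  near (G ws) (conf_at (nn ws) true (guess ws)) (conf_at (nn ws) false (guess ws))).
Proof.
have m0 := dec_lt (num_cst 2 0 0) (cars_num_num 0).
have P1 := @placement_dec (fun ws => conf_at (nn ws) true (guess ws)) (conf_num true).
have P2 := @placement_dec (fun ws => conf_at (nn ws) false (guess ws)) (conf_num false).
have r0 := num_reg 2 (isT : 0 < 1).
have S := num_sum (cars_num_num 0) (num_add (num_sub (conf_num true r0) (conf_num false r0)) (num_sub (conf_num false r0) (conf_num true r0))).
apply: dec_ext (dec_and m0 (dec_and P1 (dec_and P2 (dec_le S (num_cst 2 0 1))))) => ws rs _.
by case: (posnP (cars_num (nn ws) (guess ws))) => //= m1; rewrite near_game.
Qed.

Lemma encode_wrd : wrd 2 0 (fun ws _ => encode (G ws)).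
Proof.
have C k f : num k f -> wrd 2 k (fun ws rs => encode_car (car_of (nn ws) (guess ws) (f ws rs))).
  by move=> Hf; apply: wrd_encode_car; [apply: horiz_dec | apply: long_dec | apply: lane_num | apply: first_num].
have r0 := num_succ (num_reg 2 (isT : 0 < 1)).
apply: wrd_ext (wrd_cat (wrd_encode_nat (rows_num 0)) (wrd_cat (wrd_encode_nat (cols_num 0))
  (wrd_cat (wrd_encode_nat (exit1_num 0)) (wrd_cat (wrd_encode_nat (exit2_num 0))
  (wrd_cat (C 0 _ (num_cst 2 0 0)) (wrd_flatten (num_pred (cars_num_num 0)) (C 1 _ r0))))))) => ws rs _.
have Eo : others (G ws) = [seq car_of (nn ws) (guess ws) j.+1 | j <- iota 0 (cars_num (nn ws) (guess ws)).-1].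
  by rewrite /= (iotaDl 1 0) -map_comp.
rewrite /encode -[flatten [seq encode_car c | c <- target _ :: others _]]/(encode_car (target (G ws)) ++
  flatten [seq encode_car c | c <- others (G ws)]) Eo.
by congr (_ ++ (_ ++ (_ ++ (_ ++ (_ ++ flatten _))))); rewrite -map_comp.
Qed.

Lemma head_dec : dec 0 (fun ws _ => head_ok (nn ws) ok (ws 0) (guess ws)).
Proof.
have m0 := dec_lt (num_cst 2 0 0) (cars_num_num 0).
have X : wrd 2 0 (fun ws _ => ws 0).
  by split; [apply: num_len | apply: dec_bit => //; apply: num_reg].
have P1 := @placement_dec (fun ws => first_conf (nn ws) (guess ws)) first_num.
have h0 := horiz_dec (num_cst 2 0 0).
have e1 := exit1_num 0; have e2 := exit2_num 0; have c0 := num_cst 2 0 0.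
have EX := dec_and (dec_and (dec_lt e1 (rows_num 0)) (dec_lt e2 (cols_num 0)))
  (dec_if h0 (dec_or (dec_eq e2 c0) (dec_eq e2 (num_pred (cols_num 0)))) (dec_or (dec_eq e1 c0) (dec_eq e1 (num_pred (rows_num 0))))).
have r0 := num_reg 2 (isT : 0 < 1); have c1 := num_cst 2 1 0.
have HG : dec 1 (fun ws rs => [&& nth 0 rs 0 < car_len (car_at (fun ws => goal_conf (nn ws) (guess ws)) ws 0),
   (cell_at (car_at (fun ws => goal_conf (nn ws) (guess ws)) ws 0) (nth 0 rs 0)).1 == (exit (G ws)).1 &
   (cell_at (car_at (fun ws => goal_conf (nn ws) (guess ws)) ws 0) (nth 0 rs 0)).2 == (exit (G ws)).2]).
  apply: dec_and; first exact: dec_lt r0 (car_len_num _ c1).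
  by apply: dec_and; apply: dec_eq; [exact: (cell1_num goal_num c1 r0) | exact: exit1_num | exact: (cell2_num goal_num c1 r0) | exact: exit2_num].
apply: dec_ext (dec_and m0 (dec_and (dec_eq_wrd X encode_wrd) (dec_and (dec_and P1 EX) (dec_and (ok_dec (rows_num 0)) (dec_has (num_cst 2 0 3) HG))))) => ws rs _.
rewrite /head_ok; case: (posnP (cars_num (nn ws) (guess ws))) => // m1.
have HV : valid (G ws) = placement (G ws) [seq car_at (fun ws => first_conf (nn ws) (guess ws)) ws j |
    j <- iota 0 (cars_num (nn ws) (guess ws))] && exit_ok (G ws) by rewrite /valid cars_game.
set d := slide_to _ _.
have HX : (exit (G ws) \in cells d) = has (fun t => [&& t < car_len d, (cell_at d t).1 == (exit (G ws)).1 &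
    (cell_at d t).2 == (exit (G ws)).2]) (iota 0 3).
  case: (exit (G ws)) => a b; case: d => [[] [] l p]; rewrite /cells /cell_at /car_len /= !inE !xpair_eqE !addn0 ?addn1 ?addn2 ?orbF;
    by rewrite ?(eq_sym l) ?(eq_sym p) ?(eq_sym p.+1) ?(eq_sym p.+2) ?andbF ?orbF.
by rewrite HV HX.
Qed.

Theorem language_PSPACE : PSPACE (language_of ok).
Proof.
have [phi [Wp Rp Ep]] := dec_and head_dec near_dec.
(* Existential bits for the game and the final positions, then levels of an existential midpoint and
   a universal bit. A configuration has [n * n] bits, so there are [n * n] levels. *)
have pat : wrd 1 0 (fun ws _ => nseq (head_size (size (ws 0))) true ++
   flatten [seq rcons (nseq (size (ws 0) * size (ws 0)) true) false | _ <- iota 0 (size (ws 0) * size (ws 0))]).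
  have n1 k : Closure.num 1 k (fun ws _ => size (ws 0)) by apply: num_len.
  have sq k := num_mul (n1 k) (n1 k).
  have T k f : Closure.num 1 k f -> wrd 1 k (fun ws rs => nseq (f ws rs) true).
    move=> Hf; apply: wrd_ext (wrd_bits Hf (dec_cst 1 k.+1 true)) => ws rs _.
    by apply: (@eq_from_nth _ false); rewrite ?size_mkseq ?size_nseq // => i il; rewrite nth_mkseq // nth_nseq il.
  apply: wrd_cat; first by apply: T; apply: num_mul (n1 0); apply: num_add (num_cst _ _ _) _; apply: num_mul (num_cst _ _ _) (n1 0).
  have L := wrd_cat (T 1 _ (sq 1)) (wrd_seq1 (dec_cst 1 1 false)).
  by apply: wrd_ext (wrd_flatten (sq 0) L) => ws rs _; congr flatten; apply: eq_map => i; rewrite cats1.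
have [L [B [WL WB RL RB EL]]] := wrd_exprs pat.
apply: (qbf_PSPACE (D := L) (Q := B) (phi := phi)) => // x; rewrite EL /one_word /= {EL}.
set n := size x.
have lf path : (0 < eval (two_words x path) [::] phi) = leaf n ok x (guess (two_words x path)).
  rewrite Ep // lt0b /leaf /nn /=; case H: (head_ok _ _ _ _) => //=.
  by case/and5P: H => ->.
have full u lv : size u = head_size n -> wide (n * n) lv -> size lv = n * n ->
    guess (two_words x (rev (u ++ levels_word lv))) = u ++ levels_word lv.
  move=> su wl sl; have sz : size (u ++ levels_word lv) = total n.
    rewrite size_cat su /total -sl; congr (_ + _); elim: {sl}lv wl => //= l lv IH /andP[/eqP s1 /IH E].
    by rewrite size_cat size_rcons s1 E mulSn /level_size addn1.
  apply: (@eq_from_nth _ false); rewrite size_mkseq -[nn _]/n ?sz // => i il.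
  rewrite nth_mkseq // -[nn _]/n -[two_words _ _ 1]/(rev (u ++ levels_word lv)) nth_rev ?sz; last by lia.
  by congr nth; lia.
have Q u : size u = head_size n ->
   (qbf (flatten [seq rcons (nseq (n * n) true) false | _ <- iota 0 (n * n)]) (fun path => 0 < eval (two_words x path) [::] phi) (rev u)) <->
   halving (fun A C => head_ok n ok x u && near (game_of n u) A C) (n * n) (decode n) (n * n) (first_conf n u) (goal_conf n u).
  move=> su; have := @qbf_levels (n * n) conf (fun A C => head_ok n ok x u && near (game_of n u) A C) (decode n)
    (fun path => 0 < eval (two_words x path) [::] phi) u (first_conf n u) (goal_conf n u) (n * n) _ (n * n) [::] isT (add0n _).
  rewrite /levels_word /= cats0; apply => lv wl sl.
  by rewrite lf full // leaf_levels.
(* Guesses can be tested only in the matrix of the formula. The test of the game is the same at all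
   leaves, so it factors out of the recursion. *)
have hd d u A C : halving (fun A C => head_ok n ok x u && near (game_of n u) A C) (n * n) (decode n) d A C <->
    head_ok n ok x u /\ halving (near (game_of n u)) (n * n) (decode n) d A C.
  elim: d A C => [|d IH] A C /=; first by split=> [/andP[]|[-> ->]].
  split=> [[w sw [/IH[h h1] /IH[_ h2]]]|[h [w sw [h1 h2]]]]; first by split=> //; exists w.
  by exists w => //; split; apply/IH.
rewrite qbf_exists; split=> [/(guess_complete (n := n) erefl)[u [su h H]]|[u su]].
  by exists u; rewrite // cats0 Q // hd.
by rewrite cats0 Q // hd => -[h H]; apply: guess_sound h H.
Qed.

End Leaf.

End Membership.

(** * Hardness, and one height for all languages *)

Import Cells Programs Expressions Quantified Closure Tokens Generator Savitch Guessing Levels Membership.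

(** A unary number ends at its first 0 bit, so encodings can be parsed from the left. *)
Lemma encode_nat_inj a b s t : encode_nat a ++ s = encode_nat b ++ t -> a = b /\ s = t.
Proof.
rewrite /encode_nat !cat_rcons; elim: a b => [|a IH] [|b] //=; first by case.
by case=> /IH[-> ->].
Qed.

Lemma encode_car_inj c d s t : encode_car c ++ s = encode_car d ++ t -> c = d /\ s = t.
Proof.
case: c d => [h l a p] [h' l' a' p'] /= [-> ->]; rewrite -!catA.
by move=> /encode_nat_inj[-> /encode_nat_inj[-> ->]].
Qed.

Lemma encode_inj G G' : encode G = encode G' -> G = G'.
Proof.
case: G G' => [r c [e1 e2] t o] [r' c' [e1' e2'] t' o']; rewrite /encode.
move=> /encode_nat_inj[/= -> /encode_nat_inj[/= -> /encode_nat_inj[/= -> /encode_nat_inj[/= ->]]]].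
move=> /encode_car_inj[-> E]; congr Game.
elim: o o' E => [|d o IH] [|d' o'] //=; try by case: d || case: d'.
by move=> /encode_car_inj[-> /IH->].
Qed.

(** The space bound of a machine is an arbitrary polynomial; a bound of this simple form is
    expressible. *)
Lemma poly_bound (p : {poly nat}) : exists c d, forall n, p.[n]%R <= c * n.+1 ^ d.
Proof.
exists (\sum_(i < size p) p`_i)%R, (size p) => n; rewrite horner_coef.
rewrite [X in _ <= X](_ : _ = \sum_(i < size p) (p`_i)%R * n.+1 ^ size p); last by rewrite -big_distrl.
apply: leq_sum => i _; apply: leq_mul => //.
rewrite (_ : (n ^+ i)%R = n ^ i); last by elim: (nat_of_ord i) => // j IH; rewrite GRing.exprS expnS IH.
by apply: leq_trans (_ : n.+1 ^ i <= _); [case: (nat_of_ord i) => // j; rewrite leq_exp2r | rewrite leq_pexp2l // ltnW].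
Qed.

Lemma num_exp nw k f d : num nw k f -> num nw k (fun ws rs => f ws rs ^ d).
Proof.
move=> Hf; elim: d => [|d IH]; first by apply: num_ext (num_cst nw k 1).
by apply: num_ext (num_mul Hf IH) => ws rs _; rewrite expnS.
Qed.

Theorem hardness L : PSPACE L -> exists (M : machine) (Sp : seq bool -> nat),
  (forall k, num 1 k (fun ws _ => Sp (ws 0))) /\
  forall x, valid (game_for M Sp x) /\ (solvable (game_for M Sp x) <-> L x).
Proof.
move=> [M [p [D Hp]]]; have [c [d Hcd]] := poly_bound p.
exists M, (fun x => c * (size x).+1 ^ d).
have N k : num 1 k (fun ws _ => c * (size (ws 0)).+1 ^ d).
  by apply: num_mul (num_cst _ _ _) _; apply: num_exp; apply: num_succ; apply: num_len.
split=> // x; have [t Ht At] := D x.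
have Sm t' : small (c * (size x).+1 ^ d) (run M x t').
  move=> i; have B := leq_trans (Hp x t') (Hcd (size x)).
  have : tape_space (tapes (run M x t') i) <= space (run M x t').
    by rewrite /space (bigD1 i) //= leq_addr.
  by move=> /leq_trans/(_ B); rewrite /tape_space; lia.
have [V R] := @game_for_correct M (fun x => c * (size x).+1 ^ d) x t Ht Sm.
by split=> //; rewrite R.
Qed.

(** Both reductions run in one stack program, which avoids composing Turing machines. *)
Lemma polytime_two L1 B1 L2 B2 :
  words_below 1 L1 -> words_below 1 B1 -> regs_below 0 L1 -> regs_below 1 B1 ->
  words_below 1 L2 -> words_below 1 B2 -> regs_below 0 L2 -> regs_below 1 B2 ->
  polynomial_time (fun x => word_expr (one_word (word_expr (one_word x) L1 B1)) L2 B2).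
Proof.
move=> WL1 WB1 RL1 RB1 WL2 WB2 RL2 RB2.
(* Moving the first output from stack 7 to stack 0 reverses it and thereby undoes the reversal by
   [emit]. *)
pose c := Seq setup (Seq (emit 8 7 L1 B1) (Seq (While 0 nonempty (Pop sym 0)) (Seq (mv 7 0 (Skip sym)) (emit 8 1 L2 B2)))).
pose K := (maxn 1 (max_stack c)).+1.
have Uc : uses K c by apply: uses_max; rewrite ltnS leq_maxr.
have K1 : 1 < K by rewrite ltnS leq_maxl.
pose d1 := texp L1 + texp B1 + vexp B1 + 20.
pose d2 := texp L2 + texp B2 + vexp B2 + 20.
pose N1 n := pow n (vexp L1).+1.
pose T n := n * 42 + 3 + (pow (N1 n) d1 + ((n * 3).+1 + ((N1 n * 14).+1 + pow (pow (N1 n) (vexp L2).+1) d2))).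
have run_c x : runs c (input_store pair_bit x)
    (upd (upd (fun _ => [::]) 0 (map pair_bit (word_expr (one_word x) L1 B1))) 1
       (rev (map pair_bit (word_expr (one_word (word_expr (one_word x) L1 B1)) L2 B2)))) (T (size x)).
  set W1 := word_expr (one_word x) L1 B1; set W2 := word_expr _ _ _; set n := size x.
  pose st y : sstore := upd (fun _ => [::]) 0 (map pair_bit y).
  have ow y w : size (one_word y w) <= size y by rewrite /one_word; case: ifP.
  have nN : n <= N1 n by rewrite /N1 powS; have := pow_gt0 n (vexp L1); nia.
  have W1N : size W1 <= N1 n.
    rewrite size_mkseq; apply: leq_trans (pow_le _ (leqnSn _)); apply: eval_pow => // i.
    by rewrite nth_nil.
  have hw y w : w < 1 -> [seq a.2 | a <- st y w] = one_word y w.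
    by rewrite ltnS leqn0 => /eqP->; rewrite /st updE -map_comp (eq_map (_ : _ =1 id)) // map_id.
  have he y j : 8 <= j -> st y j = [::] by case: j.
  have R2 : runs (emit 8 7 L1 B1) (st x) (upd (st x) 7 (rev (map pair_bit W1))) (pow (N1 n) d1).
    have H : runs (emit 8 7 L1 B1) (st x) (upd (st x) 7 (rev (map pair_bit W1) ++ [::])) (pow (N1 n) d1) :=
      @emit_runs 1 (one_word x) 8 7 L1 B1 n (st x) isT (hw x) (ow x) (he x) isT WL1 WB1 RL1 RB1.
    by rewrite cats0 in H.
  have R3 : runs (While 0 nonempty (Pop sym 0)) (upd (st x) 7 (rev (map pair_bit W1)))
      (upd (fun _ => [::]) 7 (rev (map pair_bit W1))) (n * 3).+1.
    have H := runs_clear 0 (upd (st x) 7 (rev (map pair_bit W1))).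
    rewrite (_ : size _ = n) in H; last by rewrite /st /= /upd /= size_map.
    by apply: (runs_eq H); apply: functional_extensionality => -[|j].
  have R4 : runs (mv 7 0 (Skip sym)) (upd (fun _ => [::]) 7 (rev (map pair_bit W1))) (st W1) (N1 n * 14).+1.
    have H := runs_mv (upd (fun _ => [::]) 7 (rev (map pair_bit W1))) (isT : 7 != 0).
    apply: (@runs_mono _ _ _ ((size (upd (fun=> [::]) 7 (rev (map pair_bit W1)) 7) * 14).+1)).
      apply: (runs_eq H); apply: functional_extensionality => j; rewrite /st /upd /=.
      by case: j => [|[|[|[|[|[|[|[|j]]]]]]]] //=; rewrite cats0 revK.
    by rewrite updE size_rev size_map ltnS leq_mul2r W1N orbT.
  have R5 : runs (emit 8 1 L2 B2) (st W1) (upd (st W1) 1 (rev (map pair_bit W2))) (pow (pow (N1 n) (vexp L2).+1) d2).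
    have ow1 w : size (one_word W1 w) <= N1 n by apply: leq_trans (ow _ _) W1N.
    have H : runs (emit 8 1 L2 B2) (st W1) (upd (st W1) 1 (rev (map pair_bit W2) ++ [::])) (pow (pow (N1 n) (vexp L2).+1) d2) :=
      @emit_runs 1 (one_word W1) 8 1 L2 B2 (N1 n) (st W1) isT (hw W1) ow1 (he W1) isT WL2 WB2 RL2 RB2.
    by rewrite cats0 in H.
  exact: (runs_seq (setup_runs x) (runs_seq R2 (runs_seq R3 (runs_seq R4 R5)))).
have [p Hp] : exists p : {poly nat}, forall n, n + 2 * T n + (T n + n) + 4 <= p.[n]%R.
  pose e := (vexp L1).+3 * ((vexp L2).+3 * (d1 + d2).+1).
  have [p Hp] := poly_pow 400 e 2; exists p => n; rewrite Hp addn2.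
  have nN : n.+1 <= N1 n by rewrite /N1 powS; have := pow_gt0 n (vexp L1); nia.
  pose Y := pow (N1 n) (vexp L2).+1.
  have NY : N1 n <= Y by rewrite /Y powS; have := pow_gt0 (N1 n) (vexp L2); nia.
  pose Z := pow Y (d1 + d2).+1.
  have Z0 : Y <= Z by apply: leq_trans (_ : pow Y 1 <= _); [rewrite /pow expn1; lia | apply: pow_le; lia].
  have Z1 : pow (N1 n) d1 <= Z by apply: leq_trans (pow_base d1 NY) _; apply: pow_le; lia.
  have Z2 : pow Y d2 <= Z by apply: pow_le; lia.
  have Z3 : Z <= n.+2 ^ e.
    apply: leq_trans (pow_comp _ _ _) _.
    apply: leq_trans (pow_comp _ _ _) _; apply: pow_le; rewrite /e leq_mul //.
    by rewrite leq_mul2r; apply/orP; right; lia.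
  apply: leq_trans (_ : 400 * Z <= _); last by rewrite leq_mul2l Z3 orbT.
  by have := pow_gt0 Y (d1 + d2).+1; rewrite -/Z /T -/Y; lia.
exists (mach K pair_bit (@snd bool bool) (pred0 : pred (mstate (tprog c)))), p => x.
pose m := T (size x) + size x.
have [j|t tT E] := runs_bound (m := m) (run_c x).
  have : size (input_store pair_bit x j) <= size x.
    by rewrite /input_store /upd; case: eqP => // _; rewrite /bits_of size_rev size_map.
  by rewrite /m addnC leq_add2l.
have xm : size x <= m by rewrite leq_addl.
have [n [nT Hh Ho]] := transducer_run (bit := pair_bit) (@snd bool bool) K1 Uc E xm.
exists n; split=> //; last by rewrite Ho updE -map_rev revK -map_comp (eq_map (_ : _ =1 id)) // map_id.
apply: leq_trans nT _; apply: leq_trans (Hp (size x)).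
have [|_ Hs] := @ev_bound m (T (size x) + size x) c (input_store pair_bit x) _ t E.
  move=> j; have : size (input_store pair_bit x j) <= size x.
    by rewrite /input_store /upd; case: eqP => // _; rewrite /bits_of size_rev size_map.
  by move=> h; rewrite addnC leq_add.
have Hs1 := Hs 1; rewrite -[size (input_store pair_bit x 1)]/0 add0n in Hs1.
move: Hs1 tT; move: (size (upd _ 1 _ 1)) (T (size x)) (size x) => a b d; clear; lia.
Qed.

Lemma PSPACE_ext (L L' : language) : (forall x, L x <-> L' x) -> PSPACE L -> PSPACE L'.
Proof.
move=> H [M [p [D S]]]; exists M, p; split=> // x.
by have [t h a] := D x; exists t; rewrite // a H.
Qed.

Theorem theorem19 : exists k : nat, PSPACE_complete (rush_hour k).
Proof.
have H0 : PSPACE (language_of xpredT) by apply: language_PSPACE => k f _; apply: dec_cst.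
have [M0 [S0 [N0 C0]]] := hardness H0.
(* Two rows of blocks per letter, for even and odd places, two tiles per block, 17 cells per
   tile. *)
exists (gR M0 * 2 * 17); split.
  apply: (@PSPACE_ext (language_of (pred1 (gR M0 * 2 * 17)))) => [x|].
    by split=> -[G [Ex V R So]]; exists G; split=> //; apply/eqP.
  by apply: language_PSPACE => k f Hf; apply: dec_eq => //; apply: num_cst.
move=> L HL; have [M1 [S1 [N1 C1]]] := hardness HL.
have [L1 [B1 [WL1 WB1 RL1 RB1 E1]]] := wrd_exprs (game_for_wrd M1 N1).
have [L2 [B2 [WL2 WB2 RL2 RB2 E2]]] := wrd_exprs (game_for_wrd M0 N0).
exists (fun x => word_expr (one_word (word_expr (one_word x) L1 B1)) L2 B2).
  exact: polytime_two.
move=> x; rewrite E1 E2 /one_word /=; set y := encode (game_for M1 S1 x).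
have [V1 R1] := C1 x; have [V0 R0] := C0 y.
(* The word [y] encodes a single game, as [encode] is injective. *)
have Ly : language_of xpredT y <-> L x.
  rewrite -R1; split=> [[G [/encode_inj <- _ _ So]]|So] //.
  by exists (game_for M1 S1 x).
rewrite -Ly -R0; split=> [So|[G [/encode_inj <- _ _ So]]] //.
by exists (game_for M0 S0 y).
Qed.
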